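(* Let $k,n\ge1$ be integers and let $z_1,\dots,z_n$ be distinct nonzero points of the open unit disk $\mathbb D$. Then for any $F\in(H^\infty_1)^{k\times k}$, $$\operatorname{dist}(F,\mathcal I_{\mathfrak D})=\sup\left\{\left\|M_F^*|_{\mathcal M^{\mathfrak D}_{\alpha,\beta}}\right\| : (\alpha,\beta)\in\mathbb G(\ell'\times\ell),\ 1\le\ell\le\ell'\le k\right\},$$ where the distance is taken in the norm $\|\cdot\|_\infty$ and, for each $(\alpha,\beta)$, $M_F^*$ is the adjoint of the operator $M_F:f\mapsto F\cdot f$ on $H^2_{\alpha,\beta}$.
   Context: $(H^\infty)^{k\times k}$ is the space of bounded holomorphic $k\times k$ matrix functions on $\mathbb D$ with norm $\|F\|_\infty=\sup_{z\in\mathbb D}\|F(z)\|$ (operator norm), and $(H^\infty_1)^{k\times k}=\{F\in(H^\infty)^{k\times k}:F'(0)=0\}$. The ideal $\mathcal I_{\mathfrak D}$ is $$\mathcal I_{\mathfrak D}=\{F\in(H^\infty_1)^{k\times k}:F(z_i)=0,\ i=1,\dots,n\}.$$ For $1\le\ell\le\ell'\le k$, $\mathbb G(\ell'\times\ell)$ is the set of pairs $(\alpha,\beta)$ of complex $\ell'\times\ell$ matrices with $\alpha\alpha^*+\beta\beta^*=I_{\ell'}$ and $\ker\alpha=\{0\}$. $(H^2)^{k\times\ell}$ is the Hilbert space of $k\times\ell$ matrices with entries in the Hardy space $H^2$ of the disk, with inner product $\langle F,G\rangle=\frac1{2\pi}\int_{\mathbb T}\operatorname{trace}[G(z)^*F(z)]\,|dz|$.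 For $(\alpha,\beta)\in\mathbb G(\ell'\times\ell)$, $$H^2_{\alpha,\beta}=\{F\in(H^2)^{k\times\ell}:\ \exists\,U\in\mathbb C^{k\times\ell'},\ F(0)=U\alpha,\ F'(0)=U\beta\}$$ with the inherited inner product; left multiplication by any $F\in (H^\infty_1)^{k\times k}$ maps it boundedly into itself. Let $B_{\mathfrak D}(z)=\prod_{i=1}^n\frac{z-z_i}{1-\overline{z_i}z}\,I_k$ and $$\mathcal M^{\mathfrak D}_{\alpha,\beta}=H^2_{\alpha,\beta}\ominus\left(H^2_{\alpha,\beta}\cap B_{\mathfrak D}(H^2)^{k\times\ell}\right).$$ *)

(* Defs.v *)
From HB Require Import structures.
From mathcomp Require Import all_boot all_order all_algebra.
From mathcomp Require Import all_classical all_reals all_analysis.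
From mathcomp.real_closed Require Import complex.

Set Implicit Arguments.
Unset Strict Implicit.
Unset Printing Implicit Defensive.

Import Order.TTheory GRing.Theory Num.Theory numFieldNormedType.Exports.
Import ComplexField.Normc.

Local Open Scope classical_set_scope.
Local Open Scope ring_scope.
Local Open Scope sesquilinear_scope.

(* R[i] as a normed space over itself, with the topology of the modulus. *)
HB.instance Definition _ (R : realType) := GRing.ComAlgebra.copy R[i] R[i]^o.
HB.instance Definition _ (R : realType) := Vector.copy R[i] R[i]^o.
HB.instance Definition _ (R : realType) := NormedModule.copy R[i] R[i]^o.

Section Defs.
Context {R : realType}.
Local Notation C := R[i].
Implicit Types (k l : nat) (D : set C).

Definition disk : set C := [set z | `|z| < 1].

(* A function on the disk is represented by a total function on C. Its values
   outside the disk are arbitrary and no definition below depends on them. *)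
Definition holomorphic_on_disk (V : normedModType C) (f : C -> V) : Prop :=
  forall z, disk z -> derivable f z 1.

Definition l2norm k (x : 'cV[C]_k) : R :=
  Num.sqrt (\sum_(i < k) normc (x i 0) ^+ 2).

(* The norm of T restricted to the set D; +oo if it is unbounded there. *)
Definition opnorm_on (X Y : Type) (normX : X -> R) (normY : Y -> R)
    (D : set X) (T : X -> Y) : \bar R :=
  ereal_sup [set (normY (T x))%:E | x in [set x | D x /\ normX x <= 1]].

Definition mxopnorm k l (A : 'M[C]_(k, l)) : \bar R :=
  opnorm_on (@l2norm l) (@l2norm k) setT (fun x => A *m x).

Definition Hinf_norm k (F : C -> 'M[C]_k) : \bar R :=
  ereal_sup [set mxopnorm (F z) | z in disk].

Definition Hinf k : set (C -> 'M[C]_k) :=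
  [set F | holomorphic_on_disk F /\ (Hinf_norm F < +oo)%E].

Definition Hinf1 k : set (C -> 'M[C]_k) :=
  [set F | Hinf F /\ derive1 F 0 = 0].

Definition Hinf_dist k (F : C -> 'M[C]_k) (I : set (C -> 'M[C]_k)) : \bar R :=
  ereal_inf [set Hinf_norm (F \- G) | G in I].

Definition interp_ideal k n (z : 'I_n -> C) : set (C -> 'M[C]_k) :=
  [set F | Hinf1 F /\ forall i, F (z i) = 0].

Definition expi (t : R) : C := Complex (cos t) (sin t).

Definition Hardy2 (f : C -> C) : Prop :=
  holomorphic_on_disk f /\
  (ereal_sup [set ((2 * pi)^-1)%:E *
      \int[lebesgue_measure]_(t in `[0%R, (2 * pi)%R])
        (normc (f (r%:C%C * expi t)) ^+ 2)%:E | r in `[0%R, 1%R[]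
    < +oo)%E.

Definition mxHardy2 k l : set (C -> 'M[C]_(k, l)) :=
  [set F | forall i j, Hardy2 (fun z => F z i j)].

(* The radial boundary value of F at e^{it}. For F in the Hardy space it exists
   for almost every t; elsewhere lim returns a default value. *)
Definition boundary k l (F : C -> 'M[C]_(k, l)) (t : R) : 'M[C]_(k, l) :=
  lim (F (r%:C%C * expi t) @[r --> (1 : R)^'-]).

Definition cintegral (D : set R) (f : R -> C) : C :=
  Complex (\int[lebesgue_measure]_(t in D) complex.Re (f t))
          (\int[lebesgue_measure]_(t in D) complex.Im (f t)).

Definition inner k l (F G : C -> 'M[C]_(k, l)) : C :=
  ((2 * pi)^-1)%:C%C *
  cintegral `[0, 2 * pi] (fun t => \tr ((boundary G t) ^t* *m boundary F t)).

Definition inner_norm k l (F : C -> 'M[C]_(k, l)) : R :=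
  Num.sqrt (complex.Re (inner F F)).

Definition admissible l' l (a b : 'M[C]_(l', l)) : Prop :=
  a *m a ^t* + b *m b ^t* = 1%:M /\ (forall x : 'cV[C]_l, a *m x = 0 -> x = 0).

Definition Hardy2_ab k l' l (a b : 'M[C]_(l', l)) : set (C -> 'M[C]_(k, l)) :=
  [set F | mxHardy2 F /\
     exists U : 'M[C]_(k, l'), F 0 = U *m a /\ derive1 F 0 = U *m b].

Definition blaschke k n (z : 'I_n -> C) (w : C) : 'M[C]_k :=
  (\prod_(i < n) ((w - z i) / (1 - (z i)^* * w)))%:M.

(* Equality with a product B G is required on the disk only, see above. *)
Definition blaschke_Hardy2 k l n (z : 'I_n -> C) : set (C -> 'M[C]_(k, l)) :=
  [set F | exists2 G, mxHardy2 G &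
     forall w, disk w -> F w = blaschke k z w *m G w].

Definition orthocompl_in k l (H K : set (C -> 'M[C]_(k, l))) :
    set (C -> 'M[C]_(k, l)) :=
  [set F | H F /\ forall G, K G -> inner F G = 0].

Definition model_space k l' l n (z : 'I_n -> C) (a b : 'M[C]_(l', l)) :
    set (C -> 'M[C]_(k, l)) :=
  orthocompl_in (Hardy2_ab a b) (Hardy2_ab a b `&` blaschke_Hardy2 z).

Definition mulop k l (F : C -> 'M[C]_k) (f : C -> 'M[C]_(k, l)) :
    C -> 'M[C]_(k, l) := fun z => F z *m f z.

(* The adjoint of T : H -> H. For T bounded and H complete, the element h exists
   and is unique as a function on the disk. *)
Definition adjoint_in k l (H : set (C -> 'M[C]_(k, l)))
    (T : (C -> 'M[C]_(k, l)) -> (C -> 'M[C]_(k, l))) (g : C -> 'M[C]_(k, l)) :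
    C -> 'M[C]_(k, l) :=
  xget (cst 0) [set h | H h /\ forall f, H f -> inner (T f) g = inner f h].

Definition adjoint_mul_norm k l' l n (z : 'I_n -> C) (F : C -> 'M[C]_k)
    (a b : 'M[C]_(l', l)) : \bar R :=
  opnorm_on (@inner_norm k l) (@inner_norm k l) (model_space z a b)
    (adjoint_in (Hardy2_ab a b) (mulop F)).

End Defs.

(* Main.v *)
Require Import Defs.
From mathcomp Require Import all_boot all_order all_algebra.
From mathcomp Require Import all_classical all_reals all_analysis.
From mathcomp.real_closed Require Import complex.
From mathcomp Require Import ring lra measurable_realfun.

Set Implicit Arguments.
Unset Strict Implicit.
Unset Printing Implicit Defensive.

Import Order.TTheory GRing.Theory Num.Theory numFieldNormedType.Exports.
Import ComplexField.Normc.

Local Open Scope classical_set_scope.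
Local Open Scope ring_scope.
Local Open Scope sesquilinear_scope.

(* If G vanishes at the points z_i and G'(0) = 0, then M_G maps H^2_{a,b} into
   its intersection with B H^2, so M_F^* and M_{F-G}^* agree on the model space.
   This bounds the supremum by the distance.

   Conversely let g exceed the supremum. On the span K of the functions k_{z_i} x,
   x and w x (x in C^k) the backward shift B and the evaluation E at 0 satisfy
   B^*B + E^*E = 1. The operators on K which act as M_F^* on the kernels and
   commute with B include a family T0 + L X, with X a free k x k matrix: T0 + L X
   multiplies the kernel component by F(z_i)^* and the components along 1 and w
   by F(0)^* + X. If some T0 + L X has norm at most g, the lurking isometry
   argument gives a transfer function S with |S| <= g, S(z_i) = F(z_i) and
   S'(0) = 0, so dist(F, I) <= g. Otherwise finite-dimensional duality gives f, h
   in K^l with <L X f, h> = 0 for all X and g(|f|^2 + |h|^2) + 2 Re <T0 f, h> < 0.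
   Taking |E h| maximal among the pairs that define the same functional makes
   h(0) injective. Factor [h(0) h'(0)] = U [a b] with [a b] coisometric: then
   (a, b) is admissible, h is in H^2_{a,b}, and the projection of f on H^2_{a,b}
   lies in the model space because the components of f along 1 and w are
   orthogonal to H^2_{a,b}. Hence |<T0 f, h>| <= g |f| |h|, a contradiction.

   The inner product is defined through radial boundary values, so the theorem
   of Fatou for H^2 is needed to compute it; it comes from a weak-type maximal
   inequality. *)

(** * Complex numbers as a normed space: moduli, limits, derivatives *)

Section ComplexPrelim.
Context {R : realType}.
Local Notation C := R[i].

(** Why a free block X appears: since F'(0) = 0, the values (F h)(0) and (F h)'(0) are F(0) h(0) and
    F(0) h'(0), so M_F^* multiplies the components along 1 and along w by the same F(0)^*.
    Subtracting an element of the ideal keeps the values at the z_i and the vanishing derivative but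
    may change the value at 0 arbitrarily; X is the change of F(0)^*. The spaces in the statement
    are dual to this freedom. A pair f, h is blind to X exactly when the coefficients c0, c1 of f
    along 1 and w satisfy c0 h(0)^* + c1 h'(0)^* = 0, that is, when the rows of [c0 c1] are
    orthogonal to those of [h(0) h'(0)]; and the row space of [h(0) h'(0)] is what [a b] records.
    The obstacle is the condition ker a = 0: the pair given by duality may have h(0) v = 0 for some
    v. But then B is isometric on h v, and moving f and h by B in the direction v increases no norm
    and changes no pairing, because B commutes with every T0 + L X. This is why commutation is kept
    track of throughout, and why a second extremal problem is solved after the duality. *)

Lemma normr_normc (x : C) : `|x| = (normc x)%:C%C.
Proof. by case: x. Qed.

Lemma normc_ge0 (x : C) : 0 <= normc x.
Proof. by case: x => a b; exact: sqrtr_ge0. Qed.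

Lemma diskE (z : C) : disk z = (normc z < 1).
Proof. by rewrite /disk /= normr_normc -[X in (_ < X)]/(1%:C)%C ltcR. Qed.

Lemma normcB (x y : C) : normc (x - y) = normc (y - x).
Proof. by rewrite -normcN opprB. Qed.

Lemma normc_real (x : R) : normc x%:C%C = `|x|.
Proof. by rewrite /normc /= expr0n /= addr0 sqrtr_sqr. Qed.

Lemma normcX (x : C) n : normc (x ^+ n) = normc x ^+ n.
Proof.
elim: n => [|n IH]; first by rewrite !expr0 normc1.
by rewrite !exprS normcM IH.
Qed.

Lemma normc_conj (x : C) : normc (x^*) = normc x.
Proof. by case: x => a b; rewrite /= sqrrN. Qed.

Lemma normc_sqr (x : C) : normc x ^+ 2 = complex.Re x ^+ 2 + complex.Im x ^+ 2.
Proof. by case: x => a b; rewrite /= sqr_sqrtr// addr_ge0 ?sqr_ge0. Qed.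

Lemma normc_le_sum (x : C) : normc x <= `|complex.Re x| + `|complex.Im x|.
Proof.
rewrite -(@ler_pXn2r _ 2) ?nnegrE ?normc_ge0 ?addr_ge0//.
rewrite normc_sqr sqrrD !real_normK ?num_real//.
by rewrite -addrA lerD2l lerDr mulrn_wge0 ?mulr_ge0.
Qed.

Lemma Re_le_normc (x : C) : `|complex.Re x| <= normc x.
Proof.
rewrite -(@ler_pXn2r _ 2) ?nnegrE ?normc_ge0// real_normK ?num_real//.
by rewrite normc_sqr lerDl sqr_ge0.
Qed.

Lemma Im_le_normc (x : C) : `|complex.Im x| <= normc x.
Proof.
rewrite -(@ler_pXn2r _ 2) ?nnegrE ?normc_ge0// real_normK ?num_real//.
by rewrite normc_sqr lerDr sqr_ge0.
Qed.

Lemma normc_eq0 (x : C) : (normc x == 0) = (x == 0).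
Proof. by apply/eqP/eqP => [/eq0_normc|->] //; rewrite normc0. Qed.

Lemma normc_gt0 (x : C) : (0 < normc x) = (x != 0).
Proof. by rewrite lt_neqAle normc_ge0 andbT eq_sym normc_eq0. Qed.

Lemma normc_sum (I : Type) (r : seq I) (P : pred I) (F : I -> C) :
  normc (\sum_(i <- r | P i) F i) <= \sum_(i <- r | P i) normc (F i).
Proof.
elim/big_ind2 : _ => [|x a y b xa yb|//]; first by rewrite normc0.
by rewrite (le_trans (le_normcD _ _))// lerD.
Qed.

Lemma le_normcB (x y : C) : `|normc x - normc y| <= normc (x - y).
Proof.
rewrite ler_norml; apply/andP; split.
  rewrite lerNl opprB lerBlDr -{1}[y](subrK x) (le_trans (le_normcD _ _))//.
  by rewrite normcB.
by rewrite lerBlDr -{1}[x](subrK y) (le_trans (le_normcD _ _)).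
Qed.

(** The ambient notion of limit quantifies over positive elements of [C], which are exactly the
    positive reals. Real tolerances let all later estimates be carried out in [R]. *)
Lemma cvgCP (T : Type) (F : set_system T) {FF : Filter F} (f : T -> C) (l : C) :
  f @ F --> l <->
  (forall e : R, 0 < e -> \forall x \near F, normc (f x - l) < e).
Proof.
rewrite (@cvgrPdist_lt C C T F FF f l); split => h e e0.
  have e0' : 0 < e%:C%C by rewrite ltcR.
  have := h _ e0'; apply: filterS => x.
  by rewrite normr_normc ltcR normcB.
have [a ea] : exists a : R, e = a%:C%C.
  by apply/complex_realP; rewrite gtr0_real.
rewrite ea ltcR in e0.
have := h _ e0; apply: filterS => x.
by rewrite ea normr_normc ltcR normcB.
Qed.

Lemma cvg_mxP (T : Type) (F : set_system T) {FF : Filter F} k l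
    (f : T -> 'M[C]_(k, l)) (A : 'M[C]_(k, l)) :
  f @ F --> A <-> forall i j, (fun x => f x i j) @ F --> A i j.
Proof.
split=> [h i j|h].
  by apply: (cvg_comp f (fun B : 'M[C]_(k, l) => B i j) h); exact: coord_continuous.
apply/cvg_ballP => e e0.
rewrite near_map.
have : forall ij : 'I_k * 'I_l, \forall x \near F, ball (A ij.1 ij.2) e (f x ij.1 ij.2).
  by move=> [i j]; have /cvg_ballP := h i j; exact.
move=> /filter_forall; apply: filterS => x hx; split=> // i j; exact: (hx (i, j)).
Qed.

(** The form without division is trivial at [h = 0], so the punctured neighbourhood disappears. *)
Lemma derivableCP (f : C -> C) (z d : C) :
  h^-1 *: (f (h + z) - f z) @[h --> (0 : C)^'] --> d <->
  (forall e, 0 < e -> exists2 del : R, 0 < del &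
    forall h, normc h < del -> normc (f (h + z) - f z - d * h) <= e * normc h).
Proof.
rewrite cvgCP; split => H e e0.
  have [del /= del0 hdel] := H _ e0.
  have [a ea] : exists a : R, del = a%:C%C.
    by apply/complex_realP; rewrite gtr0_real.
  rewrite ea ltcR in del0; exists a => // h hh.
  have [->|h0] := eqVneq h 0; first by rewrite add0r subrr mulr0 subrr normc0 mulr0.
  have := hdel h; rewrite /= /ball_/= sub0r normrN normr_normc ea ltcR => /(_ hh h0).
  move=> /ltW hl.
  have -> : f (h + z) - f z - d * h = (h^-1 *: (f (h + z) - f z) - d) * h.
    by rewrite mulrBl /GRing.scale/= mulrAC mulVf// mul1r.
  by rewrite normcM ler_wpM2r// normc_ge0.
have e20 : 0 < e / 2 by rewrite divr_gt0.
have [del del0 hdel] := H _ e20.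
exists del%:C%C => /=; first by rewrite ltcR.
move=> h; rewrite /ball_/= sub0r normrN normr_normc ltcR => hh h0.
have -> : (h^-1 *: (f (h + z) - f z) - d) = h^-1 * (f (h + z) - f z - d * h).
  by rewrite [RHS]mulrBr mulrCA mulVf// mulr1.
have nh : 0 < normc h by rewrite normc_gt0.
rewrite normcM normcV mulrC ltr_pdivrMr//.
apply: (le_lt_trans (hdel _ hh)).
by rewrite ltr_pM2r// ltr_pdivrMr// mulr2n mulrDr mulr1 ltrDl.
Qed.

Lemma derivable1E (V : normedModType C) (f : C -> V) z :
  derivable f z 1 <-> cvg (h^-1 *: (f (h + z) - f z) @[h --> (0 : C)^']).
Proof.
rewrite /derivable.
suff -> : (fun h : C => h^-1 *: ((f \o shift z) (h *: 1) - f z)) =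
          (fun h : C => h^-1 *: (f (h + z) - f z)) by [].
by apply/funext => h /=; rewrite /GRing.scale/= mulr1.
Qed.

Lemma derive1_cvg (V : normedModType C) (f : C -> V) z d :
  h^-1 *: (f (h + z) - f z) @[h --> (0 : C)^'] --> d ->
  derivable f z 1 /\ derive1 f z = d.
Proof.
move=> h; split; first by apply/derivable1E; apply: cvgP h.
by rewrite /derive1; apply: cvg_lim h.
Qed.

Lemma derivable_cvg (V : normedModType C) (f : C -> V) z : derivable f z 1 ->
  h^-1 *: (f (h + z) - f z) @[h --> (0 : C)^'] --> derive1 f z.
Proof. by move=> /derivable1E. Qed.

Lemma derivable_mxP k l (F : C -> 'M[C]_(k, l)) (z : C) (d : 'M[C]_(k, l)) :
  h^-1 *: (F (h + z) - F z) @[h --> (0 : C)^'] --> d <->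
  (forall i j, h^-1 *: (F (h + z) i j - F z i j) @[h --> (0 : C)^'] --> d i j).
Proof.
rewrite cvg_mxP; split => H i j; have := H i j.
  suff -> : (fun x : C => (x^-1 *: (F (x + z) - F z)) i j) =
         (fun x : C => x^-1 *: (F (x + z) i j - F z i j)) by [].
  by apply/funext => x; rewrite !mxE.
suff -> : (fun x : C => (x^-1 *: (F (x + z) - F z)) i j) =
       (fun x : C => x^-1 *: (F (x + z) i j - F z i j)) by [].
by apply/funext => x; rewrite !mxE.
Qed.

Lemma derivable_mxE k l (F : C -> 'M[C]_(k, l)) z :
  derivable F z 1 <-> (forall i j, derivable (fun w => F w i j) z 1).
Proof.
split=> [H i j|H].
  have /derivable_cvg/derivable_mxP/(_ i j) hij := H.
  by case: (derive1_cvg (f := fun w => F w i j) hij).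
have : h^-1 *: (F (h + z) - F z) @[h --> (0 : C)^'] -->
    (\matrix_(i, j) derive1 (fun w => F w i j) z).
  by apply/derivable_mxP => i j; rewrite mxE; apply: derivable_cvg.
by case/derive1_cvg.
Qed.

Lemma derive1_mxE k l (F : C -> 'M[C]_(k, l)) z i j : derivable F z 1 ->
  derive1 F z i j = derive1 (fun w => F w i j) z.
Proof.
move=> /derivable_cvg/derivable_mxP/(_ i j) hij.
by case: (derive1_cvg (f := fun w => F w i j) hij).
Qed.

Lemma derivable_cts (f : C -> C) z : derivable f z 1 -> {for z, continuous f}.
Proof. by move=> h; apply: differentiable_continuous; apply/derivable1_diffP. Qed.

Lemma derivable_normc (f : C -> C) z : derivable f z 1 ->
  forall e : R, 0 < e -> exists2 del : R, 0 < del &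
    forall h, normc h < del ->
      normc (f (h + z) - f z - derive1 f z * h) <= e * normc h.
Proof. by move=> /derivable_cvg/derivableCP. Qed.

Lemma ctsCP (f : C -> C) z : {for z, continuous f} <->
  forall e : R, 0 < e -> exists2 del : R, 0 < del &
    forall w, normc (w - z) < del -> normc (f w - f z) < e.
Proof.
rewrite /prop_for /continuous_at (@cvgCP _ (nbhs z)); split => H e e0.
  have [del /= del0 hdel] := H _ e0.
  have [a ea] : exists a : R, del = a%:C%C.
    by apply/complex_realP; rewrite gtr0_real.
  rewrite ea ltcR in del0; exists a => // w hw; apply: hdel.
  by rewrite /ball_/= normr_normc ea ltcR normcB.
have [del del0 hdel] := H _ e0.
exists del%:C%C => /=; first by rewrite ltcR.
move=> w; rewrite /ball_/= normr_normc ltcR => hw; apply: hdel.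
by rewrite normcB.
Qed.

Lemma derive1_cvgC (f : C -> C) (z d : C) :
  h^-1 *: (f (h + z) - f z) @[h --> (0 : C)^'] --> d ->
  derivable f z 1 /\ derive1 f z = d.
Proof. exact: derive1_cvg. Qed.

Lemma cvgCM (T : Type) (F : set_system T) {FF : Filter F} (f g : T -> C) (a b : C) :
  f @ F --> a -> g @ F --> b -> (fun x => f x * g x) @ F --> a * b.
Proof. by move=> hf hg; exact: (@cvgM C T F FF f g a b hf hg). Qed.

Lemma cvg_shift_dnbhs (g : C -> C) z : {for z, continuous g} ->
  g (h + z) @[h --> (0 : C)^'] --> g z.
Proof.
move=> /ctsCP H; apply/cvgCP => e e0.
have [del del0 hdel] := H _ e0.
exists del%:C%C => /=; first by rewrite ltcR.
move=> h; rewrite /ball_/= sub0r normrN normr_normc ltcR => hh h0.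
by apply: hdel; rewrite addrK.
Qed.

Lemma derive1D (f g : C -> C) z : derivable f z 1 -> derivable g z 1 ->
  derivable (fun w => f w + g w) z 1 /\
  derive1 (fun w => f w + g w) z = derive1 f z + derive1 g z.
Proof.
move=> /derivable_cvg hf /derivable_cvg hg.
apply: (@derive1_cvgC (fun w => f w + g w)).
apply: cvg_trans (cvgD hf hg); apply: near_eq_cvg; near=> h => /=.
transitivity (h^-1 *: (f (h + z) - f z) + h^-1 *: (g (h + z) - g z)) => //.
by rewrite -scalerDr; congr (_ *: _); rewrite opprD addrACA.
Unshelve. all: by end_near. Qed.

Lemma derive1M (f g : C -> C) z : derivable f z 1 -> derivable g z 1 ->
  derivable (fun w => f w * g w) z 1 /\
  derive1 (fun w => f w * g w) z = derive1 f z * g z + f z * derive1 g z.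
Proof.
move=> hf hg.
have /derivable_cvg cf := hf. have /derivable_cvg cg := hg.
have gc := cvg_shift_dnbhs (derivable_cts hg).
apply: (@derive1_cvgC (fun w => f w * g w)).
have k := cvgD (cvgCM cf gc) (cvgCM (cvg_cst (f z)) cg).
apply: cvg_trans (k _ _ _ _); apply: near_eq_cvg; near=> h => /=.
transitivity (h^-1 * (f (h + z) - f z) * g (h + z) +
  f z * (h^-1 * (g (h + z) - g z))) => //.
rewrite /GRing.scale/=; ring.
Unshelve. all: by end_near. Qed.

Lemma derivableCM (f g : C -> C) z : derivable f z 1 -> derivable g z 1 ->
  derivable (fun w => f w * g w) z 1.
Proof. by move=> hf hg; case: (derive1M hf hg). Qed.

Lemma derivableCD (f g : C -> C) z : derivable f z 1 -> derivable g z 1 ->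
  derivable (fun w => f w + g w) z 1.
Proof. by move=> hf hg; case: (derive1D hf hg). Qed.

Lemma derive1V (g : C -> C) z : g z != 0 -> derivable g z 1 ->
  derivable (fun w => (g w)^-1) z 1 /\
  derive1 (fun w => (g w)^-1) z = - derive1 g z / g z ^+ 2.
Proof.
move=> gz hg; have /derivable_cvg cg := hg.
have gc := cvg_shift_dnbhs (derivable_cts hg).
apply: (@derive1_cvgC (fun w => (g w)^-1)).
have gi : (g (h + z))^-1 @[h --> (0 : C)^'] --> (g z)^-1 by exact: (@cvgV C).
have k := cvgCM (cvgCM cg gi) (cvg_cst (- (g z)^-1)).
have -> : - derive1 g z / g z ^+ 2 = derive1 g z * (g z)^-1 * - (g z)^-1.
  by rewrite expr2 invfM mulNr mulrN mulrA.
apply: cvg_trans (k _ _ _); apply: near_eq_cvg; near=> h => /=.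
rewrite /GRing.scale/=.
have gh : g (h + z) != 0.
  rewrite -normc_gt0; near: h.
  have /cvgCP/(_ (normc (g z))) := gc; rewrite normc_gt0 => /(_ gz).
  apply: filterS => h hh; have := le_normcB (g z) (g (h + z)).
  rewrite normcB => h2; have := le_lt_trans h2 hh.
  by rewrite ltr_norml => /andP[_]; rewrite gtrBl.
have h0 : h != 0 by near: h; exact: nbhs_dnbhs_neq.
by field; apply/and3P.
Unshelve. all: by end_near. Qed.

Lemma derivableCV (g : C -> C) z : g z != 0 -> derivable g z 1 ->
  derivable (fun w => (g w)^-1) z 1.
Proof. by move=> gz hg; case: (derive1V gz hg). Qed.

Lemma derivableC_cst (a z : C) : derivable (fun w : C => a) z 1.
Proof. exact: derivable_cst. Qed.

Lemma derivableC_id (z : C) : derivable (fun w : C => w) z 1.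
Proof. exact: derivable_id. Qed.

Lemma derive1C_cst (a z : C) : derive1 (fun w : C => a) z = 0.
Proof. by rewrite derive1_cst. Qed.

Lemma derive1C_id (z : C) : derive1 (fun w : C => w) z = 1.
Proof.
suff h1 : h^-1 *: (h + z - z) @[h --> (0 : C)^'] --> (1 : C).
  by case: (@derive1_cvgC (fun w => w) z 1 h1).
apply/cvgCP => e e0; near=> h.
rewrite addrK /GRing.scale/= mulVf ?subrr ?normc0//; near: h; exact: nbhs_dnbhs_neq.
Unshelve. all: by end_near. Qed.

Lemma derivableC_sum n (f : 'I_n -> C -> C) z :
  (forall i, derivable (f i) z 1) ->
  derivable (fun w => \sum_(i < n) f i w) z 1 /\
  derive1 (fun w => \sum_(i < n) f i w) z = \sum_(i < n) derive1 (f i) z.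
Proof.
elim: n f => [|n IH] f h.
  have -> : (fun w => \sum_(i < 0) f i w) = (fun=> 0).
    by apply/funext => w; rewrite big_ord0.
  by rewrite big_ord0; split; [exact: derivableC_cst | rewrite derive1C_cst].
have -> : (fun w => \sum_(i < n.+1) f i w) =
    (fun w => \sum_(i < n) f (widen_ord (leqnSn n) i) w + f ord_max w).
  by apply/funext => w; rewrite big_ord_recr.
rewrite big_ord_recr /=.
have [h1 h2] := IH (fun i => f (widen_ord (leqnSn n) i)) (fun i => h _).
by have [h3 h4] := derive1D h1 (h ord_max); split => //; rewrite h4 h2.
Qed.

(** Functions are specified on the disk only; this transfers derivatives between two representatives
    that agree near a point. *)
Lemma near_eq_derive1 (f g : C -> C) (z : C) :
  (\forall w \near z, f w = g w) -> derivable f z 1 ->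
  derivable g z 1 /\ derive1 g z = derive1 f z.
Proof.
move=> fg /derivable_cvg hf; apply: (@derive1_cvgC g).
have fgz : f z = g z by exact: (nbhs_singleton fg).
apply: cvg_trans hf; apply: near_eq_cvg.
have [e /= e0 he] := fg.
exists e => //= h; rewrite /ball_/= sub0r normrN => hh _.
by rewrite -fgz he// /ball_/= opprD addrCA subrr addr0 normrN.
Qed.

Lemma derivableC_exp n (z : C) : derivable (fun w : C => w ^+ n) z 1.
Proof.
elim: n => [|n IH].
  by under eq_fun do rewrite expr0; exact: derivableC_cst.
have -> : (fun w : C => w ^+ n.+1) = (fun w => w * w ^+ n).
  by apply/funext => w; rewrite exprS.
have H := @derivableCM (fun w => w) (fun w => w ^+ n) z (@derivableC_id z) IH.
exact: H.
Qed.

Lemma disk0 : disk (0 : C).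
Proof. by rewrite diskE normc0. Qed.

Lemma near_disk (z : C) : disk z -> \forall w \near z, disk w.
Proof.
rewrite diskE => hz; exists (1 - normc z)%:C%C => /=.
  by rewrite ltcR subr_gt0.
move=> w; rewrite /ball_/= normr_normc ltcR diskE normcB => hw.
rewrite -[w](subrK z) (le_lt_trans (le_normcD _ _))//.
by rewrite -ltrBrDr.
Qed.

End ComplexPrelim.

(** * Cauchy theory on the disk *)

Section SegInt.
Context {R : realType}.
Local Notation C := R[i].
Local Notation mu := (@lebesgue_measure R).
Implicit Types (a b : R) (f g : R -> C).

(** Curves with a real parameter and values in [C]. Stating continuity with [normc] lets one
    Lipschitz argument, [ccts_within], yield real continuity of [Re], [Im] and the modulus. *)
Definition ccts a b f := forall x, a <= x <= b -> forall e : R, 0 < e ->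
  exists2 d : R, 0 < d &
    forall y, a <= y <= b -> `|y - x| < d -> normc (f y - f x) < e.

Lemma ccts_cst a b (c : C) : ccts a b (fun=> c).
Proof. by move=> x _ e e0; exists 1 => // y _ _; rewrite subrr normc0. Qed.

Lemma cctsD a b f g : ccts a b f -> ccts a b g -> ccts a b (fun t => f t + g t).
Proof.
move=> hf hg x xab e e0.
have e2 : 0 < e / 2 by rewrite divr_gt0.
have [d1 d10 h1] := hf x xab _ e2; have [d2 d20 h2] := hg x xab _ e2.
exists (Num.min d1 d2); first by rewrite lt_min d10.
move=> y yab; rewrite lt_min => /andP[y1 y2].
rewrite opprD addrACA (le_lt_trans (le_normcD _ _))//.
by rewrite [e]splitr ltrD// ?h1 ?h2.
Qed.

Lemma cctsM a b f g : ccts a b f -> ccts a b g -> ccts a b (fun t => f t * g t).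
Proof.
move=> hf hg x xab e e0.
pose M := normc (f x) + normc (g x) + 1.
have M0 : 0 < M by rewrite ltr_wpDl// addr_ge0 ?normc_ge0.
(* With both increments below [e1], the three terms of the expanded product add up to at most
   [e1 * M], hence at most [e / 2]. *)
pose e1 := Num.min 1 (e / (2 * M)).
have e10 : 0 < e1 by rewrite lt_min ltr01 /= divr_gt0// mulr_gt0.
have [d1 d10 h1] := hf x xab _ e10; have [d2 d20 h2] := hg x xab _ e10.
exists (Num.min d1 d2); first by rewrite lt_min d10.
move=> y yab; rewrite lt_min => /andP[y1 y2].
have -> : f y * g y - f x * g x = (f y - f x) * (g y - g x) + ((f y - f x) * g x + f x * (g y - g x)) by ring.
have n1 := h1 _ yab y1; have n2 := h2 _ yab y2.
rewrite (le_lt_trans (le_normcD _ _))//.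
rewrite (@le_lt_trans _ _ (normc (f y - f x) * normc (g y - g x) + (normc (f y - f x) * normc (g x) + normc (f x) * normc (g y - g x))))//.
  by rewrite -!normcM lerD2l le_normcD.
have e1le1 : e1 <= 1 by rewrite ge_min lexx.
have e1le : e1 * (2 * M) <= e.
  by rewrite -ler_pdivlMr ?mulr_gt0// ge_min lexx orbT.
move: n1 n2 (normc_ge0 (f y - f x)) (normc_ge0 (g y - g x)) (normc_ge0 (f x)) (normc_ge0 (g x)) e1le1 e1le e10.
rewrite /M; move: (normc _) (normc (g y - _)) (normc (f x)) (normc (g x)) => p q u v.
move=> n1 n2 p0 q0 u0 v0 h3 h4 h5.
have pq : p * q <= e1 by rewrite -[e1]mulr1 ler_pM// ?ltW// (lt_le_trans n2).
have pv : p * v <= e1 * v by rewrite ler_wpM2r// ltW.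
have uq : u * q <= e1 * u by rewrite mulrC ler_wpM2r// ltW.
have h6 : 0 <= e1 * u by rewrite mulr_ge0// ltW.
have h7 : 0 <= e1 * v by rewrite mulr_ge0// ltW.
lra.
Qed.

Lemma cctsZ a b (c : C) f : ccts a b f -> ccts a b (fun t => c * f t).
Proof. by apply: cctsM; exact: ccts_cst. Qed.

Lemma cctsN a b f : ccts a b f -> ccts a b (fun t => - f t).
Proof.
by move=> /(cctsZ (-1)) h; rewrite (_ : (fun _ => _) = (fun t => -1 * f t))//;
  apply/funext => t; rewrite mulN1r.
Qed.

Lemma cctsB a b f g : ccts a b f -> ccts a b g -> ccts a b (fun t => f t - g t).
Proof. by move=> hf /cctsN hg; exact: cctsD. Qed.

Lemma ccts_sum a b n (f : 'I_n -> R -> C) : (forall i, ccts a b (f i)) ->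
  ccts a b (fun t => \sum_(i < n) f i t).
Proof.
elim: n f => [|n IH] f h.
  have -> : (fun t => \sum_(i < 0) f i t) = (fun=> 0).
    by apply/funext => w; rewrite big_ord0.
  exact: ccts_cst.
have -> : (fun t => \sum_(i < n.+1) f i t) =
    (fun t => \sum_(i < n) f (widen_ord (leqnSn n) i) t + f ord_max t).
  by apply/funext => w; rewrite big_ord_recr.
by apply: cctsD => //; exact: IH.
Qed.

Lemma ccts_within (u : C -> R) (k : forall x y, `|u x - u y| <= normc (x - y))
    a b f : ccts a b f -> {within `[a, b], continuous (u \o f)}.
Proof.
move=> h; apply/subspace_continuousP => x; rewrite /= in_itv/= => xab.
apply/cvgrPdist_lt => e e0.
have [d d0 hd] := h x xab e e0.
exists d => //= y.
rewrite /ball_/= distrC => yx; rewrite in_itv/= => yab.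
rewrite distrC; apply: (le_lt_trans (k _ _)); exact: hd.
Qed.

Lemma Re_lip (x y : C) : `|complex.Re x - complex.Re y| <= normc (x - y).
Proof. by case: x y => [x1 x2] [y1 y2]; exact: (Re_le_normc ((x1 - y1) +i* (x2 - y2))%C). Qed.

Lemma Im_lip (x y : C) : `|complex.Im x - complex.Im y| <= normc (x - y).
Proof. by case: x y => [x1 x2] [y1 y2]; exact: (Im_le_normc ((x1 - y1) +i* (x2 - y2))%C). Qed.

Lemma within_integrable a b (u : R -> R) : {within `[a, b], continuous u} ->
  mu.-integrable `[a, b] (EFin \o u).
Proof. by move=> h; apply: continuous_compact_integrable => //; exact: segment_compact. Qed.

Lemma ccts_integrable (u : C -> R) (k : forall x y, `|u x - u y| <= normc (x - y))
    a b f : ccts a b f -> mu.-integrable `[a, b] (EFin \o (u \o f)).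
Proof. by move=> /(ccts_within k); exact: within_integrable. Qed.

Lemma within_ccts a b (u : R -> R) : {within `[a, b], continuous u} ->
  ccts a b (fun t => (u t)%:C%C).
Proof.
move=> /subspace_continuousP h x xab e e0.
have := h x; rewrite /= in_itv/= => /(_ xab) /cvgrPdist_lt /(_ e e0).
move=> -[d /= d0 hd]; exists d => // y yab yx.
rewrite subr0 expr0n /= addr0 sqrtr_sqr distrC; apply: hd => //=.
  by rewrite /ball_/= distrC.
Qed.

Definition iint a b f : C := cintegral `[a, b] f.

Lemma iintD a b f g : ccts a b f -> ccts a b g ->
  iint a b (fun t => f t + g t) = iint a b f + iint a b g.
Proof.
move=> hf hg; rewrite /iint /cintegral.
have E : (fun t => complex.Re (f t + g t)) = (fun t => complex.Re (f t) + complex.Re (g t)).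
  by apply/funext => t; case: (f t) => ? ?; case: (g t).
have F : (fun t => complex.Im (f t + g t)) = (fun t => complex.Im (f t) + complex.Im (g t)).
  by apply/funext => t; case: (f t) => ? ?; case: (g t).
by rewrite E F !RintegralD//; first [exact: ccts_integrable Re_lip _ _ _ _|exact: ccts_integrable Im_lip _ _ _ _].
Qed.

Lemma iintZ a b (c : C) f : ccts a b f -> iint a b (fun t => c * f t) = c * iint a b f.
Proof.
case: c => c1 c2 hf; rewrite /iint /cintegral.
have hr := ccts_integrable Re_lip hf; have hi := ccts_integrable Im_lip hf.
have E : (fun t => complex.Re ((c1 +i* c2)%C * f t)) = (fun t => c1 * complex.Re (f t) - c2 * complex.Im (f t)).
  by apply/funext => t; case: (f t) => ? ?.
have F : (fun t => complex.Im ((c1 +i* c2)%C * f t)) = (fun t => c1 * complex.Im (f t) + c2 * complex.Re (f t)).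
  by apply/funext => t; case: (f t) => ? ?.
rewrite E F RintegralB//; last 2 first.
  exact: (integrableZl _ c1 hr).
  exact: (integrableZl _ c2 hi).
rewrite RintegralD//; last 2 first.
  exact: (integrableZl _ c1 hi).
  exact: (integrableZl _ c2 hr).
by rewrite !RintegralZl.
Qed.

Lemma eq_iint a b f g : (forall t, a <= t <= b -> f t = g t) -> iint a b f = iint a b g.
Proof.
move=> h; rewrite /iint /cintegral; congr Complex; apply: eq_Rintegral => t;
  by rewrite inE/= in_itv/= => /h ->.
Qed.

Lemma iintN a b f : ccts a b f -> iint a b (fun t => - f t) = - iint a b f.
Proof.
move=> hf; rewrite -mulN1r -iintZ//; apply: eq_iint => t _; by rewrite mulN1r.
Qed.

Lemma iintB a b f g : ccts a b f -> ccts a b g ->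
  iint a b (fun t => f t - g t) = iint a b f - iint a b g.
Proof. by move=> hf hg; rewrite iintD ?iintN//; exact: cctsN. Qed.

Lemma iint_sum a b n (f : 'I_n -> R -> C) : (forall i, ccts a b (f i)) ->
  iint a b (fun t => \sum_(i < n) f i t) = \sum_(i < n) iint a b (f i).
Proof.
elim: n f => [|n IH] f h.
  rewrite big_ord0 (@eq_iint _ _ _ (fun t => 0 * 0)).
    by rewrite iintZ ?mul0r//; exact: ccts_cst.
  by move=> t _; rewrite big_ord0 mul0r.
rewrite big_ord_recr /= -IH// -iintD//; last exact: ccts_sum.
by apply: eq_iint => t _; rewrite big_ord_recr.
Qed.

Lemma iint_cst a b (c : C) : a <= b -> iint a b (fun=> c) = (b - a)%:C%C * c.
Proof.
move=> ab; rewrite /iint /cintegral !Rintegral_cst//=.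
rewrite lebesgue_measure_itv/= lte_fin; case: ltP => ab' /=.
  case: c => c1 c2 /=; rewrite [RHS]/GRing.mul/= !mul0r subr0 addr0.
  by congr Complex; rewrite mulrC.
have -> : b = a by apply/eqP; rewrite eq_le ab ab'.
by rewrite !mulr0 subrr mul0r.
Qed.

Lemma iint_split a b c f : a <= b -> b <= c -> ccts a c f ->
  iint a c f = iint a b f + iint b c f.
Proof.
move=> ab bc hf; rewrite /iint /cintegral.
suff H u (k : forall x y, `|u x - u y| <= normc (x - y)) :
    \int[mu]_(t in `[a, c]) (u (f t)) =
    \int[mu]_(t in `[a, b]) (u (f t)) + \int[mu]_(t in `[b, c]) (u (f t)).
  by rewrite (H _ Re_lip) (H _ Im_lip).
have hi := ccts_integrable k hf.
have E : `[a, c]%classic = `[a, b] `|` `]b, c].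
  by rewrite -itv_bndbnd_setU// bnd_simp.
rewrite E Rintegral_setU//; last 2 first.
- by rewrite -E.
- rewrite disj_set2E; apply/eqP/seteqP; split => // x /= []; rewrite !in_itv/=.
  by move=> /andP[_ xb] /andP[bx _]; move: (le_lt_trans xb bx); rewrite ltxx.
rewrite (@Rintegral_itv_obnd_cbnd _ b)//.
apply: (integrableS _ _ _ hi) => //; rewrite E; exact: subsetUr.
Qed.

Lemma normc_ccts a b f : ccts a b f -> {within `[a, b], continuous ((@normc R) \o f)}.
Proof. exact: (@ccts_within (@normc R) le_normcB). Qed.

(** The factor 2 comes from bounding the real and imaginary parts separately; it only affects
    constants. *)
Lemma iint_le a b f : ccts a b f ->
  normc (iint a b f) <= 2 * \int[mu]_(t in `[a, b]) normc (f t).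
Proof.
move=> hf; apply: (le_trans (normc_le_sum _)).
have hn : mu.-integrable `[a, b] (EFin \o ((@normc R) \o f)).
  exact: (@ccts_integrable (@normc R) le_normcB).
have H u (k : forall x y, `|u x - u y| <= normc (x - y)) : (forall x, `|u x| <= normc x) ->
   `|\int[mu]_(t in `[a, b]) u (f t)| <= \int[mu]_(t in `[a, b]) normc (f t).
  move=> ku; apply: (le_trans (le_normr_Rintegral _ _)) => //.
    exact: (ccts_integrable k hf).
  apply: le_Rintegral => //.
  apply: integrable_norm => //; exact: (ccts_integrable k hf).
by rewrite mulr_natl mulr2n lerD// ?H//; [exact: Re_lip|exact: Re_le_normc|exact: Im_lip|exact: Im_le_normc].
Qed.

Lemma Rint_le_cst a b (u : R -> R) (M : R) : a <= b -> {within `[a, b], continuous u} ->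
  (forall t, a <= t <= b -> u t <= M) -> \int[mu]_(t in `[a, b]) u t <= M * (b - a).
Proof.
move=> ab cu h.
have -> : M * (b - a) = \int[mu]_(t in `[a, b]) (fun=> M) t.
  rewrite Rintegral_cst//= lebesgue_measure_itv/= lte_fin; case: ltP => ab' //=.
  have -> : b = a by apply/eqP; rewrite eq_le ab ab'.
  by rewrite subrr.
apply: le_Rintegral => //.
- exact: within_integrable.
- by apply: within_integrable => x; exact: cvg_cst.
Qed.

Lemma iint_le_cst a b f (M : R) : a <= b -> ccts a b f ->
  (forall t, a <= t <= b -> normc (f t) <= M) -> normc (iint a b f) <= 2 * (M * (b - a)).
Proof.
move=> ab hf hM; apply: (le_trans (iint_le hf)); rewrite ler_pM2l//.
apply: Rint_le_cst => //; exact: normc_ccts.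
Qed.

Lemma cts_ccts (g : C -> C) (gam : R -> C) a b :
  (forall t, a <= t <= b -> {for gam t, continuous g}) ->
  ccts a b gam -> ccts a b (g \o gam).
Proof.
move=> hg hgam x xab e e0.
have /ctsCP/(_ e e0)[d d0 hd] := hg x xab.
have [d' d'0 hd'] := hgam x xab d d0.
by exists d' => // y yab yx; apply: hd; exact: hd'.
Qed.

(** The parameter is real while the values are complex, so the derivative is taken componentwise. *)
Definition rderiv (f : R -> C) (t : R) (d : C) :=
  is_derive t 1 (fun s => complex.Re (f s)) (complex.Re d) /\
  is_derive t 1 (fun s => complex.Im (f s)) (complex.Im d).

Lemma rderiv_cst (c : C) t : rderiv (fun=> c) t 0.
Proof. by split; exact: is_derive_cst. Qed.

Lemma rderivD f g t df dg : rderiv f t df -> rderiv g t dg ->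
  rderiv (fun s => f s + g s) t (df + dg).
Proof.
move=> [f1 f2] [g1 g2]; split.
  have -> : (fun s => complex.Re (f s + g s)) = (fun s => complex.Re (f s)) + (fun s => complex.Re (g s)).
    by apply/funext => s; rewrite [RHS]/GRing.add/=; case: (f s) => ? ?; case: (g s).
  have -> : complex.Re (df + dg) = complex.Re df + complex.Re dg by case: (df) => ? ?; case: (dg).
  exact: is_deriveD.
have -> : (fun s => complex.Im (f s + g s)) = (fun s => complex.Im (f s)) + (fun s => complex.Im (g s)).
  by apply/funext => s; rewrite [RHS]/GRing.add/=; case: (f s) => ? ?; case: (g s).
have -> : complex.Im (df + dg) = complex.Im df + complex.Im dg by case: (df) => ? ?; case: (dg).
exact: is_deriveD.
Qed.

Lemma rderivM f g t df dg : rderiv f t df -> rderiv g t dg ->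
  rderiv (fun s => f s * g s) t (df * g t + f t * dg).
Proof.
move=> [f1 f2] [g1 g2]; split.
  have -> : (fun s => complex.Re (f s * g s)) =
     (fun s => complex.Re (f s)) * (fun s => complex.Re (g s)) - (fun s => complex.Im (f s)) * (fun s => complex.Im (g s)).
    apply/funext => s; transitivity (complex.Re (f s) * complex.Re (g s) - complex.Im (f s) * complex.Im (g s)) => //.
    by case: (f s) => ? ?; case: (g s).
  have h := is_deriveB (is_deriveM f1 g1) (is_deriveM f2 g2).
  apply: is_derive_eq h _.
  rewrite /GRing.scale/=; case: (df) => ? ?; case: (dg) => ? ?; case: (f t) => ? ?; case: (g t) => ? ? /=; ring.
have -> : (fun s => complex.Im (f s * g s)) =
   (fun s => complex.Re (f s)) * (fun s => complex.Im (g s)) + (fun s => complex.Im (f s)) * (fun s => complex.Re (g s)).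
  apply/funext => s; transitivity (complex.Re (f s) * complex.Im (g s) + complex.Im (f s) * complex.Re (g s)) => //.
  by case: (f s) => ? ?; case: (g s).
have h := is_deriveD (is_deriveM f1 g2) (is_deriveM f2 g1).
apply: is_derive_eq h _.
rewrite /GRing.scale/=; case: (df) => ? ?; case: (dg) => ? ?; case: (f t) => ? ?; case: (g t) => ? ? /=; ring.
Qed.

Lemma rderiv_id t : rderiv (fun s => s%:C%C) t 1.
Proof. by split; [exact: is_derive_id|exact: is_derive_cst]. Qed.

Lemma rderiv_expi t : rderiv (@expi R) t ('i%C * expi t).
Proof.
split => /=; rewrite !mul0r ?mul1r ?sub0r ?add0r.
  exact: is_derive_cos.
exact: is_derive_sin.
Qed.

Lemma rderiv_eq f t d d' : rderiv f t d -> d = d' -> rderiv f t d'.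
Proof. by move=> h <-. Qed.

Lemma rderiv_ccts a b f df : (forall t, rderiv f t (df t)) -> ccts a b f.
Proof.
move=> h.
have E : f = (fun t => (complex.Re (f t))%:C%C + 'i%C * (complex.Im (f t))%:C%C).
  by apply/funext => t; rewrite -complexE.
rewrite E; apply: cctsD; last apply: cctsZ.
  apply: within_ccts; apply: continuous_subspaceT => t.
  have [h1 _] := h t; apply: differentiable_continuous; apply/derivable1_diffP.
  exact: (@ex_derive _ _ _ _ _ _ _ h1).
apply: within_ccts; apply: continuous_subspaceT => t.
have [_ h1] := h t; apply: differentiable_continuous; apply/derivable1_diffP.
exact: (@ex_derive _ _ _ _ _ _ _ h1).
Qed.

Lemma real_FTC a b (F f : R -> R) : a <= b -> (forall t : R, is_derive t 1 F (f t)) ->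
  {within `[a, b], continuous f} -> \int[mu]_(t in `[a, b]) f t = F b - F a.
Proof.
rewrite le_eqVlt => /orP[/eqP <- _ _|ab hF cf].
  by rewrite subrr set_itv1 Rintegral_set1.
have cF t : {for t, continuous F}.
  apply: differentiable_continuous; apply/derivable1_diffP.
  exact: (@ex_derive _ _ _ _ _ _ _ (hF t)).
rewrite /Rintegral (@continuous_FTC2 _ f F)//.
split => //.
- by apply: cvg_at_right_filter; exact: cF.
- by apply: cvg_at_left_filter; exact: cF.
- by move=> t _; rewrite derive1E; exact: (@derive_val _ _ _ _ _ _ _ (hF t)).
Qed.

Lemma iint_FTC a b F f : a <= b -> (forall t, rderiv F t (f t)) -> ccts a b f ->
  iint a b f = F b - F a.
Proof.
move=> ab hF cf; rewrite /iint /cintegral.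
have h1 := @real_FTC a b (fun t => complex.Re (F t)) (fun t => complex.Re (f t)) ab
  (fun t => (hF t).1) (@ccts_within (@complex.Re R) Re_lip _ _ _ cf).
have h2 := @real_FTC a b (fun t => complex.Im (F t)) (fun t => complex.Im (f t)) ab
  (fun t => (hF t).2) (@ccts_within (@complex.Im R) Im_lip _ _ _ cf).
rewrite h1 h2.
by case: (F b) => ? ?; case: (F a).
Qed.

Lemma ccts_expi a b : ccts a b (@expi R).
Proof. exact: rderiv_ccts rderiv_expi. Qed.

Lemma normc_expi (t : R) : normc (expi t) = 1.
Proof. by rewrite /= cos2Dsin2 sqrtr1. Qed.

Lemma expi0 : expi (0 : R) = 1.
Proof. by rewrite /expi cos0 sin0. Qed.

Lemma expi2pi : expi (2 * pi : R) = 1.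
Proof. by rewrite /expi mulr_natl -[_ *+ 2]add0r cosD2pi sinD2pi cos0 sin0. Qed.

Lemma expiD (s t : R) : expi (s + t) = expi s * expi t.
Proof. by rewrite /expi cosD sinD /GRing.mul /= addrC [sin s * _]mulrC; congr Complex; rewrite addrC // mulrC. Qed.

Lemma expi_neq0 (t : R) : expi t != 0.
Proof. by rewrite -normc_gt0 normc_expi. Qed.

Lemma expiN (t : R) : expi (- t) = (expi t)^-1.
Proof. by apply: (mulfI (expi_neq0 t)); rewrite -expiD subrr expi0 divff// expi_neq0. Qed.

Lemma conj_expi (t : R) : (expi t)^* = expi (- t).
Proof. by rewrite /expi cosN sinN. Qed.

Lemma expi_lip (s t : R) : normc (expi s - expi t) <= 2 * `|s - t|.
Proof.
wlog st : s t / s <= t.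
  by move=> H; case: (leP s t) => h; [exact: H|rewrite normcB distrC; apply: H; exact: ltW].
have := iint_FTC st rderiv_expi (cctsZ 'i%C (ccts_expi (a:=s) (b:=t))).
rewrite normcB => <-.
rewrite distrC ger0_norm ?subr_ge0//.
rewrite (le_trans (iint_le_cst (M := 1) st _ _)) ?mul1r//.
  exact: cctsZ (ccts_expi (a:=s) (b:=t)).
by move=> x _; rewrite normcM normc_expi mulr1 /= expr0n expr1n add0r sqrtr1.
Qed.

End SegInt.

Local Arguments ComplexField.Normc.normc : simpl never.

(** * Goursat's lemma for polar boxes, the Cauchy formula and Taylor expansions *)

Section Goursat.
Context {R : realType}.
Local Notation C := R[i].
Local Notation mu := (@lebesgue_measure R).
Implicit Types (g : C -> C) (r t : R).

Definition pol (r t : R) : C := r%:C%C * expi t.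

Lemma normc_pol r t : normc (pol r t) = `|r|.
Proof. by rewrite normcM normc_real normc_expi mulr1. Qed.

Lemma pol_lip r t r0 t0 :
  normc (pol r t - pol r0 t0) <= `|r - r0| + `|r0| * (2 * `|t - t0|).
Proof.
have -> : pol r t - pol r0 t0 = (r - r0)%:C%C * expi t + r0%:C%C * (expi t - expi t0).
  by rewrite rmorphB /pol; ring.
rewrite (le_trans (le_normcD _ _))// !normcM !normc_real normc_expi mulr1 lerD2l.
by rewrite ler_wpM2l// expi_lip.
Qed.

Lemma rderiv_polr t r : rderiv (pol^~ t) r (expi t).
Proof.
apply: rderiv_eq (rderivM (rderiv_id _) (rderiv_cst _ _)) _.
by rewrite mul1r mulr0 addr0.
Qed.

Lemma rderiv_polt r t : rderiv (pol r) t ('i%C * pol r t).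
Proof.
apply: rderiv_eq (rderivM (rderiv_cst _ _) (rderiv_expi _)) _.
by rewrite mul0r add0r /pol mulrCA.
Qed.

Lemma ccts_polr t a b : ccts a b (pol^~ t).
Proof. exact: rderiv_ccts (rderiv_polr t). Qed.

Lemma ccts_polt r a b : ccts a b (pol r).
Proof. exact: rderiv_ccts (rderiv_polt r). Qed.

(** The contour integral of [g] around the image of a polar rectangle. Polar boxes replace the usual
    triangles because their curved sides are the circle means wanted later, and bisecting both
    parameters gives polar boxes again. *)
Definition bd g r1 r2 t1 t2 : C :=
  iint r1 r2 (fun r => g (pol r t1) * expi t1) +
  iint t1 t2 (fun t => g (pol r2 t) * ('i%C * pol r2 t)) -
  iint r1 r2 (fun r => g (pol r t2) * expi t2) -
  iint t1 t2 (fun t => g (pol r1 t) * ('i%C * pol r1 t)).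

Definition ctsbox g r1 r2 t1 t2 :=
  forall r t, r1 <= r <= r2 -> t1 <= t <= t2 -> {for pol r t, continuous g}.

Lemma ccts_radial g r1 r2 t1 t2 t : ctsbox g r1 r2 t1 t2 -> t1 <= t <= t2 ->
  ccts r1 r2 (fun r => g (pol r t) * expi t).
Proof.
move=> H tt; apply: cctsM; last exact: ccts_cst.
by apply: (@cts_ccts _ g (pol^~ t)); [move=> r rr; exact: H|exact: ccts_polr].
Qed.

Lemma ccts_circ g r1 r2 t1 t2 r : ctsbox g r1 r2 t1 t2 -> r1 <= r <= r2 ->
  ccts t1 t2 (fun t => g (pol r t) * ('i%C * pol r t)).
Proof.
move=> H rr; apply: cctsM; last by apply: cctsZ; exact: ccts_polt.
by apply: (@cts_ccts _ g (pol r)); [move=> t tt; exact: H|exact: ccts_polt].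
Qed.

Lemma ctsbox_sub g r1 r2 t1 t2 a1 a2 b1 b2 : ctsbox g r1 r2 t1 t2 ->
  r1 <= a1 -> a2 <= r2 -> t1 <= b1 -> b2 <= t2 -> ctsbox g a1 a2 b1 b2.
Proof.
move=> H ? ? ? ? r t /andP[? ?] /andP[? ?]; apply: H; apply/andP; split; lra.
Qed.

Lemma bd_split_r g r1 r2 t1 t2 r : ctsbox g r1 r2 t1 t2 -> t1 <= t2 ->
  r1 <= r -> r <= r2 -> bd g r1 r2 t1 t2 = bd g r1 r t1 t2 + bd g r r2 t1 t2.
Proof.
move=> H tt h1 h2; rewrite /bd.
rewrite (iint_split h1 h2 (ccts_radial H _)) ?lexx//.
rewrite (iint_split h1 h2 (ccts_radial H (t:=t2) _)) ?lexx ?andbT//.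
do ![move: (iint _ _ _) => ?]; ring.
Qed.

Lemma bd_split_t g r1 r2 t1 t2 t : ctsbox g r1 r2 t1 t2 -> r1 <= r2 ->
  t1 <= t -> t <= t2 -> bd g r1 r2 t1 t2 = bd g r1 r2 t1 t + bd g r1 r2 t t2.
Proof.
move=> H tt h1 h2; rewrite /bd.
rewrite (iint_split h1 h2 (ccts_circ H _)) ?lexx ?andbT//.
rewrite (iint_split h1 h2 (ccts_circ H (r:=r1) _)) ?lexx ?andbT//.
do ![move: (iint _ _ _) => ?]; ring.
Qed.

Lemma bdB g h r1 r2 t1 t2 : ctsbox g r1 r2 t1 t2 -> ctsbox h r1 r2 t1 t2 ->
  r1 <= r2 -> t1 <= t2 ->
  bd (fun z => g z - h z) r1 r2 t1 t2 = bd g r1 r2 t1 t2 - bd h r1 r2 t1 t2.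
Proof.
move=> Hg Hh rr tt; rewrite /bd.
have E1 t : t1 <= t <= t2 -> iint r1 r2 (fun r => (g (pol r t) - h (pol r t)) * expi t) =
   iint r1 r2 (fun r => g (pol r t) * expi t) - iint r1 r2 (fun r => h (pol r t) * expi t).
  move=> ht; rewrite -iintB; [|exact: (ccts_radial Hg)|exact: (ccts_radial Hh)].
  by apply: eq_iint => r _; rewrite mulrBl.
have E2 r : r1 <= r <= r2 -> iint t1 t2 (fun t => (g (pol r t) - h (pol r t)) * ('i%C * pol r t)) =
   iint t1 t2 (fun t => g (pol r t) * ('i%C * pol r t)) - iint t1 t2 (fun t => h (pol r t) * ('i%C * pol r t)).
  move=> hr; rewrite -iintB; [|exact: (ccts_circ Hg)|exact: (ccts_circ Hh)].
  by apply: eq_iint => t _; rewrite mulrBl.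
rewrite !E1 ?E2 ?lexx ?andbT//.
do ![move: (iint _ _ _) => ?]; ring.
Qed.

Lemma continuous_affine (c d : C) z : {for z, continuous (fun z => c + d * z)}.
Proof.
apply: derivable_cts; apply: derivableCD; first exact: derivableC_cst.
by apply: derivableCM; [exact: derivableC_cst|exact: derivableC_id].
Qed.

Lemma bd_affine (c d : C) r1 r2 t1 t2 : r1 <= r2 -> t1 <= t2 ->
  bd (fun z => c + d * z) r1 r2 t1 t2 = 0.
Proof.
move=> rr tt; pose G z := c * z + d / 2 * (z * z).
have H : ctsbox (fun z => c + d * z) r1 r2 t1 t2 by move=> r t _ _; exact: continuous_affine.
have dG f s df : rderiv f s df -> rderiv (fun x => G (f x)) s ((c + d * f s) * df).
  move=> hf; have h1 := rderivM (rderiv_cst c s) hf.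
  have h2 := rderivM (rderiv_cst (d / 2) s) (rderivM hf hf).
  apply: rderiv_eq (rderivD h1 h2) _.
  by field.
have E1 t : t1 <= t <= t2 -> iint r1 r2 (fun r => (c + d * pol r t) * expi t) = G (pol r2 t) - G (pol r1 t).
  move=> ht; apply: (@iint_FTC _ _ _ (fun r => G (pol r t)) _ rr _ (ccts_radial H ht)).
  by move=> s; apply: dG; exact: rderiv_polr.
have E2 r : r1 <= r <= r2 -> iint t1 t2 (fun t => (c + d * pol r t) * ('i%C * pol r t)) = G (pol r t2) - G (pol r t1).
  move=> hr; apply: (@iint_FTC _ _ _ (fun t => G (pol r t)) _ tt _ (ccts_circ H hr)).
  by move=> s; apply: dG; exact: rderiv_polt.
rewrite /bd !E1 ?E2 ?lexx ?andbT//; ring.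
Qed.

Lemma bd_le g r1 r2 t1 t2 (M : R) : ctsbox g r1 r2 t1 t2 -> 0 <= r1 -> r1 <= r2 -> r2 <= 1 ->
  t1 <= t2 -> (forall r t, r1 <= r <= r2 -> t1 <= t <= t2 -> normc (g (pol r t)) <= M) ->
  normc (bd g r1 r2 t1 t2) <= 4 * (M * ((r2 - r1) + (t2 - t1))).
Proof.
move=> H r10 rr r21 tt hM.
have M0 : 0 <= M by apply: le_trans (hM r1 t1 _ _); rewrite ?normc_ge0 ?lexx.
have E1 t : t1 <= t <= t2 -> normc (iint r1 r2 (fun r => g (pol r t) * expi t)) <= 2 * (M * (r2 - r1)).
  move=> ht; apply: iint_le_cst => //; first exact: (ccts_radial H).
  by move=> r hr; rewrite normcM normc_expi mulr1; exact: hM.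
have E2 r : r1 <= r <= r2 -> normc (iint t1 t2 (fun t => g (pol r t) * ('i%C * pol r t))) <= 2 * (M * (t2 - t1)).
  move=> /[dup] hr /andP[hr1 hr2]; apply: iint_le_cst => //; first exact: (ccts_circ H).
  move=> t ht; rewrite !normcM normc_expi mulr1 normc_real.
  have -> : normc ('i%C : C) = 1 by rewrite /normc /= expr0n expr1n add0r sqrtr1.
  rewrite mul1r ger0_norm ?(le_trans r10)// -[M]mulr1 ler_pM ?normc_ge0 ?hM ?(le_trans r10)//.
  by rewrite (le_trans hr2).
rewrite /bd.
have T (a b c d : C) : normc (a + b - c - d) <= normc a + normc b + normc c + normc d.
  rewrite (le_trans (le_normcD _ _))// normcN lerD2r (le_trans (le_normcD _ _))// normcN lerD2r.
  exact: le_normcD.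
apply: (le_trans (T _ _ _ _)).
have := E1 t1; have := E1 t2; have := E2 r1; have := E2 r2.
rewrite !lexx !andbT => /(_ rr) h1 /(_ rr) h2 /(_ tt) h3 /(_ tt) h4.
move: h1 h2 h3 h4; do ![move: (normc (iint _ _ _)) => ?]; lra.
Qed.

Lemma pow2_gt (x : R) : exists n, x < 2 ^+ n.
Proof.
exists (Num.bound x); apply: (le_lt_trans (ler_norm x)).
apply: lt_le_trans (archi_boundP (normr_ge0 x)) _.
have -> : Num.bound `|x| = Num.bound x by rewrite /Num.bound normr_id.
by rewrite -natrX ler_nat ltnW// ltn_expl.
Qed.

(** Bisection in both polar parameters gives nested boxes that keep at least a quarter of the
    integral at each step. Near their common point [g] is affine up to a small error, and an affine
    function has a primitive, so the integral is too small. *)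
Lemma goursat g r1 r2 t1 t2 : 0 <= r1 -> r1 <= r2 -> r2 <= 1 -> t1 <= t2 ->
  (forall r t, r1 <= r <= r2 -> t1 <= t <= t2 -> derivable g (pol r t) 1) ->
  bd g r1 r2 t1 t2 = 0.
Proof.
move=> r10 rr r21 tt dg.
have cg : ctsbox g r1 r2 t1 t2 by move=> r t hr ht; apply: derivable_cts; exact: dg.
have [//|b0] := eqVneq (bd g r1 r2 t1 t2) 0; exfalso.
pose be := normc (bd g r1 r2 t1 t2); have be0 : 0 < be by rewrite normc_gt0.
pose w := r2 - r1; pose h := t2 - t1.
have w0 : 0 <= w by rewrite subr_ge0. have h0 : 0 <= h by rewrite subr_ge0.
pose P n (p : R * R) := [/\ r1 <= p.1, p.1 + w / 2 ^+ n <= r2, t1 <= p.2, p.2 + h / 2 ^+ n <= t2 &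
  be / 4 ^+ n <= normc (bd g p.1 (p.1 + w / 2 ^+ n) p.2 (p.2 + h / 2 ^+ n))].
pose Q n (p q : R * R) := [/\ P n.+1 q, p.1 <= q.1, q.1 + w / 2 ^+ n.+1 <= p.1 + w / 2 ^+ n,
  p.2 <= q.2 & q.2 + h / 2 ^+ n.+1 <= p.2 + h / 2 ^+ n].
have step n p : P n p -> exists q, Q n p q.
  move=> [p1 p2 p3 p4 p5].
  have half (x y : R) : y != 0 -> x / y = x / (y * 2) + x / (y * 2) by move=> y0; field.
  have [W EW1 [EW W0]] : exists2 W, w / 2 ^+ n.+1 = W & w / 2 ^+ n = W + W /\ 0 <= W.
    exists (w / 2 ^+ n.+1) => //; split; last by rewrite divr_ge0// exprn_ge0.
    by rewrite exprSr -half// expf_neq0// pnatr_eq0.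
  have [V EV1 [EV V0]] : exists2 V, h / 2 ^+ n.+1 = V & h / 2 ^+ n = V + V /\ 0 <= V.
    exists (h / 2 ^+ n.+1) => //; split; last by rewrite divr_ge0// exprn_ge0.
    by rewrite exprSr -half// expf_neq0// pnatr_eq0.
  rewrite EW EV !addrA in p2 p4 p5.
  have [B EB1 EB] : exists2 B, be / 4 ^+ n.+1 = B & be / 4 ^+ n = B + B + B + B.
    exists (be / 4 ^+ n.+1) => //.
    have quarter (x y : R) : y != 0 -> x / y = x / (y * 4) + x / (y * 4) + x / (y * 4) + x / (y * 4).
      by move=> y0; field.
    by rewrite exprSr -quarter// expf_neq0// pnatr_eq0.
  have cb : ctsbox g p.1 (p.1 + W + W) p.2 (p.2 + V + V) by apply: (ctsbox_sub cg).
  have S1 := @bd_split_r g p.1 (p.1 + W + W) p.2 (p.2 + V + V) (p.1 + W) cb ltac:(clear -W0 V0; lra) ltac:(clear -W0 V0; lra) ltac:(clear -W0 V0; lra).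
  have c1 : ctsbox g p.1 (p.1 + W) p.2 (p.2 + V + V) by apply: (ctsbox_sub cb); clear -W0 V0; lra.
  have c2 : ctsbox g (p.1 + W) (p.1 + W + W) p.2 (p.2 + V + V) by apply: (ctsbox_sub cb); clear -W0 V0; lra.
  have S2 := @bd_split_t g p.1 (p.1 + W) p.2 (p.2 + V + V) (p.2 + V) c1 ltac:(clear -W0 V0; lra) ltac:(clear -W0 V0; lra) ltac:(clear -W0 V0; lra).
  have S3 := @bd_split_t g (p.1 + W) (p.1 + W + W) p.2 (p.2 + V + V) (p.2 + V) c2 ltac:(clear -W0 V0; lra) ltac:(clear -W0 V0; lra) ltac:(clear -W0 V0; lra).
  rewrite S1 S2 S3 EB in p5.
  have T (a b c d : C) : normc (a + b + (c + d)) <= normc a + normc b + normc c + normc d.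
    rewrite addrA (le_trans (le_normcD _ _))// lerD2r (le_trans (le_normcD _ _))// lerD2r.
    exact: le_normcD.
  have {}p5 := le_trans p5 (T _ _ _ _).
  have pick4 (b x y z u : R) : b + b + b + b <= x + y + z + u -> [\/ b <= x, b <= y, b <= z | b <= u].
    move=> hs; case: (leP b x) => q1; first exact: Or41.
    case: (leP b y) => q2; first exact: Or42.
    case: (leP b z) => q3; first exact: Or43.
    apply: Or44; clear -hs q1 q2 q3; lra.
  have l1 (x : R) : x <= x + W by rewrite lerDl.
  have l2 (x : R) : x <= x + V by rewrite lerDl.
  have QQ q : P n.+1 q -> p.1 <= q.1 -> q.1 + W <= p.1 + W + W -> p.2 <= q.2 -> q.2 + V <= p.2 + V + V -> Q n p q.
    by move=> ? ? ? ? ?; split; rewrite ?EW1 ?EV1 ?EW ?EV ?addrA.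
  have PP q : r1 <= q.1 -> q.1 + W <= r2 -> t1 <= q.2 -> q.2 + V <= t2 ->
    B <= normc (bd g q.1 (q.1 + W) q.2 (q.2 + V)) -> P n.+1 q.
    by move=> ? ? ? ? ?; split; rewrite ?EW1 ?EV1 ?EB1.
  have m1 : r1 <= p.1 + W by exact: le_trans (l1 _).
  have m2 : t1 <= p.2 + V by exact: le_trans (l2 _).
  have m3 : p.1 + W <= r2 by exact: le_trans (l1 _) p2.
  have m4 : p.2 + V <= t2 by exact: le_trans (l2 _) p4.
  case: (pick4 _ _ _ _ _ p5) => hq.
  - exists (p.1, p.2); exact: (QQ (p.1, p.2) (PP (p.1, p.2) p1 m3 p3 m4 hq) (lexx _) (l1 _) (lexx _) (l2 _)).
  - exists (p.1, p.2 + V); exact: (QQ (p.1, p.2 + V) (PP (p.1, p.2 + V) p1 m3 m2 p4 hq) (lexx _) (l1 _) (l2 _) (lexx _)).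
  - exists (p.1 + W, p.2); exact: (QQ (p.1 + W, p.2) (PP (p.1 + W, p.2) m1 p2 p3 m4 hq) (l1 _) (lexx _) (lexx _) (l2 _)).
  - exists (p.1 + W, p.2 + V); exact: (QQ (p.1 + W, p.2 + V) (PP (p.1 + W, p.2 + V) m1 p2 m2 p4 hq) (l1 _) (lexx _) (l2 _) (lexx _)).
have step' (np : nat * (R * R)) : exists q, P np.1 np.2 -> Q np.1 np.2 q.
  have [hp|hp] := pselect (P np.1 np.2); last by exists (0, 0).
  by have [q hq] := step _ _ hp; exists q.
have [F HF] := choice step'.
pose s := fix s n := if n is m.+1 then F (m, s m) else (r1, t1).
have Ps n : P n (s n).
  elim: n => [|n IH]; last by have [] := HF (n, s n) IH.
  by rewrite /P /s !expr0 !divr1 /= /w /h [r1 + _]addrC [t1 + _]addrC !subrK; split.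
have Qs n : Q n (s n) (s n.+1) by exact: (HF (n, s n) (Ps n)).
have mono m n : (m <= n)%N -> [/\ (s m).1 <= (s n).1, (s n).1 + w / 2 ^+ n <= (s m).1 + w / 2 ^+ m,
    (s m).2 <= (s n).2 & (s n).2 + h / 2 ^+ n <= (s m).2 + h / 2 ^+ m].
  elim: n => [|n IH]; first by rewrite leqn0 => /eqP ->.
  rewrite leq_eqVlt => /orP[/eqP -> //|]; rewrite ltnS => /IH[i1 i2 i3 i4].
  by have [_ j1 j2 j3 j4] := Qs n; split; [exact: le_trans j1|exact: le_trans i2|exact: le_trans j3|exact: le_trans i4].
have bnd m n : (s n).1 <= (s m).1 + w / 2 ^+ m /\ (s n).2 <= (s m).2 + h / 2 ^+ m.
  have wn k : 0 <= w / 2 ^+ k by rewrite divr_ge0// exprn_ge0.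
  have hn k : 0 <= h / 2 ^+ k by rewrite divr_ge0// exprn_ge0.
  have [mn|/ltnW mn] := leqP m n.
    have [_ i2 _ i4] := mono _ _ mn.
    by split; [apply: le_trans i2|apply: le_trans i4]; rewrite lerDl.
  have [i1 _ i3 _] := mono _ _ mn.
  by split; [apply: (le_trans i1)|apply: (le_trans i3)]; rewrite lerDl.
pose X := [set (s n).1 | n in [set: nat]]; pose Y := [set (s n).2 | n in [set: nat]].
pose r0 := sup X; pose t0 := sup Y.
have X0 : X !=set0 by exists (s 0).1, 0. have Y0 : Y !=set0 by exists (s 0).2, 0.
have xr n : (s n).1 <= r0.
  by apply: ub_le_sup; [exists ((s 0).1 + w / 2 ^+ 0) => _ [k _ <-]; have [] := bnd 0 k|exists n].
have yr n : (s n).2 <= t0.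
  by apply: ub_le_sup; [exists ((s 0).2 + h / 2 ^+ 0) => _ [k _ <-]; have [] := bnd 0 k|exists n].
have xr' n : r0 <= (s n).1 + w / 2 ^+ n by apply: ge_sup => // _ [k _ <-]; have [] := bnd n k.
have yr' n : t0 <= (s n).2 + h / 2 ^+ n by apply: ge_sup => // _ [k _ <-]; have [] := bnd n k.
have [p1 p2 p3 p4 p5] := Ps 0.
have hr0 : r1 <= r0 <= r2 by apply/andP; split; [exact: le_trans p1 (xr 0)|exact: le_trans (xr' 0) p2].
have ht0 : t1 <= t0 <= t2 by apply/andP; split; [exact: le_trans p3 (yr 0)|exact: le_trans (yr' 0) p4].
(* By [pol_lip] with radii at most 1, every point of the box of generation [n] is within
   [D / 2 ^+ n] of the limit point. *)
pose D := w + 2 * h.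
have D0 : 0 <= D by rewrite addr_ge0// mulr_ge0.
(* Small enough that [4 * ep * D * D < be]: the upper bound then falls below the lower bound
   [be / 4 ^+ n]. *)
pose ep := be / (4 * D ^+ 2 + 1).
have den0 : 0 < 4 * D ^+ 2 + 1 by rewrite ltr_wpDl// mulr_ge0// exprn_ge0.
have ep0 : 0 < ep by rewrite divr_gt0.
have [del del0 hdel] := derivable_normc (dg _ _ hr0 ht0) ep0.
have [n hn] := pow2_gt (D / del).
have pn0 : 0 < 2 ^+ n :> R by rewrite exprn_gt0.
have Dn : D / 2 ^+ n < del.
  by rewrite ltr_pdivrMr// mulrC -ltr_pdivrMr.
have [{}p1 {}p2 {}p3 {}p4 {}p5] := Ps n.
set a := (s n).1 in p1 p2 p5; set c := (s n).2 in p3 p4 p5.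
set z0 := pol r0 t0 in hdel.
set d := derive1 g z0 in hdel.
pose aff z := (g z0 - d * z0) + d * z.
have ww : 0 <= w / 2 ^+ n by rewrite divr_ge0// ltW.
have hh : 0 <= h / 2 ^+ n by rewrite divr_ge0// ltW.
have cb : ctsbox g a (a + w / 2 ^+ n) c (c + h / 2 ^+ n) by apply: (ctsbox_sub cg).
have ca : ctsbox aff a (a + w / 2 ^+ n) c (c + h / 2 ^+ n) by move=> r t _ _; exact: continuous_affine.
have E : bd g a (a + w / 2 ^+ n) c (c + h / 2 ^+ n) =
   bd (fun z => g z - aff z) a (a + w / 2 ^+ n) c (c + h / 2 ^+ n).
  by rewrite bdB ?lerDl// [X in _ - X]bd_affine ?lerDl// subr0.
have cbd : ctsbox (fun z => g z - aff z) a (a + w / 2 ^+ n) c (c + h / 2 ^+ n).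
  move=> r t hr ht.
  have k1 := cb _ _ hr ht. have k2 := ca _ _ hr ht.
  exact: (@cvgB C C _ _ _ _ _ _ _ k1 k2).
have L : normc (bd g a (a + w / 2 ^+ n) c (c + h / 2 ^+ n)) <=
    4 * (ep * (D / 2 ^+ n) * (((a + w / 2 ^+ n) - a) + ((c + h / 2 ^+ n) - c))).
  rewrite E; apply: bd_le; [exact: cbd|exact: le_trans p1|by rewrite lerDl|exact: le_trans r21|by rewrite lerDl|].
  move=> r t /andP[ra rb] /andP[tc td].
  have hz : normc (pol r t - z0) <= D / 2 ^+ n.
    apply: (le_trans (pol_lip _ _ _ _)).
    have A1 : `|r - r0| <= w / 2 ^+ n.
      by rewrite ler_norml; have := xr n; have := xr' n; rewrite -/a => k1 k2; apply/andP; split; clear -k1 k2 ra rb; lra.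
    have A2 : `|t - t0| <= h / 2 ^+ n.
      by rewrite ler_norml; have := yr n; have := yr' n; rewrite -/c => k1 k2; apply/andP; split; clear -k1 k2 tc td; lra.
    have A3 : `|r0| <= 1 by rewrite ler_norml; move: hr0 => /andP[k1 k2]; apply/andP; split; clear -k1 k2 r10 r21; lra.
    have -> : D / 2 ^+ n = w / 2 ^+ n + 1 * (2 * (h / 2 ^+ n)) by rewrite /D mulrDl mul1r mulrA.
    by apply: (lerD A1); rewrite ler_pM ?mulr_ge0 ?ler_pM2l.
  have -> : g (pol r t) - aff (pol r t) = g ((pol r t - z0) + z0) - g z0 - d * (pol r t - z0).
    by rewrite subrK /aff; ring.
  apply: (le_trans (hdel _ (le_lt_trans hz Dn))).
  by rewrite ler_pM2l.
have := le_trans p5 L; apply/negP; rewrite -ltNge.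
have -> : 4 * (ep * (D / 2 ^+ n) * (a + w / 2 ^+ n - a + (c + h / 2 ^+ n - c))) =
   (4 * ep * D * (w + h)) / 4 ^+ n.
  rewrite (_ : (4 : R) = 2 * 2); last by rewrite -natrM.
  by rewrite exprMn; field; rewrite expf_neq0// pnatr_eq0.
have q0 : 0 < (4 ^+ n : R)^-1 by rewrite invr_gt0 exprn_gt0.
rewrite (ltr_pM2r q0).
apply: (@le_lt_trans _ _ (4 * ep * D * D)).
  have ww2 : w + h <= D by rewrite lerD2l; clear -h0; lra.
  have ep4 : 0 <= 4 * ep * D by rewrite mulr_ge0// mulr_ge0// ltW.
  exact: ler_wpM2l ep4 _ _ ww2.
have -> : 4 * ep * D * D = ep * (4 * D ^+ 2) by rewrite expr2; clear; move: D ep => x y; ring.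
by rewrite /ep mulrAC ltr_pdivrMr// ltr_pM2l// ltrDl.
Qed.

(* The radial sides of a full polar box cancel. *)
Definition cmean g (r : R) : C := iint 0 (2 * pi) (fun t => g (pol r t) * pol r t).

Lemma pi2_ge0 : 0 <= 2 * pi :> R.
Proof. by rewrite mulr_ge0// pi_ge0. Qed.

Lemma cmean_const g r1 r2 : 0 <= r1 -> r1 <= r2 -> r2 <= 1 ->
  (forall z, r1 <= normc z <= r2 -> derivable g z 1) -> cmean g r1 = cmean g r2.
Proof.
move=> r10 rr r21 dg.
have dg' r t : r1 <= r <= r2 -> 0 <= t <= 2 * pi -> derivable g (pol r t) 1.
  move=> /[dup] hr /andP[h1 _] _; apply: dg; rewrite normc_pol ger0_norm//.
  exact: le_trans h1.
have := goursat r10 rr r21 pi2_ge0 dg'.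
have cg : ctsbox g r1 r2 0 (2 * pi) by move=> r t hr ht; apply: derivable_cts; exact: dg'.
rewrite /bd /pol expi0 expi2pi.
have E r : r1 <= r <= r2 -> iint 0 (2 * pi) (fun t => g (pol r t) * ('i%C * pol r t)) = 'i%C * cmean g r.
  move=> hr; rewrite /cmean -iintZ; first by apply: eq_iint => t _; rewrite mulrCA.
  apply: cctsM; last exact: ccts_polt.
  by apply: (@cts_ccts _ g (pol r)); [move=> t tt; exact: cg|exact: ccts_polt].
rewrite !E ?lexx ?andbT//.
rewrite -addrA addrAC addrA subrr add0r addrC -mulrBr => /eqP.
rewrite mulf_eq0 => /orP[/eqP h|]; last by rewrite subr_eq0 => /eqP ->.
by have := normc0 R; rewrite -h /normc /= expr0n expr1n add0r sqrtr1 => /eqP; rewrite oner_eq0.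
Qed.

Lemma ccts_circle g r a b : (forall z, disk z -> {for z, continuous g}) -> `|r| < 1 ->
  ccts a b (fun t => g (pol r t)).
Proof.
move=> cg r1; apply: (@cts_ccts _ g (pol r)); last exact: ccts_polt.
by move=> t tt; apply: cg; rewrite diskE normc_pol.
Qed.

(** The integrand is continuous in both variables, and compactness of the range of the angle makes
    the continuity in [r] uniform in [t]. *)
Lemma cmean_cts g r0 : (forall z, disk z -> {for z, continuous g}) -> `|r0| < 1 ->
  forall e, 0 < e -> exists2 d : R, 0 < d &
    forall r, `|r - r0| < d -> normc (cmean g r - cmean g r0) <= e.
Proof.
move=> cg r01 e e0.
pose G z := g z * z.
have cG z : disk z -> {for z, continuous G}.
  move=> dz; have h := cg z dz; have h2 := derivable_cts (@derivableC_id R z).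
  exact: (@cvgCM R C (nbhs z) _ g (fun w => w) _ _ h h2).
pose e1 := e / (2 * (2 * pi + 1)).
have pi1 : 0 < 2 * pi + 1 :> R by rewrite ltr_wpDl// pi2_ge0.
have e10 : 0 < e1 by rewrite divr_gt0// mulr_gt0.
have cpt : compact `[(0 : R), 2 * pi] by exact: segment_compact.
have /compact_near_coveringP := cpt.
move=> /(_ _ (nbhs r0) (fun r t => normc (G (pol r t) - G (pol r0 t)) < e1 /\ `|r| < 1)).
case.
  move=> t ht.
  have [d1 d10 hd1] : exists2 d : R, 0 < d & forall w, normc (w - pol r0 t) < d -> normc (G w - G (pol r0 t)) < e1 / 2.
    have dd : disk (pol r0 t) by rewrite diskE normc_pol.
    have /ctsCP := cG _ dd; apply.
    by rewrite divr_gt0.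
  pose del := Num.min (1 - `|r0|) (d1 / 6).
  have del0 : 0 < del by rewrite lt_min subr_gt0 r01/= divr_gt0.
  exists ([set t' | `|t' - t| < del], [set r | `|r - r0| < del]); first split => /=.
  - by exists del => //= x; rewrite /ball_/= distrC.
  - by exists del => //= x; rewrite /ball_/= distrC.
  move=> [t' r] [/= ht' hr].
  have dl1 : del <= 1 - `|r0| by rewrite ge_min lexx.
  have dl2 : del <= d1 / 6 by rewrite ge_min lexx orbT.
  have r0n := normr_ge0 r0.
  have P1 : normc (pol r t' - pol r0 t) < d1.
    apply: (le_lt_trans (pol_lip _ _ _ _)).
    have : `|r0| * (2 * `|t' - t|) <= 1 * (2 * `|t' - t|) by rewrite ler_wpM2r ?mulr_ge0// ltW.
    by clear -ht' hr dl2 d10; lra.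
  have P2 : normc (pol r0 t' - pol r0 t) < d1.
    apply: (le_lt_trans (pol_lip _ _ _ _)).
    have : `|r0| * (2 * `|t' - t|) <= 1 * (2 * `|t' - t|) by rewrite ler_wpM2r ?mulr_ge0// ltW.
    by rewrite subrr normr0; clear -ht' hr dl2 d10; lra.
  split.
    have -> : G (pol r t') - G (pol r0 t') = (G (pol r t') - G (pol r0 t)) - (G (pol r0 t') - G (pol r0 t)) by ring.
    apply: (le_lt_trans (le_normcD _ _)); rewrite normcN [e1]splitr.
    by rewrite ltrD// hd1.
  rewrite -[r](subrK r0) (le_lt_trans (ler_normD _ _))//.
  by clear -hr dl1; lra.
move=> d /= d0 hd; exists d => // r hr.
have Hr : `[0, (2 * pi)]%classic `<=` (fun t => normc (G (pol r t) - G (pol r0 t)) < e1 /\ `|r| < 1).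
  by apply: hd; rewrite /ball_/= distrC.
have r1 : `|r| < 1 by have [] := Hr 0 _; rewrite //= in_itv/= lexx pi2_ge0.
have c1 x : `|x| < 1 -> ccts 0 (2 * pi) (fun t => G (pol x t)) by exact: ccts_circle.
rewrite -[cmean g r]/(iint 0 (2 * pi) (fun t => G (pol r t))) -[cmean g r0]/(iint 0 (2 * pi) (fun t => G (pol r0 t))).
rewrite -iintB; [|exact: c1|exact: c1].
apply: le_trans (iint_le_cst (M := e1) pi2_ge0 (cctsB (c1 _ r1) (c1 _ r01)) _) _.
  by move=> t ht; apply: ltW; have [] := Hr t _; rewrite //= in_itv.
have -> : e = 2 * (e1 * (2 * pi + 1)) by rewrite mulrCA /e1 divfK// gt_eqF// mulr_gt0.
by rewrite subr0 ler_pM2l// ler_pM2l// lerDl.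
Qed.

(** Goursat's lemma only covers annuli that avoid the circle through [w]. Below that radius the mean
    equals its value 0 at the centre, and continuity in the radius carries this value across the
    circle. *)
Lemma cmean_removable g w : disk w -> (forall z, disk z -> {for z, continuous g}) ->
  (forall z, disk z -> z != w -> derivable g z 1) ->
  forall r, 0 <= r -> r < 1 -> cmean g r = 0.
Proof.
move=> dw cg dg.
have c0 : cmean g 0 = 0.
  rewrite /cmean (@eq_iint _ _ _ _ (fun=> 0)); last first.
    by move=> t _; rewrite /pol mul0r mulr0.
  by rewrite iint_cst ?pi2_ge0// mulr0.
pose rw := normc w.
have rw0 : 0 <= rw by exact: normc_ge0.
have rw1 : rw < 1 by rewrite -diskE.
have dgz z : normc z < 1 -> normc z != rw -> derivable g z 1.
  by move=> h1 h2; apply: dg; rewrite ?diskE//; apply: contraNneq h2 => ->.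
have lo r : 0 <= r -> r < rw -> cmean g r = 0.
  move=> r0 rr; rewrite -c0; symmetry; apply: cmean_const => //.
    by rewrite ltW// (lt_trans rr).
  move=> z /andP[_ zr]; apply: dgz; first by rewrite (le_lt_trans zr)// (lt_trans rr).
  by rewrite lt_eqF// (le_lt_trans zr).
have c_rw : cmean g rw = 0.
  have [rwe|rwp] := eqVneq rw 0; first by rewrite rwe.
  have {}rwp : 0 < rw by rewrite lt_neqAle eq_sym rwp.
  apply/eqP; rewrite -normc_eq0 eq_le normc_ge0 andbT.
  apply/ler_addgt0Pl => e e0; rewrite addr0.
  have rwn : `|rw| < 1 by rewrite ger0_norm.
  have [d d0 hd] := cmean_cts cg rwn e0.
  pose r := Num.max (rw / 2) (rw - d / 2).
  have hr : r < rw by rewrite gt_max; apply/andP; split; clear -rwp d0; lra.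
  have hr' : rw - d / 2 <= r by rewrite le_max lexx orbT.
  have hr0 : 0 <= r by rewrite le_max divr_ge0.
  have := hd r; rewrite lo// sub0r normcN; apply.
  by rewrite ltr_norml; apply/andP; split; clear -hr hr' d0; lra.
have hi r : rw < r -> r < 1 -> cmean g r = 0.
  move=> rr r1.
  apply/eqP; rewrite -normc_eq0 eq_le normc_ge0 andbT.
  apply/ler_addgt0Pl => e e0; rewrite addr0.
  have rwn : `|rw| < 1 by rewrite ger0_norm.
  have [d d0 hd] := cmean_cts cg rwn e0.
  pose s := Num.min r (rw + d / 2).
  have hs : rw < s by rewrite lt_min rr /=; clear -d0; lra.
  have hs' : s <= rw + d / 2 by rewrite ge_min lexx orbT.
  have sr : s <= r by rewrite ge_min lexx.
  rewrite -(@cmean_const g s r)//.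
  - have := hd s; rewrite c_rw subr0; apply.
    by rewrite ltr_norml; apply/andP; split; clear -hs hs' d0; lra.
  - by rewrite (le_trans rw0)// ltW.
  - exact: ltW.
  - move=> z /andP[z1 z2]; apply: dgz; first exact: le_lt_trans r1.
    by rewrite gt_eqF// (lt_le_trans hs).
move=> r r0 r1; case: (ltgtP r rw) => h; [exact: lo|exact: hi|by rewrite h].
Qed.

(** This is [cmean_removable] for the difference quotient of [f] at [w], extended by the derivative.
    The integral of the kernel itself is evaluated in [iint_kernel1]. *)
Lemma cauchy_kernel (f : C -> C) w r : (forall z, disk z -> derivable f z 1) ->
  normc w < r -> r < 1 ->
  iint 0 (2 * pi) (fun t => f (pol r t) * (pol r t / (pol r t - w))) =
  f w * iint 0 (2 * pi) (fun t => pol r t / (pol r t - w)).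
Proof.
move=> df wr r1.
have r0 : 0 < r by rewrite (le_lt_trans (normc_ge0 w)).
have dw : disk w by rewrite diskE (lt_trans wr).
pose g z := if z == w then derive1 f w else (f z - f w) / (z - w).
have dgw z : disk z -> z != w -> derivable g z 1.
  move=> dz zw.
  have h1 : derivable (fun z => (f z - f w) * (z - w)^-1) z 1.
    apply: derivableCM; first by apply: derivableCD; [exact: df|exact: derivableC_cst].
    apply: derivableCV; first by rewrite subr_eq0.
    by apply: derivableCD; [exact: derivableC_id|exact: derivableC_cst].
  have [|//] := @near_eq_derive1 R (fun z => (f z - f w) * (z - w)^-1) g z _ h1.
  have zw0 : 0 < normc (z - w) by rewrite normc_gt0 subr_eq0.
  exists (normc (z - w))%:C%C => /=; first by rewrite ltcR.
  move=> u; rewrite /ball_/= normr_normc ltcR => hu.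
  by rewrite /g; case: eqP => // uw; move: hu; rewrite uw ltxx.
have cg z : disk z -> {for z, continuous g}.
  move=> dz; have [zw|zw] := eqVneq z w; last by apply: derivable_cts; exact: dgw.
  rewrite zw; apply/ctsCP => e e0.
  have e2 : 0 < e / 2 by rewrite divr_gt0.
  have [d d0 hd] := derivable_normc (df w dw) e2.
  exists d => // u hu; rewrite /g eqxx; case: eqP => [_|/eqP uw]; first by rewrite subrr normc0.
  have uw0 : u - w != 0 by rewrite subr_eq0.
  have -> : (f u - f w) / (u - w) - derive1 f w = (f u - f w - derive1 f w * (u - w)) / (u - w) by field.
  rewrite normcM normcV ltr_pdivrMr ?normc_gt0//.
  have := hd _ hu; rewrite subrK => /le_lt_trans; apply.
  by rewrite ltr_pM2r ?normc_gt0// ltr_pdivrMr// ltr_pMr// ltr1n.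
have := cmean_removable dw cg dgw (ltW r0) r1.
have zw t : pol r t - w != 0.
  rewrite subr_eq0; apply/eqP => h; move: wr; rewrite -h normc_pol ger0_norm ?ltxx//.
  exact: ltW.
have cK : ccts 0 (2 * pi) (fun t => pol r t / (pol r t - w)).
  apply: cctsM; first exact: ccts_polt.
  apply: (@cts_ccts _ (fun z => (z - w)^-1) (pol r)); last exact: ccts_polt.
  move=> t _; apply: derivable_cts; apply: derivableCV => //.
have cf : ccts 0 (2 * pi) (fun t => f (pol r t)).
  by apply: ccts_circle; [move=> z dz; apply: derivable_cts; exact: df|rewrite ger0_norm// ltW].
rewrite /cmean => H.
have E : iint 0 (2 * pi) (fun t => g (pol r t) * pol r t) =
  iint 0 (2 * pi) (fun t => f (pol r t) * (pol r t / (pol r t - w)) - f w * (pol r t / (pol r t - w))).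
  apply: eq_iint => t _; rewrite /g; case: eqP => [h|_]; last by field.
  by move: (zw t); rewrite h subrr eqxx.
move: H; rewrite E iintB; [|exact: cctsM|exact: cctsZ].
by rewrite iintZ// => /eqP; rewrite subr_eq0 => /eqP.
Qed.

Lemma pol_neq0 r t : 0 < r -> pol r t != 0.
Proof. by move=> r0; rewrite -normc_gt0 normc_pol normr_gt0 gt_eqF. Qed.

Lemma ccts_polV r n a b : 0 < r -> ccts a b (fun t => (pol r t) ^- n).
Proof.
move=> r0; apply: (@cts_ccts _ (fun z => (z ^+ n)^-1) (pol r)); last exact: ccts_polt.
move=> t _; apply: derivable_cts; apply: derivableCV.
  by rewrite expf_neq0// pol_neq0.
exact: derivableC_exp.
Qed.

Lemma ccts_kernel r w a b : normc w < r -> ccts a b (fun t => pol r t / (pol r t - w)).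
Proof.
move=> wr.
have r0 : 0 < r by rewrite (le_lt_trans (normc_ge0 w)).
have zw t : pol r t - w != 0.
  rewrite subr_eq0; apply/eqP => h; move: wr; rewrite -h normc_pol ger0_norm ?ltxx//.
  exact: ltW.
apply: cctsM; first exact: ccts_polt.
apply: (@cts_ccts _ (fun z => (z - w)^-1) (pol r)); last exact: ccts_polt.
by move=> t _; apply: derivable_cts; apply: derivableCV => //.
Qed.

Lemma kernel_le r w t : normc w < r -> normc (pol r t / (pol r t - w)) <= r / (r - normc w).
Proof.
move=> wr.
have r0 : 0 < r by rewrite (le_lt_trans (normc_ge0 w)).
rewrite normcM normcV normc_pol ger0_norm ?(ltW r0)// ler_wpM2l ?(ltW r0)//.
have h : r - normc w <= normc (pol r t - w).
  apply: le_trans (le_normcB _ _); rewrite normc_pol (ger0_norm (ltW r0)); exact: ler_norm.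
by rewrite lef_pV2 ?posrE ?subr_gt0// (lt_le_trans _ h)// subr_gt0.
Qed.

(** The kernel is expanded as a geometric series in [w / pol r t]. The remainder after [N] terms is
    the [N]-th power of the ratio times the kernel again, hence the bound. *)
Lemma iint_geo (phi : R -> C) r w (M : R) N : normc w < r ->
  ccts 0 (2 * pi) phi -> (forall t, 0 <= t <= 2 * pi -> normc (phi t) <= M) ->
  normc (iint 0 (2 * pi) (fun t => phi t * (pol r t / (pol r t - w))) -
         \sum_(n < N) w ^+ n * iint 0 (2 * pi) (fun t => phi t * (pol r t) ^- n)) <=
  (normc w / r) ^+ N * (2 * (M * (r / (r - normc w)) * (2 * pi))).
Proof.
move=> wr cphi hM.
have r0 : 0 < r by rewrite (le_lt_trans (normc_ge0 w)).
have M0 : 0 <= M by apply: le_trans (hM 0 _); rewrite ?normc_ge0// lexx pi2_ge0.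
have cK := @ccts_kernel r w 0 (2 * pi) wr.
have cV n := @ccts_polV r n 0 (2 * pi) r0.
have zw t : pol r t - w != 0.
  rewrite subr_eq0; apply/eqP => h; move: wr; rewrite -h normc_pol ger0_norm ?ltxx//.
  exact: ltW.
rewrite (eq_bigr (fun n : 'I_N => iint 0 (2 * pi) (fun t => w ^+ n * (phi t * pol r t ^- n)))); last first.
  by move=> n _; rewrite iintZ//; exact: cctsM.
rewrite -iint_sum; last by move=> n; apply: cctsZ; exact: cctsM.
rewrite -iintB; last 2 first.
- exact: cctsM.
- by apply: ccts_sum => n; apply: cctsZ; exact: cctsM.
rewrite (@eq_iint _ _ _ _ (fun t => w ^+ N * (phi t * (pol r t ^- N * (pol r t / (pol r t - w)))))); last first.
  move=> t _.
  have p0 := pol_neq0 t r0.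
  have geo : pol r t / (pol r t - w) = \sum_(n < N) w ^+ n * (pol r t) ^- n + w ^+ N * (pol r t ^- N * (pol r t / (pol r t - w))).
    elim: N => [|N IH]; first by rewrite big_ord0 add0r expr0 invr1 !mul1r.
    rewrite big_ord_recr /= -addrA {1}IH; congr (_ + _).
    rewrite !exprS invfM; field.
    by rewrite zw p0 expf_neq0.
  rewrite {1}geo mulrDr mulr_sumr addrAC -sumrB big1 ?add0r; first by rewrite mulrCA.
  by move=> n _; rewrite mulrCA subrr.
rewrite iintZ; last by do 2![apply: cctsM => //].
have EE (x y z : R) : (x / y) ^+ N * z = x ^+ N * (y ^- N * z) by rewrite expr_div_n mulrA.
rewrite normcM normcX EE ler_wpM2l ?exprn_ge0 ?normc_ge0//.
have h : ccts 0 (2 * pi) (fun t => phi t * (pol r t ^- N * (pol r t / (pol r t - w)))).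
  by do 2![apply: cctsM => //].
apply: (le_trans (@iint_le_cst R 0 (2 * pi) _ (r ^- N * (M * (r / (r - normc w)))) pi2_ge0 h _)).
  move=> t ht; rewrite normcM normcM mulrCA normcV normcX normc_pol (ger0_norm (ltW r0)).
  rewrite ler_wpM2l ?invr_ge0 ?exprn_ge0 ?(ltW r0)//.
  by rewrite ler_pM ?normc_ge0 ?hM// kernel_le.
rewrite subr0; move: (r ^- N) (M * (r / _)) => x y.
by rewrite le_eqVlt; apply/orP; left; apply/eqP; rewrite !mulrA [2 * x]mulrC.
Qed.

Definition psum (a : nat -> C) (w : C) N := \sum_(n < N) a n * w ^+ n.

Definition tcoef (f : C -> C) r n : C := (2 * pi)^-1%:C%C * iint 0 (2 * pi) (fun t => f (pol r t) * (pol r t) ^- n).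

Lemma pi2_gt0 : 0 < 2 * pi :> R.
Proof. by rewrite mulr_gt0// pi_gt0. Qed.

Lemma rderiv_expin n t : rderiv (fun t => expi t ^+ n) t (n%:R * 'i%C * expi t ^+ n).
Proof.
elim: n => [|n IH].
  by rewrite !mul0r; have -> : (fun t => expi t ^+ 0) = (fun=> 1 : C) by []; exact: rderiv_cst.
have -> : (fun t => expi t ^+ n.+1) = (fun t => expi t * expi t ^+ n) :> (R -> C).
  by apply/funext => s; rewrite exprS.
apply: rderiv_eq (rderivM (rderiv_expi t) IH) _.
by rewrite exprS -natr1; ring.
Qed.

Lemma iint_expin n : iint 0 (2 * pi) (fun t => expi t ^+ n) = (if n == 0%N then (2 * pi)%:C%C else 0) :> C.
Proof.
have [->|n0] := eqVneq n 0%N.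
  rewrite (@eq_iint _ _ _ _ (fun=> 1)); last by move=> t _; rewrite expr0.
  by rewrite iint_cst ?pi2_ge0// subr0 mulr1.
have cE := @rderiv_ccts R 0 (2 * pi) _ _ (rderiv_expin n).
have i0 : 'i%C != 0 :> C by rewrite -normc_gt0 /normc /= expr0n expr1n add0r sqrtr1.
have := iint_FTC pi2_ge0 (rderiv_expin n) (cctsZ (n%:R * 'i%C) cE).
rewrite expi0 expi2pi expr1n subrr iintZ// => /eqP.
by rewrite mulf_eq0 mulf_eq0 pnatr_eq0 (negbTE n0) (negbTE i0)/= => /eqP.
Qed.

Lemma iint_conj (f : R -> C) a b : ccts a b f -> iint a b (fun t => (f t)^*) = (iint a b f)^*.
Proof.
move=> cf; rewrite /iint /cintegral.
have -> : (fun t => complex.Re (f t)^*) = (fun t => complex.Re (f t)) by apply/funext => t; case: (f t).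
have -> : (fun t => complex.Im (f t)^*) = (fun t => -1 * complex.Im (f t)).
  by apply/funext => t; case: (f t) => ? ? /=; rewrite mulN1r.
rewrite RintegralZl//; first by rewrite mulN1r.
exact: (@ccts_integrable _ (@complex.Im R) Im_lip).
Qed.

Lemma iint_expiVn n : iint 0 (2 * pi) (fun t => expi t ^- n) = (if n == 0%N then (2 * pi)%:C%C else 0) :> C.
Proof.
have E t : expi t ^- n = (expi t ^+ n)^* :> C by rewrite rmorphXn /= conj_expi expiN exprVn.
rewrite (eq_iint (g := fun t => (expi t ^+ n)^*)); last by move=> t _.
rewrite iint_conj; last exact: (rderiv_ccts (rderiv_expin n)).
by rewrite iint_expin; case: ifP => _; [rewrite /Num.conj/= oppr0 | rewrite rmorph0].
Qed.

Lemma ccts_expiV n a b : ccts a b (fun t : R => expi t ^- n).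
Proof.
have := @ccts_polV 1 n a b ltr01.
suff -> : (fun t => pol 1 t ^- n) = (fun t => expi t ^- n) by [].
by apply/funext => t; rewrite /pol mul1r.
Qed.

(** In the geometric expansion for the constant 1, only the term of order 0 has a nonzero integral,
    and the remainder tends to 0. *)
Lemma iint_kernel1 r w : normc w < r -> iint 0 (2 * pi) (fun t => pol r t / (pol r t - w)) = (2 * pi)%:C%C.
Proof.
move=> wr.
have r0 : 0 < r by rewrite (le_lt_trans (normc_ge0 w)).
apply/eqP; rewrite -subr_eq0 -normc_eq0 eq_le normc_ge0 andbT.
pose K := 2 * (1 * (r / (r - normc w)) * (2 * pi)).
have q0 : 0 <= normc w / r by rewrite divr_ge0 ?normc_ge0// ltW.
have q1 : normc w / r < 1 by rewrite ltr_pdivrMr// mul1r.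
have H N : normc (iint 0 (2 * pi) (fun t => pol r t / (pol r t - w)) - (2 * pi)%:C%C) <= (normc w / r) ^+ N.+1 * K.
  have := @iint_geo (fun=> 1) r w 1 N.+1 wr (@ccts_cst _ _ _ _) _.
  rewrite (@eq_iint _ _ _ (fun t => 1 * (pol r t / (pol r t - w))) (fun t => pol r t / (pol r t - w))); last by move=> t _; rewrite mul1r.
  have -> : \sum_(n < N.+1) w ^+ n * iint 0 (2 * pi) (fun t => 1 * pol r t ^- n) = (2 * pi)%:C%C.
    rewrite big_ord_recl big1 ?addr0.
      rewrite expr0 mul1r (@eq_iint _ _ _ _ (fun=> 1)); last by move=> t _; rewrite expr0 invr1 mul1r.
      by rewrite iint_cst ?pi2_ge0// subr0 mulr1.
    move=> n _; rewrite (@eq_iint _ _ _ _ (fun t => (r%:C%C) ^- (bump 0 n) * expi t ^- (bump 0 n))).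
      rewrite iintZ; last exact: ccts_expiV.
      by rewrite iint_expiVn /= !mulr0.
    by move=> t _; rewrite mul1r /pol exprMn invfM.
  by apply; move=> t _; rewrite normc1.
have lim : (fun N => (normc w / r) ^+ N.+1 * K) @ \oo --> (0 : R).
  rewrite -(mul0r K); apply: cvgMr_tmp.
  have h : (fun n => (normc w / r) ^+ n) @ \oo --> (0 : R) by apply: cvg_expr; rewrite ger0_norm.
  by move: h; rewrite -(cvg_shiftS (fun n => (normc w / r) ^+ n)).
apply: (ler_cvg_to (cvg_cst _) lim); exact: nearW.
Qed.

Lemma taylor_le (f : C -> C) r : (forall z, disk z -> derivable f z 1) -> 0 < r -> r < 1 ->
  exists2 K, 0 <= K & forall w N, normc w < r ->
   normc (f w - psum (tcoef f r) w N) <= (normc w / r) ^+ N * (K / (r - normc w)).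
Proof.
move=> df r0 r1.
have cf : ccts 0 (2 * pi) (fun t => f (pol r t)).
  by apply: ccts_circle; [move=> z dz; apply: derivable_cts; exact: df|rewrite ger0_norm// ltW].
have [M hM] : exists M, forall t, 0 <= t <= 2 * pi -> normc (f (pol r t)) <= M.
  have [c _ hc] := EVT_max pi2_ge0 (normc_ccts cf).
  by exists (normc (f (pol r c))) => t ht; apply: hc; rewrite in_itv.
have M0 : 0 <= M by apply: le_trans (hM 0 _); rewrite ?normc_ge0// lexx pi2_ge0.
have p0 := @pi2_gt0.
exists (2 * (M * r)); first by rewrite !mulr_ge0// ltW.
move=> w N wr.
have := iint_geo N wr cf hM; rewrite cauchy_kernel// iint_kernel1//.
set S := \sum_(_ < _) _ => H.
have -> : f w - psum (tcoef f r) w N = (2 * pi)^-1%:C%C * (f w * (2 * pi)%:C%C - S).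
  rewrite mulrBr mulrCA -rmorphM mulVf ?gt_eqF// mulr1 /psum /S mulr_sumr; congr (_ - _).
  by apply: eq_bigr => n _; rewrite /tcoef -mulrA [_ * w ^+ n]mulrC.
rewrite normcM normc_real ger0_norm ?invr_ge0 ?(ltW p0)//.
apply: (@le_trans _ _ ((2 * pi)^-1 * ((normc w / r) ^+ N * (2 * (M * (r / (r - normc w)) * (2 * pi)))))).
  by rewrite ler_wpM2l// invr_ge0 ltW.
rewrite le_eqVlt; apply/orP; left; apply/eqP.
have rw : r - normc w != 0 by rewrite subr_eq0 gt_eqF.
move: ((normc w / r) ^+ N) => x; move: (normc w) rw p0 => y; move: (2 * pi) => P rw P0.
by field; rewrite rw gt_eqF.
Qed.

Definition tame (a : nat -> C) := forall r, 0 < r -> r < 1 ->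
  exists2 M, 0 <= M & forall n, normc (a n) * r ^+ n <= M.

(* The remainder estimate is the one given by the Cauchy integral; it is uniform
   enough to multiply, divide and differentiate without a theory of power series. *)
Definition has_ps (a : nat -> C) (f : C -> C) := tame a /\
  forall r, 0 < r -> r < 1 -> exists2 K, 0 <= K & forall w N, normc w < r ->
   normc (f w - psum a w N) <= (normc w / r) ^+ N * (K / (r - normc w)).

Lemma tcoef_le (f : C -> C) r : (forall z, disk z -> derivable f z 1) -> 0 < r -> r < 1 ->
  exists2 M, 0 <= M & forall n, normc (tcoef f r n) * r ^+ n <= M.
Proof.
move=> df r0 r1.
have cf : ccts 0 (2 * pi) (fun t => f (pol r t)).
  by apply: ccts_circle; [move=> z dz; apply: derivable_cts; exact: df|rewrite ger0_norm// ltW].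
have [M hM] : exists M, forall t, 0 <= t <= 2 * pi -> normc (f (pol r t)) <= M.
  have [c _ hc] := EVT_max pi2_ge0 (normc_ccts cf).
  by exists (normc (f (pol r c))) => t ht; apply: hc; rewrite in_itv.
have M0 : 0 <= M by apply: le_trans (hM 0 _); rewrite ?normc_ge0// lexx pi2_ge0.
have p0 := @pi2_gt0.
exists (2 * M); first by rewrite mulr_ge0.
move=> n; rewrite /tcoef normcM normc_real ger0_norm ?invr_ge0 ?(ltW p0)//.
have h : ccts 0 (2 * pi) (fun t => f (pol r t) * pol r t ^- n).
  by apply: cctsM => //; exact: ccts_polV.
have := @iint_le_cst R 0 (2 * pi) _ (M * r ^- n) pi2_ge0 h _.
rewrite subr0 => H.
have rn : 0 < r ^+ n by rewrite exprn_gt0.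
apply: (@le_trans _ _ ((2 * pi)^-1 * (2 * (M / r ^+ n * (2 * pi))) * r ^+ n)).
  rewrite ler_pM2r// ler_pM2l ?invr_gt0//; apply: H => t ht.
  rewrite normcM normcV normcX normc_pol (ger0_norm (ltW r0)).
  by rewrite ler_wpM2r ?invr_ge0 ?(ltW rn)// hM.
rewrite le_eqVlt; apply/orP; left; apply/eqP.
move: (2 * pi) p0 (r ^+ n) rn => P P0 y y0.
by field; rewrite !gt_eqF.
Qed.

Lemma psumS a w N : psum a w N.+1 = psum a w N + a N * w ^+ N.
Proof. by rewrite /psum big_ord_recr. Qed.

Lemma iint_pol_pol s (m n : nat) : 0 < s ->
  iint 0 (2 * pi) (fun t => pol s t ^+ m * pol s t ^- n) = if m == n then (2 * pi)%:C%C else 0.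
Proof.
move=> s0; have cV k := @ccts_polV s k 0 (2 * pi) s0.
case: eqP => [<-|/eqP mn].
  rewrite (@eq_iint _ _ _ _ (fun=> 1)); last first.
    by move=> t _; rewrite mulfV// expf_neq0// pol_neq0.
  by rewrite iint_cst ?pi2_ge0// subr0 mulr1.
have [lt_mn|le_nm] := ltnP m n.
  rewrite (@eq_iint _ _ _ _ (fun t => s%:C%C ^- (n - m) * expi t ^- (n - m))); last first.
    move=> t _; rewrite -[X in _ ^- X](subnK (ltnW lt_mn)) exprD invfM mulrCA mulfV ?mulr1.
      by rewrite /pol exprMn invfM.
    by rewrite expf_neq0// pol_neq0.
  rewrite iintZ; last exact: ccts_expiV.
  by rewrite iint_expiVn subn_eq0 leqNgt lt_mn /= !mulr0.
rewrite (@eq_iint _ _ _ _ (fun t => s%:C%C ^+ (m - n) * expi t ^+ (m - n))); last first.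
  move=> t _; rewrite -[X in _ ^+ X / _](subnK le_nm) exprD mulfK ?expf_neq0 ?pol_neq0//.
  by rewrite /pol exprMn.
rewrite iintZ; last exact: (rderiv_ccts (rderiv_expin _)).
by rewrite iint_expin subn_eq0 leq_eqVlt (negbTE mn) /= ltnNge le_nm /= !mulr0.
Qed.

Lemma ccts_polX r m a b : ccts a b (fun t => pol r t ^+ m).
Proof.
apply: (@cts_ccts _ (fun z => z ^+ m) (pol r)); last exact: ccts_polt.
by move=> t _; apply: derivable_cts; exact: derivableC_exp.
Qed.

(* Evaluating the Taylor expansion of radius r on the circle of radius s < r and taking Fourier coefficients. *)
Lemma tcoef_indep (f : C -> C) r s n : (forall z, disk z -> derivable f z 1) ->
  0 < s -> s < r -> r < 1 -> tcoef f s n = tcoef f r n.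
Proof.
move=> df s0 sr r1.
have r0 := lt_trans s0 sr.
have [K K0 HK] := taylor_le df r0 r1.
have p0 := @pi2_gt0.
have cf : ccts 0 (2 * pi) (fun t => f (pol s t)).
  apply: ccts_circle; first by move=> z dz; apply: derivable_cts; exact: df.
  by rewrite ger0_norm ?(lt_trans sr)// ltW.
have cV m := @ccts_polV s m 0 (2 * pi) s0.
have cP N : ccts 0 (2 * pi) (fun t => psum (tcoef f r) (pol s t) N).
  apply: ccts_sum => m; apply: cctsZ.
  apply: (@cts_ccts _ (fun z => z ^+ m) (pol s)); last exact: ccts_polt.
  by move=> t _; apply: derivable_cts; exact: derivableC_exp.
apply/eqP; rewrite -subr_eq0 -normc_eq0 eq_le normc_ge0 andbT.
have q0 : 0 <= s / r := divr_ge0 (ltW s0) (ltW r0).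
have q1 : s / r < 1 by rewrite ltr_pdivrMr// mul1r.
pose L := (2 * pi)^-1 * (2 * (K / (r - s) * s ^- n * (2 * pi))).
have E N : (n < N)%N -> (2 * pi)^-1%:C%C * iint 0 (2 * pi) (fun t => psum (tcoef f r) (pol s t) N * (pol s t) ^- n) = tcoef f r n.
  move=> nN.
  rewrite (@eq_iint _ _ _ _ (fun t => \sum_(m < N) (tcoef f r m * (pol s t ^+ m * pol s t ^- n)))); last first.
    by move=> t _; rewrite /psum mulr_suml; apply: eq_bigr => m _; rewrite mulrA.
  have cm (m : nat) : ccts 0 (2 * pi) (fun t => pol s t ^+ m * pol s t ^- n).
    by apply: cctsM => //; exact: ccts_polX.
  rewrite iint_sum; last by move=> m; apply: cctsZ.
  rewrite (bigD1 (Ordinal nN))//= big1 ?addr0; last first.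
    move=> m /eqP mn; rewrite iintZ// iint_pol_pol//.
    by case: eqP => [h|]; [case: mn; exact: val_inj|rewrite mulr0].
  by rewrite iintZ// iint_pol_pol// eqxx mulrCA -rmorphM mulVf ?gt_eqF// mulr1.
have H N : (n < N)%N -> normc (tcoef f s n - tcoef f r n) <= (s / r) ^+ N * L.
  move=> nN; rewrite -(E N nN) /tcoef -mulrBr -iintB; last 2 first.
    exact: cctsM. exact: cctsM.
  have h : ccts 0 (2 * pi) (fun t => f (pol s t) / pol s t ^+ n - psum (fun n0 => (2 * pi)^-1%:C%C * iint 0 (2 * pi) (fun t0 => f (pol r t0) / pol r t0 ^+ n0)) (pol s t) N / pol s t ^+ n).
    by apply: cctsB; exact: cctsM.
  rewrite normcM normc_real ger0_norm ?invr_ge0 ?(ltW p0)//.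
  rewrite /L mulrCA ler_pM2l ?invr_gt0//.
  apply: (le_trans (@iint_le_cst R 0 (2 * pi) _ ((s / r) ^+ N * (K / (r - s)) * s ^- n) pi2_ge0 h _)).
    move=> t ht; rewrite -mulrBl normcM normcV normcX normc_pol (ger0_norm (ltW s0)).
    rewrite ler_wpM2r ?invr_ge0 ?exprn_ge0 ?(ltW s0)//.
    by have := HK (pol s t) N; rewrite normc_pol (ger0_norm (ltW s0)); apply.
  rewrite subr0; move: ((s / r) ^+ N) (K / (r - s)) (s ^- n) => x y z.
  by rewrite le_eqVlt; apply/orP; left; apply/eqP; rewrite !mulrA [2 * x]mulrC.
have lim : (fun N => (s / r) ^+ N * L) @ \oo --> (0 : R).
  rewrite -(mul0r L); apply: cvgMr_tmp.
  by apply: cvg_expr; rewrite ger0_norm.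
apply: (ler_cvg_to (cvg_cst _) lim); near=> N; apply: H; near: N.
exact: nbhs_infty_gt.
Unshelve. all: by end_near. Qed.

(** By [tcoef_indep] the coefficients computed on the circle of radius 1/2 serve for all radii, so
    one sequence works on the whole disk. *)
Theorem holomorphic_has_ps (f : C -> C) : (forall z, disk z -> derivable f z 1) ->
  exists a, has_ps a f.
Proof.
move=> df; pose a := tcoef f 2^-1; exists a.
have h0 : 0 < 2^-1 :> R by rewrite invr_gt0.
have h1 : 2^-1 < 1 :> R by rewrite invf_lt1// ltr1n.
have E r n : 0 < r -> r < 1 -> tcoef f r n = a n.
  move=> r0 r1; rewrite /a; case: (ltgtP r 2^-1) => h; last by rewrite h.
    exact: tcoef_indep.
  by symmetry; exact: tcoef_indep.
split=> r r0 r1.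
  have [M M0 hM] := tcoef_le df r0 r1; exists M; first exact: M0.
  by move=> n; rewrite -(E r n r0 r1); exact: hM.
have [K K0 HK] := taylor_le df r0 r1; exists K; first exact: K0.
move=> w N wr.
have -> : psum a w N = psum (tcoef f r) w N; last exact: HK.
by rewrite /psum; apply: eq_bigr => n _; rewrite -(E r n r0 r1).
Qed.

End Goursat.

(** * Power series and circle means *)

Section Parseval.
Context {R : realType}.
Local Notation C := R[i].
Local Notation mu := (@lebesgue_measure R).
Implicit Types (f g : C -> C) (r t : R).

(* A [Variant] and not a definition, so that unification never unfolds it; the
   same holds for [H2], [mH2] and [mcont]. *)
Variant hol f : Prop := Hol of forall z, disk z -> derivable f z 1.

Lemma holP f : hol f -> forall z, disk z -> derivable f z 1.
Proof. by case. Qed.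

Lemma hol_cst (c : C) : hol (fun=> c).
Proof. by split=> z _; exact: derivableC_cst. Qed.

Lemma hol_exp n : hol (fun z => z ^+ n).
Proof. by split=> z _; exact: derivableC_exp. Qed.

Lemma holD f g : hol f -> hol g -> hol (fun z => f z + g z).
Proof. by move=> [hf] [hg]; split=> z dz; apply: derivableCD; [exact: hf|exact: hg]. Qed.

Lemma holM f g : hol f -> hol g -> hol (fun z => f z * g z).
Proof. by move=> [hf] [hg]; split=> z dz; apply: derivableCM; [exact: hf|exact: hg]. Qed.

Lemma holZ (c : C) f : hol f -> hol (fun z => c * f z).
Proof. exact: (holM (hol_cst c)). Qed.

Lemma holB f g : hol f -> hol g -> hol (fun z => f z - g z).
Proof.
move=> hf /(holZ (-1)) hg; have := holD hf hg.
suff -> : (fun z => f z + -1 * g z) = (fun z => f z - g z) by [].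
by apply/funext => z; rewrite mulN1r.
Qed.

Lemma hol_sum n (f : 'I_n -> C -> C) : (forall i, hol (f i)) ->
  hol (fun z => \sum_(i < n) f i z).
Proof.
move=> h; split=> z dz.
by have [] := @derivableC_sum R n f z (fun i => holP (h i) dz).
Qed.

Definition cctsP f r := ccts 0 (2 * pi) (fun t => f (pol r t)).

Lemma hol_ccts f r : hol f -> `|r| < 1 -> cctsP f r.
Proof. by move=> [hf] r1; apply: ccts_circle r1 => z dz; apply: derivable_cts; exact: hf. Qed.

Lemma ccts_conj (u : R -> C) a b : ccts a b u -> ccts a b (fun t => (u t)^*).
Proof.
move=> cu x xab e e0; have [d d0 hd] := cu x xab e e0; exists d => // y yab yx.
by rewrite -rmorphB /= normc_conj; exact: hd.
Qed.

Lemma mul_conj_real (x : C) : x * x^* = (normc x ^+ 2)%:C%C.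
Proof.
rewrite normc_sqr; case: x => a b; rewrite [LHS]/GRing.mul /= mulrN opprK.
by congr Complex; rewrite ?expr2// mulrN mulrC addrC subrr.
Qed.

Definition mm f g r : C := (2 * pi)^-1%:C%C * iint 0 (2 * pi) (fun t => f (pol r t) * (g (pol r t))^*).

Definition m2 f r : R := (2 * pi)^-1 * \int[mu]_(t in `[0, 2 * pi]) (normc (f (pol r t)) ^+ 2).

Lemma mm_m2 f r : cctsP f r -> mm f f r = (m2 f r)%:C%C.
Proof.
move=> cf; rewrite /mm /m2 rmorphM /=; congr (_ * _).
rewrite (@eq_iint _ _ _ _ (fun t => (normc (f (pol r t)) ^+ 2)%:C%C)); last first.
  by move=> t _; rewrite mul_conj_real.
rewrite /iint /cintegral /=; congr Complex.
by rewrite Rintegral_cst//= mul0r.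
Qed.

Lemma mmDl f g h r : cctsP f r -> cctsP g r -> cctsP h r ->
  mm (fun z => f z + g z) h r = mm f h r + mm g h r.
Proof.
move=> cf cg ch; rewrite /mm -mulrDr -iintD; last 2 first.
  by apply: cctsM => //; exact: ccts_conj.
  by apply: cctsM => //; exact: ccts_conj.
by congr (_ * _); apply: eq_iint => t _; rewrite mulrDl.
Qed.

Lemma mmZl (c : C) f h r : cctsP f r -> cctsP h r ->
  mm (fun z => c * f z) h r = c * mm f h r.
Proof.
move=> cf ch; rewrite /mm (@eq_iint _ _ _ _ (fun t => c * (f (pol r t) * (h (pol r t))^*))).
  by rewrite iintZ 1?mulrCA//; apply: cctsM; [exact: cf|exact: ccts_conj].
by move=> t _; rewrite mulrA.
Qed.

Lemma mm_conj f g r : cctsP f r -> cctsP g r -> mm g f r = (mm f g r)^*.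
Proof.
move=> cf cg; rewrite /mm rmorphM /= -iint_conj; last first.
  by apply: cctsM => //; exact: ccts_conj.
congr (_ * _); first by rewrite /Num.conj/= oppr0.
by apply: eq_iint => t _; rewrite rmorphM /= conjCK mulrC.
Qed.

Lemma mmDr f g h r : cctsP f r -> cctsP g r -> cctsP h r ->
  mm h (fun z => f z + g z) r = mm h f r + mm h g r.
Proof.
move=> cf cg ch; rewrite -[LHS]conjCK -mm_conj//; last exact: cctsD.
by rewrite mmDl// rmorphD /= -!mm_conj.
Qed.

Lemma mmZr (c : C) f h r : cctsP f r -> cctsP h r ->
  mm h (fun z => c * f z) r = c^* * mm h f r.
Proof.
move=> cf ch; rewrite -[LHS]conjCK -mm_conj//; last exact: cctsZ.
by rewrite mmZl// rmorphM /= -!mm_conj.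
Qed.

Lemma m2_ge0 f r : 0 <= m2 f r.
Proof.
rewrite /m2 mulr_ge0 ?invr_ge0 ?pi2_ge0//.
by apply: Rintegral_ge0 => t _; rewrite exprn_ge0// normc_ge0.
Qed.

Lemma conj_realC (x : R) : (x%:C%C)^* = x%:C%C.
Proof. by rewrite /Num.conj /= oppr0. Qed.

Lemma conj_pol r t : 0 < r -> (pol r t)^* = (r ^+ 2)%:C%C * (pol r t)^-1.
Proof.
move=> r0; apply: (mulfI (pol_neq0 t r0)); rewrite mul_conj_real normc_pol.
by rewrite (ger0_norm (ltW r0)) mulrCA mulfV ?mulr1// pol_neq0.
Qed.

Lemma mm_exp f r n : cctsP f r -> 0 < r ->
  mm f (fun z => z ^+ n) r = (r ^+ (2 * n))%:C%C * tcoef f r n.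
Proof.
move=> cf r0; rewrite /mm /tcoef mulrCA; congr (_ * _).
rewrite -iintZ; last by apply: cctsM => //; exact: ccts_polV.
apply: eq_iint => t _; rewrite rmorphXn /= conj_pol// exprMn exprVn -rmorphXn /= -exprM.
by rewrite mulrCA.
Qed.

Lemma hol_psum (a : nat -> C) N : hol (fun z => psum a z N).
Proof.
by apply: hol_sum => n; apply: holZ; exact: hol_exp.
Qed.

(** Uniqueness of the coefficients: on the circle of radius [r] the partial sums converge uniformly,
    so Fourier coefficients pass to the limit. *)
Lemma has_ps_tcoef a f r n : has_ps a f -> hol f -> 0 < r -> r < 1 -> tcoef f r n = a n.
Proof.
move=> [ta hps] hf r0 r1.
have p0 := @pi2_gt0 R.
pose s := (1 + r) / 2.
have rs : r < s by rewrite /s; clear -r1; lra.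
have s1 : s < 1 by rewrite /s; clear -r1; lra.
have [K K0 HK] := hps s (lt_trans r0 rs) s1.
have cf : cctsP f r by apply: hol_ccts; rewrite ?ger0_norm// ltW.
have cP N : cctsP (fun z => psum a z N) r by apply: hol_ccts; [exact: hol_psum|rewrite ?ger0_norm// ltW].
have cV := @ccts_polV _ r n 0 (2 * pi) r0.
have E N : (n < N)%N -> tcoef (fun z => psum a z N) r n = a n.
  move=> nN; rewrite /tcoef.
  rewrite (@eq_iint _ _ _ _ (fun t => \sum_(m < N) (a m * (pol r t ^+ m * pol r t ^- n)))); last first.
    by move=> t _; rewrite /psum mulr_suml; apply: eq_bigr => m _; rewrite mulrA.
  have cm (m : nat) : ccts 0 (2 * pi) (fun t => pol r t ^+ m * pol r t ^- n).
    by apply: cctsM => //; exact: ccts_polX.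
  rewrite iint_sum; last by move=> m; apply: cctsZ.
  rewrite (bigD1 (Ordinal nN))//= big1 ?addr0; last first.
    move=> m /eqP mn; rewrite iintZ// iint_pol_pol//.
    by case: eqP => [h|]; [case: mn; exact: val_inj|rewrite mulr0].
  by rewrite iintZ// iint_pol_pol// eqxx mulrCA -rmorphM mulVf ?gt_eqF// mulr1.
apply/eqP; rewrite -subr_eq0 -normc_eq0 eq_le normc_ge0 andbT.
pose L := (2 * pi)^-1 * (2 * (K / (s - r) * r ^- n * (2 * pi))).
have q0 : 0 <= r / s := divr_ge0 (ltW r0) (ltW (lt_trans r0 rs)).
have q1 : r / s < 1 by rewrite ltr_pdivrMr ?mul1r// (lt_trans r0).
have H N : (n < N)%N -> normc (tcoef f r n - a n) <= (r / s) ^+ N * L.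
  move=> nN; rewrite -(E N nN) /tcoef -mulrBr -iintB; last 2 first.
    by apply: cctsM.
    by apply: cctsM; [exact: cP|].
  have h : ccts 0 (2 * pi) (fun t => f (pol r t) / pol r t ^+ n - psum a (pol r t) N / pol r t ^+ n).
    by apply: cctsB; apply: cctsM => //; exact: cP.
  rewrite normcM normc_real ger0_norm ?invr_ge0 ?(ltW p0)//.
  rewrite /L mulrCA ler_pM2l ?invr_gt0//.
  apply: (le_trans (@iint_le_cst R 0 (2 * pi) _ ((r / s) ^+ N * (K / (s - r)) * r ^- n) (@pi2_ge0 R) h _)).
    move=> t ht; rewrite -mulrBl normcM normcV normcX normc_pol (ger0_norm (ltW r0)).
    rewrite ler_wpM2r ?invr_ge0 ?exprn_ge0 ?(ltW r0)//.
    by have := HK (pol r t) N; rewrite normc_pol (ger0_norm (ltW r0)); apply.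
  rewrite subr0; move: ((r / s) ^+ N) (K / (s - r)) (r ^- n) => x y z.
  by rewrite le_eqVlt; apply/orP; left; apply/eqP; rewrite !mulrA [2 * x]mulrC.
have lim : (fun N => (r / s) ^+ N * L) @ \oo --> (0 : R).
  rewrite -(mul0r L); apply: cvgMr_tmp.
  by apply: cvg_expr; rewrite ger0_norm.
apply: (ler_cvg_to (cvg_cst _) lim); near=> N; apply: H; near: N.
exact: nbhs_infty_gt.
Unshelve. all: by end_near. Qed.

Definition S2 (a : nat -> C) r N : R := \sum_(n < N) normc (a n) ^+ 2 * r ^+ (2 * n).

Lemma mm_psum f (a : nat -> C) r N : cctsP f r -> 0 < r ->
  mm f (fun z => psum a z N) r = \sum_(n < N) (a n)^* * ((r ^+ (2 * n))%:C%C * tcoef f r n).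
Proof.
move=> cf r0; elim: N => [|N IH].
  rewrite big_ord0 /mm (@eq_iint _ _ _ _ (fun=> 0)).
    by rewrite iint_cst ?pi2_ge0// !mulr0.
  by move=> t _; rewrite /psum big_ord0 rmorph0 mulr0.
have cp (M : nat) : cctsP (fun z => psum a z M) r.
  by apply: ccts_sum => n; apply: cctsZ; exact: ccts_polX.
have cX n : cctsP (fun z => z ^+ n) r by exact: ccts_polX.
rewrite big_ord_recr /= -IH.
have -> : (fun z => psum a z N.+1) = (fun z => psum a z N + a N * z ^+ N).
  by apply/funext => z; rewrite psumS.
rewrite mmDr; [|exact: cp|by apply: cctsZ; exact: cX|exact: cf].
by rewrite mmZr ?mm_exp//; exact: cX.
Qed.

Lemma sum_complex n (u : 'I_n -> R) : \sum_(i < n) (u i)%:C%C = (\sum_(i < n) u i)%:C%C.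
Proof. by rewrite rmorph_sum. Qed.

(* Pythagoras for the Taylor polynomial and the Taylor remainder. *)
Lemma m2_tail a f r N : has_ps a f -> hol f -> 0 < r -> r < 1 ->
  m2 (fun z => f z - psum a z N) r = m2 f r - S2 a r N.
Proof.
move=> hps hf r0 r1.
have rn : `|r| < 1 by rewrite ger0_norm// ltW.
have cf := hol_ccts hf rn.
have cp : cctsP (fun z => psum a z N) r by apply: hol_ccts rn; exact: hol_psum.
have cNp : cctsP (fun z => -1 * psum a z N) r by exact: cctsZ.
have E1 : mm f (fun z => psum a z N) r = (S2 a r N)%:C%C.
  rewrite mm_psum// /S2 -sum_complex; apply: eq_bigr => n _.
  by rewrite (has_ps_tcoef _ hps)// mulrCA [_^* * _]mulrC mul_conj_real -rmorphM mulrC.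
have E2 : mm (fun z => psum a z N) (fun z => psum a z N) r = (S2 a r N)%:C%C.
  rewrite mm_psum// /S2 -sum_complex; apply: eq_bigr => n _.
  have -> : tcoef (fun z => psum a z N) r n = a n.
    pose a' m := if (m < N)%N then a m else 0.
    have pa' M w : (N <= M)%N -> psum a' w M = psum a w N.
      move=> NM; rewrite /psum -(subnKC NM) big_split_ord /= [X in _ + X]big1 ?addr0.
        by apply: eq_bigr => i _; rewrite /a' ltn_ord.
      by move=> i _; rewrite /a' ltnNge leq_addr /= mul0r.
    have -> : tcoef (fun z => psum a z N) r n = a' n; last by rewrite /a' ltn_ord.
    rewrite /tcoef (@eq_iint _ _ _ _ (fun t => \sum_(m < N) (a m * (pol r t ^+ m * pol r t ^- n)))); last first.
      by move=> t _; rewrite /psum mulr_suml; apply: eq_bigr => m _; rewrite mulrA.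
    have cm (m : nat) : ccts 0 (2 * pi) (fun t => pol r t ^+ m * pol r t ^- n).
      by apply: cctsM => //; [exact: ccts_polX|exact: ccts_polV].
    rewrite iint_sum; last by move=> m; apply: cctsZ.
    rewrite (bigD1 n)//= big1 ?addr0; last first.
      move=> m /eqP mn; rewrite iintZ// iint_pol_pol//.
      by case: eqP => [h|]; [case: mn; exact: val_inj|rewrite mulr0].
    by rewrite iintZ// iint_pol_pol// eqxx mulrCA -rmorphM mulVf ?gt_eqF ?pi2_gt0// mulr1 /a' ltn_ord.
  by rewrite mulrCA [_^* * _]mulrC mul_conj_real -rmorphM mulrC.
apply: (@complexI R); rewrite rmorphB /= -mm_m2//; last first.
  exact: cctsB.
have -> : (fun z => f z - psum a z N) = (fun z => f z + -1 * psum a z N).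
  by apply/funext => z; rewrite mulN1r.
have cD : cctsP (fun z => f z + -1 * psum a z N) r by exact: cctsD.
rewrite (mmDl cf cNp cD) (mmDr cf cNp cf) (mmDr cf cNp cNp) (mmZr _ cp cf).
rewrite (mmZl _ cp cf) (mmZl _ cp cNp) (mmZr _ cp cp) E2 (mm_conj cf cp) E1 (mm_m2 cf).
rewrite conj_realC rmorphN rmorph1.
ring.
Qed.

Lemma bessel a f r N : has_ps a f -> hol f -> 0 < r -> r < 1 -> S2 a r N <= m2 f r.
Proof. by move=> hps hf r0 r1; rewrite -subr_ge0 -(m2_tail N hps)// m2_ge0. Qed.

Lemma normc2_within f r : cctsP f r ->
  {within `[0, 2 * pi], continuous (fun t => normc (f (pol r t)) ^+ 2)}.
Proof.
move=> cf; have h := normc_ccts cf => x; rewrite /continuous_at.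
exact: (@continuousM _ _ _ _ x (h x) (h x)).
Qed.

Lemma m2_le_cst f r (M : R) : cctsP f r ->
  (forall t, 0 <= t <= 2 * pi -> normc (f (pol r t)) ^+ 2 <= M) -> m2 f r <= M.
Proof.
move=> cf hM; have := Rint_le_cst (@pi2_ge0 R) (normc2_within cf) hM.
by rewrite subr0 => h; rewrite /m2 mulrC ler_pdivrMr// pi2_gt0.
Qed.

(** Converse of [bessel]: on the circle of radius [r] the Taylor remainder is controlled from a
    radius [s] between [r] and 1, so its mean square tends to 0. *)
Lemma m2_le_of_S2 a f r (M : R) : has_ps a f -> hol f -> 0 < r -> r < 1 ->
  (forall N, S2 a r N <= M) -> m2 f r <= M.
Proof.
move=> hps hf r0 r1 hM.
pose s := (1 + r) / 2.
have rs : r < s by rewrite /s; clear -r1; lra.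
have s1 : s < 1 by rewrite /s; clear -r1; lra.
have [K K0 HK] := hps.2 s (lt_trans r0 rs) s1.
have q0 : 0 <= r / s := divr_ge0 (ltW r0) (ltW (lt_trans r0 rs)).
have q1 : r / s < 1 by rewrite ltr_pdivrMr ?mul1r// (lt_trans r0).
have rn : `|r| < 1 by rewrite ger0_norm// ltW.
have H N : m2 f r - M <= ((r / s) ^+ 2) ^+ N * (K / (s - r)) ^+ 2.
  apply: (@le_trans _ _ (m2 f r - S2 a r N)); first by rewrite lerD2l lerN2.
  rewrite -(m2_tail N hps)//; apply: m2_le_cst.
    by apply: hol_ccts rn; apply: holB => //; exact: hol_psum.
  move=> t ht; rewrite -exprM mulnC exprM -exprMn ler_pXn2r ?nnegrE ?normc_ge0//.
    by have := HK (pol r t) N; rewrite normc_pol (ger0_norm (ltW r0)); apply.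
  by rewrite mulr_ge0 ?exprn_ge0// divr_ge0// subr_ge0 ltW.
rewrite -subr_le0.
have lim : (fun N => ((r / s) ^+ 2) ^+ N * (K / (s - r)) ^+ 2) @ \oo --> (0 : R).
  rewrite -(mul0r ((K / (s - r)) ^+ 2)); apply: cvgMr_tmp.
  by apply: cvg_expr; rewrite ger0_norm ?exprn_ge0// expr_lt1.
by apply: (ler_cvg_to (cvg_cst _) lim); exact: nearW.
Qed.

Definition L2 (a : nat -> C) N : R := \sum_(n < N) normc (a n) ^+ 2.

Lemma S2_le_L2 a r N : 0 < r -> r < 1 -> S2 a r N <= L2 a N.
Proof.
move=> r0 r1; apply: ler_sum => n _; rewrite ler_piMr ?exprn_ge0 ?normc_ge0//.
by rewrite exprn_ile1// ltW.
Qed.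

(** Lets [r] tend to 1 in a finite sum, where all powers are at least [r ^+ (2 * N)]. *)
Lemma S2_lim (a : nat -> C) N (M : R) : (forall r, 0 < r -> r < 1 -> S2 a r N <= M) -> L2 a N <= M.
Proof.
move=> H.
have lim : (fun r : R => r ^+ (2 * N) * L2 a N) @ 1^'- --> L2 a N.
  rewrite -[X in _ --> X]mul1r -[X in X * _](expr1n _ (2 * N)); apply: cvgMr_tmp.
  by apply: cvg_at_left_filter; exact: exprn_continuous.
apply: (ler_cvg_to lim (cvg_cst M)); near=> r.
have r0 : 0 < r by near: r; exact: nbhs_left_gt.
have r1 : r < 1 by near: r; exact: nbhs_left_lt.
apply: le_trans (H r r0 r1); rewrite /L2 mulr_sumr; apply: ler_sum => n _.
rewrite mulrC ler_wpM2l ?exprn_ge0 ?normc_ge0//.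
by rewrite ler_wiXn2l ?(ltW r0) ?(ltW r1)// leq_mul2l ltnW.
Unshelve. all: by end_near. Qed.

Lemma S2_mono a r N M : (N <= M)%N -> 0 <= r -> S2 a r N <= S2 a r M.
Proof.
move=> NM r0; rewrite /S2 -(subnKC NM) big_split_ord /= lerDl.
by apply: sumr_ge0 => i _; rewrite mulr_ge0// exprn_ge0// normc_ge0.
Qed.

Lemma S2_homo a r s N : 0 <= r -> r <= s -> S2 a r N <= S2 a s N.
Proof.
move=> r0 rs; apply: ler_sum => n _; rewrite ler_wpM2l ?exprn_ge0 ?normc_ge0//.
by rewrite lerXn2r// nnegrE// (le_trans r0).
Qed.

Lemma m2_homo f r s : hol f -> 0 < r -> r <= s -> s < 1 -> m2 f r <= m2 f s.
Proof.
move=> hf r0 rs s1; have [a hps] := holomorphic_has_ps (holP hf).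
have s0 := lt_le_trans r0 rs.
apply: (m2_le_of_S2 hps) => //; first exact: le_lt_trans s1.
by move=> N; apply: le_trans (bessel N hps hf s0 s1); apply: S2_homo => //; exact: ltW.
Qed.

(** The bound does not depend on [r], which lets the maximal inequality act on Taylor remainders. *)
Lemma m2_tail_le a f r N (S : R) : has_ps a f -> hol f -> 0 < r -> r < 1 ->
  (forall M, L2 a M <= S) -> m2 (fun z => f z - psum a z N) r <= S - L2 a N.
Proof.
move=> hps hf r0 r1 hS; rewrite (m2_tail N hps)// lerBlDr.
apply: (m2_le_of_S2 hps) => // M.
have [MN|/ltnW NM] := leqP M N.
  apply: (le_trans (S2_mono a MN (ltW r0))).
  by rewrite lerDr subr_ge0.
rewrite -(subnKC NM) /S2 big_split_ord /= addrC lerD2r lerBrDr.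
apply: (le_trans _ (hS M)); rewrite addrC /L2 -(subnKC NM) big_split_ord /= subnKC // lerD2l.
by apply: ler_sum => n _; rewrite ler_piMr ?exprn_ge0 ?normc_ge0// exprn_ile1// ltW.
Qed.

End Parseval.

(** * The radial maximal function *)

Section RealMax.
Context {R : realType}.
Local Notation mu := (@lebesgue_measure R).
Implicit Types (h : R -> R).

Lemma real_FTCi (a b : R) (F f : R -> R) : a <= b ->
  (forall t : R, a <= t <= b -> is_derive t 1 F (f t)) ->
  {within `[a, b], continuous f} -> \int[mu]_(t in `[a, b]) f t = F b - F a.
Proof.
rewrite le_eqVlt => /orP[/eqP <- _ _|ab hF cf].
  by rewrite subrr set_itv1 Rintegral_set1.
have cF t : a <= t <= b -> {for t, continuous F}.
  move=> tab; apply: differentiable_continuous; apply/derivable1_diffP.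
  exact: (@ex_derive _ _ _ _ _ _ _ (hF t tab)).
rewrite /Rintegral (@continuous_FTC2 _ f F)//.
split => //.
- by move=> t; rewrite in_itv/= => /andP[/ltW ? /ltW ?]; apply: (@ex_derive _ _ _ _ _ _ _ (hF t _)); apply/andP.
- by apply: cvg_at_right_filter; apply: cF; rewrite lexx ltW.
- by apply: cvg_at_left_filter; apply: cF; rewrite lexx ltW.
- move=> t; rewrite in_itv/= => /andP[/ltW ? /ltW ?]; rewrite derive1E.
  by apply: (@derive_val _ _ _ _ _ _ _ (hF t _)); apply/andP.
Qed.

(** The integral from [a] has derivative [h] only beyond [a], so callers choose [a] strictly to the
    left of their interval. *)
Lemma primitive_near h (a : R) : continuous h ->
  exists P, forall x : R, a < x -> is_derive x 1 P (h x).
Proof.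
move=> ch; exists (fun x => \int[mu]_(t in `[a, x]) h t) => x ax.
have xu : x < x + 1 by rewrite ltrDl.
have hi : mu.-integrable `[a, x + 1] (EFin \o h).
  by apply: within_integrable; exact: continuous_subspaceT.
have ax' : (BLeft a < BRight x)%E by rewrite /= lte_fin.
have [d e] := @continuous_FTC1 R h (BLeft a) x (x + 1) xu hi ax' (ch x).
by rewrite derive1E in e; exact: (DeriveDef d e).
Qed.

(** The hypothesis bounds only the averages of [h] about [t], so one integrates by parts against
    [H u], the integral of [h] over the interval of half-length [u]. The kernel [de / (de + s)^2]
    majorizes the Poisson kernel up to a constant. *)
Lemma radial_ibp h (t la de : R) : continuous h -> (forall x, 0 <= h x) -> 0 < de -> 0 <= la ->
  (forall u, 0 < u -> u <= pi -> \int[mu]_(x in `[t - u, t + u]) h x <= 2 * u * la) ->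
  \int[mu]_(s in `[0, pi]) ((h (t + s) + h (t - s)) * (de * ((de + s)^-1 * (de + s)^-1))) <= 6 * la.
Proof.
move=> ch h0 de0 la0 Hla.
have [P dP] := primitive_near (t - pi - 1) ch.
have pi0 : 0 <= pi :> R by exact: pi_ge0.
pose v s := (de + s)^-1.
pose H u := P (t + u) - P (t - u).
have hsh s : continuous (fun x => h (s + x)).
  by move=> x; apply: (@continuous_comp _ _ _ (fun y => s + y) h); [apply: cvgD; [exact: cvg_cst|exact: cvg_id]|exact: ch].
have hsm s : continuous (fun x => h (s - x)).
  move=> x; apply: (@continuous_comp _ _ _ (fun y => s - y) h); last exact: ch.
  by apply: cvgB; [exact: cvg_cst|exact: cvg_id].
have dH (u : R) : 0 <= u <= pi -> is_derive u 1 H (h (t + u) + h (t - u)).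
  move=> /andP[u0 u1].
  have d1 : is_derive u 1 (fun x => t + x) 1.
    by apply: is_derive_eq (is_deriveD (is_derive_cst t u 1) (is_derive_id u 1)) _; rewrite add0r.
  have d2 : is_derive u 1 (fun x => t - x) (-1).
    by apply: is_derive_eq (is_deriveB (is_derive_cst t u 1) (is_derive_id u 1)) _; rewrite sub0r.
  have i1 : t - pi - 1 < t + u by clear -u0 pi0; lra.
  have i2 : t - pi - 1 < t - u by clear -u1; lra.
  have e1 := @is_derive1_comp _ P _ u _ _ (dP _ i1) d1.
  have e2 := @is_derive1_comp _ P _ u _ _ (dP _ i2) d2.
  apply: is_derive_eq (is_deriveB e1 e2) _.
  by rewrite mulr1 mulrN1 opprK.
have Hle (u : R) : 0 < u -> u <= pi -> H u <= 2 * u * la.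
  move=> u0 u1; apply: le_trans (Hla u u0 u1).
  have i1 : t - u <= t + u by clear -u0; lra.
  have i2 (x : R) : t - u <= x <= t + u -> is_derive x 1 P (h x).
    by move=> /andP[x1 x2]; apply: dP; clear -x1 u1; lra.
  by rewrite (real_FTCi i1 i2 (continuous_subspaceT ch)).
have Hle0 (u : R) : 0 <= u <= pi -> H u <= 2 * u * la.
  move=> /andP[]; rewrite le_eqVlt => /orP[/eqP <- _|]; last exact: Hle.
  by rewrite /H addr0 subr0 subrr mulr0 mul0r.
have vpos (s : R) : 0 <= s -> 0 < v s by move=> s0; rewrite invr_gt0 ltr_pwDl.
have dv (s : R) : 0 <= s -> is_derive s 1 v (- (v s * v s)).
  move=> s0.
  have d1 : is_derive s 1 (fun x => de + x) 1.
    by apply: is_derive_eq (is_deriveD (is_derive_cst de s 1) (is_derive_id s 1)) _; rewrite add0r.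
  have nz : de + s != 0 by rewrite gt_eqF// ltr_pwDl.
  have := is_deriveV nz d1 => dd; apply: is_derive_eq dd _.
  by rewrite /GRing.scale/= mulr1 /v -invfM -expr2.
pose K s := de * (v s * v s).
(* The last term compensates the derivative of [K]: as [H s <= 2 * s * la] and [s * v s <= 1], the
   derivative [F'] dominates the integrand. At the ends, [K pi * H pi <= 2 * la] and the last term
   contributes at most [4 * la], whence the constant 6. *)
pose F s := K s * H s - 4 * la * de * v s.
pose F' s := - (2 * de * (v s * (v s * v s))) * H s + K s * (h (t + s) + h (t - s)) + 4 * la * de * (v s * v s).
have dF (s : R) : 0 <= s <= pi -> is_derive s 1 F (F' s).
  move=> /[dup] sp /andP[s0 s1]; have dvs := dv s s0.
  have dK : is_derive s 1 K (- (2 * de * (v s * (v s * v s)))).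
    apply: is_derive_eq (is_deriveM (is_derive_cst de s 1) (is_deriveM dvs dvs)) _.
    by rewrite /GRing.scale/=; ring.
  have d4 := is_deriveM (is_derive_cst (4 * la * de) s 1) dvs.
  apply: is_derive_eq (is_deriveB (is_deriveM dK (dH s sp)) d4) _.
  by rewrite /F' /GRing.scale/=; ring.
have cts_of (u u' : R -> R) : (forall s : R, 0 <= s <= pi -> is_derive s 1 u (u' s)) -> {within `[0, pi], continuous u}.
  move=> du; apply: derivable_within_continuous => s; rewrite in_itv/= => sp.
  exact: (@ex_derive _ _ _ _ _ _ _ (du s sp)).
have cH := cts_of _ _ dH.
have cv : {within `[0, pi], continuous v}.
  by apply: (cts_of v (fun s => - (v s * v s))) => s /andP[s0 _]; exact: dv.
have cc (c : R) : {within `[0, (pi : R)], continuous (fun=> c : R)} by move=> x; exact: cvg_cst.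
have cM (u w : R -> R) : {within `[0, pi], continuous u} -> {within `[0, pi], continuous w} -> {within `[0, pi], continuous (fun x => u x * w x)}.
  by move=> cu cw x; exact: (@continuousM _ _ _ _ x (cu x) (cw x)).
have cD (u w : R -> R) : {within `[0, pi], continuous u} -> {within `[0, pi], continuous w} -> {within `[0, pi], continuous (fun x => u x + w x)}.
  by move=> cu cw x; exact: (@continuousD _ _ _ _ _ x (cu x) (cw x)).
have cHp : {within `[0, pi], continuous (fun s => h (t + s) + h (t - s))}.
  by apply: (cD); exact: continuous_subspaceT.
have cF' : {within `[0, pi], continuous F'}.
  apply: (cD); first apply: (cD).
  - apply: (cM (fun s => - (2 * de * (v s * (v s * v s))))) => //.
    have -> : (fun s => - (2 * de * (v s * (v s * v s)))) = (fun s => (- (2 * de)) * (v s * (v s * v s))).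
      by apply/funext => s; rewrite mulNr.
    by apply: (cM) => //; apply: (cM) => //; exact: (cM).
  - by apply: (cM) => //; apply: (cM) => //; exact: (cM).
  - by apply: (cM) => //; exact: (cM).
apply: (@le_trans _ _ (\int[mu]_(s in `[0, pi]) F' s)).
  apply: le_Rintegral => //; [|exact: within_integrable|].
    by apply: within_integrable; apply: (cM) => //; apply: (cM) => //; exact: (cM).
  move=> s; rewrite /= in_itv/= => sp; rewrite /F' /K -/(v s).
  have /andP[s0 s1] := sp.
  have h1 := Hle0 s sp; have v0 := vpos s s0.
  have sv : s * v s <= 1.
    by rewrite ler_pdivrMr ?mul1r ?ltr_pwDl// lerDr ltW.
  have k1 : v s * (v s * v s) * H s <= v s * (v s * v s) * (2 * s * la).
    by rewrite ler_pM2l// !mulr_gt0.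
  have k2 : v s * (v s * v s) * (2 * s * la) <= v s * v s * (2 * la) * 1.
    have -> : v s * (v s * v s) * (2 * s * la) = v s * v s * (2 * la) * (s * v s) by ring.
    by rewrite ler_wpM2l// !mulr_ge0// ltW.
  have k3 := le_trans k1 k2.
  have k4 : 2 * de * (v s * (v s * v s) * H s) <= 2 * de * (v s * v s * (2 * la) * 1).
    by rewrite ler_pM2l// mulr_gt0.
  rewrite -subr_ge0.
  have -> : - (2 * de * (v s * (v s * v s))) * H s + de * (v s * v s) * (h (t + s) + h (t - s)) + 4 * la * de * (v s * v s) - (h (t + s) + h (t - s)) * (de * (v s * v s)) = 2 * de * (v s * v s * (2 * la) * 1) - 2 * de * (v s * (v s * v s) * H s) by ring.
  by rewrite subr_ge0.
rewrite (real_FTCi pi0 dF cF') /F.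
have -> : H 0 = 0 by rewrite /H addr0 subr0 subrr.
have vp := vpos pi pi0. have v0 := vpos 0 (lexx _).
have hp : H pi <= 2 * pi * la by apply: Hle0; rewrite pi0 lexx.
have dv0 : de * v 0 = 1 by rewrite /v addr0 divff// gt_eqF.
have dvp : de * v pi <= 1 by rewrite /v ler_pdivrMr ?mul1r ?ltr_pwDl// lerDl.
have pvp : pi * v pi <= 1 by rewrite /v ler_pdivrMr ?mul1r ?ltr_pwDl// lerDr ltW.
have j1 : K pi * H pi <= K pi * (2 * pi * la) by rewrite ler_wpM2l// /K mulr_ge0 ?ltW// mulr_gt0.
have j2 : K pi * (2 * pi * la) <= 2 * la.
  have -> : K pi * (2 * pi * la) = (de * v pi) * (pi * v pi) * (2 * la) by rewrite /K; ring.
  by rewrite -[leRHS]mul1r ler_wpM2r ?mulr_ge0// mulr_ile1// ltW// mulr_gt0// pi_gt0.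
have j3 : 0 <= 4 * la * de * v pi by rewrite !mulr_ge0// ltW.
have j4 : 4 * la * de * v 0 = 4 * la by rewrite -mulrA dv0 mulr1.
rewrite mulr0 sub0r j4; clear -j1 j2 j3.
move: (K pi * H pi) (K pi * _) (_ * v pi) j1 j2 j3 => x y z j1 j2 j3; lra.
Qed.

Lemma Rint_shift h (a b c : R) : a <= b -> continuous h ->
  \int[mu]_(x in `[c + a, c + b]) h x = \int[mu]_(x in `[a, b]) h (c + x).
Proof.
move=> ab ch; have [P dP] := primitive_near (c + a - 1) ch.
have i1 (x : R) : c + a <= x <= c + b -> is_derive x 1 P (h x).
  by move=> /andP[x1 _]; apply: dP; clear -x1; lra.
have i2 (x : R) : a <= x <= b -> is_derive x 1 (fun x => P (c + x)) (h (c + x)).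
  move=> /andP[x1 x2].
  have d1 : is_derive x 1 (fun y => c + y) 1.
    by apply: is_derive_eq (is_deriveD (is_derive_cst c x 1) (is_derive_id x 1)) _; rewrite add0r.
  have j1 : c + a - 1 < c + x by clear -x1; lra.
  apply: is_derive_eq (@is_derive1_comp _ P _ x _ _ (dP _ j1) d1) _.
  by rewrite mulr1.
have ab' : c + a <= c + b by rewrite lerD2l.
have c2 : continuous (fun x => h (c + x)).
  move=> x; apply: (@continuous_comp _ _ _ (fun y => c + y) h); last exact: ch.
  by apply: cvgD; [exact: cvg_cst|exact: cvg_id].
by rewrite (real_FTCi ab' i1 (continuous_subspaceT ch)) (real_FTCi ab i2 (continuous_subspaceT c2)).
Qed.

Lemma Rint_reflect (h : R -> R) (a b c : R) : a <= b -> {within `[a, b], continuous h} ->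
  \int[mu]_(x in `[a, b]) h x = \int[mu]_(x in `[c - b, c - a]) h (c - x).
Proof.
move=> ab ch; rewrite /Rintegral; congr fine.
have := @integration_by_substitution_decreasing R (fun x => c - x) h (c - b) (c - a).
have d (x : R) : is_derive x 1 (fun y : R => c - y) (-1).
  by apply: is_derive_eq (is_deriveB (is_derive_cst c x 1) (is_derive_id x 1)) _; rewrite sub0r.
have -> : (derive1 (fun y : R => c - y)) = cst (-1).
  by apply/funext => x; rewrite derive1E; exact: (@derive_val _ _ _ _ _ _ _ (d x)).
rewrite !subKr => -> //.
- by apply: eq_integral => x xr /=; congr EFin; rewrite [RHS](_ : _ = h (c - x) * - - 1) ?opprK ?mulr1.
- by rewrite lerD2l lerN2.
- by move=> x y _ _ xy; rewrite ltrD2l ltrN2.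
- by move=> x _; exact: cvg_cst.
- exact: is_cvg_cst.
- exact: is_cvg_cst.
- have cF x : {for x, continuous (fun y : R => c - y)}.
    apply: differentiable_continuous; apply/derivable1_diffP.
    exact: (@ex_derive _ _ _ _ _ _ _ (d x)).
  split.
  + by move=> x _; exact: (@ex_derive _ _ _ _ _ _ _ (d x)).
  + by apply: cvg_at_right_filter; exact: cF.
  + by apply: cvg_at_left_filter; exact: cF.
Qed.

(** A crude bound suffices. Up to the arc cosine of 1/2, integrating [cos >= 1/2] twice gives
    [s ^+ 2 / 4]; beyond it, [1 - cos s] is at least 1/2, which is [4 ^+ 2 / 32], while [s <= 4]. *)
Lemma cos_quad (s : R) : 0 <= s <= pi -> s ^+ 2 / 32 <= 1 - cos s.
Proof.
move=> /andP[s0 sp].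
have pi4 : pi <= 4 :> R by have := @pihalf_lt2 R => H; clear -H; lra.
pose s1 : R := acos (1 / 2).
have half1 : -1 <= (1 / 2 : R) <= 1 by apply/andP; split; lra.
have s10 : 0 <= s1 by exact: acos_ge0.
have s1p : s1 <= pi by exact: acos_lepi.
have cs1 : cos s1 = 1 / 2 by rewrite /s1 acosK// in_itv.
have cosle (x y : R) : 0 <= x -> x <= y -> y <= pi -> cos y <= cos x.
  move=> x0; rewrite le_eqVlt => /orP[/eqP -> //|xy] yp; apply: ltW.
  by rewrite ltr_cos// in_itv/= ?x0 ?yp ?(le_trans x0) ?(le_trans _ yp)// ltW.
have [ss1|/ltW ss1] := leP s s1; last first.
  have c1 := cosle s1 s s10 ss1 sp.
  have s2 : s ^+ 2 <= 4 ^+ 2 by rewrite lerXn2r ?nnegrE//; exact: le_trans pi4.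
  rewrite cs1 in c1; clear -c1 s2; move: (s ^+ 2) s2 => x s2; rewrite -natrX/= in s2; lra.
have sinh (x : R) : 0 <= x -> x <= s1 -> x / 2 <= sin x.
  move=> x0 xs; rewrite -subr_ge0.
  have d (y : R) : is_derive y 1 (fun x : R => sin x - x / 2) (cos y - 1 / 2).
    have := is_deriveB (is_derive_sin y) (is_deriveM (is_derive_id y 1) (is_derive_cst (2^-1 : R) y 1)).
    by move=> H; apply: is_derive_eq H _; rewrite /GRing.scale/= mulr0 add0r mulr1 mul1r.
  have := @ger0_derive1_le_cc R (fun x : R => sin x - x / 2) 0 x.
  move=> /(_ _ _ _ 0 x); rewrite sin0 mul0r subrr; apply.
  - by move=> y _; exact: (@ex_derive _ _ _ _ _ _ _ (d y)).
  - move=> y; rewrite in_itv/= => /andP[/ltW y0 /ltW yx].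
    rewrite derive1E (@derive_val _ _ _ _ _ _ _ (d y)) subr_ge0 -cs1.
    by apply: cosle => //; exact: le_trans yx xs.
  - apply: derivable_within_continuous => y _; exact: (@ex_derive _ _ _ _ _ _ _ (d y)).
  - by rewrite in_itv/= lexx.
  - by rewrite in_itv/= lexx andbT.
  - by [].
have Q : s ^+ 2 / 4 <= 1 - cos s.
  rewrite -subr_ge0.
  have d (y : R) : is_derive y 1 (fun x : R => 1 - cos x - x * x * 4^-1) (sin y - y / 2).
    have := is_deriveB (is_deriveB (is_derive_cst (1 : R) y 1) (is_derive_cos y)) (is_deriveM (is_deriveM (is_derive_id y 1) (is_derive_id y 1)) (is_derive_cst (4^-1 : R) y 1)).
    move=> H; apply: is_derive_eq H _; rewrite /GRing.scale/=.
    by rewrite mulr0 !add0r opprK !mulr1; clear; lra.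
  have := @ger0_derive1_le_cc R (fun x : R => 1 - cos x - x * x * 4^-1) 0 s.
  move=> /(_ _ _ _ 0 s); rewrite cos0 !mul0r !subrr expr2; apply.
  - by move=> y _; exact: (@ex_derive _ _ _ _ _ _ _ (d y)).
  - move=> y; rewrite in_itv/= => /andP[/ltW y0 /ltW yx].
    rewrite derive1E (@derive_val _ _ _ _ _ _ _ (d y)) subr_ge0.
    by apply: sinh => //; exact: le_trans yx ss1.
  - apply: derivable_within_continuous => y _; exact: (@ex_derive _ _ _ _ _ _ _ (d y)).
  - by rewrite in_itv/= lexx.
  - by rewrite in_itv/= lexx andbT.
  - by [].
apply: le_trans Q; have := sqr_ge0 s; move: (s ^+ 2) => x x0; clear -x0; lra.
Qed.

End RealMax.

Section Poisson.
Context {R : realType}.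
Local Notation C := R[i].
Local Notation mu := (@lebesgue_measure R).
Implicit Types (f : C -> C) (r t : R).

Lemma hol_rot f t : hol f -> hol (fun z => f (expi t * z)).
Proof.
move=> [hf]; split=> z dz.
have dw : disk (expi t * z) by rewrite diskE normcM normc_expi mul1r -diskE.
have /derivable_cvg/derivableCP H := hf _ dw.
suff H2 : h^-1 *: (f (expi t * (h + z)) - f (expi t * z)) @[h --> (0 : C)^'] --> derive1 f (expi t * z) * expi t.
  by have [] := @derive1_cvgC R (fun z => f (expi t * z)) z _ H2.
apply/(@derivableCP R (fun z => f (expi t * z))) => e e0.
have [d d0 hd] := H e e0; exists d => // h hh.
have := hd (expi t * h); rewrite normcM normc_expi mul1r => /(_ hh).
by rewrite mulrDr mulrA.
Qed.

Lemma circ_continuous f (rho : R) : hol f -> `|rho| < 1 ->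
  continuous (fun x : R => normc (f (pol rho x)) : R).
Proof.
move=> [hf] r1 x; apply/cvgrPdist_lt => e e0.
have dw : disk (pol rho x) by rewrite diskE normc_pol.
have /ctsCP/(_ e e0)[d d0 hd] := derivable_cts (hf _ dw).
exists (d / 2) => /=; first by rewrite divr_gt0.
move=> y; rewrite /ball_/= => xy.
rewrite distrC; apply: (le_lt_trans (le_normcB _ _)); apply: hd.
apply: (le_lt_trans (pol_lip _ _ _ _)); rewrite subrr normr0 add0r.
have : `|rho| * (2 * `|y - x|) <= 1 * (2 * `|y - x|) by rewrite ler_wpM2r ?mulr_ge0// ltW.
by rewrite distrC in xy; clear -xy; lra.
Qed.

Lemma expi_periodic t : expi (t + 2 * pi : R) = expi t.
Proof. by rewrite expiD expi2pi mulr1. Qed.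

(** The Cauchy formula is applied to the rotated function divided by [1 - c z]. On the circle this
    factor times the Cauchy kernel has modulus [1 / D s], so the Poisson kernel appears without
    harmonic functions; at the point [w] the factor is [1 / (1 - r ^+ 2)]. *)
Lemma poisson_bound f (rho r t : R) : hol f -> 1 / 2 <= r -> r < rho -> rho < 1 ->
  normc (f (pol (r * rho) t)) <=
  64 * \int[mu]_(s in `[0, pi])
    ((normc (f (pol rho (t + s))) + normc (f (pol rho (t - s)))) *
     ((1 - r) * ((1 - r + s)^-1 * (1 - r + s)^-1))).
Proof.
move=> hf r2 rr rho1.
have r0 : 0 < r by apply: lt_le_trans r2; rewrite divr_gt0.
have rho0 : 0 < rho by exact: lt_trans rr.
have r1 : r < 1 by exact: lt_trans rho1.
have pi0 : 0 < pi :> R := pi_gt0 R.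
have rn : `|rho| < 1 by rewrite ger0_norm// ltW.
pose h (x : R) := normc (f (pol rho x)).
have ch : continuous h by exact: circ_continuous.
have hper x : h (x + 2 * pi) = h x by rewrite /h /pol expi_periodic.
pose ft z := f (expi t * z).
have hft : hol ft by exact: hol_rot.
pose c : C := (r / rho)%:C%C.
have nc : normc c < 1 by rewrite normc_real ger0_norm ?divr_ge0 ?(ltW r0) ?(ltW rho0)// ltr_pdivrMr ?mul1r.
have nz z : disk z -> 1 - c * z != 0.
  rewrite diskE => dz; rewrite subr_eq0; apply/eqP => e.
  have : normc (c * z) < 1 by rewrite normcM mulr_ilt1 ?normc_ge0.
  by rewrite -e normc1 ltxx.
have hinv : hol (fun z => (1 - c * z)^-1).
  split=> z dz; apply: derivableCV; first exact: nz.
  by apply: (holP (holB (hol_cst 1) (holZ c (hol_exp 1)))).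
pose phi z := ft z * (1 - c * z)^-1.
have hphi : hol phi by exact: holM.
pose w : C := (r * rho)%:C%C.
have nw : normc w < rho.
  by rewrite normc_real ger0_norm ?mulr_ge0 ?(ltW r0) ?(ltW rho0)// gtr_pMl.
have := cauchy_kernel (holP hphi) nw rho1.
rewrite iint_kernel1// => E.
have Ew : phi w = f (pol (r * rho) t) / (1 - r ^+ 2)%:C%C.
  rewrite /phi /ft /w /pol mulrC [expi t * _]mulrC; rewrite mulrC; congr (_ / _).
  rewrite /c -rmorphM -(rmorphB (real_complex R) 1); congr (_%:C%C).
  by field; rewrite gt_eqF.
pose D (s : R) := 1 - 2 * r * cos s + r ^+ 2.
have DE s : D s = (1 - r) ^+ 2 + 2 * r * (1 - cos s) by rewrite /D; ring.
have D0 s : 0 < D s.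
  by rewrite DE ltr_pwDl ?exprn_gt0 ?subr_gt0// !mulr_ge0// ?(ltW r0)// subr_ge0 ?cos_le1.
have normE s : normc (1 - c * pol rho s) ^+ 2 = D s /\ normc (pol rho s - w) ^+ 2 = rho ^+ 2 * D s.
  have -> : c * pol rho s = r%:C%C * expi s.
    by rewrite /c /pol mulrA -rmorphM divfK// gt_eqF.
  have -> : pol rho s - w = rho%:C%C * (expi s - r%:C%C).
    by rewrite mulrBr /pol /w rmorphM [_ * rho%:C%C]mulrC.
  rewrite normcM normc_real exprMn real_normK ?num_real//; split; last congr (_ * _).
    rewrite normc_sqr /D /= !(mul0r, subr0, addr0, add0r, sub0r).
    by transitivity (1 - 2 * r * cos s + r ^+ 2 * (cos s ^+ 2 + sin s ^+ 2)); [ring|rewrite cos2Dsin2 mulr1].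
  rewrite normc_sqr /D /= !(mul0r, subr0, addr0, add0r, sub0r).
  by transitivity (cos s ^+ 2 + sin s ^+ 2 - 2 * r * cos s + r ^+ 2); [ring|rewrite cos2Dsin2].
have E1 s : normc (phi (pol rho s) * (pol rho s / (pol rho s - w))) = h (t + s) / D s.
  rewrite /phi normcM (normcM (ft _)) (normcM (pol rho s) (_^-1)) !normcV normc_pol (ger0_norm (ltW rho0)).
  have -> : normc (ft (pol rho s)) = h (t + s).
    by rewrite /ft /h /pol mulrCA -expiD.
  have [e1 e2] := normE s.
  have -> : normc (1 - c * pol rho s) = Num.sqrt (D s).
    by rewrite -e1 sqrtr_sqr ger0_norm// normc_ge0.
  have -> : normc (pol rho s - w) = rho * Num.sqrt (D s).
    by rewrite -[LHS]ger0_norm ?normc_ge0// -sqrtr_sqr e2 sqrtrM ?sqr_ge0// sqrtr_sqr ger0_norm// ltW.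
  have sq : Num.sqrt (D s) * Num.sqrt (D s) = D s by rewrite -expr2 sqr_sqrtr// ltW.
  have sn : Num.sqrt (D s) != 0 by rewrite gt_eqF// sqrtr_gt0.
  rewrite -[in RHS]sq; field; by rewrite sn gt_eqF.
have dz s : disk (pol rho s) by rewrite diskE normc_pol.
have cphi : ccts 0 (2 * pi) (fun s => phi (pol rho s) * (pol rho s / (pol rho s - w))).
  by apply: cctsM; [exact: hol_ccts|exact: ccts_kernel].
have := iint_le cphi; rewrite E normcM normc_real (ger0_norm (@pi2_ge0 R)) Ew (normcM (f _) (_^-1)) normcV.
have r20 : 0 < 1 - r ^+ 2 by rewrite subr_gt0 exprn_ilt1// ltW.
rewrite normc_real (gtr0_norm r20).
rewrite (@eq_Rintegral _ _ _ mu `[0, 2 * pi] (fun s => h (t + s) / D s)); last by move=> s _; exact: E1.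
have cD : continuous D.
  rewrite /D => s; apply: cvgD; last exact: cvg_cst.
  apply: cvgB; first exact: cvg_cst.
  by apply: cvgM; [exact: cvg_cst|exact: continuous_cos].
have chD : continuous (fun s => h (t + s) / D s).
  move=> s; apply: cvgM; last by apply: cvgV; [rewrite gt_eqF|exact: cD].
  apply: (@continuous_comp _ _ _ (fun y => t + y) h); last exact: ch.
  by apply: cvgD; [exact: cvg_cst|exact: cvg_id].
have wchD a b : {within `[a, b], continuous (fun s => h (t + s) / D s)} by exact: continuous_subspaceT.
have split_int : \int[mu]_(s in `[0, 2 * pi]) (h (t + s) / D s) =
   \int[mu]_(s in `[0, pi]) (h (t + s) / D s) + \int[mu]_(s in `[pi, 2 * pi]) (h (t + s) / D s).
  have pp : pi <= 2 * pi :> R by clear -pi0; lra.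
  have := @iint_split R 0 pi (2 * pi) _ (ltW pi0) pp (within_ccts (wchD 0 (2 * pi))).
  by move=> /(congr1 (@complex.Re R)).
have refl : \int[mu]_(s in `[pi, 2 * pi]) (h (t + s) / D s) = \int[mu]_(s in `[0, pi]) (h (t - s) / D s).
  have pp : pi <= 2 * pi :> R by clear -pi0; lra.
  rewrite (Rint_reflect (2 * pi) pp (wchD _ _)) subrr (_ : 2 * pi - pi = pi); last by clear; lra.
  apply: eq_Rintegral => s _; rewrite /D.
  have -> : t + (2 * pi - s) = (t - s) + 2 * pi by ring.
  by rewrite hper; congr (_ / (_ - _ * _ + _)); rewrite addrC mulr_natl cosD2pi cosN.
rewrite split_int refl => HH.
have hge x : 0 <= h x by exact: normc_ge0.
have chm : continuous (fun s => h (t - s) / D s).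
  move=> s; apply: cvgM; last by apply: cvgV; [rewrite gt_eqF|exact: cD].
  apply: (@continuous_comp _ _ _ (fun y => t - y) h); last exact: ch.
  by apply: cvgB; [exact: cvg_cst|exact: cvg_id].
rewrite -RintegralD// in HH; last 2 first.
  exact: within_integrable.
  by apply: within_integrable; exact: continuous_subspaceT.
set I := \int[mu]_(s in `[0, pi]) (_ + _) in HH.
have step1 : normc (f (pol (r * rho) t)) <= (1 - r) * I.
  have I0 : 0 <= I by apply: Rintegral_ge0 => s _; rewrite addr_ge0// divr_ge0// ltW.
  have x0 := normc_ge0 (f (pol (r * rho) t)).
  move: HH; rewrite mulrAC ler_pdivrMr//.
  move: (normc _) x0 => x x0 HH.
  have pi2 := pi_ge2 R.
  have k1 : x * 4 <= x * (2 * pi) by rewrite ler_wpM2l//; clear -pi2; lra.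
  have k2 : 1 - r ^+ 2 <= 2 * (1 - r) by rewrite -subr_ge0 (_ : _ - _ = (1 - r) ^+ 2) ?sqr_ge0//; ring.
  have k3 : 2 * I * (1 - r ^+ 2) <= 2 * I * (2 * (1 - r)) by rewrite ler_wpM2l// mulr_ge0.
  have := le_trans k1 (le_trans HH k3).
  have -> : 2 * I * (2 * (1 - r)) = (1 - r) * I * 4 by ring.
  by rewrite ler_pM2r.
apply: (le_trans step1).
have cK : {within `[0, pi], continuous (fun s : R => (1 - r) * ((1 - r + s)^-1 * (1 - r + s)^-1))}.
  have cinv : {within `[0, pi], continuous (fun s : R => (1 - r + s)^-1)}.
    apply: derivable_within_continuous => s; rewrite in_itv/= => /andP[s0 _].
    apply: derivableV; first by rewrite gt_eqF// ltr_pwDl// subr_gt0.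
    by apply: derivableD; [exact: derivable_cst|exact: derivable_id].
  move=> s; apply: (@continuousM _ _ _ _ s); first exact: cvg_cst.
  exact: (@continuousM _ _ _ _ s (cinv s) (cinv s)).
have chh : {within `[0, pi], continuous (fun s : R => h (t + s) + h (t - s))}.
  apply: continuous_subspaceT => s; apply: cvgD.
    apply: (@continuous_comp _ _ _ (fun y => t + y) h); last exact: ch.
    by apply: cvgD; [exact: cvg_cst|exact: cvg_id].
  apply: (@continuous_comp _ _ _ (fun y => t - y) h); last exact: ch.
  by apply: cvgB; [exact: cvg_cst|exact: cvg_id].
have cprod : {within `[0, pi], continuous (fun s : R => (h (t + s) + h (t - s)) * ((1 - r) * ((1 - r + s)^-1 * (1 - r + s)^-1)))}.
  by move=> s; exact: (@continuousM _ _ _ _ s (chh s) (cK s)).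
have cI : {within `[0, pi], continuous (fun s => h (t + s) / D s + h (t - s) / D s)}.
  by apply: continuous_subspaceT => s; apply: cvgD; [exact: chD|exact: chm].
rewrite /I -RintegralZl//; last exact: within_integrable.
rewrite -RintegralZl//; last exact: within_integrable.
apply: le_Rintegral => //.
- apply: within_integrable => s; apply: (@continuousM _ _ _ _ s); [exact: cvg_cst|exact: cI].
- apply: within_integrable => s; apply: (@continuousM _ _ _ _ s); [exact: cvg_cst|exact: cprod].
move=> s; rewrite /= in_itv/= => /andP[s0 sp].
have de0 : 0 < 1 - r by rewrite subr_gt0.
(* The constant 64 comes from [(x + s)^2 <= 2 x^2 + 2 s^2] combined with [s^2 <= 32 (1 - cos s)]; as
   [r >= 1/2], [D s] is at least [(1 - r)^2 + (1 - cos s)]. *)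
have dlow : (1 - r + s) ^+ 2 <= 64 * D s.
  have := @cos_quad R s; rewrite s0 sp => /(_ isT) cq.
  rewrite DE; have c1 : 0 <= 1 - cos s by rewrite subr_ge0 cos_le1.
  have rc : 1 - cos s <= 2 * r * (1 - cos s) by rewrite ler_peMl//; clear -r2; lra.
  have sq : (1 - r + s) ^+ 2 <= 2 * (1 - r) ^+ 2 + 2 * s ^+ 2.
    by rewrite -subr_ge0 (_ : _ - _ = (1 - r - s) ^+ 2) ?sqr_ge0//; ring.
  have := sqr_ge0 (1 - r); clear -cq rc sq; move: ((1 - r) ^+ 2) (s ^+ 2) (1 - cos s) (2 * r * _) ((_ + s) ^+ 2) cq rc sq => a b x y z; lra.
rewrite -mulrDl -invfM -expr2 mulrCA [64 * _]mulrCA [64 * _]mulrCA.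
rewrite ler_wpM2l ?addr_ge0//= ler_pM2l//.
have ds0 : 0 < (1 - r + s) ^+ 2 by rewrite exprn_gt0// ltr_pwDl.
by rewrite ler_pdivlMr// mulrC ler_pdivrMr.
Qed.

End Poisson.

Section WeakMax.
Context {R : realType}.
Local Notation C := R[i].
Local Notation mu := (@lebesgue_measure R).
Implicit Types (f : C -> C) (r t : R).

Definition circ f (rho x : R) : R := normc (f (pol rho x)).

(** The maximal inequality involves the integral over the whole line, so the periodic function is
    cut off. One extra period on each side keeps every interval of half-length at most [pi] about a
    point of [[0, 2 pi]] inside the window. *)
Definition circ_cut f (rho : R) : R -> R := circ f rho \_ `[- (2 * pi), 4 * pi].

Lemma circ_cut_locint f (rho : R) : hol f -> `|rho| < 1 ->
  locally_integrable setT (circ_cut f rho).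
Proof.
move=> hf r1; apply: integrable_locally_restrict => //.
by apply: within_integrable; apply: continuous_subspaceT; exact: circ_continuous.
Qed.

Lemma EFin_Rint (u : R -> R) a b : {within `[a, b], continuous u} ->
  (\int[mu]_(x in `[a, b]) u x)%:E = (\int[mu]_(x in `[a, b]) (u x)%:E)%E.
Proof.
move=> cu; rewrite /Rintegral fineK//.
by apply: integrable_fin_num => //; exact: within_integrable.
Qed.

Lemma max_bound f (rho t la r : R) : hol f -> rho < 1 -> 0 <= t <= 2 * pi -> 0 <= la ->
  (HL_maximal (circ_cut f rho) t <= la%:E)%E -> 1 / 2 <= r -> r < rho ->
  normc (f (pol (r * rho) t)) <= 768 * la.
Proof.
move=> hf rho1 /andP[t0 t2] la0 Hla r2 rr.
have r0 : 0 < r by apply: lt_le_trans r2; rewrite divr_gt0.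
have rho0 : 0 < rho by exact: lt_trans rr.
have rn : `|rho| < 1 by rewrite ger0_norm// ltW.
have pi0 : 0 < pi :> R := pi_gt0 R.
have ch := circ_continuous hf rn.
have g0 x : 0 <= circ_cut f rho x.
  by rewrite /circ_cut patchE; case: ifP => // _; exact: normc_ge0.
(* The maximal function averages over open balls, so the closed interval of half-length [u] is
   placed in the ball of radius [2 * u]. This costs a factor 2, and 768 = 64 * 6 * 2. *)
have H u : 0 < u -> u <= pi -> \int[mu]_(x in `[t - u, t + u]) circ f rho x <= 2 * u * (2 * la).
  move=> u0 u1.
  have u20 : 0 < 2 * u by rewrite mulr_gt0.
  have := @ereal_sup_ubound R [set iavg (circ_cut f rho) (ball t r) | r in `]0, +oo[%classic] (iavg (circ_cut f rho) (ball t (2 * u))).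
  have hin : [set iavg (circ_cut f rho) (ball t r) | r in `]0, +oo[%classic] (iavg (circ_cut f rho) (ball t (2 * u))).
    by exists (2 * u) => //=; rewrite in_itv/= andbT.
  move=> /(_ hin) h1.
  have {h1} := le_trans h1 Hla; rewrite /iavg lebesgue_measure_ball ?(ltW u20)//.
  have m0 : 0 < 2 * u *+ 2 by rewrite pmulrn_lgt0.
  have li := circ_cut_locint hf rn.
  have mg : measurable_fun setT (circ_cut f rho) by case: li.
  have le1 : (\int[mu]_(x in `[(t - u)%R, (t + u)%R]) (circ f rho x)%:E <= \int[mu]_(y in ball t (2 * u)) `|(circ_cut f rho y)%:E|)%E.
    have -> : (\int[mu]_(x in `[(t - u)%R, (t + u)%R]) (circ f rho x)%:E = \int[mu]_(x in `[(t - u)%R, (t + u)%R]) `|(circ_cut f rho x)%:E|)%E.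
      apply: eq_integral => x; rewrite inE/= in_itv/= => /andP[x1 x2].
      rewrite /circ_cut patchE ifT; last first.
        rewrite inE/= in_itv/=; apply/andP; split; clear -x1 x2 u1 t0 t2 pi0; lra.
      by rewrite /= ger0_norm// normc_ge0.
    apply: ge0_subset_integral => //.
    - exact: measurable_ball.
    - by apply: measurable_funTS; apply/measurableT_comp => //=; exact: measurableT_comp.
    - move=> x /=; rewrite in_itv/= => /andP[x1 x2]; rewrite ball_itv /= in_itv/=.
      by apply/andP; split; clear -x1 x2 u0; lra.
  rewrite -EFin_Rint in le1; last exact: continuous_subspaceT.
  rewrite inver (negbTE (lt0r_neq0 m0)) => h2.
  have h3 : ((2 * u *+ 2)^-1%:E * (\int[mu]_(x in `[t - u, t + u]) circ f rho x)%:E <= la%:E)%E.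
    by apply: le_trans h2; rewrite lee_wpmul2l// lee_fin invr_ge0 ltW.
  rewrite -EFinM lee_fin ler_pdivrMl// in h3; apply: (le_trans h3).
  by rewrite -mulr_natr; clear; move: u la => u la; rewrite le_eqVlt; apply/orP; left; apply/eqP; ring.
have r1 : r < 1 by exact: lt_trans rho1.
have d0 : 0 < 1 - r by rewrite subr_gt0.
have la20 : 0 <= 2 * la by rewrite mulr_ge0.
have := @radial_ibp R (circ f rho) t (2 * la) (1 - r) ch (fun x => normc_ge0 _) d0 la20 H.
have := poisson_bound t hf r2 rr rho1.
rewrite /circ; move: (\int[mu]_(s in _) _) => I h1 h2; clear -h1 h2; lra.
Qed.

(** In place of the Cauchy-Schwarz inequality, [y <= y^2 / (2 ep) + ep / 2] is integrated. *)
Lemma circ_L1 f (rho ep : R) : hol f -> 0 < rho -> rho < 1 -> 0 < ep -> m2 f rho <= ep ^+ 2 ->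
  \int[mu]_(x in `[0, 2 * pi]) circ f rho x <= 2 * pi * ep.
Proof.
move=> hf r0 r1 e0 hm.
have rn : `|rho| < 1 by rewrite ger0_norm// ltW.
have ch := circ_continuous hf rn.
have cf := hol_ccts hf rn.
have p0 := @pi2_gt0 R.
have cw : {within `[0, 2 * pi], continuous (fun x => ep^-1 / 2 * (normc (f (pol rho x)) ^+ 2))}.
  by move=> x; apply: (@continuousM _ _ _ _ x); [exact: cvg_cst|exact: (normc2_within cf)].
apply: (@le_trans _ _ (\int[mu]_(x in `[0, 2 * pi]) (ep^-1 / 2 * (normc (f (pol rho x)) ^+ 2) + ep / 2))).
  apply: le_Rintegral => //.
  - by apply: within_integrable; exact: continuous_subspaceT.
  - by apply: within_integrable => x; apply: (@continuousD _ _ _ _ _ x); [exact: cw|exact: cvg_cst].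
  move=> x _; rewrite /circ; move: (normc _) => y.
  rewrite -subr_ge0 (_ : _ - _ = ep^-1 / 2 * (y - ep) ^+ 2).
    by rewrite mulr_ge0 ?sqr_ge0// divr_ge0// invr_ge0 ltW.
  by field; rewrite gt_eqF.
rewrite RintegralD//; last 2 first.
  exact: within_integrable.
  by apply: within_integrable => x; exact: cvg_cst.
have wi := within_integrable (normc2_within cf).
have -> : \int[mu]_(x in `[0, 2 * pi]) (ep^-1 / 2 * normc (f (pol rho x)) ^+ 2) =
    ep^-1 / 2 * \int[mu]_(x in `[0, 2 * pi]) (normc (f (pol rho x)) ^+ 2).
  by apply: RintegralZl.
rewrite Rintegral_cst//= lebesgue_measure_itv/= lte_fin p0 /=.
have : \int[mu]_(x in `[0, 2 * pi]) (normc (f (pol rho x)) ^+ 2) <= ep ^+ 2 * (2 * pi).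
  by move: hm; rewrite /m2 ler_pdivrMl// (mulrC (ep ^+ 2)).
rewrite subr0; move: (\int[mu]_(x in `[0, 2 * pi]) (normc (f (pol rho x)) ^+ 2)) => I hI.
move: (2 * pi) p0 hI => P P0 hI.
have h : ep^-1 / 2 * I <= ep^-1 / 2 * (ep ^+ 2 * P) by rewrite ler_wpM2l// divr_ge0// invr_ge0 ltW.
apply: (le_trans (lerD h (lexx _))).
by rewrite le_eqVlt; apply/orP; left; apply/eqP; field; rewrite gt_eqF.
Qed.

Lemma circ_cut_L1 f (rho ep : R) : hol f -> 0 < rho -> rho < 1 -> 0 < ep -> m2 f rho <= ep ^+ 2 ->
  (\int[mu]_y `|(circ_cut f rho y)%:E| <= (3 * (2 * pi * ep))%:E)%E.
Proof.
move=> hf r0 r1 e0 hm.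
have rn : `|rho| < 1 by rewrite ger0_norm// ltW.
have ch := circ_continuous hf rn.
have p0 := @pi_gt0 R.
have per (x : R) : circ f rho (2 * pi + x) = circ f rho x by rewrite /circ /pol addrC expi_periodic.
have -> : (\int[mu]_y `|(circ_cut f rho y)%:E| = \int[mu]_(y in `[(- (2 * pi))%R, (4 * pi)%R]) (circ f rho y)%:E)%E.
  rewrite [RHS]integral_mkcond; apply: eq_integral => x _.
  rewrite /circ_cut !patchE; case: ifP => _ /=; last by rewrite normr0.
  by rewrite ger0_norm// normc_ge0.
have cw a b : {within `[a, b], continuous (circ f rho)} by exact: continuous_subspaceT.
rewrite -EFin_Rint// lee_fin.
have I0 := circ_L1 hf r0 r1 e0 hm.
have split3 a b c : a <= b -> b <= c -> \int[mu]_(s in `[a, c]) circ f rho s =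
   \int[mu]_(s in `[a, b]) circ f rho s + \int[mu]_(s in `[b, c]) circ f rho s.
  move=> ab bc; have := @iint_split R a b c _ ab bc (within_ccts (cw a c)).
  by move=> /(congr1 (@complex.Re R)).
rewrite (split3 _ 0); [|by clear -p0; lra|by clear -p0; lra].
rewrite (split3 0 (2 * pi)); [|by clear -p0; lra|by clear -p0; lra].
have e1 : \int[mu]_(s in `[2 * pi, 4 * pi]) circ f rho s = \int[mu]_(s in `[0, 2 * pi]) circ f rho s.
  have -> : `[2 * pi, 4 * pi]%classic = `[2 * pi + 0, 2 * pi + 2 * pi]%classic :> set R.
    by rewrite addr0 (_ : 4 * pi = 2 * pi + 2 * pi)//; clear; lra.
  rewrite (@Rint_shift R (circ f rho) 0 (2 * pi) (2 * pi) (@pi2_ge0 R) ch).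
  by apply: eq_Rintegral => x _; exact: per.
have e2 : \int[mu]_(s in `[- (2 * pi), 0]) circ f rho s = \int[mu]_(s in `[0, 2 * pi]) circ f rho s.
  have -> : `[0, 2 * pi]%classic = `[2 * pi + - (2 * pi), 2 * pi + 0]%classic :> set R.
    by rewrite addr0 subrr.
  have pm : - (2 * pi) <= 0 :> R by rewrite oppr_le0 pi2_ge0.
  rewrite (@Rint_shift R (circ f rho) (- (2 * pi)) 0 (2 * pi) pm ch).
  by apply: eq_Rintegral => x _; rewrite per.
rewrite e1 e2; clear -I0; lra.
Qed.

(* The bound holds for all radii at once off a single small set, which is what
   makes the radial limits exist almost everywhere. *)
Lemma weak_max f (ep la : R) : hol f -> 0 < ep -> 0 < la ->
  (forall r, 0 < r -> r < 1 -> m2 f r <= ep ^+ 2) ->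
  exists G : set R, [/\ measurable G, (mu G <= (18 * pi * (ep / la))%:E)%E &
    forall t, 0 <= t <= 2 * pi -> ~ G t -> forall r, 1 / 2 <= r -> r < 1 ->
      normc (f (pol r t)) <= 768 * la].
Proof.
move=> hf e0 l0 hm.
pose rho n : R := 1 - (2 ^+ n.+1)^-1.
have p2 n : 0 < (2 ^+ n.+1)^-1 :> R by rewrite invr_gt0 exprn_gt0.
have p2h n : (2 ^+ n.+1)^-1 <= 1 / 2 :> R.
  by rewrite div1r lef_pV2 ?posrE ?exprn_gt0// exprS ler_peMr// exprn_ege1// ler1n.
have rho0 n : 0 < rho n by rewrite /rho; have := p2h n; move: (_^-1) => x; lra.
have rho1 n : rho n < 1 by rewrite /rho; have := p2 n; move: (_^-1) => x; lra.
have rhon n : `|rho n| < 1 by rewrite ger0_norm// ltW.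
pose E n := [set x | (HL_maximal (circ_cut f (rho n)) x > la%:E)%E].
have mE n : measurable (E n).
  rewrite -[X in measurable X]setTI; apply: emeasurable_fun_o_infty => //.
  by apply: measurable_HL_maximal; exact: circ_cut_locint.
have muE n : (mu (E n) <= (18 * pi * (ep / la))%:E)%E.
  apply: (le_trans (maximal_inequality (circ_cut_locint hf (rhon n)) l0)).
  have h := circ_cut_L1 hf (rho0 n) (rho1 n) e0 (hm _ (rho0 n) (rho1 n)).
  apply: (@le_trans _ _ ((3 / la)%:E * (3 * (2 * pi * ep))%:E)%E).
    by rewrite lee_wpmul2l// lee_fin divr_ge0// ltW.
  rewrite -EFinM lee_fin le_eqVlt; apply/orP; left; apply/eqP; field.
  by rewrite gt_eqF.
(* The exceptional set is the lower limit of the [E n], not their union: it inherits the measure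
   bound of a single [E n], and a point outside it avoids [E n] for arbitrarily large [n]. *)
pose F n := \bigcap_(m in [set m | (n <= m)%N]) E m.
have mF n : measurable (F n) by apply: bigcap_measurable => //; exists n => /=.
have ndF : nondecreasing_seq F.
  by move=> m n mn; apply/subsetPset => x Fx k /= nk; apply: Fx; exact: leq_trans nk.
exists (\bigcup_n F n); split.
- exact: bigcup_measurable.
- have mU : measurable (\bigcup_n F n) by exact: bigcup_measurable.
  have cv := @nondecreasing_cvg_mu _ _ R mu F mF mU ndF.
  rewrite -(cvg_lim _ cv)//; apply: lime_le; first by apply/cvg_ex; eexists; exact: cv.
  near=> n; apply: le_trans (muE n); apply: le_measure; rewrite ?inE//.
  - exact: mF.
  - exact: mE.
  - by move=> x; apply => /=.
- move=> t ht nG r r2 r1.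
  have [m hmr] := pow2_gt ((1 - r)^-1).
  have d0 : 0 < 1 - r by rewrite subr_gt0.
  have [n mn nE] : exists2 n, (m <= n)%N & ~ E n t.
    apply: contrapT => hh; apply: nG; exists m => // k /= mk.
    by apply: contrapT => hk; apply: hh; exists k.
  (* [max_bound] sees the point at radius [r] as [r / rho n] times [rho n] and needs the first
     factor below [rho n]. *)
  have hrho : r < rho n * rho n.
    have h1 : 1 - rho n * rho n <= 2 * (2 ^+ n.+1)^-1.
      rewrite /rho; have := sqr_ge0 ((2 ^+ n.+1)^-1 : R); rewrite expr2.
      by move: (_^-1) => x; lra.
    have h2 : 2 * (2 ^+ n.+1)^-1 = (2 ^+ n)^-1 :> R.
      by rewrite exprS invfM mulrA divff ?mul1r.
    have h3 : (2 ^+ n)^-1 <= (2 ^+ m)^-1 :> R.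
      by rewrite lef_pV2 ?posrE ?exprn_gt0// ler_weXn2l// ler1n.
    have h4 : (2 ^+ m)^-1 < 1 - r.
      by rewrite -[ltRHS]invrK ltf_pV2 ?posrE ?exprn_gt0 ?invr_gt0.
    rewrite h2 in h1; clear -h1 h3 h4; move: (_^-1) (_^-1) h1 h3 h4 => x y; lra.
  have rr : r / rho n < rho n by rewrite ltr_pdivrMr.
  have r2' : 1 / 2 <= r / rho n.
    apply: (le_trans r2); rewrite ler_pdivlMr// ler_piMr//.
      by apply: le_trans r2; rewrite divr_ge0.
    exact: ltW.
  have := max_bound hf (rho1 n) ht (ltW l0) _ r2' rr; rewrite divfK ?gt_eqF//; apply.
  by rewrite leNgt; apply/negP.
Unshelve. all: by end_near. Qed.

End WeakMax.

(** * Radial boundary values *)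

Section NullSets.
Local Open Scope ereal_scope.
Context {d} {T : measurableType d} {R : realType}.
Variable mu : {measure set T -> \bar R}.
Import HBNNSimple.

(** No measurability is asked of [f] or [g]: the function [boundary] is a [lim] whose values on the
    exceptional set are uncontrolled. A simple function below [f] is set to 0 on [N], after which it
    lies below [g]. *)
Lemma ge0_le_integral_null (D N : set T) (f g : T -> \bar R) :
  measurable D -> measurable N -> mu N = 0 ->
  (forall x, D x -> 0 <= f x) -> (forall x, D x -> 0 <= g x) ->
  (forall x, D x -> ~ N x -> f x = g x) ->
  \int[mu]_(x in D) f x <= \int[mu]_(x in D) g x.
Proof.
move=> mD mN N0 f0 g0 fg; rewrite [leLHS]integral_mkcond [leRHS]integral_mkcond.
rewrite ge0_integralTE; last by move=> x; rewrite patchE; case: ifPn => //; rewrite inE => /f0.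
apply: ge_ereal_sup => _ [h /= hf <-].
pose h' := mul_nnsfun h (indic_nnsfun R (measurableC mN)).
have -> : sintegral mu h = sintegral mu h'.
  rewrite -!integralT_nnsfun; apply: ae_eq_integral => //.
  - by apply/measurable_EFinP; exact: measurable_funTS.
  - by apply/measurable_EFinP; exact: measurable_funTS.
  exists N; split => //= x /= hx; apply: contrapT => nN; apply: hx => _.
  by rewrite /= mindicE mem_set ?mulr1.
rewrite ge0_integralTE; last by move=> x; rewrite patchE; case: ifPn => //; rewrite inE => /g0.
apply: ereal_sup_ubound; exists h' => //= x; rewrite patchE.
case: ifPn => [|xD].
  rewrite inE => Dx; rewrite /= mindicE; have [Nx|Nx] := pselect (N x).
    by rewrite memNset ?mulr0; [exact: g0|move=> nn; exact: nn].
  rewrite mem_set// mulr1 -fg//; have := hf x; rewrite patchE ifT//.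
  by rewrite inE.
have := hf x; rewrite patchE (negbTE xD) lee_fin => h0.
by rewrite lee_fin mulr_le0_ge0// mindicE; case: (_ \in _).
Qed.

Lemma ge0_integral_null (D N : set T) (f g : T -> \bar R) :
  measurable D -> measurable N -> mu N = 0 ->
  (forall x, D x -> 0 <= f x) -> (forall x, D x -> 0 <= g x) ->
  (forall x, D x -> ~ N x -> f x = g x) ->
  \int[mu]_(x in D) f x = \int[mu]_(x in D) g x.
Proof.
move=> mD mN N0 f0 g0 fg; apply/eqP; rewrite eq_le !(@ge0_le_integral_null _ N)//.
by move=> x Dx Nx; rewrite fg.
Qed.

Lemma integral_null (D N : set T) (f g : T -> \bar R) :
  measurable D -> measurable N -> mu N = 0 ->
  (forall x, D x -> ~ N x -> f x = g x) ->
  \int[mu]_(x in D) f x = \int[mu]_(x in D) g x.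
Proof.
move=> mD mN N0 fg; rewrite integralE [RHS]integralE; congr (_ - _).
  by apply: (ge0_integral_null mD mN N0) => // x Dx Nx; rewrite funeposE fg -?funeposE.
by apply: (ge0_integral_null mD mN N0) => // x Dx Nx; rewrite funenegE fg -?funenegE.
Qed.

Lemma Rintegral_null (D N : set T) (f g : T -> R) :
  measurable D -> measurable N -> mu N = 0 ->
  (forall x, D x -> ~ N x -> f x = g x) ->
  (\int[mu]_(x in D) f x = \int[mu]_(x in D) g x)%R.
Proof.
move=> mD mN N0 fg; rewrite /Rintegral (@integral_null D N _ (EFin \o g))//.
by move=> x Dx Nx; rewrite /= fg.
Qed.

End NullSets.

Section Fatou.
Context {R : realType}.
Local Notation C := R[i].
Local Notation mu := (@lebesgue_measure R).
Implicit Types (f : C -> C) (r t : R).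

Lemma cvg_left1 (g : R -> R) (l : R) :
  (forall e, 0 < e -> exists2 r0, r0 < 1 & forall r, r0 < r -> r < 1 -> `|g r - l| < e) ->
  g r @[r --> 1^'-] --> l.
Proof.
move=> h; apply/cvgrPdist_lt => e e0; have [r0 r01 H] := h _ e0.
near=> r; rewrite distrC; apply: H; near: r; [exact: nbhs_left_gt|exact: nbhs_left_lt].
Unshelve. all: by end_near. Qed.

Lemma nbhs_left1 (P : R -> Prop) : (\forall r \near 1^'-, P r) ->
  exists2 r0, r0 < 1 & forall r, r0 < r -> r < 1 -> P r.
Proof.
case => e /= e0 h; exists (1 - e); first by rewrite ltrBlDr ltrDl.
move=> r h1 h2; apply: h => //=; rewrite gtr0_norm ?subr_gt0//; lra.
Qed.

Lemma L2_sup a f (M : R) : hol f -> has_ps a f ->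
  (forall r, 0 < r -> r < 1 -> m2 f r <= M) ->
  exists S : R, [/\ forall N, L2 a N <= S,
    forall e, 0 < e -> exists N, S - e < L2 a N & S <= M].
Proof.
move=> hf hps hM.
have hL N : L2 a N <= M.
  by apply: S2_lim => r r0 r1; apply: le_trans (hM r r0 r1); exact: bessel.
have hs : has_sup (range (L2 a)).
  by split; [exists (L2 a 0%N); exists 0%N|exists M => _ [N _ <-]].
exists (sup (range (L2 a))); split.
- by move=> N; apply: ub_le_sup; [exact: hs.2|exists N].
- by move=> e e0; have [_ [N _ <-] h] := sup_adherent e0 hs; exists N.
- by apply: ge_sup; [exact: hs.1|move=> _ [N _ <-]].
Qed.

Lemma m2_cvg a f (S : R) : hol f -> has_ps a f ->
  (forall N, L2 a N <= S) -> (forall e, 0 < e -> exists N, S - e < L2 a N) ->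
  m2 f r @[r --> 1^'-] --> S.
Proof.
move=> hf hps hS hS2; apply: cvg_left1 => e e0.
have [N hN] := hS2 _ e0.
have [r0 /andP[r00 r01] h0] : exists2 r0, 0 < r0 < 1 & S - e < S2 a r0 N.
  apply: contrapT => hh; suff : L2 a N <= S - e by rewrite leNgt hN.
  apply: S2_lim => r r0 r1; rewrite leNgt; apply/negP => h; apply: hh.
  by exists r => //; rewrite r0.
exists r0 => // r rr r1; have rp : 0 < r by exact: lt_trans rr.
rewrite ltr_distl; apply/andP; split.
  apply: (lt_le_trans h0); apply: le_trans (bessel N hps hf rp r1).
  by apply: S2_homo; exact: ltW.
apply: (@le_lt_trans _ _ S); last by rewrite ltrDl.
apply: (m2_le_of_S2 hps) => // M; apply: le_trans (hS M); exact: S2_le_L2.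
Qed.

Definition rlim f t (v : C) := forall e : R, 0 < e -> exists2 r0 : R, r0 < 1 &
  forall r, r0 < r -> r < 1 -> normc (f (pol r t) - v) < e.

Lemma rlimD f g t u v : rlim f t u -> rlim g t v -> rlim (fun z => f z + g z) t (u + v).
Proof.
move=> hu hv e e0; have e2 : 0 < e / 2 by rewrite divr_gt0.
have [r0 r01 h0] := hu _ e2; have [s0 s01 h1] := hv _ e2.
exists (Num.max r0 s0); first by rewrite gt_max r01.
move=> r; rewrite gt_max => /andP[h2 h3] r1; rewrite opprD addrACA.
by apply: (le_lt_trans (le_normcD _ _)); rewrite (splitr e) ltrD// ?h0 ?h1.
Qed.

Lemma gt_max2 (a b r : R) : Num.max a b < r -> a < r /\ b < r.
Proof. by rewrite gt_max => /andP[]. Qed.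

Lemma rlim_cauchy f t : (forall e : R, 0 < e -> exists2 r0 : R, r0 < 1 &
   forall r s, r0 < r -> r < 1 -> r0 < s -> s < 1 -> normc (f (pol r t) - f (pol s t)) < e) ->
  exists v, rlim f t v.
Proof.
move=> h.
have key (p : C -> R) : (forall x y, p x - p y = p (x - y)) -> (forall x, `|p x| <= normc x) ->
    exists l : R, p (f (pol r t)) @[r --> 1^'-] --> l.
  move=> pB ple; apply/cvg_ex; apply/cauchy_cvgP/cauchy_exP => e e0.
  have [r0 r01 H] := h _ e0.
  have [s s0 s1] : exists2 s, r0 < s & s < 1 by exists ((r0 + 1) / 2); lra.
  exists (p (f (pol s t))); change (\forall r \near 1^'-, ball (p (f (pol s t))) e (p (f (pol r t)))).
  near=> r; change (`|p (f (pol s t)) - p (f (pol r t))| < e); rewrite pB; apply: (le_lt_trans (ple _)).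
  exact: H.
have [a ha] := key _ (fun x y => esym (raddfB (@complex.Re R) x y)) (@Re_le_normc R).
have [b hb] := key _ (fun x y => esym (raddfB (@complex.Im R) x y)) (@Im_le_normc R).
exists (Complex a b) => e e0; have e2 : 0 < e / 2 by rewrite divr_gt0.
have /cvgrPdist_lt/(_ _ e2)/nbhs_left1 [r0 r01 h0] := ha.
have /cvgrPdist_lt/(_ _ e2)/nbhs_left1 [s0 s01 h1] := hb.
exists (Num.max r0 s0); first by rewrite gt_max r01.
move=> r; rewrite gt_max => /andP[h2 h3] r1.
apply: (le_lt_trans (normc_le_sum _)); rewrite (splitr e).
by apply: ltrD; [have := h0 r h2 r1|have := h1 r h3 r1]; rewrite raddfB distrC.
Unshelve. all: by end_near. Qed.

Definition rn (n : nat) : R := 1 - (2 ^+ n.+1)^-1.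

Lemma rn_gt (r0 : R) : r0 < 1 -> exists m, forall n, (m <= n)%N -> r0 < rn n.
Proof.
move=> r01; have d0 : 0 < 1 - r0 by rewrite subr_gt0.
have [m hm] := pow2_gt ((1 - r0)^-1); exists m => k mk; rewrite /rn ltrBrDr -ltrBrDl.
rewrite -[ltRHS]invrK ltf_pV2 ?posrE ?exprn_gt0 ?invr_gt0//; apply: (lt_le_trans hm).
by rewrite ler_weXn2l ?ler1n// leqW.
Qed.

Lemma rn_itv n : 0 < rn n /\ rn n < 1.
Proof.
rewrite /rn; split; last by rewrite ltrBlDr ltrDl invr_gt0 exprn_gt0.
by rewrite subr_gt0 invf_lt1 ?exprn_gt0// exprn_egt1// ltr1n.
Qed.

Lemma rlim_cts f t : derivable f (expi t) 1 -> rlim f t (f (expi t)).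
Proof.
move=> /derivable_cts/ctsCP h e e0; have [d d0 hd] := h _ e0.
exists (1 - d); first by rewrite ltrBlDr ltrDl.
move=> r r0 r1; apply: hd.
have -> : pol r t - expi t = (r - 1)%:C%C * expi t by rewrite rmorphB rmorph1 mulrBl mul1r.
rewrite normcM normc_expi normc_real mulr1 distrC gtr0_norm ?subr_gt0//.
by rewrite ltrBlDr -ltrBlDl.
Qed.

Lemma derivable_psum (a : nat -> C) N z : derivable (fun w => psum a w N) z 1.
Proof.
apply: (derivableC_sum _).1 => i; apply: derivableCM; first exact: derivableC_cst.
exact: derivableC_exp.
Qed.

Lemma normc_four (x y u v : C) (l m : R) : normc x <= l -> normc y <= l ->
  normc u < m -> normc v < m -> normc ((x - y) + (u - v)) < 2 * l + 2 * m.
Proof.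
have n1 (p q : C) : normc (p - q) <= normc p + normc q by rewrite (le_trans (le_normcD _ _))// normcN.
move=> hx hy hu hv; apply: (le_lt_trans (le_normcD _ _)).
have := n1 x y; have := n1 u v; move: (normc (x - y)) (normc (u - v)) => p q; lra.
Qed.

(** Weak-type bound and Borel-Cantelli: off a null set, the remainders after suitable Taylor
    polynomials are eventually small uniformly along the radius. Polynomials are continuous up to
    the circle, so [f] is Cauchy along the radius. *)
Lemma rlim_ae a f (S : R) : hol f -> has_ps a f -> (forall N, L2 a N <= S) ->
  (forall e, 0 < e -> exists N, S - e < L2 a N) ->
  exists B : set R, [/\ measurable B, mu B = 0 &
    forall t, 0 <= t <= 2 * pi -> ~ B t -> exists v, rlim f t v].
Proof.
move=> hf hps hS hS2.
(* The exceptional sets have measure of order [ep j / la j = 2^-j], which is summable, while the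
   pointwise bounds [la j] still tend to 0. *)
pose ep j : R := (4 ^+ j)^-1; pose la j : R := (2 ^+ j)^-1.
have ep0 j : 0 < ep j by rewrite invr_gt0 exprn_gt0.
have la0 j : 0 < la j by rewrite invr_gt0 exprn_gt0.
have /choice [N hN] : forall j, exists N, S - ep j ^+ 2 < L2 a N.
  by move=> j; apply: hS2; rewrite exprn_gt0.
pose g j z := f z - psum a z (N j).
have /choice [G hG] : forall j, exists G : set R, [/\ measurable G,
    (mu G <= (18 * pi * (ep j / la j))%:E)%E &
    forall t, 0 <= t <= 2 * pi -> ~ G t -> forall r, 1 / 2 <= r -> r < 1 ->
      normc (g j (pol r t)) <= 768 * la j].
  move=> j; apply: weak_max => //; first by apply: holB => //; exact: hol_psum.
  move=> r r0 r1; apply: (le_trans (m2_tail_le (N j) hps hf r0 r1 hS)).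
  by rewrite lerBlDr -lerBlDl ltW.
have mG j : measurable (G j) by case: (hG j).
exists (lim_sup_set G); split.
- by apply: bigcap_measurable => // n _; exact: bigcup_measurable.
- apply: lim_sup_set_cvg0 => //.
  have p36 : 0 <= 36 * pi :> R by rewrite mulr_ge0// pi_ge0.
  apply: (@le_lt_trans _ _ (36 * pi)%:E); last exact: ltry.
  apply: le_trans (epsilon_trick0 xpredT p36).
  apply: lee_nneseries => // j _; case: (hG j) => _ h _; apply: (le_trans h).
  have p2 : 0 < 2 ^+ j :> R by rewrite exprn_gt0.
  have -> : ep j / la j = (2 ^+ j)^-1.
    by rewrite /ep /la (_ : 4 = 2 * 2 :> R) ?exprMn -?natrM//; field; rewrite gt_eqF.
  have -> : 36 * pi / (2 ^ j.+1)%:R = 18 * pi * (2 ^+ j)^-1 :> R.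
    by rewrite natrX exprS; field; rewrite gt_eqF.
  exact: lexx.
move=> t ht nB.
have [J hJ] : exists J, forall j, (J <= j)%N -> ~ G j t.
  apply: contrapT => hh; apply: nB => J _; apply: contrapT => hk; apply: hh; exists J => j Jj Gj.
  by apply: hk; exists j.
apply: rlim_cauchy => e e0.
have [j [Jj hj]] : exists j, (J <= j)%N /\ 768 * la j < e / 4.
  have [m hm] := pow2_gt (4 * 768 / e); exists (maxn J m); split; first exact: leq_maxl.
  rewrite /la -[X in _ < X]invrK ltr_pdivrMr ?exprn_gt0// mulrC -ltr_pdivrMr ?invr_gt0 ?invr_gt0 ?divr_gt0//.
  have : 2 ^+ m <= 2 ^+ (maxn J m) :> R by rewrite ler_weXn2l ?ler1n// leq_maxr.
  apply: lt_le_trans; apply: le_lt_trans hm; rewrite invrK; lra.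
have e4 : 0 < e / 4 by rewrite divr_gt0.
have [r0 r01 hp] := rlim_cts (@derivable_psum a (N j) (expi t)) e4.
have [c c2 c1] : exists2 c : R, 1 / 2 <= c & c < 1 by exists (1 / 2) => //; lra.
exists (Num.max c r0); first by rewrite gt_max c1 r01.
case: (hG j) => _ _ /(_ t ht (hJ j Jj)) hg.
move=> r s /gt_max2[r2 r0r] r1 /gt_max2[s2 r0s] s1.
have -> : f (pol r t) - f (pol s t) = g j (pol r t) - g j (pol s t) +
   ((psum a (pol r t) (N j) - psum a (expi t) (N j)) - (psum a (pol s t) (N j) - psum a (expi t) (N j))).
  rewrite /g; move: (f _) (f _) (psum _ _ _) (psum _ _ _) (psum _ _ _); clear => *; ring.
have r3' := le_trans c2 (ltW r2); have s2' := le_trans c2 (ltW s2).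
have h3 := hg r r3' r1; have h4 := hg s s2' s1.
have h5 := hp r r0r r1; have h6 := hp s r0s s1.
apply: lt_trans (normc_four h3 h4 h5 h6) _.
by clear -hj; move: (la j) hj => x; lra.
Qed.

Lemma tcoef_psum (a : nat -> C) N r n : 0 < r ->
  tcoef (fun z => psum a z N) r n = if (n < N)%N then a n else 0.
Proof.
move=> r0; rewrite /tcoef.
rewrite (@eq_iint _ _ _ _ (fun t => \sum_(m < N) a m * (pol r t ^+ m * pol r t ^- n))); last first.
  by move=> t _; rewrite /psum mulr_suml; apply: eq_bigr => i _; rewrite mulrA.
have cX (m : nat) : ccts 0 (2 * pi) (fun t => pol r t ^+ m * pol r t ^- n).
  by apply: cctsM; [exact: ccts_polX|exact: ccts_polV].
rewrite iint_sum; last by move=> i; exact: cctsZ.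
rewrite mulr_sumr (eq_bigr (fun m : 'I_N => if m == n :> nat then a n else 0)); last first.
  move=> m _; rewrite iintZ// iint_pol_pol//; case: eqP => [->|_]; last by rewrite !mulr0.
  by rewrite mulrCA -rmorphM mulVf ?gt_eqF ?pi2_gt0// mulr1.
case: ltnP => nN; last first.
  by rewrite big1// => m _; case: eqP => // mn; have := ltn_ord m; rewrite mn ltnNge nN.
rewrite (bigD1 (Ordinal nN))//= eqxx big1 ?addr0// => i /eqP ni; case: eqP => // e.
by case: ni; apply: val_inj.
Qed.

(** Polynomials can be evaluated on the unit circle itself, where they serve as exact references for
    the boundary values. *)
Lemma m2_psum1 (a : nat -> C) N : m2 (fun z => psum a z N) 1 = L2 a N.
Proof.
have cp M : cctsP (fun z => psum a z M) 1.
  apply: (@cts_ccts _ (fun z => psum a z M) (pol 1)); last exact: ccts_polt.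
  by move=> t _; apply: derivable_cts; exact: derivable_psum.
have : (m2 (fun z => psum a z N) 1)%:C%C = (L2 a N)%:C%C.
  rewrite -mm_m2// mm_psum// /L2 -sum_complex; apply: eq_bigr => n _.
  by rewrite expr1n mul1r tcoef_psum// ltn_ord mulrC mul_conj_real.
by case.
Qed.

End Fatou.

Section Radial.
Context {R : realType}.
Local Notation C := R[i].
Local Notation mu := (@lebesgue_measure R).
Implicit Types (f : C -> C) (r t : R).

Lemma rlim_seq (p : C -> R) f t v : (forall x y, `|p x - p y| <= normc (x - y)) ->
  rlim f t v -> p (f (pol (rn n) t)) @[n --> \oo] --> p v.
Proof.
move=> pl h; apply/cvgrPdist_lt => e e0; have [r0 r01 H] := h _ e0.
have [m hm] := rn_gt r01; exists m => // n /= mn.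
by rewrite distrC (le_lt_trans (pl _ _))// H ?hm//; case: (@rn_itv R n).
Qed.

Lemma circ_cont (p : C -> R) f (rho : R) : (forall x y, `|p x - p y| <= normc (x - y)) ->
  hol f -> `|rho| < 1 -> continuous (fun x : R => p (f (pol rho x)) : R).
Proof.
move=> pl [hf] r1 x; apply/cvgrPdist_lt => e e0.
have dw : disk (pol rho x) by rewrite diskE normc_pol.
have /ctsCP/(_ e e0)[d d0 hd] := derivable_cts (hf _ dw).
exists (d / 2) => /=; first by rewrite divr_gt0.
move=> y; rewrite /ball_/= => xy.
rewrite distrC; apply: (le_lt_trans (pl _ _)); apply: hd.
apply: (le_lt_trans (pol_lip _ _ _ _)); rewrite subrr normr0 add0r.
have : `|rho| * (2 * `|y - x|) <= 1 * (2 * `|y - x|) by rewrite ler_wpM2r ?mulr_ge0// ltW.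
by rewrite distrC in xy; clear -xy; lra.
Qed.

Lemma measurable_normc2 (D : set R) (u : R -> C) :
  measurable_fun D (fun t => complex.Re (u t)) -> measurable_fun D (fun t => complex.Im (u t)) ->
  measurable_fun D (fun t => normc (u t) ^+ 2).
Proof.
move=> mr mi; under eq_fun do rewrite normc_sqr.
by apply: measurable_funD; apply: measurable_funX.
Qed.

(** A form of Fatou's lemma for a limit known only off a null set, whose measurability is not at
    hand. *)
Lemma fatou_le (D B : set R) (u : nat -> R -> R) (v : R -> R) (c : R) :
  measurable D -> measurable B -> mu B = 0 ->
  (forall n, measurable_fun D (u n)) -> (forall n t, D t -> 0 <= u n t) ->
  (forall t, 0 <= v t) ->
  (forall t, D t -> ~ B t -> u n t @[n --> \oo] --> v t) ->
  (forall n, (\int[mu]_(t in D) (u n t)%:E <= c%:E)%E) ->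
  (\int[mu]_(t in D) (v t)%:E <= c%:E)%E.
Proof.
move=> mD mB B0 mu_ u0 v0 uv uc.
have -> : (\int[mu]_(t in D) (v t)%:E = \int[mu]_(t in D) limn_einf (fun n => (u n t)%:E))%E.
  apply: (@ge0_integral_null _ _ R mu D B _ _ mD mB B0) => [t _|t Dt|t Dt nB]; first by rewrite lee_fin.
    rewrite limn_einf_lim; apply: lime_ge; first exact: is_cvg_einfs.
    by apply: nearW => n; apply: le_ereal_inf_tmp => _ [m _ <-]; rewrite lee_fin u0.
  have cv : (fun n => (u n t)%:E) @ \oo --> (v t)%:E.
    by apply/fine_cvgP; split; [exact: nearW|exact: uv].
  by rewrite (cvg_limn_einf_sup cv).1.
apply: (le_trans (fatou mu mD _ _)).
- by move=> n; apply: measurableT_comp => //; exact: (mu_ n).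
- by move=> n t Dt; rewrite lee_fin u0.
rewrite limn_einf_lim; apply: lime_le; first exact: is_cvg_einfs.
apply: nearW => n; apply: le_trans (uc n).
by apply: ereal_inf_lbound; exists n => /=.
Qed.

(* The two inequalities are Peter-Paul for [|f|^2] and [|p|^2] with error [|f - p|^2]. *)
Lemma squeeze_eq (I S : R) : 0 <= I -> 0 <= S ->
  (forall d, 0 < d -> exists P E, [/\ 0 <= E <= d, S - d <= P <= S &
     forall eta, 0 < eta -> I <= (1 + eta) * P + (1 + eta^-1) * E /\
        P <= (1 + eta) * I + (1 + eta^-1) * E]) -> I = S.
Proof.
move=> I0 S0 h.
have key eta : 0 < eta -> eta <= 1 -> I <= S + eta * (S + 2) /\ S <= I + eta * (I + 3).
  move=> e0 e1; have [|P [E [/andP[E0 Ed] /andP[P1 P2] H]]] := h (eta ^+ 2); first by rewrite exprn_gt0.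
  have [h1 h2] := H _ e0.
  have a1 : (1 + eta^-1) * E <= eta ^+ 2 + eta.
    have -> : eta ^+ 2 + eta = (1 + eta^-1) * eta ^+ 2 by field; rewrite gt_eqF.
    by rewrite ler_wpM2l// addr_ge0// invr_ge0 ltW.
  have a2 : (1 + eta) * P <= (1 + eta) * S by rewrite ler_wpM2l// addr_ge0// ltW.
  have a3 : eta ^+ 2 <= eta by rewrite expr2 ler_piMr// ltW.
  move: a1 a2 a3 h1 h2 P1; move: (eta ^+ 2) (_^-1) => x y; clear; nra.
have lim (A K : R) : 0 <= K -> (forall eta, 0 < eta -> eta <= 1 -> A <= eta * K) -> A <= 0.
  move=> K0 H; rewrite leNgt; apply/negP => A0.
  have e0 : 0 < A / (A + 2 * K + 1) by rewrite divr_gt0//; lra.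
  have e1 : A / (A + 2 * K + 1) <= 1 by rewrite ler_pdivrMr; lra.
  have := H _ e0 e1; rewrite mulrAC ler_pdivlMr; last by lra.
  rewrite ler_pM2l//; lra.
apply/eqP; rewrite eq_le; apply/andP; split; rewrite -subr_le0.
  by apply: (lim _ (S + 2)) => [|eta e0 e1]; [lra|have [] := key _ e0 e1; lra].
by apply: (lim _ (I + 3)) => [|eta e0 e1]; [lra|have [] := key _ e0 e1; lra].
Qed.

Lemma peter_paul (x y : C) (eta : R) : 0 < eta ->
  normc x ^+ 2 <= (1 + eta) * normc y ^+ 2 + (1 + eta^-1) * normc (x - y) ^+ 2.
Proof.
move=> e0; have h : normc x <= normc y + normc (x - y).
  by rewrite -{1}[x](subrK y) addrC (le_trans (le_normcD _ _)).
have h0 := normc_ge0 x; have h1 := normc_ge0 y; have h2 := normc_ge0 (x - y).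
move: (normc x) (normc y) (normc (x - y)) h h0 h1 h2 => a b c h a0 b0 c0.
apply: (@le_trans _ _ ((b + c) ^+ 2)); first by rewrite lerXn2r ?nnegrE ?addr_ge0.
rewrite -subr_ge0 (_ : _ - _ = eta * (b - eta^-1 * c) ^+ 2).
  by rewrite mulr_ge0 ?sqr_ge0// ltW.
by field; rewrite gt_eqF.
Qed.

Lemma integrableZR (D : set R) (v : R -> R) (c : R) : measurable D ->
  mu.-integrable D (EFin \o v) -> mu.-integrable D (EFin \o (fun t => c * v t)).
Proof.
by move=> mD iv; have := @integrableZl _ _ R mu D mD c _ iv; apply: eq_integrable.
Qed.

Lemma Rint_le_lin (D : set R) (u v w : R -> R) (c d : R) : measurable D ->
  mu.-integrable D (EFin \o u) -> mu.-integrable D (EFin \o v) -> mu.-integrable D (EFin \o w) ->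
  (forall t, D t -> u t <= c * v t + d * w t) ->
  \int[mu]_(t in D) u t <= c * \int[mu]_(t in D) v t + d * \int[mu]_(t in D) w t.
Proof.
move=> mD iu iv iw h.
have icv : mu.-integrable D (EFin \o (fun t => c * v t)) by exact: integrableZR.
have idw : mu.-integrable D (EFin \o (fun t => d * w t)) by exact: integrableZR.
rewrite -RintegralZl// -RintegralZl// -RintegralD//.
by apply: le_Rintegral => //; have := @integrableD _ _ R mu D mD _ _ icv idw; apply: eq_integrable.
Qed.

(** The pointwise limits come from [rlim_ae]. For the norm, the boundary values are compared with
    Taylor polynomials on the unit circle: Fatou's lemma bounds their mean-square distance by the
    tail [S - L2 a N], and [squeeze_eq] turns this into the exact value. *)
Theorem radial_limit f (M : R) : hol f -> (forall r, 0 < r -> r < 1 -> m2 f r <= M) ->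
  exists (B : set R) (fb : R -> C),
    [/\ measurable B /\ mu B = 0,
        measurable_fun setT (fun t => complex.Re (fb t)) /\
        measurable_fun setT (fun t => complex.Im (fb t)),
        forall t, 0 <= t <= 2 * pi -> ~ B t -> rlim f t (fb t),
        mu.-integrable `[0, 2 * pi] (EFin \o (fun t => normc (fb t) ^+ 2)) &
        m2 f r @[r --> 1^'-] --> (2 * pi)^-1 * \int[mu]_(t in `[0, 2 * pi]) (normc (fb t) ^+ 2)].
Proof.
move=> hf hM; have [a hps] := holomorphic_has_ps (holP hf).
have [S [hS hS2 _]] := L2_sup hf hps hM.
have [B [mB B0 hB]] := rlim_ae hf hps hS hS2.
pose D : set R := `[0, 2 * pi]%classic.
have mD : measurable D by exact: measurable_itv.
(* Setting [fb] to 0 outside the good set makes it an everywhere limit of measurable functions,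
   hence measurable. *)
have /choice [fb hfb] : forall t, exists v, ((D `\` B) t -> rlim f t v) /\ (~ (D `\` B) t -> v = 0).
  move=> t; have [[Dt nB]|nt] := pselect ((D `\` B) t); last by exists 0; split.
  have [|v hv] := hB t _ nB; first by move: Dt; rewrite /D /= in_itv.
  by exists v; split => // nn; case: nn.
have p0 := @pi2_gt0 R.
have hr n : `|rn n : R| < 1 by case: (@rn_itv R n) => h1 h2; rewrite gtr0_norm.
have mfb (p : C -> R) : p 0 = 0 -> (forall x y, `|p x - p y| <= normc (x - y)) ->
    measurable_fun setT (fun t => p (fb t)).
  move=> p00 pl.
  apply: (@measurable_fun_cvg _ _ _ setT (fun n t => p (f (pol (rn n) t)) * \1_(D `\` B) t)).
    move=> n; apply: measurable_funM; last by apply: measurable_indic; exact: measurableD.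
    by apply: continuous_measurable_fun; exact: (circ_cont pl hf (hr n)).
  move=> t _; rewrite indicE; have [h|h] := pselect ((D `\` B) t).
    rewrite mem_set//; under eq_fun do rewrite mulr1.
    exact: (rlim_seq pl ((hfb t).1 h)).
  rewrite memNset// (hfb t).2// p00; under eq_fun do rewrite mulr0.
  exact: cvg_cst.
have mRe := mfb _ erefl (@Re_lip R); have mIm := mfb _ erefl (@Im_lip R).
have cp N : cctsP (fun z => psum a z N) 1.
  apply: (@cts_ccts _ (fun z => psum a z N) (pol 1)); last exact: ccts_polt.
  by move=> t _; apply: derivable_cts; exact: derivable_psum.
have mp (p : C -> R) N : (forall x y, `|p x - p y| <= normc (x - y)) ->
    measurable_fun D (fun t => p (psum a (pol 1 t) N)).
  move=> pl; apply/measurable_EFinP; apply: (@measurable_int _ _ R mu).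
  exact: (ccts_integrable pl (cp N)).
have p1 t : pol 1 t = expi t by rewrite /pol mul1r.
pose e N t := normc (fb t - psum a (pol 1 t) N) ^+ 2.
have me N : measurable_fun D (e N).
  apply: measurable_normc2.
    under eq_fun do rewrite raddfB; apply: measurable_funB; first exact: measurable_funTS.
    by apply: mp; exact: Re_lip.
  under eq_fun do rewrite raddfB; apply: measurable_funB; first exact: measurable_funTS.
  by apply: mp; exact: Im_lip.
have ce N : (\int[mu]_(t in D) (e N t)%:E <= (2 * pi * (S - L2 a N))%:E)%E.
  pose u n t := normc (f (pol (rn n) t) - psum a (pol (rn n) t) N) ^+ 2.
  have hg : hol (fun z => f z - psum a z N) by apply: holB => //; exact: hol_psum.
  apply: (@fatou_le D B u) => //.
  - move=> n; apply: measurable_normc2; apply: measurable_funTS; apply: continuous_measurable_fun.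
      exact: (circ_cont (@Re_lip R) hg (hr n)).
    exact: (circ_cont (@Im_lip R) hg (hr n)).
  - by move=> n t _; rewrite exprn_ge0// normc_ge0.
  - by move=> t; rewrite exprn_ge0// normc_ge0.
  - move=> t Dt nB; rewrite /u /e p1.
    have h1 : rlim (fun z => f z - psum a z N) t (fb t - psum a (expi t) N).
      have h2 : rlim (fun z => - psum a z N) t (- psum a (expi t) N).
        have := rlim_cts (@derivable_psum R a N (expi t)).
        move=> h e0 /h[r0 r01 H]; exists r0 => // r rr r1.
        by rewrite -opprD normcN; exact: H.
      by apply: rlimD => //; apply: (hfb t).1.
    have nl (x y : C) : `|normc x - normc y| <= normc (x - y) := le_normcB x y.
    have h3 := rlim_seq nl h1.
    by under eq_fun do rewrite expr2; rewrite expr2; exact: cvgM.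
  move=> n; case: (@rn_itv R n) => r0 r1.
  rewrite -EFin_Rint; last first.
    by apply: (@normc2_within R (fun z => f z - psum a z N)); exact: hol_ccts.
  rewrite lee_fin; have := m2_tail_le N hps hf r0 r1 hS.
  by rewrite /m2 ler_pdivrMl.
have ie N : mu.-integrable D (EFin \o e N).
  apply/integrableP; split; first by apply/measurable_EFinP; exact: me.
  have -> : (\int[mu]_(t in D) `|(EFin \o e N) t| = \int[mu]_(t in D) (e N t)%:E)%E.
    by apply: eq_integral => t _; rewrite /= ger0_norm// exprn_ge0// normc_ge0.
  by rewrite (le_lt_trans (ce N))// ltry.
have ip N : mu.-integrable D (EFin \o (fun t => normc (psum a (pol 1 t) N) ^+ 2)).
  exact: (within_integrable (normc2_within (cp N))).
have pp (x y : C) : normc x ^+ 2 <= 2 * normc y ^+ 2 + 2 * normc (x - y) ^+ 2.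
  by have := peter_paul x y ltr01; rewrite invr1.
have ifb : mu.-integrable D (EFin \o (fun t => normc (fb t) ^+ 2)).
  apply: (@le_integrable _ _ _ mu D mD _ (EFin \o (fun t => 2 * normc (psum a (pol 1 t) 0) ^+ 2 + 2 * e 0%N t))).
  - by apply/measurable_EFinP; apply: measurable_normc2; exact: measurable_funTS.
  - move=> t _; rewrite /= lee_fin ger0_norm ?exprn_ge0 ?normc_ge0//.
    by apply: le_trans (ler_norm _); exact: pp.
  - have := @integrableD _ _ R mu D mD _ _ (integrableZR 2 mD (ip 0%N)) (integrableZR 2 mD (ie 0%N)).
    by [].
exists B, fb; split=> //.
  by move=> t ht nB; apply: (hfb t).1; split => //; rewrite /D /= in_itv.
have -> : (2 * pi)^-1 * \int[mu]_(t in D) (normc (fb t) ^+ 2) = S.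
  have S0 : 0 <= S by apply: le_trans (hS 0%N); rewrite /L2 big_ord0.
  apply: (mulfI (lt0r_neq0 p0)); rewrite mulrA mulfV ?gt_eqF// mul1r.
  apply: squeeze_eq.
  - by apply: Rintegral_ge0 => t _; rewrite exprn_ge0// normc_ge0.
  - by rewrite mulr_ge0// ltW.
  move=> d d0; have d1 : 0 < (2 * pi)^-1 * d by rewrite mulr_gt0// invr_gt0.
  have [N hN] := hS2 _ d1.
  have EP : \int[mu]_(t in D) (normc (psum a (pol 1 t) N) ^+ 2) = 2 * pi * L2 a N.
    by rewrite -m2_psum1 /m2 mulrA mulfV ?gt_eqF// mul1r.
  have E0 : 0 <= \int[mu]_(t in D) e N t.
    by apply: Rintegral_ge0 => t _; rewrite exprn_ge0// normc_ge0.
  exists (2 * pi * L2 a N), (\int[mu]_(t in D) e N t).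
  have hN' : 2 * pi * S - d <= 2 * pi * L2 a N.
    rewrite lerBlDr -lerBlDl -mulrBr; rewrite ltrBlDr -ltrBlDl in hN.
    by rewrite mulrC -ler_pdivlMr// mulrC ltW.
  split.
  - rewrite E0/=; have := ce N.
    have -> : (\int[mu]_(t in D) (e N t)%:E = (\int[mu]_(t in D) e N t)%:E)%E.
      by rewrite /Rintegral fineK//; apply: integrable_fin_num => //; exact: ie.
    by rewrite lee_fin mulrBr => h; apply: (le_trans h); rewrite lerBlDr -lerBlDl.
  - by rewrite hN'/= ler_wpM2l// ltW.
  move=> eta e0; rewrite -EP.
  split.
    by apply: Rint_le_lin => // t _; exact: peter_paul.
  by apply: Rint_le_lin => // t _; rewrite /e normcB; exact: peter_paul.
exact: m2_cvg hS hS2.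
Qed.

End Radial.

(** * The scalar Hardy space *)

Section Clim.
Context {R : realType}.
Local Notation C := R[i].
Implicit Types (g h : R -> C) (r t : R).

Definition clim g (v : C) := forall e : R, 0 < e -> exists2 r0 : R, r0 < 1 &
  forall r, r0 < r -> r < 1 -> normc (g r - v) < e.

Lemma clim_eq g h v : (forall r, 0 < r -> r < 1 -> g r = h r) -> clim g v -> clim h v.
Proof.
move=> gh cg e e0; have [r0 r01 H] := cg _ e0; exists (Num.max r0 0); first by rewrite gt_max r01 ltr01.
by move=> r /gt_max2[h1 h2] r1; rewrite -gh//; exact: H.
Qed.

Lemma clim_uniq g u v : clim g u -> clim g v -> u = v.
Proof.
move=> hu hv; apply/eqP; rewrite -subr_eq0 -normc_eq0 eq_le normc_ge0 andbT.
apply/ler_addgt0Pr => e e0; rewrite add0r.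
have e2 : 0 < e / 2 by rewrite divr_gt0.
have [r0 r01 h0] := hu _ e2; have [s0 s01 h1] := hv _ e2.
have m1 : Num.max r0 s0 < 1 by rewrite gt_max r01.
have [a b] : Num.max r0 s0 < (Num.max r0 s0 + 1) / 2 /\ (Num.max r0 s0 + 1) / 2 < 1.
  by move: (Num.max _ _) m1 => m m1; split; lra.
have [a1 a2] := gt_max2 a; have k1 := h0 _ a1 b; have k2 := h1 _ a2 b.
move: (g _) k1 k2 => x k1 k2.
rewrite (_ : u - v = (x - v) - (x - u)); last by ring.
apply: (le_trans (le_normcD _ _)); rewrite normcN (splitr e); apply: lerD; exact: ltW.
Qed.

Lemma climD g h u v : clim g u -> clim h v -> clim (fun r => g r + h r) (u + v).
Proof.
move=> hu hv e e0; have e2 : 0 < e / 2 by rewrite divr_gt0.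
have [r0 r01 h0] := hu _ e2; have [s0 s01 h1] := hv _ e2.
exists (Num.max r0 s0); first by rewrite gt_max r01.
move=> r /gt_max2[h2 h3] r1; rewrite opprD addrACA.
by apply: (le_lt_trans (le_normcD _ _)); rewrite (splitr e) ltrD// ?h0 ?h1.
Qed.

Lemma clim_cst (c : C) : clim (fun=> c) c.
Proof. by move=> e e0; exists 0 => // r _ _; rewrite subrr normc0. Qed.

Lemma climZ (c : C) g u : clim g u -> clim (fun r => c * g r) (c * u).
Proof.
move=> hu e e0; have c1 : 0 < normc c + 1 by rewrite (le_lt_trans (normc_ge0 c))// ltrDl.
have [r0 r01 h0] := hu (e / (normc c + 1)) (divr_gt0 e0 c1).
exists r0 => // r h1 h2; rewrite -mulrBr normcM.
have := h0 r h1 h2; rewrite ltr_pdivlMr//; apply: le_lt_trans.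
by rewrite mulrC ler_wpM2l ?normc_ge0// lerDl.
Qed.

Lemma clim_conj g u : clim g u -> clim (fun r => (g r)^*) (u^*).
Proof.
move=> hu e e0; have [r0 r01 h0] := hu e e0; exists r0 => // r h1 h2.
by rewrite -rmorphB /= normc_conj; exact: h0.
Qed.

Lemma clim_sum (I : Type) (s : seq I) (g : I -> R -> C) (u : I -> C) :
  (forall i, clim (g i) (u i)) -> clim (fun r => \sum_(i <- s) g i r) (\sum_(i <- s) u i).
Proof.
move=> h; elim: s => [|i s IH].
  by rewrite big_nil; apply: clim_eq (clim_cst 0) => r _ _; rewrite big_nil.
rewrite big_cons; apply: clim_eq (climD (h i) IH) => r _ _; by rewrite big_cons.
Qed.

Lemma clim_real (g : R -> R) (l : R) : g r @[r --> 1^'-] --> l -> clim (fun r => (g r)%:C%C) l%:C%C.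
Proof.
move=> gl e e0; have /cvgrPdist_lt/(_ _ e0)/nbhs_left1 [r0 r01 h0] := gl.
by exists r0 => // r h1 h2; rewrite -rmorphB normc_real distrC; exact: h0.
Qed.

End Clim.

Section H2.
Context {R : realType}.
Local Notation C := R[i].
Local Notation mu := (@lebesgue_measure R).
Implicit Types (f g h : C -> C) (r t : R).

Variant H2 f : Prop := H2_intro of hol f & (exists M, forall r, 0 < r -> r < 1 -> m2 f r <= M).

Lemma H2_hol f : H2 f -> hol f.
Proof. by case. Qed.

Lemma m2_scale f g r (c : R) : hol f -> hol g -> `|r| < 1 -> 0 <= c ->
  (forall t, 0 <= t <= 2 * pi -> normc (f (pol r t)) <= c * normc (g (pol r t))) ->
  m2 f r <= c ^+ 2 * m2 g r.
Proof.
move=> hf hg r1 c0 h; rewrite /m2 mulrCA ler_wpM2l ?invr_ge0 ?pi2_ge0//.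
have If := within_integrable (normc2_within (hol_ccts hf r1)).
have Ig := within_integrable (normc2_within (hol_ccts hg r1)).
have := @Rint_le_lin R `[0, 2 * pi]%classic _ _ _ (c ^+ 2) 0 (measurable_itv _) If Ig Ig.
rewrite mul0r addr0; apply => t; rewrite /= in_itv/= => tt; rewrite mul0r addr0 -exprMn.
by rewrite lerXn2r ?nnegrE ?mulr_ge0 ?normc_ge0// h.
Qed.

Lemma m2_add f g r : hol f -> hol g -> `|r| < 1 ->
  m2 (fun z => f z + g z) r <= 2 * m2 f r + 2 * m2 g r.
Proof.
move=> hf hg r1; rewrite /m2 !(mulrCA 2) -mulrDr ler_wpM2l ?invr_ge0 ?pi2_ge0//.
have If := within_integrable (normc2_within (hol_ccts hf r1)).
have Ig := within_integrable (normc2_within (hol_ccts hg r1)).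
have Ifg := within_integrable (normc2_within (hol_ccts (holD hf hg) r1)).
apply: (@Rint_le_lin R `[0, 2 * pi]%classic _ _ _ 2 2 (measurable_itv _) Ifg If Ig) => t _.
have := peter_paul (f (pol r t) + g (pol r t)) (f (pol r t)) ltr01.
by rewrite invr1 (addrC (f _)) addrK.
Qed.

Lemma H2_cst (c : C) : H2 (fun=> c).
Proof.
split; [exact: hol_cst|exists (normc c ^+ 2)] => r r0 r1; apply: m2_le_cst => //.
by apply: hol_ccts; [exact: hol_cst|rewrite ger0_norm// ltW].
Qed.

Lemma H2_bounded f (M : R) : hol f -> (forall w, disk w -> normc (f w) <= M) -> H2 f.
Proof.
move=> hf hM; split=> //; exists (M ^+ 2) => r r0 r1.
have rn : `|r| < 1 by rewrite gtr0_norm.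
apply: m2_le_cst; first exact: hol_ccts.
move=> t _; have h : normc (f (pol r t)) <= M by apply: hM; rewrite diskE normc_pol.
by rewrite lerXn2r ?nnegrE ?normc_ge0// (le_trans (normc_ge0 _) h).
Qed.

Lemma H2_mul f g (M : R) : hol g -> (forall w, disk w -> normc (g w) <= M) -> H2 f ->
  H2 (fun z => g z * f z).
Proof.
move=> hg hM [hf [K hK]]; split; first exact: holM.
have M0 : 0 <= M by apply: le_trans (normc_ge0 _) (hM 0 _); exact: disk0.
exists (M ^+ 2 * K) => r r0 r1; have rn : `|r| < 1 by rewrite gtr0_norm.
apply: (@le_trans _ _ (M ^+ 2 * m2 f r)); last by rewrite ler_wpM2l ?exprn_ge0// hK.
apply: m2_scale => //; first exact: holM.
by move=> t _; rewrite normcM ler_wpM2r ?normc_ge0// hM// diskE normc_pol.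
Qed.

Lemma H2D f g : H2 f -> H2 g -> H2 (fun z => f z + g z).
Proof.
move=> [hf [K hK]] [hg [L hL]]; split; first exact: holD.
exists (2 * K + 2 * L) => r r0 r1; have rn : `|r| < 1 by rewrite gtr0_norm.
by apply: (le_trans (m2_add hf hg rn)); rewrite lerD// ler_wpM2l// ?hK ?hL.
Qed.

Lemma H2Z (c : C) f : H2 f -> H2 (fun z => c * f z).
Proof. by apply: H2_mul (hol_cst c) (fun w _ => lexx (normc c)). Qed.

Lemma H2B f g : H2 f -> H2 g -> H2 (fun z => f z - g z).
Proof.
move=> hf /(H2Z (-1)) hg; have := H2D hf hg.
suff -> : (fun z => f z + -1 * g z) = (fun z => f z - g z) by [].
by apply/funext => z; rewrite mulN1r.
Qed.

Lemma H2_sum (I : Type) (s : seq I) (f : I -> C -> C) : (forall i, H2 (f i)) ->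
  H2 (fun z => \sum_(i <- s) f i z).
Proof.
move=> h; elim: s => [|i s IH].
  have -> : (fun z => \sum_(i <- [::]) f i z) = fun=> 0 by apply/funext => z; rewrite big_nil.
  exact: H2_cst.
have -> : (fun z => \sum_(j <- i :: s) f j z) = fun z => f i z + \sum_(j <- s) f j z.
  by apply/funext => z; rewrite big_cons.
exact: H2D.
Qed.

Lemma Hardy2P f : Hardy2 f <-> H2 f.
Proof.
have p0 := @pi2_gt0 R.
have E r : hol f -> `|r| < 1 ->
    (((2 * pi)^-1)%:E * \int[mu]_(t in `[0%R, (2 * pi)%R]) (normc (f (r%:C%C * Defs.expi t)) ^+ 2)%:E)%E = (m2 f r)%:E.
  by move=> hf r1; rewrite /m2 EFinM EFin_Rint//; apply: normc2_within; exact: hol_ccts.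
split=> [[hd]|[hf [M hM]]].
  have hf : hol f by split.
  set s := ereal_sup _ => hs; split=> //.
  have ub r : 0 <= r -> r < 1 -> ((m2 f r)%:E <= s)%E.
    move=> r0 r1; rewrite -E//; last by rewrite ger0_norm.
    by apply: ereal_sup_ubound; exists r => //=; rewrite in_itv/= r0.
  have := ub 0 (lexx _) ltr01; case: s hs ub => [s _ ub _|//|_ _ //].
  by exists s => r r0 r1; rewrite -lee_fin ub// ltW.
split; first by case: hf.
(* The supremum defining [Hardy2] includes the radius 0, while the bound in [H2] starts at positive
   radii. *)
apply: (@le_lt_trans _ _ (Num.max M (m2 f 0))%:E); last exact: ltry.
apply: ge_ereal_sup => _ [r /= rr <-]; move: rr; rewrite in_itv/= => /andP[r0 r1].
rewrite (E r hf); last by rewrite ger0_norm.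
rewrite lee_fin le_max; move: r0; rewrite le_eqVlt => /orP[/eqP <-|r0].
  by rewrite lexx orbT.
by rewrite hM.
Qed.

End H2.

(** * Reproducing kernels and division by Blaschke factors *)

Section Reproducing.
Context {R : realType}.
Local Notation C := R[i].
Implicit Types (f g h : C -> C) (r t : R).

(** The Szego kernel: pairing with [kern z] evaluates at [z]. *)
Definition kern (z w : C) : C := (1 - z^* * w)^-1.

Lemma kern_den (z w : C) : disk z -> disk w -> 1 - normc z <= normc (1 - z^* * w).
Proof.
rewrite !diskE => z1 w1; apply: le_trans (le_trans (ler_norm _) (le_normcB _ _)).
rewrite normc1 normcM normc_conj lerB// ler_piMr ?normc_ge0//; exact: ltW.
Qed.

Lemma kern_neq0 (z w : C) : disk z -> disk w -> 1 - z^* * w != 0.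
Proof.
move=> dz dw; rewrite -normc_gt0; apply: lt_le_trans (kern_den dz dw).
by rewrite subr_gt0 -diskE.
Qed.

Lemma hol_kern_den (z : C) : hol (fun w => 1 - z^* * w).
Proof. by apply: holB (hol_cst 1) (holZ _ _); split => w _; exact: derivableC_id. Qed.

Lemma hol_kern (z : C) : disk z -> hol (kern z).
Proof.
move=> dz; split => w dw; apply: derivableCV; first exact: kern_neq0.
exact: (holP (hol_kern_den z)).
Qed.

Lemma H2_kern (z : C) : disk z -> H2 (kern z).
Proof.
move=> dz; apply: (@H2_bounded _ _ (1 - normc z)^-1); first exact: hol_kern.
have z0 : 0 < 1 - normc z by rewrite subr_gt0 -diskE.
move=> w dw; rewrite /kern normcV lef_pV2 ?posrE ?kern_den//.
by apply: lt_le_trans (kern_den dz dw).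
Qed.

(** On the circle of radius [r] the conjugate of [pol r t] is [r ^+ 2 / pol r t], which turns the
    conjugate of the kernel into the Cauchy kernel at [r ^+ 2] times [z]. *)
Lemma mm_kern (z : C) h r : disk z -> hol h -> 0 < r -> r < 1 ->
  mm h (kern z) r = h ((r ^+ 2)%:C%C * z).
Proof.
move=> dz hh r0 r1.
have nw : normc ((r ^+ 2)%:C%C * z) < r.
  rewrite normcM normc_real ger0_norm ?exprn_ge0 ?(ltW r0)// expr2 -mulrA gtr_pMr//.
  rewrite diskE in dz; apply: le_lt_trans dz; rewrite ler_piMl ?normc_ge0//; exact: ltW.
rewrite /mm; rewrite (@eq_iint _ _ _ _ (fun t => h (pol r t) * (pol r t / (pol r t - (r ^+ 2)%:C%C * z)))).
  rewrite (cauchy_kernel (holP hh) nw r1) iint_kernel1// mulrCA -rmorphM mulVf ?mulr1//.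
  by rewrite gt_eqF// pi2_gt0.
move=> t _; congr (_ * _); rewrite /kern.
have p0 := pol_neq0 t r0.
rewrite fmorphV rmorphB rmorph1 rmorphM /= conjCK conj_pol//.
rewrite -[in RHS](invrK (pol r t)) -invfM; congr (_^-1).
by move: (pol r t) p0 (_%:C%C) => p p0 c; field.
Qed.

Lemma clim_kern (z : C) h : disk z -> hol h -> clim (mm h (kern z)) (h z).
Proof.
move=> dz hh; apply: (clim_eq (g := fun r => h ((r ^+ 2)%:C%C * z))).
  by move=> r r0 r1; rewrite mm_kern.
move=> e e0; have /derivable_cts/ctsCP/(_ _ e0)[d d0 hd] := holP hh dz.
exists (Num.max (1 - d / 2) 0); first by rewrite gt_max ltr01 andbT ltrBlDr ltrDl divr_gt0.
move=> r /gt_max2[h1 h0] h2; apply: hd.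
have -> : (r ^+ 2)%:C%C * z - z = (r ^+ 2 - 1)%:C%C * z by rewrite rmorphB rmorph1 mulrBl mul1r.
rewrite diskE in dz; rewrite normcM normc_real; apply: (@le_lt_trans _ _ `|r ^+ 2 - 1|).
  by rewrite ler_piMr//; exact: ltW.
rewrite distrC ger0_norm; last by rewrite subr_ge0 exprn_ile1// ltW.
have := sqr_ge0 (r - 1); rewrite sqrrB1; move: (r ^+ 2) => x; clear -h1; lra.
Qed.

Lemma has_ps_derive a f : has_ps a f -> hol f -> f 0 = a 0%N /\ derive1 f 0 = a 1%N.
Proof.
move=> [_ hps] hf; have h2 : 0 < 2^-1 :> R by rewrite invr_gt0.
have h21 : 2^-1 < 1 :> R by rewrite invf_lt1// ltr1n.
have [K K0 hK] := hps _ h2 h21.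
have f0 : f 0 = a 0%N.
  apply/eqP; rewrite -subr_eq0 -normc_eq0 eq_le normc_ge0 andbT.
  have := hK 0 1%N; rewrite normc0 => /(_ h2); rewrite /psum big_ord1 expr0 mulr1.
  by rewrite mul0r expr1 mul0r.
split=> //; apply: (derive1_cvgC _).2; apply/derivableCP => e e0.
pose L := 16 * K + 1.
exists (Num.min (4^-1) (e / L)).
  by rewrite lt_min invr_gt0 divr_gt0 /L ?andbT//; lra.
move=> h; rewrite lt_min => /andP[h4 hL].
have hh : normc h < 2^-1 by lra.
have := hK h 2 hh; rewrite /psum big_ord_recr big_ord1 /= expr0 mulr1 expr1 addr0 f0 opprD addrA.
move=> H; apply: (le_trans H).
have x0 := normc_ge0 h; move: (normc h) x0 h4 hL hh => x x0 h4 hL hh; clear -x0 h4 hL hh K0 e0.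
have L0 : 0 < L by rewrite /L; lra.
have a1 : K / (2^-1 - x) <= 4 * K by rewrite ler_pdivrMr; nra.
have a2 : x * L <= e by rewrite -ler_pdivlMr// ltW.
apply: (@le_trans _ _ ((x / 2^-1) ^+ 2 * (4 * K))); first by rewrite ler_wpM2l// sqr_ge0.
rewrite invrK (_ : (x * 2) ^+ 2 * (4 * K) = x * (x * (16 * K))); last by ring.
rewrite mulrC ler_wpM2r//; apply: le_trans a2; rewrite ler_wpM2l// /L; lra.
Qed.

Lemma clim_id h : hol h -> clim (mm h id) (derive1 h 0).
Proof.
move=> hh; have [a hps] := holomorphic_has_ps (holP hh).
rewrite (has_ps_derive hps hh).2.
apply: (clim_eq (g := fun r => (r ^+ 2)%:C%C * a 1%N)).
  move=> r r0 r1; have -> : mm h id r = mm h (fun z => z ^+ 1) r by [].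
  rewrite mm_exp//; last by apply: hol_ccts => //; rewrite gtr0_norm.
  by rewrite (has_ps_tcoef _ hps hh).
rewrite -[X in clim _ X]mul1r -(rmorph1 (@real_complex R)).
have := climZ (a 1%N) (@clim_real R (fun r => r ^+ 2) 1 _).
rewrite mulrC => H; apply: clim_eq (H _) => [r _ _|]; first by rewrite mulrC.
apply: cvg_left1 => e e0; exists (Num.max (1 - e / 2) 0).
  by rewrite gt_max ltr01 andbT ltrBlDr ltrDl divr_gt0.
move=> r /gt_max2[h1 h0] h2; rewrite distrC ger0_norm; last by rewrite subr_ge0 exprn_ile1// ltW.
by have := sqr_ge0 (r - 1); rewrite sqrrB1; move: (r ^+ 2) => x; clear -h1; lra.
Qed.

Lemma derive1_affine h (z c s : C) : derivable h (z + c * s) 1 ->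
  derivable (fun s => h (z + c * s)) s 1 /\
  derive1 (fun s => h (z + c * s)) s = derive1 h (z + c * s) * c.
Proof.
move=> dh; apply: derive1_cvgC; apply/(@derivableCP R (fun s => h (z + c * s))) => e e0.
have c0 : 0 < normc c + 1 by rewrite (le_lt_trans (normc_ge0 c))// ltrDl.
have [d d0 hd] := derivable_normc dh (divr_gt0 e0 c0).
exists (d / (normc c + 1)); first exact: divr_gt0.
move=> x hx; have := hd (c * x); rewrite normcM.
have hcx : normc c * normc x <= (normc c + 1) * normc x by rewrite ler_wpM2r ?normc_ge0// lerDl.
have hx' : (normc c + 1) * normc x < d by rewrite mulrC -ltr_pdivlMr.
move=> /(_ (le_lt_trans hcx hx')).
rewrite addrCA -mulrDr mulrA => h1; apply: (le_trans h1).
rewrite mulrAC mulrA ler_pdivrMr// -!mulrA ler_wpM2l ?(ltW e0)// mulrC.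
by rewrite ler_wpM2l ?normc_ge0// lerDl.
Qed.

Definition dquot h (z w : C) : C := if w == z then derive1 h z else h w / (w - z).

Lemma dquotE h (z w : C) : h z = 0 -> h w = (w - z) * dquot h z w.
Proof.
move=> hz; rewrite /dquot; case: eqP => [->|/eqP wz]; first by rewrite subrr mul0r.
by rewrite mulrC divfK// subr_eq0.
Qed.

(** Only the point [z] is delicate. Rescaling a disk about [z] to the unit disk gives a Taylor
    expansion of [h] there; its remainder of order 3, divided by [w - z], is still quadratic in
    [w - z], and this yields the derivative of the quotient. *)
Lemma hol_dquot h (z : C) : disk z -> hol h -> h z = 0 -> hol (dquot h z).
Proof.
move=> dz hh hz; split => w dw; have [wz|wz] := eqVneq w z; last first.
  have wz0 : w - z != 0 by rewrite subr_eq0.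
  have di : derivable (fun w : C => w - z) w 1.
    by apply: derivableCD; [exact: derivableC_id|exact: derivableC_cst].
  have dq : derivable (fun w => h w / (w - z)) w 1.
    by apply: derivableCM; [exact: holP hh _ dw|exact: (derivableCV (g := fun w => w - z) wz0 di)].
  apply: (near_eq_derive1 _ dq).1.
  have [d d0 hd] := (ctsCP _ _).1 (derivable_cts di) _ (etrans (normc_gt0 _) wz0).
  have nx := (@cvgCP _ _ (nbhs w) (nbhs_filter w) id w).1 cvg_id _ d0.
  apply: filterS nx => x /hd xw; rewrite /dquot ifF//; apply/eqP => xz.
  by move: xw; rewrite xz subrr sub0r normcN ltxx.
rewrite wz {w wz dw}.
pose rho : R := 1 - normc z.
have rho0 : 0 < rho by rewrite subr_gt0 -diskE.
have rc : rho%:C%C != 0 :> C by rewrite -normc_gt0 normc_real gtr0_norm.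
pose u (s : C) := h (z + rho%:C%C * s).
have inD (s : C) : disk s -> disk (z + rho%:C%C * s).
  rewrite !diskE => s1; apply: (le_lt_trans (le_normcD _ _)).
  rewrite normcM normc_real gtr0_norm// -ltrBrDl -[ltRHS]mulr1 ltr_pM2l//.
have hu : hol u by split => s ds; exact: (derive1_affine (holP hh (inD _ ds))).1.
have [a hps] := holomorphic_has_ps (holP hu).
have [u0 u1] := has_ps_derive hps hu.
have h2 : 0 < 2^-1 :> R by rewrite invr_gt0.
have h21 : 2^-1 < 1 :> R by rewrite invf_lt1// ltr1n.
have [K K0 hK] := hps.2 _ h2 h21.
have dh : derive1 h z = a 1%N / rho%:C%C.
  have dz0 : derivable h (z + rho%:C%C * 0) 1 by rewrite mulr0 addr0; exact: holP hh _ dz.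
  by rewrite -u1 (derive1_affine dz0).2 mulr0 addr0 mulfK.
apply: (derive1_cvgC (d := a 2 / (rho%:C%C ^+ 2)) _).1; apply/derivableCP => e e0.
pose L := 32 * K + 1; have L0 : 0 < L by rewrite /L; lra.
exists (Num.min (rho / 4) (e * rho ^+ 3 / L)).
  by rewrite lt_min divr_gt0//= divr_gt0// mulr_gt0// exprn_gt0.
move=> x; rewrite lt_min => /andP[x4 xL].
have [->|x0] := eqVneq x 0.
  by rewrite add0r subrr mulr0 subrr normc0 mulr0.
pose s := x / rho%:C%C.
have xs : x = rho%:C%C * s by rewrite /s mulrC divfK.
have s0 : s != 0 by rewrite mulf_neq0 ?invr_neq0.
have ns : normc s = normc x / rho by rewrite normcM normcV normc_real gtr0_norm.
have s4 : normc s < 4^-1 by rewrite ns ltr_pdivrMr// mulrC.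
have sh : normc s < 2^-1 by clear -s4; lra.
have := hK s 3 sh; rewrite /psum !big_ord_recr big_ord0 /= add0r expr0 mulr1 expr1 -u0.
rewrite {2}/u mulr0 addr0 hz add0r => H.
have -> : dquot h z (x + z) - dquot h z z - a 2 / rho%:C%C ^+ 2 * x =
    (u s - (a 1 * s + a 2 * s ^+ 2)) / (rho%:C%C * s).
  rewrite /dquot eqxx ifF; last by apply/eqP => xz; move/eqP: x0; apply; rewrite -[x](addrK z) xz subrr.
  rewrite addrK dh /u -xs (addrC z) {3 5}xs; move: (h _) (a 1%N) (a 2) => p q r.
  rewrite xs; move: rho%:C%C rc => k k0; clear -s0 k0; field; rewrite k0 s0//.
rewrite normcM normcV -xs ler_pdivrMr ?normc_gt0//; apply: (le_trans H).
rewrite invrK.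
have x0' := normc_ge0 x; have a1 : K / (2^-1 - normc s) <= 4 * K.
  by rewrite ler_pdivrMr; [nra|lra].
apply: (@le_trans _ _ ((normc s * 2) ^+ 3 * (4 * K))).
  by rewrite ler_wpM2l// exprn_ge0// mulr_ge0 ?normc_ge0.
rewrite (_ : (normc s * 2) ^+ 3 * (4 * K) = normc s ^+ 3 * (32 * K)); last by ring.
rewrite ns expr_div_n mulrAC ler_pdivrMr ?exprn_gt0//.
rewrite -(mulrA e) -expr2 exprS -(mulrA (normc x)) mulrC -!mulrA.
have a2 : normc x * L <= e * rho ^+ 3 by rewrite -ler_pdivlMr// ltW.
move: (normc x) x0' (rho ^+ 3) a2 => y y0 p a2.
rewrite [leRHS](_ : _ = y * (y * (e * p))); last by ring.
rewrite !ler_wpM2l//; apply: le_trans a2; rewrite /L; clear -y0 K0; nra.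
Qed.

Lemma m2_bound_near f (M s : R) : hol f -> 0 < s -> s < 1 ->
  (forall r, s <= r -> r < 1 -> m2 f r <= M) -> H2 f.
Proof.
move=> hf s0 s1 h; split=> //; exists M => r r0 r1; have [sr|rs] := leP s r; first exact: h.
by apply: le_trans (h s (lexx _) s1); apply: m2_homo => //; exact: ltW.
Qed.

Definition bfac (z w : C) : C := (w - z) / (1 - z^* * w).

(** Near the circle [w - z] is bounded below, so dividing by it costs a constant; smaller radii
    follow because mean squares increase with the radius. *)
Lemma blaschke_div1 h (z : C) : disk z -> H2 h -> h z = 0 ->
  exists2 g, H2 g & forall w, disk w -> h w = bfac z w * g w.
Proof.
move=> dz [hh [M hM]] hz; have hq := hol_dquot dz hh hz.
exists (fun w => (1 - z^* * w) * dquot h z w); last first.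
  move=> w dw; rewrite (dquotE _ hz) /bfac mulrA divfK// kern_neq0//.
have z1 : 0 < 1 - normc z by rewrite subr_gt0 -diskE.
pose s := (1 + normc z) / 2; have z0 := normc_ge0 z.
have s0 : 0 < s by rewrite /s; lra.
have s1 : s < 1 by rewrite /s; clear -z1; lra.
have hg : hol (fun w => (1 - z^* * w) * dquot h z w) by apply: holM => //; exact: hol_kern_den.
pose c := 4 / (1 - normc z); have c0 : 0 <= c by rewrite divr_ge0// ltW.
apply: (@m2_bound_near _ (c ^+ 2 * M) s) => // r sr r1.
have r0 := lt_le_trans s0 sr.
apply: (@le_trans _ _ (c ^+ 2 * m2 h r)); last by rewrite ler_wpM2l ?exprn_ge0// hM.
apply: m2_scale => //; first by rewrite gtr0_norm.
move=> t _; have nw : normc (pol r t) = r by rewrite normc_pol gtr0_norm.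
move: (pol r t) nw => w nw.
rewrite (dquotE w hz) (normcM (1 - z^* * w)) (normcM (w - z)) [leRHS]mulrA.
apply: ler_wpM2r; first exact: normc_ge0.
have b1 : normc (1 - z^* * w) <= 2.
  apply: (le_trans (le_normcD _ _)); rewrite normc1 normcN normcM normc_conj nw.
  have : normc z * r <= 1 * 1 by apply: ler_pM => //; clear -z1 r1 r0; lra.
  lra.
have b2 : (1 - normc z) / 2 <= normc (w - z).
  apply: le_trans (le_trans (ler_norm _) (le_normcB _ _)); rewrite nw.
  by move: sr; rewrite /s; clear; lra.
apply: (le_trans b1); rewrite /c mulrAC ler_pdivlMr//; lra.
Qed.

Lemma bfac_neq0 (z w : C) : disk z -> disk w -> w != z -> bfac z w != 0.
Proof. by move=> dz dw wz; rewrite mulf_neq0 ?subr_eq0// invr_neq0// kern_neq0. Qed.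

(** The remaining zeros pass to the quotient because the factor just removed vanishes only at its
    own point; this is where the points must be distinct. *)
Lemma blaschke_div n (z : 'I_n -> C) h : injective z -> (forall i, disk (z i)) ->
  H2 h -> (forall i, h (z i) = 0) ->
  exists2 g, H2 g & forall w, disk w -> h w = (\prod_(i < n) bfac (z i) w) * g w.
Proof.
elim: n z h => [|n IH] z h zi zd hh hz.
  by exists h => // w _; rewrite big_ord0 mul1r.
have [g hg E] := blaschke_div1 (zd ord0) hh (hz ord0).
have [g' hg' E'] : exists2 g', H2 g' & forall w, disk w ->
    g w = (\prod_(i < n) bfac (z (lift ord0 i)) w) * g' w.
  apply: IH => //.
  - by move=> i j /zi /lift_inj.
  move=> i; have /eqP := hz (lift ord0 i); rewrite E// mulf_eq0 => /orP[|/eqP//].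
  by rewrite (negbTE (bfac_neq0 _ _ _))//; apply/eqP => /zi/eqP; rewrite eq_sym (negbTE (neq_lift _ _)).
by exists g' => // w dw; rewrite big_ord_recl -mulrA -E'// E.
Qed.

End Reproducing.

(** * The inner product of the matrix Hardy space *)

Section BoundaryInner.
Context {R : realType}.
Local Notation C := R[i].
Local Notation mu := (@lebesgue_measure R).
Local Notation D := (`[0, 2 * pi]%classic : set R).
Implicit Types (f g h : C -> C) (r t : R).

Lemma rlim_uniq f t u v : rlim f t u -> rlim f t v -> u = v.
Proof. by move=> hu hv; exact: (@clim_uniq R (fun r => f (pol r t)) u v hu hv). Qed.

(* [fb] is a measurable version of the radial limits of [f], off the null set [B]. *)
Definition bdval f (B : set R) (fb : R -> C) : Prop :=
  [/\ measurable B /\ mu B = 0,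
      measurable_fun setT (fun t => complex.Re (fb t)) /\
      measurable_fun setT (fun t => complex.Im (fb t)),
      forall t, 0 <= t <= 2 * pi -> ~ B t -> rlim f t (fb t),
      mu.-integrable D (EFin \o (fun t => normc (fb t) ^+ 2)) &
      m2 f r @[r --> 1^'-] --> (2 * pi)^-1 * \int[mu]_(t in D) (normc (fb t) ^+ 2)].

Lemma H2_bd f : H2 f -> exists B fb, bdval f B fb.
Proof. by move=> [hf [M hM]]; exact: radial_limit hM. Qed.

Lemma integrable_Re_mul (fb gb : R -> C) (p : C -> R) :
  (forall x, `|p x| <= normc x) ->
  measurable_fun D (fun t => p (fb t * (gb t)^*)) ->
  mu.-integrable D (EFin \o (fun t => normc (fb t) ^+ 2)) ->
  mu.-integrable D (EFin \o (fun t => normc (gb t) ^+ 2)) ->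
  mu.-integrable D (EFin \o (fun t => p (fb t * (gb t)^*))).
Proof.
move=> hp mp If Ig; have mD : measurable D by exact: measurable_itv.
have If2 := @integrableD _ _ R mu D mD _ _ If Ig.
apply: (@le_integrable _ _ _ mu D mD _ (EFin \o (fun t => normc (fb t) ^+ 2 + normc (gb t) ^+ 2))).
- by apply/measurable_EFinP.
- move=> t _; rewrite /= lee_fin; apply: le_trans (ler_norm _).
  apply: (le_trans (hp _)); rewrite normcM normc_conj.
  have := sqr_ge0 (normc (fb t) - normc (gb t)); rewrite sqrrB.
  have := mulr_ge0 (normc_ge0 (fb t)) (normc_ge0 (gb t)).
  by move: (_ * _) (_ ^+ 2) (_ ^+ 2) => x y z; clear; lra.
- by apply: eq_integrable If2.
Qed.

Lemma Re_conjD (x y : C) :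
  normc (x + y) ^+ 2 = normc x ^+ 2 + normc y ^+ 2 + 2 * complex.Re (x * y^*).
Proof.
rewrite !normc_sqr; case: x => a b; case: y => c d /=; rewrite /Num.conj /=; ring.
Qed.

Lemma measurable_Re_mul (fb gb : R -> C) :
  measurable_fun setT (fun t => complex.Re (fb t)) -> measurable_fun setT (fun t => complex.Im (fb t)) ->
  measurable_fun setT (fun t => complex.Re (gb t)) -> measurable_fun setT (fun t => complex.Im (gb t)) ->
  measurable_fun D (fun t => complex.Re (fb t * (gb t)^*)) /\
  measurable_fun D (fun t => complex.Im (fb t * (gb t)^*)).
Proof.
move=> m1 m2 m3 m4; split.
  have -> : (fun t => complex.Re (fb t * (gb t)^*)) =
     (fun t => complex.Re (fb t) * complex.Re (gb t) + complex.Im (fb t) * complex.Im (gb t)).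
    by apply/funext => t; case: (fb t) (gb t) => [a b] [c d]; rewrite /Num.conj /=; ring.
  by apply: measurable_funTS; apply: measurable_funD; apply: measurable_funM.
have -> : (fun t => complex.Im (fb t * (gb t)^*)) =
   (fun t => complex.Im (fb t) * complex.Re (gb t) - complex.Re (fb t) * complex.Im (gb t)).
  by apply/funext => t; case: (fb t) (gb t) => [a b] [c d]; rewrite /Num.conj /=; ring.
by apply: measurable_funTS; apply: measurable_funB; apply: measurable_funM.
Qed.

(** [radial_limit] speaks of norms only; polarization with [f], [g] and [f + g] recovers the real
    part of the pairing. By uniqueness of radial limits, the boundary function of [f + g] is almost
    everywhere the sum of the other two. *)
Lemma Re_mm_cvg f g Bf Bg fb gb : H2 f -> H2 g -> bdval f Bf fb -> bdval g Bg gb ->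
  complex.Re (mm f g r) @[r --> 1^'-] -->
  (2 * pi)^-1 * \int[mu]_(t in D) complex.Re (fb t * (gb t)^*).
Proof.
move=> hf hg [[mBf Bf0] [mf1 mf2] lf If cf] [[mBg Bg0] [mg1 mg2] lg Ig cg].
have [Bh [hb [[mBh Bh0] _ lh Ih ch]]] := H2_bd (H2D hf hg).
have mD : measurable D by exact: measurable_itv.
have [mr mi] := measurable_Re_mul mf1 mf2 mg1 mg2.
have Ir := integrable_Re_mul (@Re_le_normc R) mr If Ig.
have eh : \int[mu]_(t in D) (normc (hb t) ^+ 2) = \int[mu]_(t in D) (normc (fb t) ^+ 2) +
    \int[mu]_(t in D) (normc (gb t) ^+ 2) + 2 * \int[mu]_(t in D) complex.Re (fb t * (gb t)^*).
  have Ifg : mu.-integrable D (EFin \o (fun t => normc (fb t) ^+ 2 + normc (gb t) ^+ 2)).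
    by have := @integrableD _ _ R mu D mD _ _ If Ig; apply: eq_integrable.
  have I2r := integrableZR 2 mD Ir.
  rewrite -RintegralD// -RintegralZl// -RintegralD//.
  apply: (@Rintegral_null _ _ R mu D (Bf `|` (Bg `|` Bh))) => //.
  - by apply: measurableU => //; exact: measurableU.
  - by rewrite null_set_setU// ?null_set_setU//; exact: measurableU.
  move=> t Dt nB; rewrite -Re_conjD; congr (normc _ ^+ 2).
  have Dt' : 0 <= t <= 2 * pi by move: Dt; rewrite /= in_itv.
  apply: (@rlim_uniq _ t); first by apply: lh => // b; apply: nB; right; right.
  by apply: rlimD; [apply: lf => // b; apply: nB; left|apply: lg => // b; apply: nB; right; left].
have E r : 0 < r -> r < 1 -> complex.Re (mm f g r) = 2^-1 * (m2 (fun z => f z + g z) r - m2 f r - m2 g r).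
  move=> r0 r1; have rn : `|r| < 1 by rewrite gtr0_norm.
  have hf' := H2_hol hf; have hg' := H2_hol hg.
  have cf' := hol_ccts hf' rn; have cg' := hol_ccts hg' rn; have ch' := hol_ccts (holD hf' hg') rn.
  have e1 : (m2 (fun z => f z + g z) r)%:C%C = mm f f r + mm f g r + (mm g f r + mm g g r).
    by rewrite -mm_m2// mmDl// !mmDr.
  move: e1; rewrite (@mm_m2 R f)// (@mm_m2 R g)// (mm_conj cf' cg').
  case: (mm f g r) => a b; rewrite /Num.conj /=.
  move=> /(congr1 (@complex.Re R)) /= ->; lra.
have lim : 2^-1 * (m2 (fun z => f z + g z) r - m2 f r - m2 g r) @[r --> 1^'-] -->
   (2 * pi)^-1 * \int[mu]_(t in D) complex.Re (fb t * (gb t)^*).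
  rewrite [X in _ --> X](_ : _ = 2^-1 * ((2 * pi)^-1 * \int[mu]_(t in D) (normc (hb t) ^+ 2)
     - (2 * pi)^-1 * \int[mu]_(t in D) (normc (fb t) ^+ 2) - (2 * pi)^-1 * \int[mu]_(t in D) (normc (gb t) ^+ 2))).
    by apply: cvgMr; apply: cvgB cg; apply: cvgB cf.
  rewrite eh; move: (\int[mu]_(t in _) _) (\int[mu]_(t in _) _) (\int[mu]_(t in _) _) (_^-1) => x y z w; lra.
apply: cvg_left1 => e e0; have /cvgrPdist_lt/(_ _ e0)/nbhs_left1[r0 r01 H] := lim.
exists (Num.max r0 0); first by rewrite gt_max r01 ltr01.
by move=> r /gt_max2[h1 h2] h3; rewrite E// distrC; exact: H.
Qed.

Lemma bdZi g B gb : bdval g B gb -> bdval (fun z => Complex 0 1 * g z) B (fun t => Complex 0 1 * gb t).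
Proof.
have ni (x : C) : normc (Complex 0 1 * x) = normc x.
  by rewrite normcM /normc/= expr0n expr1n add0r sqrtr1 mul1r.
move=> [? [mr mi] l I c]; split=> //.
- split.
    have -> : (fun t => complex.Re (Complex 0 1 * gb t)) = (fun t => - complex.Im (gb t)).
      by apply/funext => t; case: (gb t) => a b /=; ring.
    exact: measurableT_comp.
  have -> : (fun t => complex.Im (Complex 0 1 * gb t)) = (fun t => complex.Re (gb t)).
    by apply/funext => t; case: (gb t) => a b /=; ring.
  exact: mr.
- move=> t ht nB e /(l t ht nB)[r0 r01 H]; exists r0 => // r h1 h2.
  by rewrite -mulrBr ni; exact: H.
- by apply: eq_integrable I => // t _; rewrite /= ni.
have -> : \int[mu]_(t in D) (normc (Complex 0 1 * gb t) ^+ 2) = \int[mu]_(t in D) (normc (gb t) ^+ 2).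
  by apply: eq_Rintegral => t _; rewrite ni.
have -> : m2 (fun z => Complex 0 1 * g z) = m2 g.
  by apply/funext => r; rewrite /m2; congr (_ * _); apply: eq_Rintegral => t _; rewrite ni.
exact: c.
Qed.

Lemma clim_ReIm (g : R -> C) v : complex.Re (g r) @[r --> 1^'-] --> complex.Re v ->
  complex.Im (g r) @[r --> 1^'-] --> complex.Im v -> clim g v.
Proof.
move=> ha hb e e0; have e2 : 0 < e / 2 by rewrite divr_gt0.
have /cvgrPdist_lt/(_ _ e2)/nbhs_left1 [r0 r01 h0] := ha.
have /cvgrPdist_lt/(_ _ e2)/nbhs_left1 [s0 s01 h1] := hb.
exists (Num.max r0 s0); first by rewrite gt_max r01.
move=> r /gt_max2[h2 h3] r1.
apply: (le_lt_trans (normc_le_sum _)); rewrite (splitr e).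
by apply: ltrD; [have := h0 r h2 r1|have := h1 r h3 r1]; rewrite raddfB distrC.
Qed.

(** The imaginary part of the pairing is the real part of the pairing of [f] with [i g]. *)
Lemma clim_mm f g Bf Bg fb gb : H2 f -> H2 g -> bdval f Bf fb -> bdval g Bg gb ->
  clim (mm f g) ((2 * pi)^-1%:C%C * cintegral D (fun t => fb t * (gb t)^*)).
Proof.
move=> hf hg bf bg; apply: clim_ReIm.
  have := Re_mm_cvg hf hg bf bg; rewrite /cintegral.
  set I := \int[mu]_(t in _) _; set J := \int[mu]_(t in _) _.
  by have -> : complex.Re ((2 * pi)^-1%:C%C * Complex I J) = (2 * pi)^-1 * I by rewrite /= mul0r subr0.
have := Re_mm_cvg hf (H2Z (Complex 0 1) hg) bf (bdZi bg); rewrite /cintegral.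
set I := \int[mu]_(t in _) _; set J := \int[mu]_(t in _) _; set K := \int[mu]_(t in _) _.
have -> : complex.Im ((2 * pi)^-1%:C%C * Complex J K) = (2 * pi)^-1 * K by rewrite /= mul0r addr0.
have -> : I = K.
  apply: eq_Rintegral => t _; case: (fb t) (gb t) => [a b] [c d]; rewrite /Num.conj /=; ring.
move=> lim; apply: cvg_left1 => e e0; have /cvgrPdist_lt/(_ _ e0)/nbhs_left1[r0 r01 H] := lim.
exists (Num.max r0 0); first by rewrite gt_max r01 ltr01.
move=> r /gt_max2[h1 h2] h3; rewrite distrC; have := H r h1 h3.
have rn : `|r| < 1 by rewrite gtr0_norm.
rewrite mmZr; [|exact: hol_ccts (H2_hol hg) rn|exact: hol_ccts (H2_hol hf) rn].
by case: (mm f g r) => a b; rewrite /Num.conj /= mul0r sub0r mulN1r opprK.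
Qed.

End BoundaryInner.

Section MatrixInner.
Context {R : realType}.
Local Notation C := R[i].
Local Notation mu := (@lebesgue_measure R).
Local Notation D := (`[0, 2 * pi]%classic : set R).
Implicit Types (r t : R).

Definition cint (u : R -> C) := mu.-integrable D (EFin \o (fun t => complex.Re (u t))) /\
  mu.-integrable D (EFin \o (fun t => complex.Im (u t))).

Lemma cintegralD (u v : R -> C) : cint u -> cint v -> cint (fun t => u t + v t) /\
  cintegral D (fun t => u t + v t) = cintegral D u + cintegral D v.
Proof.
move=> [u1 u2] [v1 v2]; have mD : measurable D by exact: measurable_itv.
have RD (x y : C) : complex.Re (x + y) = complex.Re x + complex.Re y by case: x y => [a b] [c d].
have ID (x y : C) : complex.Im (x + y) = complex.Im x + complex.Im y by case: x y => [a b] [c d].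
split; first split.
- have := @integrableD _ _ R mu D mD _ _ u1 v1; apply: eq_integrable => // t _.
  by rewrite /= RD EFinD.
- have := @integrableD _ _ R mu D mD _ _ u2 v2; apply: eq_integrable => // t _.
  by rewrite /= ID EFinD.
rewrite /cintegral [RHS]/GRing.add /=; congr Complex.
  by rewrite -RintegralD//; apply: eq_Rintegral => t _; rewrite RD.
by rewrite -RintegralD//; apply: eq_Rintegral => t _; rewrite ID.
Qed.

Lemma cintegral_sum (I : Type) (s : seq I) (u : I -> R -> C) : (forall i, cint (u i)) ->
  cint (fun t => \sum_(i <- s) u i t) /\
  cintegral D (fun t => \sum_(i <- s) u i t) = \sum_(i <- s) cintegral D (u i).
Proof.
move=> h; elim: s => [|i s [IH1 IH2]].
  rewrite big_nil; have -> : (fun t => \sum_(i <- [::]) u i t) = fun=> 0.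
    by apply/funext => t; rewrite big_nil.
  have i0 : mu.-integrable D (EFin \o (fun=> 0 : R)) by exact: integrable0.
  by split; [split|rewrite /cintegral /= !Rintegral_cst// !mul0r].
have -> : (fun t => \sum_(j <- i :: s) u j t) = fun t => u i t + \sum_(j <- s) u j t.
  by apply/funext => t; rewrite big_cons.
by rewrite big_cons -IH2; exact: cintegralD.
Qed.

Lemma finite_null (I : eqType) (s : seq I) (B : I -> set R) :
  (forall i, measurable (B i) /\ mu (B i) = 0) ->
  exists B', [/\ measurable B', mu B' = 0 & forall i t, i \in s -> B i t -> B' t].
Proof.
move=> h; elim: s => [|i s [B' [mB B0 hB]]]; first by exists set0; split=> //; rewrite measure0.
have [mi i0] := h i.
exists (B i `|` B'); split.
- exact: measurableU.
- by rewrite null_set_setU.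
move=> j t; rewrite inE => /orP[/eqP ->|js] Bt; first by left.
by right; apply: hB Bt.
Qed.

Definition smm k l (F G : C -> 'M[C]_(k, l)) r : C :=
  \sum_(i < k) \sum_(j < l) mm (fun z => F z i j) (fun z => G z i j) r.

Variant mH2 k l (F : C -> 'M[C]_(k, l)) : Prop := MH2 of forall i j, H2 (fun z => F z i j).

Lemma mH2E k l (F : C -> 'M[C]_(k, l)) : mH2 F -> forall i j, H2 (fun z => F z i j).
Proof. by case. Qed.

Lemma mxHardy2P k l (F : C -> 'M[C]_(k, l)) : mxHardy2 F <-> mH2 F.
Proof.
split => [h|[h] i j]; last by apply/Hardy2P; exact: h.
by split=> i j; apply/Hardy2P; exact: h.
Qed.

Lemma boundaryE k l (F : C -> 'M[C]_(k, l)) t (A : 'M[C]_(k, l)) :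
  (forall i j, rlim (fun z => F z i j) t (A i j)) -> boundary F t = A.
Proof.
move=> h; rewrite /boundary; apply: cvg_lim => //.
apply/cvg_mxP => i j; apply/cvgCP => e e0; have [r0 r01 H] := h i j e e0.
near=> r; apply: H; near: r; [exact: nbhs_left_gt|exact: nbhs_left_lt].
Unshelve. all: by end_near. Qed.

(** The bridge from the boundary definition to the interior: algebraic properties of [inner] are
    proved below on circles inside the disk and then pass to the limit. *)
Lemma inner_clim k l (F G : C -> 'M[C]_(k, l)) : mH2 F -> mH2 G -> clim (smm F G) (inner F G).
Proof.
move=> hF hG.
have /choice [fB hfB] : forall p : 'I_k * 'I_l, exists Bf : set R * (R -> C),
    bdval (fun z => F z p.1 p.2) Bf.1 Bf.2.
  by move=> p; have [B [fb h]] := H2_bd (mH2E hF p.1 p.2); exists (B, fb).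
have /choice [gB hgB] : forall p : 'I_k * 'I_l, exists Bf : set R * (R -> C),
    bdval (fun z => G z p.1 p.2) Bf.1 Bf.2.
  by move=> p; have [B [fb h]] := H2_bd (mH2E hG p.1 p.2); exists (B, fb).
pose fb i j := (fB (i, j)).2; pose gb i j := (gB (i, j)).2.
pose B (p : 'I_k * 'I_l) := (fB p).1 `|` (gB p).1.
have [B' [mB B0 hB]] : exists B', [/\ measurable B', mu B' = 0 &
    forall i t, i \in enum {: 'I_k * 'I_l} -> B i t -> B' t].
  apply: finite_null => p; case: (hfB p) => -[m1 n1] _ _ _ _; case: (hgB p) => -[m2 n2] _ _ _ _.
  by split; [exact: measurableU|rewrite null_set_setU].
have mD : measurable D by exact: measurable_itv.
pose u i j t := fb i j t * (gb i j t)^*.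
have iu i j : cint (u i j).
  case: (hfB (i, j)) => _ [m1 m2] _ If _; case: (hgB (i, j)) => _ [m3 m4] _ Ig _.
  have [mr mi] := measurable_Re_mul m1 m2 m3 m4.
  by split; [exact: (integrable_Re_mul (@Re_le_normc R) mr)|exact: (integrable_Re_mul (@Im_le_normc R) mi)].
have -> : inner F G = \sum_(i < k) \sum_(j < l) (2 * pi)^-1%:C%C * cintegral D (u i j).
  rewrite /inner; have -> : cintegral D (fun t => \tr ((boundary G t)^t* *m boundary F t)) =
      cintegral D (fun t => \sum_(i < k) \sum_(j < l) u i j t).
    have bE t : D t -> ~ B' t -> \tr ((boundary G t)^t* *m boundary F t) = \sum_(i < k) \sum_(j < l) u i j t.
      move=> Dt nB; have Dt' : 0 <= t <= 2 * pi by move: Dt; rewrite /= in_itv.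
      rewrite (@boundaryE _ _ F t (\matrix_(i, j) fb i j t)); last first.
        move=> i j; rewrite mxE; case: (hfB (i, j)) => _ _ lf _ _; apply: lf => // b.
        by apply: nB; apply: (hB (i, j)); [rewrite mem_enum|left].
      rewrite (@boundaryE _ _ G t (\matrix_(i, j) gb i j t)); last first.
        move=> i j; rewrite mxE; case: (hgB (i, j)) => _ _ lf _ _; apply: lf => // b.
        by apply: nB; apply: (hB (i, j)); [rewrite mem_enum|right].
      rewrite /mxtrace exchange_big /=; apply: eq_bigr => j _.
      rewrite mxE; apply: eq_bigr => i _; rewrite !mxE mulrC//.
    rewrite /cintegral; congr Complex; apply: (@Rintegral_null _ _ R mu D B') => // t Dt nB;
    by rewrite bE.
  have c1 i := cintegral_sum (index_enum 'I_l) (iu i).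
  have [_ ->] := cintegral_sum (index_enum 'I_k) (fun i => (c1 i).1).
  rewrite mulr_sumr; apply: eq_bigr => i _; rewrite (c1 i).2 mulr_sumr//.
apply: clim_sum => i; apply: clim_sum => j.
exact: clim_mm (mH2E hF i j) (mH2E hG i j) (hfB (i, j)) (hgB (i, j)).
Qed.

End MatrixInner.

Section InnerFacts.
Context {R : realType}.
Local Notation C := R[i].
Local Notation mu := (@lebesgue_measure R).
Local Notation D := (`[0, 2 * pi]%classic : set R).
Implicit Types (r t : R).

Lemma H2_eq (f g : C -> C) : (forall z, disk z -> f z = g z) -> H2 f -> H2 g.
Proof.
move=> fg [[hf] [M hM]]; split.
  split=> z dz; apply: (near_eq_derive1 _ (hf z dz)).1.
  by apply: filterS (near_disk dz) => w dw; exact: fg.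
exists M => r r0 r1; rewrite (_ : m2 g r = m2 f r) ?hM//.
rewrite /m2; congr (_ * _); apply: eq_Rintegral => t _; rewrite fg// diskE normc_pol.
by rewrite gtr0_norm.
Qed.

Lemma mH2_eq k l (F G : C -> 'M[C]_(k, l)) : (forall z, disk z -> F z = G z) -> mH2 F -> mH2 G.
Proof. by move=> FG hF; apply: MH2 => i j; apply: H2_eq (mH2E hF i j) => z dz; rewrite FG. Qed.

Lemma mH2D k l (F G : C -> 'M[C]_(k, l)) : mH2 F -> mH2 G -> mH2 (fun z => F z + G z).
Proof.
move=> hF hG; apply: MH2 => i j; have := H2D (mH2E hF i j) (mH2E hG i j).
by apply: H2_eq => z _; rewrite mxE.
Qed.

Lemma mH2Z k l (c : C) (F : C -> 'M[C]_(k, l)) : mH2 F -> mH2 (fun z => c *: F z).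
Proof. by move=> hF; apply: MH2 => i j; have := H2Z c (mH2E hF i j); apply: H2_eq => z _; rewrite mxE. Qed.

Lemma mH2B k l (F G : C -> 'M[C]_(k, l)) : mH2 F -> mH2 G -> mH2 (fun z => F z - G z).
Proof.
move=> hF hG; apply: MH2 => i j; have := H2B (mH2E hF i j) (mH2E hG i j).
by apply: H2_eq => z _; rewrite !mxE.
Qed.

Lemma mH2_scal k l (phi : C -> C) (X : 'M[C]_(k, l)) : H2 phi -> mH2 (fun w => phi w *: X).
Proof.
by move=> h; apply: MH2 => i j; have := H2Z (X i j) h; apply: H2_eq => z _; rewrite mxE mulrC.
Qed.

Lemma mH2_cst k l (X : 'M[C]_(k, l)) : mH2 (fun=> X).
Proof. by apply: MH2 => i j; exact: H2_cst. Qed.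

Lemma mH2_sum k l (I : Type) (s : seq I) (F : I -> C -> 'M[C]_(k, l)) :
  (forall i, mH2 (F i)) -> mH2 (fun z => \sum_(i <- s) F i z).
Proof.
move=> h; apply: MH2 => i j; have := H2_sum s (fun n => mH2E (h n) i j).
by apply: H2_eq => z _; rewrite summxE.
Qed.

Lemma mH2_mulmx k l m (S : C -> 'M[C]_(m, k)) (F : C -> 'M[C]_(k, l)) (M : R) :
  (forall i j, hol (fun z => S z i j)) ->
  (forall i j z, disk z -> normc (S z i j) <= M) -> mH2 F -> mH2 (fun z => S z *m F z).
Proof.
move=> hS bS hF; apply: MH2 => i j.
have h n : H2 (fun z => S z i n * F z n j) by apply: (@H2_mul _ _ _ M (hS i n) _ (mH2E hF n j)) => w; exact: bS.
by have := H2_sum (index_enum 'I_k) h; apply: H2_eq => z _; rewrite mxE.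
Qed.

Lemma eq_mml (f f' g : C -> C) r : (forall z, f z = f' z) -> mm f g r = mm f' g r.
Proof. by move=> /funext ->. Qed.

Let itv_normr r : 0 < r -> r < 1 -> `|r| < 1.
Proof. by move=> r0 r1; rewrite gtr0_norm. Qed.

Lemma innerDl k l (F G H : C -> 'M[C]_(k, l)) : mH2 F -> mH2 G -> mH2 H ->
  inner (fun z => F z + G z) H = inner F H + inner G H.
Proof.
move=> hF hG hH; apply: (clim_uniq (inner_clim (mH2D hF hG) hH)).
apply: clim_eq (climD (inner_clim hF hH) (inner_clim hG hH)) => r r0 r1.
rewrite /smm -big_split; apply: eq_bigr => i _; rewrite -big_split; apply: eq_bigr => j _ /=.
have rn := itv_normr r0 r1.
rewrite -mmDl; [|exact: hol_ccts (H2_hol (mH2E hF i j)) rn|exact: hol_ccts (H2_hol (mH2E hG i j)) rn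
  |exact: hol_ccts (H2_hol (mH2E hH i j)) rn].
by apply: eq_mml => z; rewrite mxE.
Qed.

Lemma innerZl k l (c : C) (F H : C -> 'M[C]_(k, l)) : mH2 F -> mH2 H ->
  inner (fun z => c *: F z) H = c * inner F H.
Proof.
move=> hF hH; apply: (clim_uniq (inner_clim (mH2Z c hF) hH)).
apply: clim_eq (climZ c (inner_clim hF hH)) => r r0 r1.
rewrite /smm mulr_sumr; apply: eq_bigr => i _; rewrite mulr_sumr; apply: eq_bigr => j _ /=.
have rn := itv_normr r0 r1.
rewrite -mmZl; [|exact: hol_ccts (H2_hol (mH2E hF i j)) rn|exact: hol_ccts (H2_hol (mH2E hH i j)) rn].
by apply: eq_mml => z; rewrite mxE.
Qed.

Lemma inner_conj k l (F H : C -> 'M[C]_(k, l)) : mH2 F -> mH2 H ->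
  inner H F = (inner F H)^*.
Proof.
move=> hF hH; apply: (clim_uniq (inner_clim hH hF)).
apply: clim_eq (clim_conj (inner_clim hF hH)) => r r0 r1.
rewrite /smm rmorph_sum; apply: eq_bigr => i _; rewrite rmorph_sum; apply: eq_bigr => j _ /=.
have rn := itv_normr r0 r1.
by rewrite -mm_conj; [|exact: hol_ccts (H2_hol (mH2E hF i j)) rn|exact: hol_ccts (H2_hol (mH2E hH i j)) rn].
Qed.

Lemma innerDr k l (F G H : C -> 'M[C]_(k, l)) : mH2 F -> mH2 G -> mH2 H ->
  inner H (fun z => F z + G z) = inner H F + inner H G.
Proof.
move=> hF hG hH; rewrite (inner_conj (mH2D hF hG) hH) innerDl// rmorphD /=.
by rewrite (inner_conj hF hH) (inner_conj hG hH).
Qed.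

Lemma innerZr k l (c : C) (F H : C -> 'M[C]_(k, l)) : mH2 F -> mH2 H ->
  inner H (fun z => c *: F z) = c^* * inner H F.
Proof.
move=> hF hH; rewrite (inner_conj (mH2Z c hF) hH) innerZl// rmorphM /=.
by rewrite (inner_conj hF hH).
Qed.

Lemma inner_eq k l (F F' G G' : C -> 'M[C]_(k, l)) :
  (forall z, disk z -> F z = F' z) -> (forall z, disk z -> G z = G' z) ->
  mH2 F -> mH2 G -> inner F G = inner F' G'.
Proof.
move=> FF GG hF hG.
apply: (clim_uniq _ (inner_clim (mH2_eq FF hF) (mH2_eq GG hG))).
apply: clim_eq (inner_clim hF hG) => r r0 r1; apply: eq_bigr => i _; apply: eq_bigr => j _.
rewrite /mm; congr (_ * _); apply: eq_iint => t _.
by rewrite FF ?GG// diskE normc_pol gtr0_norm.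
Qed.

Lemma inner0l k l (H : C -> 'M[C]_(k, l)) : mH2 H -> inner (fun=> 0) H = 0.
Proof.
move=> hH; have := innerZl 0 (@mH2_cst k l 0) hH; rewrite mul0r => <-.
by congr (inner _ H); apply/funext => z; rewrite scaler0.
Qed.

Lemma innerBl k l (F G H : C -> 'M[C]_(k, l)) : mH2 F -> mH2 G -> mH2 H ->
  inner (fun z => F z - G z) H = inner F H - inner G H.
Proof.
move=> hF hG hH.
have -> : (fun z => F z - G z) = (fun z => F z + (-1) *: G z).
  by apply/funext => z; rewrite scaleN1r.
by rewrite (innerDl hF (mH2Z (-1) hG) hH) (innerZl (-1) hG hH) mulN1r.
Qed.

Lemma innerBr k l (F G H : C -> 'M[C]_(k, l)) : mH2 F -> mH2 G -> mH2 H ->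
  inner H (fun z => F z - G z) = inner H F - inner H G.
Proof.
move=> hF hG hH; rewrite (inner_conj (mH2B hF hG) hH) innerBl// rmorphB /=.
by rewrite (inner_conj hF hH) (inner_conj hG hH).
Qed.

Lemma inner_suml k l (I : Type) (s : seq I) (F : I -> C -> 'M[C]_(k, l)) (H : C -> 'M[C]_(k, l)) :
  (forall i, mH2 (F i)) -> mH2 H ->
  inner (fun z => \sum_(i <- s) F i z) H = \sum_(i <- s) inner (F i) H.
Proof.
move=> hF hH; elim: s => [|i s IH].
  have -> : (fun z => \sum_(j <- [::]) F j z) = (fun=> 0).
    by apply/funext => z; rewrite big_nil.
  by rewrite big_nil inner0l.
have -> : (fun z => \sum_(j <- i :: s) F j z) = (fun z => F i z + \sum_(j <- s) F j z).
  by apply/funext => z; rewrite big_cons.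
by rewrite big_cons (innerDl (hF i) (mH2_sum s hF) hH) IH.
Qed.

Lemma inner_sumr k l (I : Type) (s : seq I) (F : I -> C -> 'M[C]_(k, l)) (H : C -> 'M[C]_(k, l)) :
  (forall i, mH2 (F i)) -> mH2 H ->
  inner H (fun z => \sum_(i <- s) F i z) = \sum_(i <- s) inner H (F i).
Proof.
move=> hF hH; rewrite (inner_conj (mH2_sum s hF) hH) (inner_suml s hF hH) rmorph_sum.
by apply: eq_bigr => i _; rewrite (inner_conj (hF i) hH).
Qed.

Definition sm2 k l (F : C -> 'M[C]_(k, l)) r : R :=
  \sum_(i < k) \sum_(j < l) m2 (fun z => F z i j) r.

Lemma smm_sm2 k l (F : C -> 'M[C]_(k, l)) r : mH2 F -> 0 < r -> r < 1 ->
  smm F F r = (sm2 F r)%:C%C.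
Proof.
move=> hF r0 r1; have rn := itv_normr r0 r1.
rewrite /smm /sm2 rmorph_sum; apply: eq_bigr => i _; rewrite rmorph_sum; apply: eq_bigr => j _ /=.
by rewrite mm_m2//; exact: hol_ccts (H2_hol (mH2E hF i j)) rn.
Qed.

Lemma inner_self k l (F : C -> 'M[C]_(k, l)) : mH2 F -> inner F F = (complex.Re (inner F F))%:C%C.
Proof.
move=> hF; have := inner_conj hF hF; case: (inner F F) => a b; rewrite /Num.conj/= => -[h].
by congr Complex; lra.
Qed.

Lemma clim_Re (g : R -> C) v : clim g v -> forall e : R, 0 < e ->
  exists2 r0 : R, r0 < 1 & forall r, r0 < r -> r < 1 -> `|complex.Re (g r) - complex.Re v| < e.
Proof.
move=> h e /h[r0 r01 H]; exists r0 => // r h1 h2; apply: le_lt_trans (H r h1 h2).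
exact: Re_lip.
Qed.

Lemma clim_le (g h : R -> R) (u v : R) : clim (fun r => (g r)%:C%C) u%:C%C ->
  clim (fun r => (h r)%:C%C) v%:C%C -> (forall r, 0 < r -> r < 1 -> g r <= h r) -> u <= v.
Proof.
move=> /clim_Re hu /clim_Re hv gh; apply/ler_addgt0Pr => e e0.
have e2 : 0 < e / 2 by rewrite divr_gt0.
have [r0 r01 h0] := hu _ e2; have [s0 s01 h1] := hv _ e2.
have [m [m0 m1 m2 m3]] : exists m, [/\ r0 < m, s0 < m, 0 < m & m < 1].
  pose c := Num.max 0 (Num.max r0 s0); have c1 : c < 1 by rewrite /c !gt_max r01 s01 ltr01.
  have [c0 /gt_max2[cr cs]] : 0 < (c + 1) / 2 /\ Num.max r0 s0 < (c + 1) / 2.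
    by apply: gt_max2; rewrite -/c; lra.
  by exists ((c + 1) / 2); split=> //; lra.
have := h0 m m0 m3; have := h1 m m1 m3; have := gh m m2 m3; rewrite /= !ltr_norml.
by move: (g m) (h m) => x y xy /andP[a b] /andP[c d]; lra.
Qed.

Lemma inner_le k l m p (F : C -> 'M[C]_(k, l)) (G : C -> 'M[C]_(m, p)) (c : R) :
  mH2 F -> mH2 G -> (forall r, 0 < r -> r < 1 -> sm2 F r <= c * sm2 G r) ->
  complex.Re (inner F F) <= c * complex.Re (inner G G).
Proof.
move=> hF hG h.
have cF := inner_clim hF hF; have cG := climZ c%:C%C (inner_clim hG hG).
rewrite inner_self// in cF; rewrite inner_self// -rmorphM /= in cG.
apply: (@clim_le (sm2 F) (fun r => c * sm2 G r)) h.
  by apply: clim_eq cF => r r0 r1; rewrite smm_sm2.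
by apply: clim_eq cG => r r0 r1; rewrite smm_sm2// -rmorphM.
Qed.

Lemma inner_ge0 k l (F : C -> 'M[C]_(k, l)) : mH2 F -> 0 <= complex.Re (inner F F).
Proof.
move=> hF; have := @inner_le k l k l (fun=> 0) F 1 (@mH2_cst k l 0) hF.
rewrite inner0l ?mul1r; last exact: mH2_cst.
apply => r r0 r1; rewrite mul1r; apply: ler_sum => i _; apply: ler_sum => j _.
rewrite (_ : m2 _ r = 0) ?m2_ge0// /m2 [X in _ * X](_ : _ = 0) ?mulr0//.
rewrite (@eq_Rintegral _ _ _ mu _ (fun=> 0)) ?Rintegral_cst ?mul0r// => t _.
by rewrite mxE normc0 expr0n.
Qed.

Lemma inner_norm_ge0 k l (F : C -> 'M[C]_(k, l)) : 0 <= inner_norm F.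
Proof. exact: sqrtr_ge0. Qed.

Lemma inner_normsq k l (F : C -> 'M[C]_(k, l)) : mH2 F ->
  inner_norm F ^+ 2 = complex.Re (inner F F).
Proof. by move=> hF; rewrite sqr_sqrtr// inner_ge0. Qed.

Lemma inner_normE k l (F : C -> 'M[C]_(k, l)) : mH2 F -> inner F F = (inner_norm F ^+ 2)%:C%C.
Proof. by move=> hF; rewrite inner_normsq// -inner_self. Qed.

Local Opaque inner inner_norm.

Lemma CS_expand (c : C) (a b s : R) :
  complex.Re (a%:C%C - s%:C%C * c * c^* - ((s%:C%C * c)^* * c - s%:C%C * c * ((s%:C%C * c)^* * b%:C%C))) =
  a - 2 * s * normc c ^+ 2 + s ^+ 2 * normc c ^+ 2 * b.
Proof. by rewrite normc_sqr; case: c => x y; rewrite /Num.conj /=; ring. Qed.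

(** Used with [c] the squared modulus of the inner product of [F] and [G], and with the vectors
    [F - s <F, G> G], so that a real parameter [s] suffices. *)
Lemma discriminant_le (c a b : R) : 0 <= c -> 0 <= a -> 0 <= b ->
  (forall s : R, 0 <= a - 2 * s * c + s ^+ 2 * c * b) -> c <= a * b.
Proof.
move=> c0 a0 b0 key; have [b00|b00] := eqVneq b 0.
  rewrite leNgt; apply/negP; rewrite b00 mulr0 => c1.
  have := key ((a + 1) / c); rewrite b00 mulr0 addr0 -mulrA divfK ?gt_eqF//; lra.
have bp : 0 < b by rewrite lt_neqAle eq_sym b00.
have := key b^-1; rewrite expr2.
rewrite (_ : b^-1 * b^-1 * c * b = c / b); last by field.
rewrite (_ : 2 * b^-1 * c = 2 * (c / b)); last by field.
rewrite -ler_pdivrMr//; lra.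
Qed.

Lemma inner_CauchySchwarz k l (F G : C -> 'M[C]_(k, l)) : mH2 F -> mH2 G ->
  normc (inner F G) <= inner_norm F * inner_norm G.
Proof.
move=> hF hG; rewrite -(@ler_pXn2r _ 2) ?nnegrE ?mulr_ge0 ?inner_norm_ge0 ?normc_ge0//.
rewrite exprMn; have hGF := inner_conj hF hG.
have hFF := inner_normE hF; have hGG := inner_normE hG.
apply: discriminant_le; [exact: sqr_ge0|exact: sqr_ge0|exact: sqr_ge0|] => s.
have hsG : mH2 (fun z => (s%:C%C * inner F G) *: G z) by exact: mH2Z.
have := inner_ge0 (mH2B hF hsG).
rewrite (innerBr hF hsG (mH2B hF hsG)) (innerBl hF hsG hF) (innerBl hF hsG hsG).
rewrite (innerZl _ hG hsG) (innerZr _ hG hF) (innerZr _ hG hG) (innerZl _ hG hF).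
by rewrite hFF hGG hGF CS_expand.
Qed.

End InnerFacts.

Section InnerFacts2.
Context {R : realType}.
Local Notation C := R[i].
Local Notation mu := (@lebesgue_measure R).
Local Notation D := (`[0, 2 * pi]%classic : set R).
Implicit Types (r t : R).

Lemma m2_fun (u : C -> C) r : hol u -> `|r| < 1 ->
  mu.-integrable D (EFin \o (fun t => normc (u (pol r t)) ^+ 2)).
Proof. by move=> hu r1; apply: within_integrable; apply: normc2_within; exact: hol_ccts. Qed.

Lemma Rint_sum (I : Type) (s : seq I) (u : I -> R -> R) :
  (forall i, mu.-integrable D (EFin \o u i)) ->
  mu.-integrable D (EFin \o (fun t => \sum_(i <- s) u i t)) /\
  \int[mu]_(t in D) (\sum_(i <- s) u i t) = \sum_(i <- s) \int[mu]_(t in D) u i t.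
Proof.
move=> h; have mD : measurable D by exact: measurable_itv.
elim: s => [|i s [IH1 IH2]].
  rewrite big_nil; have -> : (fun t => \sum_(i <- [::]) u i t) = fun=> 0.
    by apply/funext => t; rewrite big_nil.
  by split; [exact: integrable0|rewrite Rintegral_cst// mul0r].
have -> : (fun t => \sum_(j <- i :: s) u j t) = fun t => u i t + \sum_(j <- s) u j t.
  by apply/funext => t; rewrite big_cons.
rewrite big_cons -IH2; split; last by rewrite RintegralD.
by have := @integrableD _ _ R mu D mD _ _ (h i) IH1; apply: eq_integrable.
Qed.

Definition fro2 k l (A : 'M[C]_(k, l)) : R := \sum_(i < k) \sum_(j < l) normc (A i j) ^+ 2.

Lemma sm2_int k l (F : C -> 'M[C]_(k, l)) r : mH2 F -> 0 < r -> r < 1 ->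
  mu.-integrable D (EFin \o (fun t => fro2 (F (pol r t)))) /\
  sm2 F r = (2 * pi)^-1 * \int[mu]_(t in D) fro2 (F (pol r t)).
Proof.
move=> hF r0 r1; have rn : `|r| < 1 by rewrite gtr0_norm.
have I2 i j := m2_fun (H2_hol (mH2E hF i j)) rn.
have S1 i := Rint_sum (index_enum 'I_l) (I2 i).
have [I1 ->] := Rint_sum (index_enum 'I_k) (fun i => (S1 i).1).
split=> //; rewrite mulr_sumr; apply: eq_bigr => i _.
by rewrite (S1 i).2 mulr_sumr.
Qed.

Lemma inner_le_pointwise k l m p (F : C -> 'M[C]_(k, l)) (G : C -> 'M[C]_(m, p)) (c : R) :
  mH2 F -> mH2 G -> (forall z, disk z -> fro2 (F z) <= c * fro2 (G z)) ->
  complex.Re (inner F F) <= c * complex.Re (inner G G).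
Proof.
move=> hF hG h; apply: inner_le => // r r0 r1.
have [IF ->] := sm2_int hF r0 r1; have [IG ->] := sm2_int hG r0 r1.
rewrite mulrCA ler_wpM2l ?invr_ge0 ?pi2_ge0//.
have := @Rint_le_lin R D _ _ _ c 0 (measurable_itv _) IF IG IG.
rewrite mul0r addr0; apply => t _; rewrite mul0r addr0.
by apply: h; rewrite diskE normc_pol gtr0_norm.
Qed.

Definition frod k l (X Y : 'M[C]_(k, l)) : C := \sum_(i < k) \sum_(j < l) (X i j)^* * Y i j.

Lemma frodE k l (X Y : 'M[C]_(k, l)) : frod X Y = \tr (X^t* *m Y).
Proof.
rewrite /mxtrace /frod exchange_big; apply: eq_bigr => j _; rewrite mxE.
by apply: eq_bigr => i _; rewrite !mxE.
Qed.

(** Common source of the reproducing formulas for the kernels, the constants and the coordinate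
    function. *)
Lemma inner_repr k l (F : C -> 'M[C]_(k, l)) (phi : C -> C) (X Y : 'M[C]_(k, l)) :
  mH2 F -> H2 phi -> (forall i j, clim (mm (fun z => F z i j) phi) (Y i j)) ->
  inner F (fun w => phi w *: X) = frod X Y.
Proof.
move=> hF hp h; apply: (clim_uniq (inner_clim hF (mH2_scal X hp))).
rewrite /frod /smm; apply: clim_sum => i; apply: clim_sum => j.
apply: clim_eq (climZ _ (h i j)) => r r0 r1.
have rn : `|r| < 1 by rewrite gtr0_norm.
rewrite -(mmZr _ (hol_ccts (H2_hol hp) rn) (hol_ccts (H2_hol (mH2E hF i j)) rn)).
congr (mm _ _ r); apply/funext => z; by rewrite mxE mulrC.
Qed.

Lemma H2_id : H2 (fun w : C => w).
Proof.
apply: (@H2_bounded _ _ 1); first by split=> z _; exact: derivableC_id.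
by move=> w; rewrite diskE => /ltW.
Qed.

Lemma inner_kern k l (F : C -> 'M[C]_(k, l)) (z : C) (X : 'M[C]_(k, l)) : mH2 F -> disk z ->
  inner F (fun w => kern z w *: X) = frod X (F z).
Proof.
move=> hF dz; apply: (inner_repr (phi := kern z)) => //; first exact: H2_kern.
by move=> i j; apply: (clim_kern (h := fun z => F z i j)) => //; exact: H2_hol (mH2E hF i j).
Qed.

Lemma inner_cst k l (F : C -> 'M[C]_(k, l)) (X : 'M[C]_(k, l)) : mH2 F ->
  inner F (fun=> X) = frod X (F 0).
Proof.
move=> hF; rewrite -(inner_kern X hF disk0); congr (inner F _).
by apply/funext => w; rewrite /kern conjC0 mul0r subr0 invr1 scale1r.
Qed.

Lemma mH2_derivable k l (F : C -> 'M[C]_(k, l)) z : mH2 F -> disk z -> derivable F z 1.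
Proof. by move=> hF dz; apply/derivable_mxE => i j; exact: holP (H2_hol (mH2E hF i j)) _ dz. Qed.

Lemma inner_id k l (F : C -> 'M[C]_(k, l)) (X : 'M[C]_(k, l)) : mH2 F ->
  inner F (fun w => w *: X) = frod X (derive1 F 0).
Proof.
move=> hF; apply: (inner_repr (phi := id)) => //; first exact: H2_id.
move=> i j; rewrite derive1_mxE; last by apply: mH2_derivable => //; exact: disk0.
by apply: clim_id; exact: H2_hol (mH2E hF i j).
Qed.

Lemma fro2_eq0 k l (A : 'M[C]_(k, l)) : frod A A = 0 -> A = 0.
Proof.
move=> h; apply/matrixP => i j; rewrite mxE; apply/eqP; rewrite -normc_eq0.
have : fro2 A = 0.
  have : frod A A = (fro2 A)%:C%C.
    rewrite /frod /fro2 rmorph_sum; apply: eq_bigr => i' _; rewrite rmorph_sum; apply: eq_bigr => j' _.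
    by rewrite mulrC mul_conj_real.
  by rewrite h => -[].
rewrite /fro2 => /eqP; rewrite psumr_eq0; last by move=> *; apply: sumr_ge0 => *; exact: sqr_ge0.
move=> /allP/(_ i (mem_index_enum _)); rewrite psumr_eq0; last by move=> *; exact: sqr_ge0.
by move=> /allP/(_ j (mem_index_enum _)); rewrite sqrf_eq0.
Qed.

End InnerFacts2.

(** * Positive matrices and contractions *)

Section Adjoint.
Context {R : realType}.
Local Notation C := R[i].

Lemma ctmxE m n (A : 'M[C]_(m, n)) i j : A ^t* i j = (A j i)^*.
Proof. by rewrite !mxE. Qed.

Lemma ctmxM m n p (A : 'M[C]_(m, n)) (B : 'M[C]_(n, p)) : (A *m B) ^t* = B ^t* *m A ^t*.
Proof. by rewrite trmx_mul map_mxM. Qed.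

Lemma ctmxD m n (A B : 'M[C]_(m, n)) : (A + B) ^t* = A ^t* + B ^t*.
Proof. by rewrite linearD map_mxD. Qed.

Lemma ctmxN m n (A : 'M[C]_(m, n)) : (- A) ^t* = - A ^t*.
Proof. by rewrite linearN map_mxN. Qed.

Lemma ctmxB m n (A B : 'M[C]_(m, n)) : (A - B) ^t* = A ^t* - B ^t*.
Proof. by rewrite ctmxD ctmxN. Qed.

Lemma ctmxZ m n (c : C) (A : 'M[C]_(m, n)) : (c *: A) ^t* = c^* *: A ^t*.
Proof. by rewrite linearZ map_mxZ. Qed.

Lemma ctmx1 n : (1%:M : 'M[C]_n) ^t* = 1%:M.
Proof. by rewrite trmx1 map_mx1. Qed.

Lemma ctmx0 m n : (0 : 'M[C]_(m, n)) ^t* = 0.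
Proof. by rewrite trmx0 map_mx0. Qed.

Lemma tr_adj n (A : 'M[C]_n) : \tr (A ^t*) = (\tr A)^*.
Proof. by rewrite /mxtrace rmorph_sum; apply: eq_bigr => i _; rewrite ctmxE. Qed.

Lemma fro2E m n (A : 'M[C]_(m, n)) : (fro2 A)%:C%C = \tr (A ^t* *m A).
Proof.
rewrite -frodE /frod /fro2 rmorph_sum; apply: eq_bigr => i _; rewrite rmorph_sum.
by apply: eq_bigr => j _; rewrite mulrC mul_conj_real.
Qed.

Lemma fro2Re m n (A : 'M[C]_(m, n)) : fro2 A = complex.Re (\tr (A ^t* *m A)).
Proof. by rewrite -fro2E. Qed.

Lemma fro2_ge0 m n (A : 'M[C]_(m, n)) : 0 <= fro2 A.
Proof. by apply: sumr_ge0 => i _; apply: sumr_ge0 => j _; exact: sqr_ge0. Qed.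

Lemma fro2_0 m n (A : 'M[C]_(m, n)) : fro2 A = 0 -> A = 0.
Proof. by move=> h; apply: fro2_eq0; rewrite frodE -fro2E h. Qed.

Lemma fro2_entry m n (A : 'M[C]_(m, n)) i j : normc (A i j) ^+ 2 <= fro2 A.
Proof.
rewrite /fro2 (bigD1 i)//= (bigD1 j)//= -addrA lerDl addr_ge0//.
  by apply: sumr_ge0 => *; exact: sqr_ge0.
by apply: sumr_ge0 => *; apply: sumr_ge0 => *; exact: sqr_ge0.
Qed.

Lemma fro2_lin m n (A H : 'M[C]_(m, n)) (e : R) :
  fro2 (A + e%:C%C *: H) = fro2 A + 2 * e * complex.Re (\tr (A ^t* *m H)) + e ^+ 2 * fro2 H.
Proof.
rewrite -frodE /frod /fro2 raddf_sum mulr_sumr mulr_sumr -!big_split; apply: eq_bigr => i _ /=.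
rewrite raddf_sum mulr_sumr mulr_sumr -!big_split; apply: eq_bigr => j _ /=.
rewrite !mxE Re_conjD !normc_sqr; case: (A i j) => a b; case: (H i j) => c d.
rewrite /Num.conj /=; ring.
Qed.

(** A first-order condition: were the derivative negative, the linear term in [fro2_lin] would win
    for small [e]. The explicit [e] makes the quadratic term at most half of the linear one. *)
Lemma frod_ge (m n : nat) (A H : 'M[C]_(m, n)) (x : R) :
  (forall e : R, 0 < e -> e < 1 -> fro2 A <= fro2 (A + (x * e)%:C%C *: H)) ->
  0 <= x * complex.Re (\tr (A ^t* *m H)).
Proof.
move=> h; rewrite leNgt; apply/negP => neg.
set t := complex.Re _ in neg *.
have H0 := fro2_ge0 H; pose K := x ^+ 2 * fro2 H.
have K0 : 0 <= K by rewrite mulr_ge0 ?sqr_ge0.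
pose e := - (x * t) / (K + 1 - x * t).
have d0 : 0 < K + 1 - x * t by lra.
have e0 : 0 < e by rewrite divr_gt0// oppr_gt0.
have e1 : e < 1 by rewrite ltr_pdivrMr// mul1r; lra.
have := h e e0 e1; rewrite fro2_lin -/t.
rewrite (_ : 2 * (x * e) * t = e * (2 * (x * t))); last by ring.
rewrite (_ : (x * e) ^+ 2 * fro2 H = e * (e * K)); last by rewrite /K; ring.
rewrite -addrA -mulrDr lerDl pmulr_rge0//.
have : e * K <= - (x * t).
  by rewrite /e mulrAC ler_pdivrMr// ler_wpM2l; lra.
lra.
Qed.

Definition psd n (A : 'M[C]_n) := A ^t* = A /\ forall x : 'cV[C]_n, 0 <= complex.Re (\tr (x ^t* *m A *m x)).

Lemma psd_factor n (A : 'M[C]_n) : psd A -> exists V : 'M[C]_n, A = V *m V ^t*.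
Proof.
move=> [hA pA].
have nA : A \is normalmx by apply/normalmxP; rewrite hA.
have /orthomx_spectralP := nA; set P := spectralmx A; set D := spectral_diag A => eA.
have uP : P \is unitarymx by exact: spectral_unitarymx.
have PP : P *m P ^t* = 1%:M by apply/unitarymxP.
rewrite (invmx_unitary uP) in eA.
have DE : diag_mx D = P *m A *m P ^t*.
  by rewrite eA !mulmxA PP mul1mx -mulmxA PP mulmx1.
have Dr i : 0 <= complex.Re (D 0 i) /\ complex.Im (D 0 i) = 0.
  have e : D 0 i = \tr (((row i P) ^t*) ^t* *m A *m (row i P) ^t*).
    rewrite trmxCK; have := congr1 (fun M : 'M[C]_n => M i i) DE; rewrite !mxE eqxx mulr1n => ->.
    rewrite /mxtrace big_ord1 mxE; apply: eq_bigr => j _; rewrite !mxE; congr (_ * _).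
    by apply: eq_bigr => l _; rewrite !mxE.
  split; first by rewrite e; exact: pA.
  have : (D 0 i)^* = D 0 i.
    rewrite {1}e -tr_adj !ctmxM !trmxCK hA mulmxA e trmxCK; congr (\tr _).
  by case: (D 0 i) => a b; rewrite /Num.conj /= => -[]; lra.
pose s i := Num.sqrt (complex.Re (D 0 i)).
pose S : 'rV[C]_n := \row_i (s i)%:C%C.
have SS : diag_mx S *m (diag_mx S) ^t* = diag_mx D.
  rewrite tr_diag_mx map_diag_mx mulmx_diag; congr diag_mx; apply/rowP => i; rewrite !mxE.
  rewrite mul_conj_real normc_real real_normK ?num_real// sqr_sqrtr ?(Dr i).1//.
  by case: (D 0 i) (Dr i).2 => a b /= ->.
exists (P ^t* *m diag_mx S).
by rewrite ctmxM trmxCK mulmxA -(mulmxA (P ^t*)) SS.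
Qed.

Lemma sub_coisometry p q r (M : 'M[C]_(p, q)) (Q : 'M[C]_(r, q)) :
  Q *m Q ^t* = 1%:M -> (M <= Q)%MS -> M *m Q ^t* *m Q = M.
Proof. by move=> QQ /submxP[D ->]; rewrite -(mulmxA D) QQ mulmx1. Qed.

(** Gram-Schmidt gives an orthonormal basis [Q] of the row space of [M]; then [U = M Q^*] has full
    column rank, hence a left inverse. *)
Lemma row_orthonormal p q (M : 'M[C]_(p, q)) : exists r (U : 'M[C]_(p, r)) (Q : 'M[C]_(r, q))
    (U' : 'M[C]_(r, p)),
  [/\ M = U *m Q, Q *m Q ^t* = 1%:M, U' *m U = 1%:M & (r <= p)%N].
Proof.
have rq : (\rank M <= q)%N by exact: rank_leq_col.
pose Q := schmidt (row_base M).
have QQ : Q *m Q ^t* = 1%:M by apply/unitarymxP; exact: schmidt_unitarymx.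
have MQ : (M <= Q)%MS.
  by apply: submx_trans (schmidt_sub _); rewrite eq_row_base.
have ME : M = (M *m Q ^t*) *m Q.
  by rewrite sub_coisometry.
have fU : row_full (M *m Q ^t*).
  rewrite /row_full eqn_leq rank_leq_col /=; rewrite {1}ME; exact: mxrankM_maxl.
exists (\rank M), (M *m Q ^t*), Q, (pinvmx (M *m Q ^t*)); split=> //.
- exact: mulVpmx.
- exact: rank_leq_row.
Qed.

Definition mxcontraction m n (U : 'M[C]_(m, n)) := forall l (x : 'M[C]_(n, l)), fro2 (U *m x) <= fro2 x.

Lemma coisometry_contraction r q (Q : 'M[C]_(r, q)) : Q *m Q ^t* = 1%:M -> mxcontraction Q.
Proof.
move=> QQ l x; rewrite -subr_ge0.
have -> : fro2 x - fro2 (Q *m x) = fro2 (x - Q ^t* *m (Q *m x)).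
  rewrite !fro2Re -raddfB /=; congr (complex.Re _).
  rewrite ctmxB !ctmxM trmxCK mulmxBl !mulmxBr -!mulmxA (mulmxA Q (Q ^t*)) QQ mul1mx.
  by rewrite subrr subr0 [RHS]raddfB.
exact: fro2_ge0.
Qed.

Lemma isometry_fro2 r q l (J : 'M[C]_(q, r)) (x : 'M[C]_(r, l)) : J ^t* *m J = 1%:M -> fro2 (J *m x) = fro2 x.
Proof. by move=> JJ; rewrite !fro2Re ctmxM mulmxA -(mulmxA _ (J ^t*)) JJ mulmx1. Qed.

(** Write [M1 = Q^* Cc] with [Cc] right invertible. Equality of the Gram matrices makes [J = M2 Cc']
    an isometry with [J Cc = M2], and [U = J Q] has a contractive adjoint. *)
Lemma douglas p q n (M1 : 'M[C]_(p, n)) (M2 : 'M[C]_(q, n)) : M1 ^t* *m M1 = M2 ^t* *m M2 ->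
  exists2 U : 'M[C]_(q, p), mxcontraction (U ^t*) & U *m M1 = M2.
Proof.
move=> MM; have [r [U0 [Q [U' [E QQ UU _]]]]] := row_orthonormal (M1 ^t*).
have E1 : M1 = Q ^t* *m U0 ^t* by rewrite -ctmxM -E trmxCK.
pose Cc := U0 ^t*; pose Cc' := U' ^t*.
have CC : Cc *m Cc' = 1%:M by rewrite /Cc /Cc' -ctmxM UU ctmx1.
have M11 : M1 ^t* *m M1 = Cc ^t* *m Cc.
  by rewrite E1 ctmxM !trmxCK mulmxA -(mulmxA U0 Q) QQ mulmx1.
pose J := M2 *m Cc'.
have JJ : J ^t* *m J = 1%:M.
  rewrite ctmxM mulmxA -(mulmxA (Cc' ^t*)) -MM M11 mulmxA -mulmxA CC mulmx1.
  by rewrite -ctmxM CC ctmx1.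
have JC : J *m Cc = M2.
  apply/eqP; rewrite -subr_eq0; apply/eqP; apply: fro2_0.
  have -> : J *m Cc - M2 = M2 *m (Cc' *m Cc - 1%:M) by rewrite mulmxBr mulmx1 /J mulmxA.
  rewrite fro2Re ctmxM mulmxA -(mulmxA _ (M2 ^t*)) -MM M11 mulmxA -mulmxA.
  have -> : Cc *m (Cc' *m Cc - 1%:M) = 0 by rewrite mulmxBr mulmxA CC mul1mx mulmx1 subrr.
  by rewrite mulmx0 linear0.
exists (J *m Q).
  have JJ' : J ^t* *m (J ^t*) ^t* = 1%:M by rewrite trmxCK.
  move=> l x; rewrite ctmxM -mulmxA isometry_fro2; first exact: coisometry_contraction JJ' _ _.
  by rewrite trmxCK.
by rewrite E1 -mulmxA (mulmxA Q) QQ mul1mx JC.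
Qed.

End Adjoint.

(** * Duality and commutants in finite dimension *)

Section Optimize.
Context {R : realType} (p q : nat).
Local Notation C := R[i].
Local Notation M := 'M[C]_(p, q).
Implicit Types (f g : M -> R).

(** Matrices are coded as real row vectors, where boxes are compact; [cont] is continuity read
    through this code. *)
Definition dec (u : 'rV[R]_(p * q + p * q)) : M :=
  \matrix_(i, j) Complex (u 0 (lshift _ (mxvec_index i j))) (u 0 (rshift _ (mxvec_index i j))).

Definition enc (A : M) : 'rV[R]_(p * q + p * q) :=
  row_mx (mxvec (map_mx (@complex.Re R) A)) (mxvec (map_mx (@complex.Im R) A)).

Lemma encK A : dec (enc A) = A.
Proof.
apply/matrixP => i j; rewrite mxE /enc row_mxEl row_mxEr !mxvecE !mxE.
by case: (A i j).
Qed.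

Definition cont f := continuous (fun u => f (dec u)).

Lemma cont_cst (c : R) : cont (fun=> c).
Proof. by move=> u; exact: cst_continuous. Qed.

Lemma contD f g : cont f -> cont g -> cont (fun A => f A + g A).
Proof. by move=> cf cg u; apply: continuousD; [exact: (cf u)|exact: (cg u)]. Qed.

Lemma contM f g : cont f -> cont g -> cont (fun A => f A * g A).
Proof. by move=> cf cg u; apply: continuousM; [exact: (cf u)|exact: (cg u)]. Qed.

Lemma contN f : cont f -> cont (fun A => - f A).
Proof. by move=> cf u; apply: continuousN; exact: (cf u). Qed.

Lemma cont_sum (I : Type) (s : seq I) (f : I -> M -> R) : (forall i, cont (f i)) ->
  cont (fun A => \sum_(i <- s) f i A).
Proof.
move=> h; elim: s => [|i s IH].
  have -> : (fun A => \sum_(i <- [::]) f i A) = fun=> 0 by apply/funext => A; rewrite big_nil.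
  exact: cont_cst.
have -> : (fun A => \sum_(j <- i :: s) f j A) = fun A => f i A + \sum_(j <- s) f j A.
  by apply/funext => A; rewrite big_cons.
exact: contD.
Qed.

Variant mcont m n (F : M -> 'M[C]_(m, n)) : Prop := MCont of
  forall i j, cont (fun A => complex.Re (F A i j)) /\ cont (fun A => complex.Im (F A i j)).

Lemma mcontE m n (F : M -> 'M[C]_(m, n)) : mcont F ->
  forall i j, cont (fun A => complex.Re (F A i j)) /\ cont (fun A => complex.Im (F A i j)).
Proof. by case. Qed.

Lemma mcont_id : mcont (fun A => A).
Proof.
split => i j; split => u; rewrite /dec.
  by under eq_fun do rewrite mxE /=; exact: coord_continuous.
by under eq_fun do rewrite mxE /=; exact: coord_continuous.
Qed.

Lemma mcont_cst m n (A : 'M[C]_(m, n)) : mcont (fun=> A).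
Proof. by split => i j; split; exact: cont_cst. Qed.

Lemma mcontD m n (F G : M -> 'M[C]_(m, n)) : mcont F -> mcont G -> mcont (fun A => F A + G A).
Proof.
move=> hF hG; split => i j; have [f1 f2] := mcontE hF i j; have [g1 g2] := mcontE hG i j; split.
  have -> : (fun A => complex.Re ((F A + G A) i j)) = fun A => complex.Re (F A i j) + complex.Re (G A i j).
    by apply/funext => A; rewrite mxE raddfD.
  exact: contD.
have -> : (fun A => complex.Im ((F A + G A) i j)) = fun A => complex.Im (F A i j) + complex.Im (G A i j).
  by apply/funext => A; rewrite mxE raddfD.
exact: contD.
Qed.

Lemma mcont_mul m n l (F : M -> 'M[C]_(m, n)) (G : M -> 'M[C]_(n, l)) :
  mcont F -> mcont G -> mcont (fun A => F A *m G A).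
Proof.
move=> hF hG; split => i j; split.
  have -> : (fun A => complex.Re ((F A *m G A) i j)) = fun A => \sum_n (complex.Re (F A i n) * complex.Re (G A n j)
      + - (complex.Im (F A i n) * complex.Im (G A n j))).
    apply/funext => A; rewrite mxE raddf_sum; apply: eq_bigr => a _.
    by case: (F A i a) (G A a j) => [x y] [z w].
  apply: cont_sum => a; have [f1 f2] := mcontE hF i a; have [g1 g2] := mcontE hG a j.
  by apply: contD; [exact: contM|apply: contN; exact: contM].
have -> : (fun A => complex.Im ((F A *m G A) i j)) = fun A => \sum_n (complex.Re (F A i n) * complex.Im (G A n j)
    + (complex.Im (F A i n) * complex.Re (G A n j))).
  apply/funext => A; rewrite mxE raddf_sum; apply: eq_bigr => a _.
  by case: (F A i a) (G A a j) => [x y] [z w].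
apply: cont_sum => a; have [f1 f2] := mcontE hF i a; have [g1 g2] := mcontE hG a j.
by apply: contD; exact: contM.
Qed.

Lemma mcont_adj m n (F : M -> 'M[C]_(m, n)) : mcont F -> mcont (fun A => (F A) ^t*).
Proof.
move=> hF; split => i j; have [f1 f2] := mcontE hF j i; split.
  have -> : (fun A => complex.Re ((F A)^t* i j)) = fun A => complex.Re (F A j i).
    by apply/funext => A; rewrite ctmxE; case: (F A j i).
  exact: f1.
have -> : (fun A => complex.Im ((F A)^t* i j)) = fun A => - complex.Im (F A j i).
  by apply/funext => A; rewrite ctmxE; case: (F A j i).
exact: contN.
Qed.

Lemma mcont_reindex m n m' n' (F : M -> 'M[C]_(m, n)) (G : M -> 'M[C]_(m', n')) a b :
  mcont F -> (forall A i j, G A i j = F A (a i) (b j)) -> mcont G.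
Proof.
move=> hF E; split => i j; have [f1 f2] := mcontE hF (a i) (b j); split.
  by have -> : (fun A => complex.Re (G A i j)) = fun A => complex.Re (F A (a i) (b j)) by apply/funext => A; rewrite E.
by have -> : (fun A => complex.Im (G A i j)) = fun A => complex.Im (F A (a i) (b j)) by apply/funext => A; rewrite E.
Qed.

Lemma cont_fro2 m n (F : M -> 'M[C]_(m, n)) : mcont F -> cont (fun A => fro2 (F A)).
Proof.
move=> hF; apply: cont_sum => i; apply: cont_sum => j; have [f1 f2] := mcontE hF i j.
have -> : (fun A => normc (F A i j) ^+ 2) = fun A => complex.Re (F A i j) * complex.Re (F A i j)
     + complex.Im (F A i j) * complex.Im (F A i j).
  by apply/funext => A; rewrite normc_sqr !expr2.
by apply: contD; exact: contM.
Qed.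

Lemma cont_tr n (F : M -> 'M[C]_n) : mcont F ->
  cont (fun A => complex.Re (\tr (F A))) /\ cont (fun A => complex.Im (\tr (F A))).
Proof.
move=> hF; split.
  have -> : (fun A => complex.Re (\tr (F A))) = fun A => \sum_i complex.Re (F A i i).
    by apply/funext => A; rewrite raddf_sum.
  by apply: cont_sum => i; case: (mcontE hF i i).
have -> : (fun A => complex.Im (\tr (F A))) = fun A => \sum_i complex.Im (F A i i).
  by apply/funext => A; rewrite raddf_sum.
by apply: cont_sum => i; case: (mcontE hF i i).
Qed.

Definition box (r : R) : set M := [set A | forall i j, normc (A i j) <= r].

Let ubox (r : R) : set 'rV[R]_(p * q + p * q) := [set u | forall i, `[- r, r]%classic (u 0 i)].

Lemma enc_box r A : box r A -> ubox r (enc A).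
Proof.
move=> h i; rewrite /= in_itv /= -ler_norml /enc mxE.
case: fintype.split => a; case/mxvec_indexP: a => s t; rewrite mxvecE mxE; apply: le_trans (h s t).
  exact: Re_le_normc.
exact: Im_le_normc.
Qed.

Lemma max_attained (I : Type) (h : I -> M -> R) f (r : R) A0 : cont f -> (forall i, cont (h i)) ->
  (forall i, h i A0 <= 0) -> (forall A, (forall i, h i A <= 0) -> box r A) ->
  exists2 A, forall i, h i A <= 0 & forall A', (forall i, h i A' <= 0) -> f A' <= f A.
Proof.
move=> cf ch h0 hb.
pose S : set 'rV[R]_(p * q + p * q) := [set u | forall i, h i (dec u) <= 0] `&` ubox r.
have cS : compact S.
  apply: (@subclosed_compact _ _ (ubox r)); last by move=> u [].
    apply: closedI; last first.
      rewrite (_ : ubox r = \bigcap_i [set u | `[- r, r]%classic (u 0 i)]); last first.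
        by apply/seteqP; split => [u hu i _|u hu i]; exact: hu.
      apply: closed_bigI => i _.
      apply: (@preimage_closed _ _ (fun u : 'rV[R]_(p * q + p * q) => u 0 i)).
        by move=> u _; exact: coord_continuous.
      exact: interval_closed.
    rewrite (_ : [set u | _] = \bigcap_i [set u | h i (dec u) <= 0]); last first.
      by apply/seteqP; split => [u hu i _|u hu i]; exact: hu.
    apply: closed_bigI => i _.
    apply: (@preimage_closed _ _ (fun u => h i (dec u)) [set x | x <= 0]).
      by move=> u _; exact: (ch i u).
    exact: closed_le.
  exact: (rV_compact (A := fun=> `[- r, r]%classic) (fun=> @segment_compact R _ _)).
have Se A : (forall i, h i A <= 0) -> S (enc A).
  by move=> hA; split; [move=> i /=; rewrite encK|apply: enc_box; exact: hb].
have [|u] := @compact_EVT_max _ R (fun u => f (dec u)) S _ cS (continuous_subspaceT cf).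
  by exists (enc A0); exact: Se.
rewrite inE => -[Su _] hu; exists (dec u) => // A' hA'.
by have := hu (enc A'); rewrite encK; apply; rewrite inE; exact: Se.
Qed.

End Optimize.

Section Duality.
Context {R : realType}.
Local Notation C := R[i].

Lemma adj_block m n p q (A : 'M[C]_(m, p)) (B : 'M[C]_(m, q)) (D : 'M[C]_(n, p)) (E : 'M[C]_(n, q)) :
  (block_mx A B D E) ^t* = block_mx (A ^t*) (D ^t*) (B ^t*) (E ^t*).
Proof. by rewrite tr_block_mx map_block_mx. Qed.

Lemma adj_col m n p (A : 'M[C]_(m, p)) (B : 'M[C]_(n, p)) : (col_mx A B) ^t* = row_mx (A ^t*) (B ^t*).
Proof. by rewrite tr_col_mx map_row_mx. Qed.

Lemma normc_le_mx m n p (A : 'M[C]_(m, n)) (B : 'M[C]_(n, p)) (a b : R) :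
  (forall i j, normc (A i j) <= a) -> (forall i j, normc (B i j) <= b) ->
  0 <= a -> forall i j, normc ((A *m B) i j) <= n%:R * (a * b).
Proof.
move=> hA hB a0 i j; rewrite mxE; apply: (le_trans (normc_sum _ _ _)).
apply: (@le_trans _ _ (\sum_(l < n) a * b)); last by rewrite sumr_const card_ord mulr_natl.
by apply: ler_sum => l _; rewrite normcM ler_pM ?normc_ge0.
Qed.

Lemma mx_bounded m n (A : 'M[C]_(m, n)) : exists2 a : R, 0 <= a & forall i j, normc (A i j) <= a.
Proof.
exists (\sum_i \sum_j normc (A i j)).
  by apply: sumr_ge0 => i _; apply: sumr_ge0 => j _; exact: normc_ge0.
move=> i j; rewrite (bigD1 i)//= (bigD1 j)//= -addrA lerDl addr_ge0//.
  by apply: sumr_ge0 => *; exact: normc_ge0.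
by apply: sumr_ge0 => *; apply: sumr_ge0 => *; exact: normc_ge0.
Qed.

Lemma mcont_block p q m n m' n' (A : 'M[C]_(p, q) -> 'M[C]_(m, n)) (B : 'M[C]_(p, q) -> 'M[C]_(m, n'))
  (D : 'M[C]_(p, q) -> 'M[C]_(m', n)) (E : 'M[C]_(p, q) -> 'M[C]_(m', n')) :
  mcont A -> mcont B -> mcont D -> mcont E ->
  mcont (fun Z => block_mx (A Z) (B Z) (D Z) (E Z)).
Proof.
move=> hA hB hD hE; apply: MCont => i j.
case: (split_ordP i) => i' ->; case: (split_ordP j) => j' ->.
- have [h1 h2] := mcontE hA i' j'; split.
    by have -> : (fun Z => complex.Re (block_mx (A Z) (B Z) (D Z) (E Z) (lshift _ i') (lshift _ j'))) =
      fun Z => complex.Re (A Z i' j') by apply/funext => Z; rewrite block_mxEul.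
  by have -> : (fun Z => complex.Im (block_mx (A Z) (B Z) (D Z) (E Z) (lshift _ i') (lshift _ j'))) =
    fun Z => complex.Im (A Z i' j') by apply/funext => Z; rewrite block_mxEul.
- have [h1 h2] := mcontE hB i' j'; split.
    by have -> : (fun Z => complex.Re (block_mx (A Z) (B Z) (D Z) (E Z) (lshift _ i') (rshift _ j'))) =
      fun Z => complex.Re (B Z i' j') by apply/funext => Z; rewrite block_mxEur.
  by have -> : (fun Z => complex.Im (block_mx (A Z) (B Z) (D Z) (E Z) (lshift _ i') (rshift _ j'))) =
    fun Z => complex.Im (B Z i' j') by apply/funext => Z; rewrite block_mxEur.
- have [h1 h2] := mcontE hD i' j'; split.
    by have -> : (fun Z => complex.Re (block_mx (A Z) (B Z) (D Z) (E Z) (rshift _ i') (lshift _ j'))) =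
      fun Z => complex.Re (D Z i' j') by apply/funext => Z; rewrite block_mxEdl.
  by have -> : (fun Z => complex.Im (block_mx (A Z) (B Z) (D Z) (E Z) (rshift _ i') (lshift _ j'))) =
    fun Z => complex.Im (D Z i' j') by apply/funext => Z; rewrite block_mxEdl.
- have [h1 h2] := mcontE hE i' j'; split.
    by have -> : (fun Z => complex.Re (block_mx (A Z) (B Z) (D Z) (E Z) (rshift _ i') (rshift _ j'))) =
      fun Z => complex.Re (E Z i' j') by apply/funext => Z; rewrite block_mxEdr.
  by have -> : (fun Z => complex.Im (block_mx (A Z) (B Z) (D Z) (E Z) (rshift _ i') (rshift _ j'))) =
    fun Z => complex.Im (E Z i' j') by apply/funext => Z; rewrite block_mxEdr.
Qed.

Lemma mcontN p q m n (F : 'M[C]_(p, q) -> 'M[C]_(m, n)) : mcont F -> mcont (fun A => - F A).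
Proof.
move=> hF; have := mcont_mul (mcont_cst p q ((-1)%:M)) hF.
have -> // : (fun A => (-1)%:M *m F A) = (fun A => - F A).
by apply/funext => A; rewrite mul_scalar_mx scaleN1r.
Qed.

Lemma mxBE m n (A B : 'M[C]_(m, n)) i j : (A - B) i j = A i j - B i j.
Proof. by rewrite !mxE. Qed.

Lemma mxDE m n (A B : 'M[C]_(m, n)) i j : (A + B) i j = A i j + B i j.
Proof. by rewrite mxE. Qed.

Lemma diag_ge m n (Y : 'M[C]_(m, n)) a b : normc (Y a b) ^+ 2 <= normc ((Y *m Y ^t*) a a).
Proof.
have -> : (Y *m Y ^t*) a a = (\sum_j normc (Y a j) ^+ 2)%:C%C.
  by rewrite mxE rmorph_sum; apply: eq_bigr => j _; rewrite ctmxE mul_conj_real.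
rewrite normc_real ger0_norm; last by apply: sumr_ge0 => *; exact: sqr_ge0.
by rewrite (bigD1 b)//= lerDl; apply: sumr_ge0 => *; exact: sqr_ge0.
Qed.

Lemma le_add3 (x y z : R) : 0 <= x -> 0 <= y -> 0 <= z ->
  [/\ x + 1 <= x + 1 + (y + 1) + z, y + 1 <= x + 1 + (y + 1) + z & z <= x + 1 + (y + 1) + z].
Proof. by move=> *; split; lra. Qed.

Lemma sqr_le_le (x d : R) : 0 <= d -> x ^+ 2 <= d -> x <= d + 1.
Proof. by move=> d0 h; rewrite leNgt; apply/negP => h1; nra. Qed.

Variables (N k : nat) (T0 : 'M[C]_N) (J1 J2 : 'M[C]_(N, k)) (J1' J2' : 'M[C]_(k, N)) (g : R)
  (P1 : 'M[C]_(k, N)) (P2 : 'M[C]_(N, k)).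

Let L X := J1 *m X *m J1' + J2 *m X *m J2'.

Hypothesis PL : forall X, P1 *m L X *m P2 = X.

Let LD (X Y : 'M[C]_k) : L (X + Y) = L X + L Y.
Proof. by rewrite /L !mulmxDr !mulmxDl addrACA. Qed.

Let LZ (c : C) (X : 'M[C]_k) : L (c *: X) = c *: L X.
Proof. by rewrite /L scalerDr -!scalemxAr -!scalemxAl. Qed.

(* For [0 < g], positive semidefinite if and only if [T0 + L X] has
   norm at most [g]. *)
Definition pickM (X : 'M[C]_k) : 'M[C]_(N + N) :=
  block_mx (g%:C%C%:M) ((T0 + L X) ^t*) (T0 + L X) (g%:C%C%:M).

Definition dirM (X : 'M[C]_k) : 'M[C]_(N + N) := block_mx 0 ((L X) ^t*) (L X) 0.

Lemma pickM_lin (X Y : 'M[C]_k) (e : R) : pickM (X + e%:C%C *: Y) = pickM X + e%:C%C *: dirM Y.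
Proof.
rewrite /pickM /dirM scale_block_mx add_block_mx !scaler0 !addr0; congr block_mx.
  by rewrite LD LZ addrA (ctmxD (T0 + L X)) (ctmxZ e%:C%C (L Y)) conj_realC.
by rewrite LD LZ addrA.
Qed.

Lemma pickM_herm X : (pickM X) ^t* = pickM X.
Proof.
by rewrite /pickM adj_block trmxCK tr_scalar_mx map_scalar_mx /= conj_realC.
Qed.

(** The pairs range over an unbounded set, but those at least as good as [(0, 0)] are bounded: the
    diagonal of [pickM X] is independent of [X], which bounds the rows of [Y]; then the lower left
    block bounds [L X], and [PL] recovers [X]. *)
Lemma pick_min : exists X (Y : 'M[C]_(N + N)), forall X' (Y' : 'M[C]_(N + N)),
  fro2 (pickM X - Y *m Y ^t*) <= fro2 (pickM X' - Y' *m Y' ^t*).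
Proof.
pose n2 := (N + N)%N.
(* [max_attained] has a single matrix variable, so [X] and [Y] become the diagonal blocks of one
   matrix; the penalty keeps the other two blocks bounded. *)
pose f (Z : 'M[C]_(k + n2)) := fro2 (pickM (ulsubmx Z) - drsubmx Z *m (drsubmx Z) ^t*) +
  (fro2 (ursubmx Z) + fro2 (dlsubmx Z)).
pose d0 := fro2 (pickM 0); have d00 : 0 <= d0 by exact: fro2_ge0.
have cul : mcont (fun Z : 'M[C]_(k + n2) => ulsubmx Z).
  by apply: (mcont_reindex (a := lshift n2) (b := lshift n2) (mcont_id _ _)) => A i j; rewrite !mxE.
have cdr : mcont (fun Z : 'M[C]_(k + n2) => drsubmx Z).
  by apply: (mcont_reindex (a := @rshift k n2) (b := @rshift k n2) (mcont_id _ _)) => A i j; rewrite !mxE.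
have cur : mcont (fun Z : 'M[C]_(k + n2) => ursubmx Z).
  by apply: (mcont_reindex (a := lshift n2) (b := @rshift k n2) (mcont_id _ _)) => A i j; rewrite !mxE.
have cdl : mcont (fun Z : 'M[C]_(k + n2) => dlsubmx Z).
  by apply: (mcont_reindex (a := @rshift k n2) (b := lshift n2) (mcont_id _ _)) => A i j; rewrite !mxE.
have cT : mcont (fun Z : 'M[C]_(k + n2) => T0 + L (ulsubmx Z)).
  apply: mcontD; first exact: mcont_cst.
  by apply: mcontD; apply: mcont_mul; try exact: mcont_cst; apply: mcont_mul => //; exact: mcont_cst.
have cf : cont f.
  apply: contD; last by apply: contD; exact: cont_fro2.
  apply: cont_fro2; apply: mcontD.
    by apply: mcont_block; try exact: mcont_cst; [exact: mcont_adj|].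
  by apply: mcontN; apply: mcont_mul => //; exact: mcont_adj.
have f0 X (Y : 'M[C]_n2) : f (block_mx X 0 0 Y) = fro2 (pickM X - Y *m Y ^t*).
  rewrite /f block_mxKul block_mxKdr block_mxKur block_mxKdl.
  have -> : fro2 (0 : 'M[C]_(k, n2)) = 0 by rewrite fro2Re mulmx0 linear0.
  have -> : fro2 (0 : 'M[C]_(n2, k)) = 0 by rewrite fro2Re mulmx0 linear0.
  by rewrite !addr0.
have [tb tb0 htb] := mx_bounded T0.
have [p1 p10 hp1] := mx_bounded P1.
have [p2 p20 hp2] := mx_bounded P2.
pose c := normc g%:C%C + (d0 + 1); have c0 : 0 <= c by rewrite /c !addr_ge0 ?normc_ge0.
pose tt := (d0 + 1) + n2%:R * ((c + 1) * (c + 1)) + tb.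
have tt0 : 0 <= tt by rewrite /tt !addr_ge0// mulr_ge0// mulr_ge0// addr_ge0.
pose xx := N%:R * (N%:R * (p1 * tt) * p2).
have xx0 : 0 <= xx by rewrite /xx !mulr_ge0.
pose r := (d0 + 1) + (c + 1) + xx.
have hbox A : f A - d0 <= 0 -> box r A.
  rewrite subr_le0 => hf.
  have [h1 h2 h3] : [/\ fro2 (pickM (ulsubmx A) - drsubmx A *m (drsubmx A) ^t*) <= d0,
      fro2 (ursubmx A) <= d0 & fro2 (dlsubmx A) <= d0].
    have i1 := fro2_ge0 (pickM (ulsubmx A) - drsubmx A *m (drsubmx A) ^t*).
    have i2 := fro2_ge0 (ursubmx A); have i3 := fro2_ge0 (dlsubmx A).
    by move: hf; rewrite /f; split; lra.
  have e1 a b := sqr_le_le d00 (le_trans (fro2_entry _ a b) h1).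
  have e2 a b := sqr_le_le d00 (le_trans (fro2_entry _ a b) h2).
  have e3 a b := sqr_le_le d00 (le_trans (fro2_entry _ a b) h3).
  have diag a : normc (pickM (ulsubmx A) a a) <= normc g%:C%C.
    rewrite /pickM; case: (split_ordP a) => a' ->; rewrite ?block_mxEul ?block_mxEdr mxE eqxx mulr1n//.
  have yb a b : normc (drsubmx A a b) <= c + 1.
    apply: sqr_le_le => //.
    have : normc ((drsubmx A *m (drsubmx A) ^t*) a a) <= c.
      have := e1 a a; rewrite mxBE; have := diag a.
      move: (pickM _ a a) ((drsubmx A *m _) a a) => x y hx h.
      rewrite (_ : y = x - (x - y)); last by rewrite opprB addrC subrK. apply: (le_trans (le_normcD _ _)); rewrite normcN.
      by rewrite /c lerD.
    exact: le_trans (diag_ge _ _ _).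
  have lb a b : normc (L (ulsubmx A) a b) <= tt.
    have yb' i j : normc ((drsubmx A) ^t* i j) <= c + 1 by rewrite ctmxE normc_conj.
    have hY := normc_le_mx yb yb'.
    have h4 := hY (addr_ge0 c0 ler01) (rshift N a) (lshift N b).
    have := e1 (rshift N a) (lshift N b); rewrite mxBE /pickM block_mxEdl mxDE => h5; have h6 := htb a b.
    have -> : L (ulsubmx A) a b = (T0 a b + L (ulsubmx A) a b -
      (drsubmx A *m (drsubmx A) ^t*) (rshift N a) (lshift N b)) +
      (drsubmx A *m (drsubmx A) ^t*) (rshift N a) (lshift N b) - T0 a b.
      by rewrite subrK addrAC subrr add0r.
    apply: (le_trans (le_normcD _ _)); rewrite normcN /tt lerD//.
    by apply: (le_trans (le_normcD _ _)); rewrite lerD.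
  have xb a b : normc (ulsubmx A a b) <= xx.
    rewrite -(PL (ulsubmx A)).
    apply: normc_le_mx => //; last by rewrite !mulr_ge0.
    by apply: normc_le_mx.
  have [r1 r2 r3] : [/\ d0 + 1 <= r, c + 1 <= r & xx <= r].
    exact: le_add3.
  move=> i j; rewrite -[A]submxK.
  case: (split_ordP i) => i' ->; case: (split_ordP j) => j' ->.
  - by rewrite block_mxEul (le_trans (xb _ _)).
  - by rewrite block_mxEur (le_trans (e2 _ _)).
  - by rewrite block_mxEdl (le_trans (e3 _ _)).
  - by rewrite block_mxEdr (le_trans (yb _ _)).
have [||||A hA min] := @max_attained R _ _ unit (fun _ Z => f Z - d0) (fun Z => - f Z) r 0.
- exact: contN.
- by move=> _; apply: contD => //; exact: cont_cst.
- move=> _; rewrite -(block_mx0 _ k n2 k n2) f0 mul0mx subr0 subrr//.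
- by move=> A h; apply: hbox; exact: (h Datatypes.tt).
exists (ulsubmx A), (drsubmx A) => X' Y'.
have fA : fro2 (pickM (ulsubmx A) - drsubmx A *m (drsubmx A) ^t*) <= f A.
  by rewrite /f lerDl addr_ge0 ?fro2_ge0.
have [h|h] := leP (f (block_mx X' 0 0 Y')) d0.
  rewrite -(f0 X' Y'); apply: (le_trans fA); rewrite -lerN2; apply: min => _.
  by rewrite subr_le0.
rewrite -(f0 X' Y'); apply: (le_trans fA); apply: le_trans (ltW h).
by rewrite -subr_le0; exact: (hA Datatypes.tt).
Qed.

(* The witness is a square root of the gap between [pickM X] and the cone of
   positive matrices, taken at a pair that minimizes the distance. *)
Lemma duality : (exists X, psd (pickM X)) \/
  exists V : 'M[C]_(N + N), (forall X, complex.Re (\tr (V ^t* *m dirM X *m V)) = 0) /\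
     complex.Re (\tr (V ^t* *m pickM 0 *m V)) < 0.
Proof.
have [X [Y H]] := pick_min.
pose P := Y *m Y ^t*; pose A := pickM X - P.
have hP : P ^t* = P by rewrite /P ctmxM trmxCK.
have hA : A ^t* = A by rewrite /A ctmxB pickM_herm hP.
have psd_min (Q : 'M[C]_(N + N)) : psd Q -> fro2 A <= fro2 (pickM X - Q).
  by move=> /psd_factor[Y' ->]; exact: H.
have pP : psd P.
  split=> // x; have -> : x ^t* *m P *m x = (Y ^t* *m x) ^t* *m (Y ^t* *m x).
    by rewrite ctmxM trmxCK /P !mulmxA.
  by rewrite -fro2Re fro2_ge0.
(* First-order conditions at the minimum. [X] moves along a whole line, so that derivative is zero;
   scaling [P] up and down gives [o2], and adding a positive rank-one matrix to [P] gives [pE]. *)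
have o1 Z : complex.Re (\tr (A *m dirM Z)) = 0.
  have key (x : R) : 0 <= x * complex.Re (\tr (A ^t* *m dirM Z)).
    apply: frod_ge => e e0 e1; have := H (X + (x * e)%:C%C *: Z) Y.
    by rewrite pickM_lin -/P addrAC.
  by have := key 1; have := key (-1); rewrite hA; lra.
have o2 : complex.Re (\tr (A *m P)) = 0.
  have key (x : R) : -1 <= x -> x <= 1 -> 0 <= x * complex.Re (\tr (A ^t* *m P)).
    move=> x1 x2; apply: frod_ge => e e0 e1.
    have c0 : 0 <= 1 - x * e by nra.
    have -> : A + (x * e)%:C%C *: P = pickM X - (1 - x * e)%:C%C *: P.
      by rewrite rmorphB rmorph1 scalerBl scale1r opprB addrA addrAC.
    apply: psd_min; case: pP => _ pP; split; first by rewrite ctmxZ conj_realC hP.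
    move=> y; rewrite -scalemxAr -scalemxAl mxtraceZ.
    have := pP y; move: (\tr _) => -[a b] /= a0; rewrite mul0r subr0 mulr_ge0//.
  have := key 1 _ _; have := key (-1) _ _; rewrite hA => h1 h2.
  have := h1 ltac:(lra) ltac:(lra); have := h2 ltac:(lra) ltac:(lra); lra.
have pE : psd (- A).
  split; first by rewrite ctmxN hA.
  move=> x.
  have -> : \tr (x ^t* *m - A *m x) = \tr (A ^t* *m - (x *m x ^t*)).
    by rewrite hA mulmxN mulNmx mulmxN !raddfN /= -mulmxA mxtrace_mulC -mulmxA.
  rewrite -[complex.Re _]mul1r; apply: frod_ge => e e0 e1; rewrite mul1r.
  have -> : A + e%:C%C *: - (x *m x ^t*) = pickM X - (P + e%:C%C *: (x *m x ^t*)).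
    by rewrite scalerN opprD addrA.
  apply: psd_min; case: pP => _ pP; split; first by rewrite ctmxD ctmxZ conj_realC hP ctmxM trmxCK.
  move=> y; rewrite mulmxDr mulmxDl mxtraceD -scalemxAr -scalemxAl mxtraceZ.
  have -> : y ^t* *m (x *m x ^t*) *m y = (x ^t* *m y) ^t* *m (x ^t* *m y) by rewrite ctmxM trmxCK !mulmxA.
  rewrite -fro2E -rmorphM raddfD /= addr_ge0// mulr_ge0 ?fro2_ge0// ltW//.
have [A0|A0] := eqVneq (fro2 A) 0.
  left; exists X; have /eqP := fro2_0 A0; rewrite subr_eq0 => /eqP ->; exact: pP.
right; have [V VE] := psd_factor pE; exists V.
have trV (Z : 'M[C]_(N + N)) : \tr (V ^t* *m Z *m V) = - \tr (A *m Z).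
  by rewrite -mulmxA mxtrace_mulC -mulmxA -VE mulmxN raddfN /= mxtrace_mulC.
split=> [Z|]; first by rewrite trV raddfN /= o1 oppr0.
rewrite trV raddfN /= oppr_lt0.
have -> : pickM 0 = P + A - dirM X.
  rewrite /A addrCA subrr addr0; have := pickM_lin 0 X 1; rewrite rmorph1 !scale1r add0r => ->.
  by rewrite addrK.
have trAA : complex.Re (\tr (A *m A)) = fro2 A by rewrite fro2Re hA.
rewrite mulmxBr mulmxDr 2!raddfB 2!raddfD /= o1 o2 trAA subr0 add0r.
by rewrite lt_neqAle eq_sym A0 fro2_ge0.
Qed.

End Duality.

(** * Making the second vector of a pair injective at 0 *)

Section Commutant.
Context {R : realType}.
Local Notation C := R[i].
Variables (N k : nat) (B : 'M[C]_N) (E : 'M[C]_(k, N)) (I : Type) (T : I -> 'M[C]_N).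
Hypothesis BE : B ^t* *m B + E ^t* *m E = 1%:M.
Hypothesis TB : forall X, T X *m B = B *m T X.
Hypothesis obs : forall x : 'cV[C]_N, (forall j, E *m iter j (mulmx B) x = 0) -> x = 0.

(* Replaces [f v] by [B f v] for a unit vector [v]. If [E g v = 0], doing so to
   [f] and [g] preserves the traces [tr (g^* T X f)]; if moreover [|E g|] is
   maximal, then [E B^j g v = 0] for all [j], and [g v = 0] by observability. *)
Definition shift1 l (v : 'cV[C]_l) (f : 'M[C]_(N, l)) := f + (B *m f - f) *m (v *m v ^t*).

Lemma tr_sandwich m l r (a b : 'M[C]_(m, l)) (Y : 'M[C]_m) (P Q : 'M[C]_(l, r)) :
  \tr ((a *m P) ^t* *m Y *m (b *m Q)) = \tr (a ^t* *m Y *m b *m (Q *m P ^t*)).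
Proof. by rewrite ctmxM -!mulmxA mxtrace_mulC !mulmxA. Qed.

Lemma tr_split m l (a b c d : 'M[C]_(m, l)) (Y : 'M[C]_m) (P Q : 'M[C]_l) :
  Q *m Q ^t* = Q -> Q *m P ^t* = 0 -> P *m Q ^t* = 0 -> P *m P ^t* = P ->
  \tr ((a *m Q + c *m P) ^t* *m Y *m (b *m Q + d *m P)) =
  \tr (a ^t* *m Y *m b *m Q) + \tr (c ^t* *m Y *m d *m P).
Proof.
move=> QQ QP PQ PP.
have D1 (u v w : 'M[C]_(m, l)) : \tr ((u + v) ^t* *m Y *m w) = \tr (u ^t* *m Y *m w) + \tr (v ^t* *m Y *m w).
  by rewrite (ctmxD u v) (mulmxDl (u ^t*)) mulmxDl mxtraceD.
have D2 (u v w : 'M[C]_(m, l)) : \tr (w ^t* *m Y *m (u + v)) = \tr (w ^t* *m Y *m u) + \tr (w ^t* *m Y *m v).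
  by rewrite mulmxDr mxtraceD.
have z (A : 'M[C]_(l, l)) : \tr (A *m (0 : 'M[C]_l)) = 0 by rewrite mulmx0 mxtrace0.
have E1 := tr_sandwich a b Y Q Q; rewrite QQ in E1.
have E2 := tr_sandwich a d Y Q P; rewrite PQ z in E2.
have E3 := tr_sandwich c b Y P Q; rewrite QP z in E3.
have E4 := tr_sandwich c d Y P P; rewrite PP in E4.
have F1 := etrans (D2 (b *m Q) (d *m P) (a *m Q)) (congr2 +%R E1 E2).
have F2 := etrans (D2 (b *m Q) (d *m P) (c *m P)) (congr2 +%R E3 E4).
by apply: etrans (etrans (D1 _ _ _) (congr2 +%R F1 F2)) _; rewrite addr0 add0r.
Qed.

Lemma shift1_bil l (v : 'cV[C]_l) (f g : 'M[C]_(N, l)) (Y : 'M[C]_N) : v ^t* *m v = 1%:M ->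
  \tr ((shift1 v g) ^t* *m Y *m shift1 v f) =
  \tr (g ^t* *m Y *m f) + (\tr ((B *m g) ^t* *m Y *m (B *m f) *m (v *m v ^t*)) -
    \tr (g ^t* *m Y *m f *m (v *m v ^t*))).
Proof.
move=> vv; rewrite /shift1; set P := v *m v ^t*.
have hP : P ^t* = P by rewrite /P ctmxM trmxCK.
have PP : P *m P = P by rewrite /P mulmxA -(mulmxA v) vv mulmx1.
have split_ (h : 'M[C]_(N, l)) : h + (B *m h - h) *m P = h *m (1%:M - P) + (B *m h) *m P.
  by rewrite mulmxBl mulmxBr mulmx1 -addrA (addrC (- _)).
pose Q : 'M[C]_l := 1%:M - P.
have hQ : Q ^t* = Q by rewrite /Q ctmxB ctmx1 hP.
have QP : Q *m P = 0 by rewrite /Q mulmxBl mul1mx PP subrr.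
have PQ : P *m Q = 0 by rewrite /Q mulmxBr mulmx1 PP subrr.
have QQ : Q *m Q = Q by rewrite {2}/Q mulmxBr mulmx1 QP subr0.
rewrite !split_ -/Q tr_split ?hQ ?hP//.
rewrite {1}/Q mulmxBr mulmx1 [\tr (_ - _)]raddfB /=.
by rewrite -!addrA; congr (_ + _); rewrite addrC.
Qed.

Lemma BBE : B ^t* *m B = 1%:M - E ^t* *m E.
Proof. by rewrite -BE addrK. Qed.

(** Because [T X] commutes with [B] and [B^* B = 1 - E^* E], applying [B] to both vectors in the
    direction [v] changes the pairing only by a term containing [E g v]. *)
Lemma shift1_T l (v : 'cV[C]_l) (f g : 'M[C]_(N, l)) X : v ^t* *m v = 1%:M -> E *m g *m v = 0 ->
  \tr ((shift1 v g) ^t* *m T X *m shift1 v f) = \tr (g ^t* *m T X *m f).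
Proof.
move=> vv Egv; rewrite shift1_bil//.
have -> : (B *m g) ^t* *m T X *m (B *m f) = g ^t* *m T X *m f - (E *m g) ^t* *m (E *m T X *m f).
  rewrite !ctmxM -!mulmxA (mulmxA (T X)) TB -!mulmxA (mulmxA (B ^t*)) BBE mulmxBl mul1mx mulmxBr.
  by rewrite !mulmxA.
rewrite mulmxBl raddfB /= addrAC subrr add0r.
have -> : \tr ((E *m g)^t* *m (E *m T X *m f) *m (v *m v^t*)) = 0.
  rewrite mulmxA mxtrace_mulC !mulmxA -ctmxM Egv ctmx0 !mul0mx linear0//.
by rewrite subr0.
Qed.

Lemma shift1_le l (v : 'cV[C]_l) (f : 'M[C]_(N, l)) : v ^t* *m v = 1%:M -> fro2 (shift1 v f) <= fro2 f.
Proof.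
move=> vv; rewrite !fro2Re -[(shift1 v f)^t*]mulmx1 shift1_bil// !mulmx1.
have -> : (B *m f) ^t* *m (B *m f) = f ^t* *m f - (E *m f) ^t* *m (E *m f).
  by rewrite !ctmxM -!mulmxA (mulmxA (B ^t*)) BBE mulmxBl mul1mx mulmxBr !mulmxA.
rewrite mulmxBl raddfB /= addrAC subrr add0r raddfB /= lerBlDr lerDl.
have -> : \tr ((E *m f)^t* *m (E *m f) *m (v *m v^t*)) = \tr ((E *m f *m v) ^t* *m (E *m f *m v)).
  by rewrite (ctmxM (E *m f)) mulmxA mxtrace_mulC !mulmxA.
by rewrite -fro2Re fro2_ge0.
Qed.

Lemma shift1_E l (v : 'cV[C]_l) (g : 'M[C]_(N, l)) : v ^t* *m v = 1%:M -> E *m g *m v = 0 ->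
  fro2 (E *m shift1 v g) = fro2 (E *m g) + fro2 (E *m B *m g *m v).
Proof.
move=> vv Egv.
have -> : E *m shift1 v g = E *m g + (1 : R)%:C%C *: (E *m B *m g *m v *m v ^t*).
  by rewrite rmorph1 scale1r /shift1 mulmxDr mulmxBl mulmxBr !mulmxA Egv mul0mx subr0.
rewrite fro2_lin expr1n mul1r.
have -> : \tr ((E *m g)^t* *m (E *m B *m g *m v *m v^t*)) = 0.
  rewrite mulmxA mxtrace_mulC mulmxA -ctmxM Egv ctmx0 mul0mx linear0//.
rewrite mulr0 addr0; congr (_ + _).
rewrite !fro2Re ctmxM trmxCK -!mulmxA mxtrace_mulC.
by rewrite !mulmxA -(mulmxA _ (v^t*) v) vv mulmx1.
Qed.

Definition adm l (f g f' g' : 'M[C]_(N, l)) := [/\ fro2 f' <= fro2 f, fro2 g' <= fro2 g &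
  forall X, \tr (g' ^t* *m T X *m f') = \tr (g ^t* *m T X *m f)].

(** The admissible pairs form a compact set, given by two norm bounds and one complex equation per
    index. To fit [max_attained], each equation is written as four real inequalities. *)
Lemma adm_max l (f g : 'M[C]_(N, l)) : exists f' g', adm f g f' g' /\
  forall f'' g'', adm f g f'' g'' -> fro2 (E *m g'') <= fro2 (E *m g').
Proof.
pose tz X (Z : 'M[C]_(N + N, l)) := \tr ((dsubmx Z) ^t* *m T X *m usubmx Z).
pose t0 X := \tr (g ^t* *m T X *m f).
pose h (i : bool + I * (bool * bool)) (Z : 'M[C]_(N + N, l)) : R :=
  match i with
  | inl true => fro2 (usubmx Z) - fro2 f
  | inl false => fro2 (dsubmx Z) - fro2 g
  | inr (X, (true, true)) => complex.Re (tz X Z) - complex.Re (t0 X)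
  | inr (X, (true, false)) => - complex.Re (tz X Z) + complex.Re (t0 X)
  | inr (X, (false, true)) => complex.Im (tz X Z) - complex.Im (t0 X)
  | inr (X, (false, false)) => - complex.Im (tz X Z) + complex.Im (t0 X)
  end.
have cu : mcont (fun Z : 'M[C]_(N + N, l) => usubmx Z).
  by apply: (mcont_reindex (a := lshift N) (b := id) (mcont_id _ _)) => A i j; rewrite !mxE.
have cd : mcont (fun Z : 'M[C]_(N + N, l) => dsubmx Z).
  by apply: (mcont_reindex (a := @rshift N N) (b := id) (mcont_id _ _)) => A i j; rewrite !mxE.
have ct X : cont (fun Z => complex.Re (tz X Z)) /\ cont (fun Z => complex.Im (tz X Z)).
  apply: cont_tr; apply: mcont_mul => //; apply: mcont_mul; last exact: mcont_cst.
  exact: mcont_adj.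
have ch i : cont (h i).
  case: i => [[]|[X [[] []]]]; rewrite /h; have [h1 h2] : True /\ True by [].
  - by apply: contD; [exact: cont_fro2|exact: cont_cst].
  - by apply: contD; [exact: cont_fro2|exact: cont_cst].
  - by apply: contD; [exact: (ct X).1|exact: cont_cst].
  - by apply: contD; [apply: contN; exact: (ct X).1|exact: cont_cst].
  - by apply: contD; [exact: (ct X).2|exact: cont_cst].
  - by apply: contD; [apply: contN; exact: (ct X).2|exact: cont_cst].
have hP Z : (forall i, h i Z <= 0) <-> adm f g (usubmx Z) (dsubmx Z).
  split => [H|[h1 h2 h3] i].
    split; [by have := H (inl true); rewrite /= subr_le0|by have := H (inl false); rewrite /= subr_le0|] => X.
    have := H (inr (X, (true, true))); have := H (inr (X, (true, false))).
    have := H (inr (X, (false, true))); have := H (inr (X, (false, false))).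
    rewrite /= -/(tz X Z) -/(t0 X); case: (tz X Z) (t0 X) => [a b] [c d] /= *.
    by congr Complex; lra.
  case: i => [[]|[X [[] []]]] /=; rewrite ?subr_le0// ?/tz ?h3 ?subrr// addrC subrr//.
have box_adm Z : (forall i, h i Z <= 0) -> box (fro2 f + fro2 g + 1) Z.
  move=> /hP[h1 h2 _] i j; have f0 := fro2_ge0 f; have g0 := fro2_ge0 g.
  rewrite -[Z]vsubmxK; case: (split_ordP i) => i' ->; rewrite ?col_mxEu ?col_mxEd.
    have := sqr_le_le f0 (le_trans (fro2_entry _ i' j) h1); lra.
  have := sqr_le_le g0 (le_trans (fro2_entry _ i' j) h2); lra.
have [||||Z /hP hZ hmax] := @max_attained R _ _ _ h (fun Z => fro2 (E *m dsubmx Z)) (fro2 f + fro2 g + 1) (col_mx f g).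
- by apply: cont_fro2; apply: mcont_mul => //; exact: mcont_cst.
- exact: ch.
- by apply/hP; rewrite col_mxKu col_mxKd; split.
- exact: box_adm.
exists (usubmx Z), (dsubmx Z); split=> // f'' g'' hfg.
have := hmax (col_mx f'' g''); rewrite col_mxKd; apply; apply/hP.
by rewrite col_mxKu col_mxKd.
Qed.

Lemma adm_trans l (f g f' g' f'' g'' : 'M[C]_(N, l)) : adm f g f' g' -> adm f' g' f'' g'' -> adm f g f'' g''.
Proof.
move=> [h1 h2 h3] [k1 k2 k3]; split; [exact: le_trans h1|exact: le_trans h2|] => X.
by rewrite k3 h3.
Qed.

Lemma max_kernel l (f g f' g' : 'M[C]_(N, l)) (v : 'cV[C]_l) : v ^t* *m v = 1%:M ->
  adm f g f' g' -> (forall f'' g'', adm f g f'' g'' -> fro2 (E *m g'') <= fro2 (E *m g')) ->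
  E *m g' *m v = 0 -> g' *m v = 0.
Proof.
move=> vv.
(* The shifted pair is again admissible and still attains the maximum, so the step can be
   iterated. *)
have step : forall f' g' : 'M[C]_(N, l), adm f g f' g' ->
   (forall f'' g'', adm f g f'' g'' -> fro2 (E *m g'') <= fro2 (E *m g')) -> E *m g' *m v = 0 ->
   E *m B *m g' *m v = 0 /\ exists f1 g1, [/\ adm f g f1 g1,
     (forall f'' g'', adm f g f'' g'' -> fro2 (E *m g'') <= fro2 (E *m g1)), E *m g1 *m v = 0 &
     g1 *m v = B *m (g' *m v)].
  move=> {}f' {}g' a mx Ev.
  have a1 : adm f g (shift1 v f') (shift1 v g').
    apply: adm_trans a _; split; [exact: shift1_le|exact: shift1_le|] => X; exact: shift1_T.
  have EB : E *m B *m g' *m v = 0.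
    apply: fro2_0; apply/eqP; rewrite eq_le fro2_ge0 andbT.
    by have := mx _ _ a1; rewrite shift1_E// gerDl.
  have gv : shift1 v g' *m v = B *m (g' *m v).
    rewrite /shift1 (mulmxDl g') -(mulmxA (B *m g' - g')) -(mulmxA v) vv mulmx1 mulmxBl.
    by rewrite addrC subrK mulmxA.
  split=> //; exists (shift1 v f'), (shift1 v g'); split=> //.
    move=> f'' g'' /mx h; apply: (le_trans h); rewrite shift1_E// lerDl fro2_ge0//.
  by rewrite -mulmxA gv !mulmxA.
move=> a mx Ev; apply: obs => j.
suff H : forall j (f' g' : 'M[C]_(N, l)), adm f g f' g' ->
   (forall f'' g'', adm f g f'' g'' -> fro2 (E *m g'') <= fro2 (E *m g')) -> E *m g' *m v = 0 ->
   E *m iter j (mulmx B) (g' *m v) = 0 by exact: H a mx Ev.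
elim => [|j' IH] f1 g1 a1 mx1 Ev1; first by rewrite mulmxA.
have [_ [f2 [g2 [a2 mx2 Ev2 e2]]]] := step _ _ a1 mx1 Ev1.
by rewrite iterSr -e2; exact: IH a2 mx2 Ev2.
Qed.

Lemma unit_scale l (v : 'cV[C]_l) : v != 0 -> exists2 c : R, 0 < c & (c%:C%C *: v) ^t* *m (c%:C%C *: v) = 1%:M.
Proof.
move=> v0; have n0 : 0 < fro2 v.
  by rewrite lt_neqAle fro2_ge0 andbT eq_sym; apply/eqP => /fro2_0/eqP; rewrite (negbTE v0).
exists (Num.sqrt (fro2 v))^-1; first by rewrite invr_gt0 sqrtr_gt0.
rewrite ctmxZ conj_realC -scalemxAl -scalemxAr scalerA [v^t* *m v]mx11_scalar -rmorphM.
have -> : (v ^t* *m v) 0 0 = (fro2 v)%:C%C by rewrite fro2E /mxtrace big_ord1.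
rewrite scale_scalar_mx -rmorphM -expr2 exprVn sqr_sqrtr ?fro2_ge0// mulVf ?gt_eqF//.
Qed.

(** By [max_kernel] the kernel of [E g1] lies in that of [g1]; passing to an orthonormal basis [Q]
    of the row space of [g1] removes this kernel without changing the pairings. *)
Lemma injective_pair l (f g : 'M[C]_(N, l)) : exists l' (f' g' : 'M[C]_(N, l')),
  [/\ forall v : 'cV[C]_l', E *m g' *m v = 0 -> v = 0, fro2 f' <= fro2 f, fro2 g' <= fro2 g &
  forall X, \tr (g' ^t* *m T X *m f') = \tr (g ^t* *m T X *m f)].
Proof.
have [f1 [g1 [a1 mx1]]] := adm_max f g; case: (a1) => n1 n2 n3.
have [r [U [Q [U' [gE QQ UU _]]]]] := row_orthonormal g1.
have gQQ : g1 *m Q ^t* *m Q = g1 by rewrite gE -(mulmxA U) QQ mulmx1.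
have cQ m (h : 'M[C]_(m, l)) : fro2 (h *m Q ^t*) <= fro2 h.
  have tr m' n' (A : 'M[C]_(m', n')) : fro2 (A ^t*) = fro2 A.
    by rewrite !fro2Re trmxCK mxtrace_mulC.
  by rewrite -tr ctmxM trmxCK -(tr _ _ h); exact: coisometry_contraction.
exists r, (f1 *m Q ^t*), (g1 *m Q ^t*); split.
- move=> v; rewrite !mulmxA -(mulmxA _ (Q^t*)) => Ev.
  have gv : g1 *m (Q ^t* *m v) = 0.
    have [->|v0] := eqVneq (Q ^t* *m v) 0; first by rewrite mulmx0.
    have [c c0 cc] := unit_scale v0.
    have := max_kernel cc a1 mx1; rewrite -!scalemxAr Ev scaler0 => /(_ erefl).
    by move=> /eqP; rewrite scaler_eq0 -normc_eq0 normc_real gt_eqF ?normr_gt0 ?gt_eqF//= => /eqP.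
  have : U *m v = 0 by move: gv; rewrite gE mulmxA -(mulmxA U) QQ mulmx1.
  by move=> h; rewrite -[v]mul1mx -UU -mulmxA h mulmx0.
- exact: le_trans (cQ _ _) n1.
- exact: le_trans (cQ _ _) n2.
move=> X; rewrite -n3 tr_sandwich trmxCK mxtrace_mulC.
by rewrite -[in RHS]gQQ !ctmxM !trmxCK !mulmxA.
Qed.

End Commutant.

(** * Either a lurking isometry or a dual witness *)

Section Lifting.
Context {R : realType}.
Local Notation C := R[i].
Variables (N k : nat) (B : 'M[C]_N) (E : 'M[C]_(k, N)) (T0 : 'M[C]_N).
Variables (J1 J2 : 'M[C]_(N, k)) (J1' J2' : 'M[C]_(k, N)) (g : R) (P1 : 'M[C]_(k, N)) (P2 : 'M[C]_(N, k)).

Definition Lpar (X : 'M[C]_k) := J1 *m X *m J1' + J2 *m X *m J2'.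

Hypothesis BE : B ^t* *m B + E ^t* *m E = 1%:M.
Hypothesis TB : forall X, (T0 + Lpar X) *m B = B *m (T0 + Lpar X).
Hypothesis obs : forall x : 'cV[C]_N, (forall j, E *m iter j (mulmx B) x = 0) -> x = 0.
Hypothesis PL : forall X, P1 *m Lpar X *m P2 = X.
Hypothesis g0 : 0 < g.

Lemma LparZ (c : C) X : Lpar (c *: X) = c *: Lpar X.
Proof. by rewrite /Lpar scalerDr -!scalemxAr -!scalemxAl. Qed.

Lemma tr_quad2 l (a b : 'M[C]_(N, l)) (M11 M12 M21 M22 : 'M[C]_N) :
  \tr ((col_mx a b) ^t* *m block_mx M11 M12 M21 M22 *m col_mx a b) =
  \tr (a ^t* *m M11 *m a) + \tr (b ^t* *m M21 *m a) + (\tr (a ^t* *m M12 *m b) + \tr (b ^t* *m M22 *m b)).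
Proof.
by rewrite adj_col mul_row_block mul_row_col !mulmxDl !mxtraceD.
Qed.

Lemma Re4 (a b c d : C) :
  complex.Re (a + b + (c + d)) = complex.Re a + complex.Re b + (complex.Re c + complex.Re d).
Proof. by case: a b c d => [? ?] [? ?] [? ?] []. Qed.

Lemma ReB (u v : C) : complex.Re (u - v) = complex.Re u - complex.Re v.
Proof. by case: u v => [? ?] []. Qed.

Lemma Re_conjC (z : C) : complex.Re (z^*) = complex.Re z.
Proof. by case: z. Qed.

Lemma tr_adj3 m l (a b : 'M[C]_(m, l)) (M : 'M[C]_m) : \tr (a ^t* *m M ^t* *m b) = (\tr (b ^t* *m M *m a))^*.
Proof. by rewrite -tr_adj !ctmxM trmxCK mulmxA. Qed.

Lemma tr_scalar_quad m l (a : 'M[C]_(m, l)) (c : R) :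
  complex.Re (\tr (a ^t* *m (c%:C%C)%:M *m a)) = c * fro2 a.
Proof.
rewrite mul_mx_scalar -scalemxAl mxtraceZ -fro2E -rmorphM//.
Qed.

Lemma tr_pick l (a b : 'M[C]_(N, l)) (T : 'M[C]_N) :
  complex.Re (\tr ((col_mx a b) ^t* *m block_mx (g%:C%C%:M) (T ^t*) T (g%:C%C%:M) *m col_mx a b)) =
  g * (fro2 a + fro2 b) + 2 * complex.Re (\tr (b ^t* *m T *m a)).
Proof.
have e1 := tr_scalar_quad a g; have e2 := tr_scalar_quad b g.
have e3 := congr1 (@complex.Re R) (tr_adj3 a b T); rewrite Re_conjC in e3.
have sum (x1 x2 x3 x4 u v : R) : x1 = g * u -> x4 = g * v -> x3 = x2 ->
    x1 + x2 + (x3 + x4) = g * (u + v) + 2 * x2 by move=> -> -> ->; ring.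
by rewrite tr_quad2 Re4; exact: sum e1 e2 e3.
Qed.

(** A Schur complement: the block form is tested on [x] and [- T x / g], the minimizer in the second
    variable. *)
Lemma psd_defect (T : 'M[C]_N) : psd (block_mx (g%:C%C%:M) (T ^t*) T (g%:C%C%:M)) ->
  psd ((g ^+ 2)%:C%C%:M - T ^t* *m T).
Proof.
move=> -[_ h]; split.
  by rewrite ctmxB ctmxM trmxCK tr_scalar_mx map_scalar_mx /= conj_realC.
move=> x; pose y := (- g^-1)%:C%C *: (T *m x).
have := h (col_mx x y); rewrite tr_pick.
have -> : complex.Re (\tr (y ^t* *m T *m x)) = - g^-1 * fro2 (T *m x).
  by rewrite /y ctmxZ conj_realC -!scalemxAl mxtraceZ -mulmxA -fro2E -rmorphM.
have -> : fro2 y = g^-1 ^+ 2 * fro2 (T *m x).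
  rewrite fro2Re /y ctmxZ conj_realC -scalemxAl -scalemxAr !mxtraceZ -fro2E -!rmorphM /=; ring.
move=> h1; rewrite mulmxBr mulmxBl [\tr (_ - _)]raddfB /=.
have e1 := tr_scalar_quad x (g ^+ 2).
have e2 : complex.Re (\tr (x ^t* *m (T ^t* *m T) *m x)) = fro2 (T *m x).
  by rewrite fro2Re ctmxM !mulmxA.
suff h2 : 0 <= g ^+ 2 * fro2 x - fro2 (T *m x) by rewrite -e1 -e2 -ReB in h2.
move: (fro2 x) (fro2 (T *m x)) h1 => a b h1.
have -> : g ^+ 2 * a - b = g * (g * (a + g^-1 ^+ 2 * b) + 2 * (- g^-1 * b)).
  by field; rewrite gt_eqF.
by rewrite mulr_ge0// ltW.
Qed.

(* Lurking isometry: [B^* B + E^* E = 1] and [T B = B T] turn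
   [g^2 - T^* T = D^* D] into an equality of two Gram matrices. *)
Lemma lurking X : psd (pickM T0 J1 J2 J1' J2' g X) ->
  exists (D : 'M[C]_N) (U : 'M[C]_(N + k)), mxcontraction (U ^t*) /\
    U *m col_mx (D *m B) (g%:C%C *: E) = col_mx D (E *m (T0 + Lpar X)).
Proof.
move=> h; have {h} /psd_factor[V VE] := @psd_defect (T0 + Lpar X) h.
have := TB X; move: (T0 + Lpar X) VE => T VE TX.
pose D := V ^t*; have DD : D ^t* *m D = (g ^+ 2)%:C%C%:M - T ^t* *m T by rewrite trmxCK -VE.
have [U cU UE] : exists2 U : 'M[C]_(N + k), mxcontraction (U ^t*) & U *m col_mx (D *m B) (g%:C%C *: E) = col_mx D (E *m T).
  apply: douglas; rewrite !adj_col !mul_row_col !ctmxM ctmxZ conj_realC.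
  rewrite -(mulmxA (B ^t*)) (mulmxA (D ^t*)) DD.
  rewrite -scalemxAl -scalemxAr scalerA -rmorphM -expr2.
  rewrite mulmxBl mulmxBr mul_scalar_mx -scalemxAr.
  have -> : B ^t* *m (T ^t* *m T *m B) = T ^t* *m (B ^t* *m B) *m T.
    by rewrite -!mulmxA TX !mulmxA -!ctmxM TX.
  have -> : B ^t* *m B = 1%:M - E ^t* *m E by rewrite -BE addrK.
  rewrite mulmxBr mulmx1 mulmxBl scalerBr scalemx1 !mulmxA.
  by rewrite addrAC /= subrK opprB addrA addrAC.
by exists D, U.
Qed.

(** The pair given by duality kills every [L X], so its pairings with all [T0 + L X] coincide.
    [injective_pair] preserves these pairings, hence both the annihilation and the strict
    inequality. *)
Theorem lift_or_witness :
  (exists X (D : 'M[C]_N) (U : 'M[C]_(N + k)), mxcontraction (U ^t*) /\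
    U *m col_mx (D *m B) (g%:C%C *: E) = col_mx D (E *m (T0 + Lpar X))) \/
  (exists l (f h : 'M[C]_(N, l)), [/\ forall v : 'cV[C]_l, E *m h *m v = 0 -> v = 0,
     forall X, \tr (h ^t* *m Lpar X *m f) = 0 &
     g * (fro2 f + fro2 h) + 2 * complex.Re (\tr (h ^t* *m T0 *m f)) < 0]).
Proof.
have [[X pX]|[V [V1 V2]]] := @duality R N k T0 J1 J2 J1' J2' g P1 P2 PL.
  by left; exists X; exact: lurking.
right; pose f := usubmx V; pose h := dsubmx V.
have VE : V = col_mx f h by rewrite vsubmxK.
have L0 X : \tr (h ^t* *m Lpar X *m f) = 0.
  have re Y : complex.Re (\tr (h ^t* *m Lpar Y *m f)) = 0.
    have := V1 Y; rewrite VE /dirM -/(Lpar Y) tr_quad2 !mulmx0 !mul0mx mxtrace0 add0r addr0.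
    rewrite raddfD /= tr_adj3 Re_conjC; lra.
  (* Duality controls real parts only; replacing [X] by [i X] recovers the imaginary part. *)
  have := re X; have := re (Complex 0 1 *: X); rewrite LparZ -scalemxAr -scalemxAl mxtraceZ.
  by case: (\tr _) => a b /= h1 h2; congr Complex; lra.
have [l' [f' [h' [inj nf nh tr]]]] := injective_pair BE TB obs f h.
have tr' X : \tr (h' ^t* *m (T0 + Lpar X) *m f') = \tr (h ^t* *m T0 *m f).
  by rewrite tr mulmxDr mulmxDl mxtraceD L0 addr0.
have Lz : Lpar 0 = 0 by rewrite /Lpar !mulmx0 !mul0mx addr0.
have e0 : \tr (h' ^t* *m T0 *m f') = \tr (h ^t* *m T0 *m f).
  by have := tr' 0; rewrite Lz addr0.
exists l', f', h'; split=> // [X|].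
  by have := tr' X; rewrite mulmxDr mulmxDl mxtraceD e0 -[RHS]addr0 => /addrI.
rewrite e0; have := V2; rewrite VE /pickM -/(Lpar 0) Lz addr0 tr_pick.
have : g * (fro2 f' + fro2 h') <= g * (fro2 f + fro2 h) by rewrite ler_pM2l// lerD.
move: (complex.Re _) (fro2 f') (fro2 h') (fro2 f) (fro2 h) => a x y z w; rewrite !mulrDr; lra.
Qed.

End Lifting.

(** * The easy inequality *)

Local Opaque inner inner_norm.

Lemma sqr_le_mono (R : realType) (x y : R) : 0 <= x -> 0 <= y -> x ^+ 2 <= y ^+ 2 -> x <= y.
Proof. by move=> x0 y0; rewrite ler_pXn2r ?nnegrE. Qed.

Lemma sq_le_of (R : realType) (x y c a b : R) : 0 <= x -> 0 <= y -> 0 <= c -> x ^+ 2 = a ->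
  y ^+ 2 = b -> a <= c ^+ 2 * b -> x <= c * y.
Proof.
move=> x0 y0 c0 <- <- h; apply: sqr_le_mono => //; first exact: mulr_ge0.
by rewrite exprMn.
Qed.

Lemma le_of_sq_le (R : realType) (x c a : R) : 0 <= x -> 0 <= c -> x ^+ 2 = a -> a <= c * x -> x <= c.
Proof.
move=> x0 c0 <- h; move: x0; rewrite le_eqVlt => /orP[/eqP <-//|p].
by move: h; rewrite expr2 ler_pM2r.
Qed.

Lemma Re_le_prod (R : realType) (u : R[i]) (p q d : R) : normc u <= p * q -> p <= d -> q <= 1 ->
  0 <= p -> complex.Re u <= d.
Proof.
move=> h pd q1 p0; apply: (le_trans (ler_norm _)); apply: (le_trans (Re_le_normc _)).
by apply: (le_trans h); apply: (le_trans _ pd); rewrite ler_piMr.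
Qed.

Section LowerBound.
Context {R : realType}.
Local Notation C := R[i].

Lemma l2norm_sqr k (x : 'cV[C]_k) : l2norm x ^+ 2 = fro2 x.
Proof.
rewrite /l2norm sqr_sqrtr; last by apply: sumr_ge0 => *; exact: sqr_ge0.
by rewrite /fro2; apply: eq_bigr => i _; rewrite big_ord1.
Qed.

Lemma l2norm_ge0 k (x : 'cV[C]_k) : 0 <= l2norm x.
Proof. exact: sqrtr_ge0. Qed.

Lemma fro2Z m n (c : C) (A : 'M[C]_(m, n)) : fro2 (c *: A) = normc c ^+ 2 * fro2 A.
Proof.
rewrite /fro2 mulr_sumr; apply: eq_bigr => i _; rewrite mulr_sumr; apply: eq_bigr => j _.
by rewrite mxE normcM exprMn.
Qed.

Lemma fro2mx0 m n : fro2 (0 : 'M[C]_(m, n)) = 0.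
Proof. by rewrite fro2Re mulmx0 mxtrace0. Qed.

Lemma fro2_cols m n (A : 'M[C]_(m, n)) : fro2 A = \sum_j fro2 (col j A).
Proof.
rewrite /fro2 exchange_big; apply: eq_bigr => j _; apply: eq_bigr => i _.
by rewrite big_ord1 mxE.
Qed.

Lemma le_mxopnorm m n (A : 'M[C]_(m, n)) (c : R) : 0 <= c ->
  (forall x : 'cV[C]_n, fro2 (A *m x) <= c ^+ 2 * fro2 x) -> (mxopnorm A <= c%:E)%E.
Proof.
move=> c0 h; apply: ge_ereal_sup => _ [x [_ x1] <-]; rewrite lee_fin.
rewrite -(@ler_pXn2r _ 2) ?nnegrE ?l2norm_ge0// l2norm_sqr; apply: (le_trans (h x)).
rewrite ler_piMr ?exprn_ge0// -l2norm_sqr exprn_ile1 ?l2norm_ge0//.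
Qed.

(** The operator norm tests columns of norm at most 1; scaling, then summing over columns, extends
    the bound to matrices. *)
Lemma mxopnorm_le m n (A : 'M[C]_(m, n)) (c : R) : (mxopnorm A <= c%:E)%E ->
  forall l (x : 'M[C]_(n, l)), fro2 (A *m x) <= c ^+ 2 * fro2 x.
Proof.
move=> h l x; rewrite fro2_cols [fro2 x]fro2_cols mulr_sumr; apply: ler_sum => j _.
rewrite colE -mulmxA -colE; move: (col j x) => {}x.
have [->|x0] := eqVneq x 0.
  by rewrite mulmx0 !fro2mx0 mulr0.
have n0 : 0 < fro2 x.
  by rewrite lt_neqAle fro2_ge0 andbT eq_sym; apply/eqP => /fro2_0/eqP; rewrite (negbTE x0).
pose t := (Num.sqrt (fro2 x))^-1; have t0 : 0 < t by rewrite invr_gt0 sqrtr_gt0.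
have tt : t ^+ 2 = (fro2 x)^-1 by rewrite exprVn sqr_sqrtr ?fro2_ge0.
have nt : normc t%:C%C ^+ 2 = (fro2 x)^-1 by rewrite normc_real gtr0_norm.
have y1 : l2norm (t%:C%C *: x) <= 1.
  rewrite -(@ler_pXn2r _ 2) ?nnegrE ?l2norm_ge0// l2norm_sqr expr1n fro2Z nt mulVf ?gt_eqF//.
have := le_trans (ereal_sup_ubound (ex_intro2 _ _ (t%:C%C *: x) (conj I y1) erefl)) h.
rewrite lee_fin => h1.
have c0 : 0 <= c by exact: le_trans (l2norm_ge0 _) h1.
move: h1; rewrite -(@ler_pXn2r _ 2) ?nnegrE ?l2norm_ge0// l2norm_sqr -scalemxAr fro2Z nt.
by rewrite ler_pdivrMl// mulrC.
Qed.

Lemma mxopnorm_ge0 m n (A : 'M[C]_(m, n)) : (0 <= mxopnorm A)%E.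
Proof.
apply: ereal_sup_ubound; exists 0 => /=.
  by split=> //; rewrite /l2norm big1 ?sqrtr0// => i _; rewrite mxE normc0 expr0n.
by rewrite mulmx0 /l2norm big1 ?sqrtr0// => i _; rewrite mxE normc0 expr0n.
Qed.

Lemma Hinf_norm_ge0 k (F : C -> 'M[C]_k) : (0 <= Hinf_norm F)%E.
Proof.
apply: le_trans (mxopnorm_ge0 (F 0)) _; apply: ereal_sup_ubound; exists 0 => //; exact: disk0.
Qed.

Lemma Hinf_norm_real k (F : C -> 'M[C]_k) : (Hinf_norm F < +oo)%E ->
  exists2 c : R, 0 <= c & Hinf_norm F = c%:E.
Proof.
have := Hinf_norm_ge0 F; case: (Hinf_norm F) => [c c0 _|//|//]; by exists c.
Qed.

Lemma Hinf_norm_le k (F : C -> 'M[C]_k) (c : R) : (Hinf_norm F <= c%:E)%E ->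
  forall z, disk z -> forall l (x : 'M[C]_(k, l)), fro2 (F z *m x) <= c ^+ 2 * fro2 x.
Proof.
move=> h z dz; apply: mxopnorm_le; apply: le_trans h.
by apply: ereal_sup_ubound; exists z.
Qed.

Lemma le_Hinf_norm k (F : C -> 'M[C]_k) (c : R) : 0 <= c ->
  (forall z, disk z -> forall x : 'cV[C]_k, fro2 (F z *m x) <= c ^+ 2 * fro2 x) ->
  (Hinf_norm F <= c%:E)%E.
Proof. by move=> c0 h; apply: ge_ereal_sup => _ [z dz <-]; apply: le_mxopnorm => //; exact: h. Qed.

Lemma entry_bound k (F : C -> 'M[C]_k) (c : R) : 0 <= c -> (Hinf_norm F <= c%:E)%E ->
  forall i j z, disk z -> normc (F z i j) <= c.
Proof.
move=> c0 h i j z dz; rewrite -(@ler_pXn2r _ 2) ?nnegrE ?normc_ge0//.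
have := Hinf_norm_le h dz (delta_mx j (0 : 'I_1)).
have -> : fro2 (delta_mx j (0 : 'I_1) : 'cV[C]_k) = 1.
  rewrite /fro2 (bigD1 j)//= big_ord1 mxE !eqxx /= normc1 expr1n big1 ?addr0// => a /negbTE aj.
  by rewrite big_ord1 mxE aj normc0 expr0n.
rewrite mulr1; apply: le_trans; rewrite -colE; have := fro2_entry (col j (F z)) i 0.
by rewrite mxE.
Qed.

Lemma Hinf_entry_hol k (F : C -> 'M[C]_k) : Hinf F -> forall i j, hol (fun z => F z i j).
Proof. by move=> [hF _] i j; split => z dz; have /derivable_mxE := hF z dz; apply. Qed.

Lemma mulop_mH2 k l (F : C -> 'M[C]_k) (f : C -> 'M[C]_(k, l)) : Hinf F -> mH2 f -> mH2 (mulop F f).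
Proof.
move=> hF hf; have [c c0 hc] := Hinf_norm_real hF.2.
apply: (mH2_mulmx (M := c)) => //; first exact: Hinf_entry_hol.
by move=> i j z; apply: entry_bound => //; rewrite hc.
Qed.

Lemma mulop_le k l (F : C -> 'M[C]_k) (f : C -> 'M[C]_(k, l)) (c : R) : Hinf F -> mH2 f ->
  0 <= c -> (Hinf_norm F <= c%:E)%E -> inner_norm (mulop F f) <= c * inner_norm f.
Proof.
move=> hF hf c0 hc; have hm := mulop_mH2 hF hf.
have e1 := inner_normsq hm; have e2 := inner_normsq hf.
have h : complex.Re (inner (mulop F f) (mulop F f)) <= c ^+ 2 * complex.Re (inner f f).
  by apply: (inner_le_pointwise hm hf) => z dz; exact: (Hinf_norm_le hc dz).
exact: (sq_le_of (inner_norm_ge0 _) (inner_norm_ge0 _) c0 e1 e2 h).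
Qed.

Lemma derive1_mulmx k l m (F : C -> 'M[C]_(m, k)) (f : C -> 'M[C]_(k, l)) (z : C) :
  derivable F z 1 -> derivable f z 1 ->
  derivable (fun w => F w *m f w) z 1 /\
  derive1 (fun w => F w *m f w) z = derive1 F z *m f z + F z *m derive1 f z.
Proof.
move=> dF df.
have dF' i j : derivable (fun w => F w i j) z 1 by have /derivable_mxE := dF; apply.
have df' i j : derivable (fun w => f w i j) z 1 by have /derivable_mxE := df; apply.
have key i j : derivable (fun w => (F w *m f w) i j) z 1 /\
   derive1 (fun w => (F w *m f w) i j) z = (derive1 F z *m f z + F z *m derive1 f z) i j.
  have -> : (fun w => (F w *m f w) i j) = fun w => \sum_n F w i n * f w n j.
    by apply/funext => w; rewrite mxE.
  have [d ->] := derivableC_sum (fun n => derivableCM (dF' i n) (df' n j)).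
  split=> //; rewrite 3!mxE -big_split; apply: eq_bigr => n _ /=.
  by rewrite (derive1M (dF' i n) (df' n j)).2 !derive1_mxE.
have dd : derivable (fun w => F w *m f w) z 1 by apply/derivable_mxE => i j; exact: (key i j).1.
split=> //; apply/matrixP => i j; rewrite derive1_mxE//; exact: (key i j).2.
Qed.

Lemma mulop_ab k l' l (a b : 'M[C]_(l', l)) (F : C -> 'M[C]_k) f : Hinf1 F ->
  @Hardy2_ab R k l' l a b f -> Hardy2_ab a b (mulop F f).
Proof.
move=> [hF dF] [/mxHardy2P hf [U [f0 f1]]].
split; first by apply/mxHardy2P; exact: mulop_mH2.
exists (F 0 *m U); split; first by rewrite /mulop f0 mulmxA.
rewrite /mulop (derive1_mulmx (hF.1 _ disk0) (mH2_derivable hf disk0)).2.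
by rewrite dF mul0mx add0r f1 mulmxA.
Qed.

Lemma Hinf_sub k (F G : C -> 'M[C]_k) : Hinf F -> Hinf G -> Hinf (F \- G).
Proof.
move=> hF hG; have [c c0 hc] := Hinf_norm_real hF.2; have [d d0 hd] := Hinf_norm_real hG.2.
split.
  move=> z dz; apply/derivable_mxE => i j.
  have := holP (holB (Hinf_entry_hol hF i j) (Hinf_entry_hol hG i j)) dz.
  by have -> : (fun w => (F \- G) w i j) = (fun w => F w i j - G w i j) by apply/funext => w; rewrite !mxE.
pose e := Num.sqrt (2 * c ^+ 2 + 2 * d ^+ 2).
have ee : e ^+ 2 = 2 * c ^+ 2 + 2 * d ^+ 2 by rewrite sqr_sqrtr// addr_ge0// mulr_ge0// sqr_ge0.
apply: (@le_lt_trans _ _ e%:E); last exact: ltry.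
apply: le_Hinf_norm; first exact: sqrtr_ge0.
move=> z dz x; rewrite ee /=.
have h1 : fro2 (F z *m x) <= c ^+ 2 * fro2 x by apply: Hinf_norm_le => //; rewrite hc.
have h2 : fro2 (G z *m x) <= d ^+ 2 * fro2 x by apply: Hinf_norm_le => //; rewrite hd.
have h3 (u v : 'cV[C]_k) : fro2 (u - v) <= 2 * fro2 u + 2 * fro2 v.
  rewrite /fro2 !mulr_sumr -big_split; apply: ler_sum => i _; rewrite !big_ord1 !mxE.
  have := peter_paul (u i 0 - v i 0) (u i 0) ltr01.
  by rewrite invr1 (_ : u i 0 - v i 0 - u i 0 = - v i 0) ?normcN// addrAC subrr add0r.
rewrite mulmxBl; apply: (le_trans (h3 _ _)).
have h1' := ler_wpM2l (ler0n R 2) h1; have h2' := ler_wpM2l (ler0n R 2) h2.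
by apply: (le_trans (lerD h1' h2')); rewrite !mulrA -mulrDl.
Qed.

(** For [x] in the model space and [h = M_F^* x], the function [G h] vanishes at the [z i], so it is
    a Blaschke multiple and orthogonal to [x]. Hence [|h|^2 = <F h, x> = <(F - G) h, x>], which is
    at most [c |h|]. *)
Lemma adjoint_le k l' l n (z : 'I_n -> C) (a b : 'M[C]_(l', l)) (F G : C -> 'M[C]_k) :
  injective z -> (forall i, disk (z i)) -> Hinf1 F -> interp_ideal z G ->
  (adjoint_mul_norm z F a b <= Hinf_norm (F \- G)%R)%E.
Proof.
move=> zi zd hF [hG Gz].
have hFG : Hinf (F \- G) by exact: Hinf_sub hF.1 hG.1.
have [c c0 hc] := Hinf_norm_real hFG.2; rewrite hc.
apply: ge_ereal_sup => _ [x [[Hx ox] x1] <-]; rewrite lee_fin.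
have hx : mH2 x by apply/mxHardy2P; exact: Hx.1.
have key (h : C -> 'M[C]_(k, l)) : Hardy2_ab a b h ->
    (forall f, Hardy2_ab a b f -> inner (mulop F f) x = inner f h) -> inner_norm h <= c.
  move=> Hh adj.
  have hh : mH2 h by apply/mxHardy2P; exact: Hh.1.
  have hFh := mulop_mH2 hF.1 hh; have hGh := mulop_mH2 hG.1 hh.
  have Gab := mulop_ab hG Hh.
  have Gbl : blaschke_Hardy2 z (mulop G h).
    have /choice [g hg] : forall p : 'I_k * 'I_l, exists g : C -> C, H2 g /\
        forall w, disk w -> mulop G h w p.1 p.2 = (\prod_(i < n) bfac (z i) w) * g w.
      move=> p; have [|g hg E] := blaschke_div zi zd (mH2E hGh p.1 p.2).
        by move=> i; rewrite /mulop Gz mul0mx mxE.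
      by exists g.
    exists (fun w => \matrix_(i, j) g (i, j) w).
      apply/mxHardy2P; apply: MH2 => i j; have := (hg (i, j)).1.
      by apply: H2_eq => w _; rewrite mxE.
    move=> w dw; rewrite /blaschke mul_scalar_mx; apply/matrixP => i j.
    by rewrite (hg (i, j)).2// !mxE.
  have o : inner x (mulop G h) = 0 by apply: ox.
  have e1 : inner h h = inner (mulop (F \- G) h) x.
    rewrite -(adj h Hh); have -> : mulop (F \- G) h = fun w => mulop F h w - mulop G h w.
      by apply/funext => w; rewrite /mulop mulmxBl.
    by rewrite (innerBl hFh hGh hx) (inner_conj hx hGh) o conjC0 subr0.
  have hm := mulop_mH2 hFG hh.
  have e2 : complex.Re (inner h h) <= c * inner_norm h.
    have ml : inner_norm (mulop (F \- G) h) <= c * inner_norm h by apply: (mulop_le hFG hh c0); rewrite hc.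
    by rewrite e1; exact: (Re_le_prod (inner_CauchySchwarz hm hx) ml x1 (inner_norm_ge0 _)).
  exact: (le_of_sq_le (inner_norm_ge0 h) c0 (inner_normsq hh) e2).
(* If no adjoint vector existed, [adjoint_in] would return 0, whose norm satisfies the bound as
   well. *)
rewrite /adjoint_in; case: xgetP => [h _ [Hh adj]|_]; last first.
  have h0 : mH2 (fun=> 0 : 'M[C]_(k, l)) by exact: mH2_cst.
  have /eqP := inner_normsq h0; rewrite (inner0l h0) sqrf_eq0 => /eqP e0.
  by apply: (le_trans _ c0); rewrite -e0.
exact: key.
Qed.

End LowerBound.

(** * The span of the kernels, the constants and the coordinate function *)

Section MatrixUnits.
Context {R : realType} (A : finType) (k : nat).
Local Notation C := R[i].
Local Notation N := #|{: A * 'I_k}|.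

(** A column of height [N] is a stack of blocks of height [k] indexed by [A]; [emb a] is the
    inclusion of block [a]. *)
Definition emb (a : A) : 'M[C]_(N, k) := \matrix_(p, i) (enum_val p == (a, i))%:R.

Lemma emb_conj a : emb a ^t* = (emb a)^T.
Proof. by apply/matrixP => i j; rewrite !mxE conjC_nat. Qed.

Lemma emb_orth a b : emb a ^t* *m emb b = if a == b then 1%:M else 0.
Proof.
apply/matrixP => i j; rewrite emb_conj mxE.
under eq_bigr do rewrite !mxE.
rewrite (reindex enum_rank) /=; last by apply: onW_bij; exact: enum_rank_bij.
under eq_bigr do rewrite enum_rankK.
rewrite (bigD1 (a, i))//= eqxx mul1r big1 => [|p /negbTE ->]; last by rewrite mul0r.
rewrite addr0 xpair_eqE; case: eqP => _ /=; rewrite !mxE//.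
Qed.

Lemma emb_orth1 a : emb a ^t* *m emb a = 1%:M.
Proof. by rewrite emb_orth eqxx. Qed.

Lemma emb_sum : \sum_a emb a *m emb a ^t* = 1%:M.
Proof.
apply/matrixP => p q; rewrite summxE mxE.
under eq_bigr => a _ do (rewrite emb_conj mxE; under eq_bigr => i _ do rewrite !mxE).
rewrite pair_bigA /= (bigD1 (enum_val p)) //= -surjective_pairing eqxx mul1r big1; last first.
  by move=> [a i] /=; rewrite eq_sym => /negbTE ->; rewrite mul0r.
by rewrite addr0 (inj_eq enum_val_inj) eq_sym.
Qed.

Lemma emb_eq l (x y : 'M[C]_(N, l)) : (forall a, emb a ^t* *m x = emb a ^t* *m y) -> x = y.
Proof.
move=> h; rewrite -[x]mul1mx -[y]mul1mx -emb_sum !mulmx_suml.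
by apply: eq_bigr => a _; rewrite -!mulmxA h.
Qed.

Lemma emb_pick l a (f : A -> 'M[C]_(k, l)) : emb a ^t* *m (\sum_b emb b *m f b) = f a.
Proof.
rewrite mulmx_sumr (bigD1 a)//= mulmxA emb_orth1 mul1mx big1 ?addr0// => b /negbTE ba.
by rewrite mulmxA emb_orth eq_sym ba mul0mx.
Qed.

End MatrixUnits.

Section ModelSpace.
Context {R : realType} (n k : nat).
Local Notation C := R[i].
Variable (z : 'I_n -> C).
Hypotheses (z_inj : injective z) (z_disk : forall i, disk (z i)) (z_neq0 : forall i, z i != 0).
Local Notation A := ('I_n + bool)%type.
Local Notation N := #|{: A * 'I_k}|.
Local Notation emb a := (@emb R A k a).

(* [inl i] stands for the kernel at [z i], [inr false] for the constant function
   and [inr true] for the coordinate function; [phi a] represents [ev a]. *)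
Definition phi (a : A) (w : C) : C :=
  match a with inl i => kern (z i) w | inr b => if b then w else 1 end.

Definition ev m l (a : A) (F : C -> 'M[C]_(m, l)) : 'M[C]_(m, l) :=
  match a with inl i => F (z i) | inr b => if b then derive1 F 0 else F 0 end.

Lemma H2_phi a : H2 (phi a).
Proof. by case: a => [i|[]] /=; [exact: H2_kern|exact: H2_id|exact: H2_cst]. Qed.

Lemma inner_phi l (F : C -> 'M[C]_(k, l)) a (X : 'M[C]_(k, l)) : mH2 F ->
  inner F (fun w => phi a w *: X) = \tr (X ^t* *m ev a F).
Proof.
move=> hF; rewrite -frodE; case: a => [i|[]] /=.
- exact: inner_kern.
- exact: inner_id.
- rewrite -(inner_cst X hF); congr (inner F _); apply/funext => w; exact: scale1r.
Qed.

Lemma ev_mulmxr m l p (F : C -> 'M[C]_(m, l)) (X : 'M[C]_(l, p)) a : mH2 F ->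
  ev a (fun w => F w *m X) = ev a F *m X.
Proof.
move=> hF; case: a => [i|[]] //=.
have dX : derivable (fun=> X : 'M[C]_(l, p)) (0 : C) 1 by apply/derivable_mxE => *; exact: derivableC_cst.
rewrite (derive1_mulmx (mH2_derivable hF disk0) dX).2.
suff -> : derive1 (fun=> X : 'M[C]_(l, p)) (0 : C) = 0 by rewrite mulmx0 addr0.
by apply/matrixP => i j; rewrite derive1_mxE// derive1C_cst mxE.
Qed.

Lemma mH2_mulmxr m l p (F : C -> 'M[C]_(m, l)) (X : 'M[C]_(l, p)) : mH2 F -> mH2 (fun w => F w *m X).
Proof.
move=> hF; apply: MH2 => i j.
have := @H2_sum R 'I_l (index_enum _) (fun t w => X t j * F w i t) (fun t => H2Z _ (mH2E hF i t)).
by apply: H2_eq => w _; rewrite mxE; apply: eq_bigr => t _; rewrite mulrC.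
Qed.

(** [Evr w *m x] is the value at [w] of the function with coefficients [x], and [Ecol F] stacks the
    functionals [ev a] of [F]; [inner_Phi] shows that the two constructions are adjoint. *)
Definition Ecol l (F : C -> 'M[C]_(k, l)) : 'M[C]_(N, l) := \sum_a emb a *m ev a F.
Definition Evr (w : C) : 'M[C]_(k, N) := \sum_a phi a w *: emb a ^t*.

Lemma Evr_emb w a : Evr w *m emb a = (phi a w)%:M.
Proof.
rewrite mulmx_suml (bigD1 a)//= -scalemxAl emb_orth1 scalemx1 big1 ?addr0// => b /negbTE ba.
by rewrite -scalemxAl emb_orth ba scaler0.
Qed.

Lemma mH2_Evr : mH2 Evr.
Proof. by apply: mH2_sum => a; apply: mH2_scal; exact: H2_phi. Qed.

Lemma mH2_Phi l (x : 'M[C]_(N, l)) : mH2 (fun w => Evr w *m x).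
Proof. exact/mH2_mulmxr/mH2_Evr. Qed.

Lemma inner_Phi l (F : C -> 'M[C]_(k, l)) (y : 'M[C]_(N, l)) : mH2 F ->
  inner F (fun w => Evr w *m y) = \tr (y ^t* *m Ecol F).
Proof.
move=> hF; have -> : (fun w => Evr w *m y) = fun w => \sum_a phi a w *: (emb a ^t* *m y).
  by apply/funext => w; rewrite mulmx_suml; apply: eq_bigr => a _; rewrite scalemxAl.
rewrite (inner_sumr _ _ hF); last by move=> a; apply: mH2_scal; exact: H2_phi.
rewrite /Ecol mulmx_sumr raddf_sum /=; apply: eq_bigr => a _.
by rewrite (inner_phi _ _ hF) ctmxM trmxCK mulmxA.
Qed.

Lemma Ecol_mulmxr l p (F : C -> 'M[C]_(k, l)) (x : 'M[C]_(l, p)) : mH2 F ->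
  Ecol (fun w => F w *m x) = Ecol F *m x.
Proof.
move=> hF; rewrite /Ecol mulmx_suml; apply: eq_bigr => a _.
by rewrite (ev_mulmxr _ _ hF) mulmxA.
Qed.

(** Thus [Ecol Evr] is the Gram matrix of the functions [phi a]. *)
Lemma inner_PhiPhi l (x y : 'M[C]_(N, l)) :
  inner (fun w => Evr w *m x) (fun w => Evr w *m y) = \tr (y ^t* *m Ecol Evr *m x).
Proof. by rewrite inner_Phi ?Ecol_mulmxr ?mulmxA//; [exact: mH2_Evr|exact: mH2_Phi]. Qed.

Lemma tr_ext p q (M M' : 'M[C]_(p, q)) :
  (forall (x : 'cV[C]_q) (y : 'cV[C]_p), \tr (y ^t* *m M *m x) = \tr (y ^t* *m M' *m x)) -> M = M'.
Proof.
have e (M0 : 'M[C]_(p, q)) i j :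
    \tr ((delta_mx i (0 : 'I_1) : 'cV[C]_p) ^t* *m M0 *m delta_mx j (0 : 'I_1)) = M0 i j.
  rewrite (_ : (delta_mx _ _) ^t* = delta_mx 0 i); last first.
    by apply/matrixP => a b; rewrite !mxE conjC_nat andbC.
  by rewrite -rowE -colE trace_mx11 !mxE.
by move=> h; apply/matrixP => i j; rewrite -!e h.
Qed.

Lemma gram_psd : psd (Ecol Evr).
Proof.
split.
  apply: tr_ext => x y; rewrite tr_adj3 -!inner_PhiPhi.
  by rewrite -inner_conj//; exact: mH2_Phi.
move=> x; rewrite -inner_PhiPhi; exact: inner_ge0 (mH2_Phi x).
Qed.

Lemma H2_poly (p : {poly C}) : H2 (fun w => p.[w]).
Proof.
have hx j : H2 (fun w : C => w ^+ j).
  apply: (@H2_bounded R _ 1); first exact: hol_exp.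
  by move=> w; rewrite diskE => d; rewrite normcX exprn_ile1 ?normc_ge0// ltW.
have := @H2_sum R 'I_(size p) (index_enum _) (fun t w => p`_t * w ^+ t) (fun t => H2Z _ (hx t)).
by apply: H2_eq => w _; rewrite horner_coef.
Qed.

(* [w^2 \prod_(j != a) (w - z j)]; it needs the [z i] distinct and nonzero. *)
Lemma test_fun (a : 'I_n) : exists2 p : C -> C, H2 p &
  [/\ p (z a) != 0, forall i, i != a -> p (z i) = 0, p 0 = 0 & derive1 p 0 = 0].
Proof.
pose q : {poly C} := \prod_(i | i != a) ('X - (z i)%:P).
have qE w : q.[w] = \prod_(i | i != a) (w - z i).
  by rewrite horner_prod; apply: eq_bigr => i _; rewrite !hornerE.
have dq : hol (fun w => q.[w]) by exact: H2_hol (H2_poly q).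
have dX : hol (fun w : C => w) by exact: H2_hol H2_id.
exists (fun w => w * (w * q.[w])).
  by have := H2_poly ('X * ('X * q)); apply: H2_eq => w _; rewrite !hornerE.
split.
- rewrite !mulf_neq0 ?z_neq0// qE; apply/prodf_neq0 => i ia.
  by rewrite subr_eq0 eq_sym; apply: contra ia => /eqP/z_inj ->.
- by move=> i ia; rewrite qE (bigD1 i)//= subrr mul0r !mulr0.
- by rewrite mul0r.
- rewrite (derive1M (holP dX disk0) (holP (holM dX dq) disk0)).2.
  by rewrite mul0r mulr0 mul0r addr0.
Qed.

Lemma ev_scal m l (p : C -> C) (X : 'M[C]_(m, l)) a : H2 p ->
  ev a (fun w => p w *: X) = (match a with inl i => p (z i) | inr b => if b then derive1 p 0 else p 0 end) *: X.
Proof.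
move=> hp; case: a => [i|[]] //=; apply/matrixP => i j.
rewrite derive1_mxE; last by apply: mH2_derivable disk0; exact: mH2_scal.
have -> : (fun w => (p w *: X) i j) = fun w => p w * X i j by apply/funext => w; rewrite mxE.
rewrite (derive1M (holP (H2_hol hp) disk0) (@derivableC_cst R (X i j) 0)).2 derive1C_cst mulr0 addr0.
by rewrite mxE.
Qed.

(** A function of norm 0 is orthogonal to everything. The functions of [test_fun] isolate the
    coefficients at the kernels; then 1 and w, with value and derivative at 0 equal to (1, 0) and
    (0, 1), isolate the other two. *)
Lemma Phi_indep l (x : 'M[C]_(N, l)) : inner_norm (fun w => Evr w *m x) = 0 -> x = 0.
Proof.
move=> h0; have o (F : C -> 'M[C]_(k, l)) : mH2 F -> \tr (x ^t* *m Ecol F) = 0.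
  move=> hF; rewrite -inner_Phi//.
  have := inner_CauchySchwarz hF (mH2_Phi x); rewrite h0 mulr0 => h.
  by apply/eqP; rewrite -normc_eq0 eq_le h normc_ge0.
have o' p : H2 p -> forall Y : 'M[C]_(k, l), \sum_a
   (match a with inl i => p (z i) | inr b => if b then derive1 p 0 else p 0 end) * frod (emb a ^t* *m x) Y = 0.
  move=> hp Y; rewrite -[RHS](o _ (mH2_scal Y hp)) /Ecol mulmx_sumr raddf_sum /=.
  by apply: eq_bigr => a _; rewrite ev_scal// -!scalemxAr mxtraceZ frodE ctmxM trmxCK mulmxA.
have oi i : emb (inl i) ^t* *m x = 0.
  have [p hp [p1 p2 p3 p4]] := test_fun i.
  apply: fro2_eq0; have := o' p hp (emb (inl i) ^t* *m x).
  rewrite (bigD1 (inl i))//= big1; last first.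
    move=> [j|[]] ji /=; rewrite ?p3 ?p4 ?mul0r// p2 ?mul0r//.
  by rewrite addr0 => /eqP; rewrite mulf_eq0 (negbTE p1) => /eqP.
have f0 Y : frod (0 : 'M[C]_(k, l)) Y = 0.
  by rewrite frodE ctmx0 mul0mx mxtrace0.
apply: emb_eq => a; rewrite mulmx0; case: a => // b.
have h1 := o' _ (H2_cst 1); have h2 := o' _ H2_id.
have s (c : A -> C) (Y : 'M[C]_(k, l)) : \sum_a c a * frod (emb a ^t* *m x) Y =
    \sum_b c (inr b) * frod (emb (inr b) ^t* *m x) Y.
  by rewrite big_sumType /= big1 ?add0r// => i _; rewrite oi f0 mulr0.
apply: fro2_eq0; case: b.
  have := h2 (emb (inr true) ^t* *m x); rewrite s big_bool /= derive1C_id mul1r mul0r addr0.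
  by [].
have := h1 (emb (inr false) ^t* *m x); rewrite s big_bool /= derive1C_cst mul1r mul0r add0r.
by [].
Qed.

End ModelSpace.

Section Shift.
Context {R : realType}.
Local Notation C := R[i].

Lemma clim_contract (s : R -> C) (g : R -> C) v : (forall r, 0 < r -> r < 1 -> normc (s r) <= 1) ->
  clim s 1 -> clim g v -> clim (fun r => s r * g r) v.
Proof.
move=> s1 hs hg e e0.
have d0 : 0 < e / 2 / (normc v + 1) by rewrite !divr_gt0// ltr_wpDl// normc_ge0.
have [r1 l1 h1] := hs _ d0; have [r2 l2 h2] := hg (e / 2) ltac:(by rewrite divr_gt0).
exists (Num.max 0 (Num.max r1 r2)); first by rewrite !gt_max ltr01 l1 l2.
move=> r; rewrite !gt_max => /andP[r0 /andP[a1 a2]] ar.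
have {h1 a1}h1 := h1 r a1 ar; have {h2 a2}h2 := h2 r a2 ar; have {}s1 := s1 r r0 ar.
rewrite (_ : s r * g r - v = s r * (g r - v) + (s r - 1) * v); last by ring.
apply: (le_lt_trans (le_normcD _ _)); rewrite !normcM.
have n0 := normc_ge0 (g r - v); have n1 := normc_ge0 v; have n2 := normc_ge0 (s r - 1).
have q : normc (s r - 1) * (normc v + 1) < e / 2 by rewrite -ltr_pdivlMr// ltr_wpDl.
have q2 : normc (s r) * normc (g r - v) <= 1 * normc (g r - v) by rewrite ler_wpM2r.
move: (normc (s r)) (normc (g r - v)) (normc (s r - 1)) (normc v) s1 h2 n0 n1 n2 q q2 => a b c d *; lra.
Qed.

(** On the circle of radius [r] the factor [w] has modulus [r], so the mean is multiplied by
    [r ^+ 2], which tends to 1. *)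
Lemma inner_shift k l (F G : C -> 'M[C]_(k, l)) : mH2 F -> mH2 G ->
  inner (fun w => w *: F w) (fun w => w *: G w) = inner F G.
Proof.
move=> hF hG.
have hs (H : C -> 'M[C]_(k, l)) : mH2 H -> mH2 (fun w => w *: H w).
  move=> hH; apply: MH2 => i j; have := @H2_mul R _ _ 1 (H2_hol H2_id) _ (mH2E hH i j).
  have b (w : C) : disk w -> normc w <= 1 by rewrite diskE => /ltW.
  by move=> /(_ b); apply: H2_eq => w _; rewrite mxE.
have c1 := inner_clim (hs _ hF) (hs _ hG); have c2 := inner_clim hF hG.
apply: (clim_uniq c1).
apply: (@clim_eq _ (fun r => (r ^+ 2)%:C%C * smm F G r)).
  move=> r r0 r1; have ar : `|r| < 1 by rewrite gtr0_norm.
  rewrite /smm mulr_sumr; apply: eq_bigr => i _; rewrite mulr_sumr; apply: eq_bigr => j _.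
  rewrite -mmZl; [|exact: hol_ccts (H2_hol (mH2E hF i j)) ar|exact: hol_ccts (H2_hol (mH2E hG i j)) ar].
  rewrite /mm; congr (_ * _); apply: eq_iint => t _; rewrite !mxE.
  have -> : (r ^+ 2)%:C%C = pol r t * (pol r t)^*.
    by rewrite -normCK normr_normc normc_pol gtr0_norm// -rmorphXn.
  by move: (F _ i j) (G _ i j) => a b; move: (pol r t) => u; rewrite rmorphM /=; ring.
apply: clim_contract c2.
  by move=> r r0 r1; rewrite normc_real ger0_norm ?exprn_ge0 ?exprn_ile1 ?ltW.
apply: clim_real.
have : r ^+ 2 @[r --> (1 : R)] --> (1 : R) ^+ 2 by exact: exprn_continuous.
by rewrite expr1n; apply: cvg_at_left_filter.
Qed.

End Shift.

Lemma isometry_split (R : realType) m p q l (B : 'M[R[i]]_(m, q)) (E : 'M[R[i]]_(p, q)) (x : 'M[R[i]]_(q, l)) :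
  B ^t* *m B + E ^t* *m E = 1%:M -> fro2 x = fro2 (B *m x) + fro2 (E *m x).
Proof.
move=> h; rewrite !fro2Re !ctmxM -[X in complex.Re (\tr (_ *m X)) = _]mul1mx -h.
rewrite mulmxDl mulmxDr mxtraceD !mulmxA.
by case: (\tr _) (\tr _) => [? ?] [].
Qed.

(** * Orthonormal coordinates and the backward shift *)

Section Orthonormal.
Context {R : realType} (n k : nat).
Local Notation C := R[i].
Variable (z : 'I_n -> C).
Hypotheses (z_inj : injective z) (z_disk : forall i, disk (z i)) (z_neq0 : forall i, z i != 0).
Local Notation A := ('I_n + bool)%type.
Local Notation N := #|{: A * 'I_k}|.
Local Notation emb a := (@emb R A k a).
Local Notation Ev := (@Evr R n k z).

Lemma unitmx_inj p (M : 'M[C]_p) : (forall x : 'M[C]_p, M *m x = 0 -> x = 0) -> M \in unitmx.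
Proof.
move=> h; rewrite -unitmx_tr -row_free_unit -kermx_eq0 -trmx_eq0; apply/eqP/h.
by apply: trmx_inj; rewrite trmx_mul trmxK mulmx_ker trmx0.
Qed.

Lemma gram_root : exists2 R0 : 'M[C]_N, R0 \in unitmx & R0 ^t* *m R0 = Ecol z Ev.
Proof.
have [V VE] := psd_factor (gram_psd k z_disk).
exists (V ^t*); last by rewrite trmxCK -VE.
apply: unitmx_inj => x Vx; apply: (Phi_indep z_inj z_disk z_neq0).
have hx := mH2_Phi z_disk x.
have : inner_norm (fun w => Ev w *m x) ^+ 2 = 0.
  rewrite (inner_normsq hx) (inner_PhiPhi z_disk) VE -!mulmxA Vx !mulmx0 mxtrace0//.
by move/eqP; rewrite sqrf_eq0 => /eqP.
Qed.

Variable R0 : 'M[C]_N.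
Hypotheses (R0u : R0 \in unitmx) (R0K : R0 ^t* *m R0 = Ecol z Ev).

(* [R0] is a square root of the Gram matrix, so [x |-> onb w *m x] is an isometry
   onto the span of the functions [phi a]. *)
Definition onb (w : C) : 'M[C]_(k, N) := Ev w *m invmx R0.
Definition modelcoord l (F : C -> 'M[C]_(k, l)) : 'M[C]_(N, l) := (invmx R0) ^t* *m Ecol z F.

Lemma onbE l (x : 'M[C]_(N, l)) w : onb w *m x = Ev w *m (invmx R0 *m x).
Proof. by rewrite mulmxA. Qed.

Lemma mH2_onb l (x : 'M[C]_(N, l)) : mH2 (fun w => onb w *m x).
Proof. by apply: mH2_mulmxr; exact: mH2_Phi. Qed.

Lemma inner_onb l (F : C -> 'M[C]_(k, l)) (y : 'M[C]_(N, l)) : mH2 F ->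
  inner F (fun w => onb w *m y) = \tr (y ^t* *m modelcoord F).
Proof.
move=> hF; have -> : (fun w => onb w *m y) = fun w => Ev w *m (invmx R0 *m y).
  by apply/funext => w; rewrite onbE.
by rewrite (inner_Phi z_disk _ hF) ctmxM !mulmxA.
Qed.

Lemma modelcoord_onb l (x : 'M[C]_(N, l)) : modelcoord (fun w => onb w *m x) = x.
Proof.
rewrite /modelcoord (Ecol_mulmxr _ _ (mH2_mulmxr _ (mH2_Evr k z_disk))) (Ecol_mulmxr _ _ (mH2_Evr k z_disk)).
by rewrite -R0K !mulmxA -ctmxM mulmxV// ctmx1 mul1mx mulmxV// mul1mx.
Qed.

Lemma inner_onbonb l (x y : 'M[C]_(N, l)) :
  inner (fun w => onb w *m x) (fun w => onb w *m y) = \tr (y ^t* *m x).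
Proof. by rewrite (inner_onb _ (mH2_onb x)) modelcoord_onb. Qed.

Lemma norm_onb l (x : 'M[C]_(N, l)) : inner_norm (fun w => onb w *m x) ^+ 2 = fro2 x.
Proof. by rewrite (inner_normsq (mH2_onb x)) inner_onbonb fro2Re. Qed.

(* The backward shift [f |-> (f - f 0) / w] on the functions [phi a]. *)
Definition bshift0 : 'M[C]_N :=
  \sum_(i < n) (z i)^* *: (emb (inl i) *m emb (inl i) ^t*) + emb (inr false) *m emb (inr true) ^t*.

Lemma Ev0 : Ev 0 = \sum_(i < n) emb (inl i) ^t* + emb (inr false) ^t*.
Proof.
rewrite /Ev big_sumType big_bool /= scale0r add0r scale1r; congr (_ + _).
by apply: eq_bigr => i _; rewrite /kern mulr0 subr0 invr1 scale1r.
Qed.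

Lemma Ev_bshift w : disk w -> w *: (Ev w *m bshift0) = Ev w - Ev 0.
Proof.
move=> dw; rewrite Ev0 /Ev [in RHS]big_sumType big_bool /= mulmxDr mulmx_sumr.
rewrite mulmxA (Evr_emb _ _ w (inr false)) mul1mx scalerDr scaler_sumr scale1r.
rewrite opprD addrACA addrK; congr (_ + _); rewrite -sumrB.
apply: eq_bigr => i _; rewrite -scalemxAr mulmxA (Evr_emb _ _ w (inl i)) /= mul_scalar_mx.
rewrite !scalerA -[X in _ = _ - X]scale1r -scalerBl; congr (_ *: _).
by rewrite /kern; have := kern_neq0 (z_disk i) dw; move=> d; field.
Qed.

Definition bshift := R0 *m bshift0 *m invmx R0.

Lemma onb_bshift w : disk w -> w *: (onb w *m bshift) = onb w - onb 0.
Proof.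
move=> dw; rewrite /onb /bshift -mulmxBl -(Ev_bshift dw) -scalemxAl; congr (_ *: _).
by rewrite !mulmxA mulmxKV.
Qed.

Lemma onb_decomp l (x : 'M[C]_(N, l)) w : disk w ->
  onb w *m x = onb 0 *m x + w *: (onb w *m (bshift *m x)).
Proof. by move=> dw; rewrite mulmxA scalemxAl onb_bshift// mulmxBl addrC subrK. Qed.

(** [onb_decomp] splits a function of the span into its value at 0 and [w] times its backward shift;
    the two terms are orthogonal, and multiplication by [w] is isometric. *)
Lemma bshift_isometry : bshift ^t* *m bshift + (onb 0) ^t* *m onb 0 = 1%:M.
Proof.
apply: tr_ext => x y; rewrite mulmx1 -inner_onbonb.
pose S (u : 'cV[C]_N) w := w *: (onb w *m (bshift *m u)).
have hS u : mH2 (S u).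
  have := mH2B (mH2_onb u) (mH2_cst (onb 0 *m u)); apply: mH2_eq => w dw.
  by rewrite (onb_decomp u dw) addrC addKr.
have S0 u X : inner (S u) (fun=> X) = 0.
  by rewrite (inner_cst X (hS u)) /S scale0r frodE mulmx0 mxtrace0.
have hD u : mH2 (fun w => onb 0 *m u + S u w) by apply: mH2D (hS u); exact: mH2_cst.
rewrite (@inner_eq _ _ _ _ (fun w => onb 0 *m x + S x w) _ (fun w => onb 0 *m y + S y w)); last 1 first.
all: try by [exact: mH2_onb | move=> w; exact: onb_decomp].
have c (X : 'cV[C]_k) := mH2_cst X.
rewrite (innerDl (c _) (hS x) (hD y)) (innerDr (c _) (hS y) (c _)) (innerDr (c _) (hS y) (hS x)).
rewrite S0 (inner_conj (hS y) (c _)) S0 conjC0 addr0 add0r.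
rewrite (inner_shift (mH2_onb _) (mH2_onb _)) inner_onbonb (inner_cst _ (c _)) frodE.
by rewrite mulmxDr mulmxDl mxtraceD addrC (ctmxM bshift y) (ctmxM (onb 0) y) !mulmxA.
Qed.

Lemma onb_iter l (x : 'M[C]_(N, l)) w : disk w -> (forall j, onb 0 *m iter j (mulmx bshift) x = 0) ->
  forall j, onb w *m x = w ^+ j *: (onb w *m iter j (mulmx bshift) x).
Proof.
move=> dw h; elim=> [|j ->]; first by rewrite expr0 scale1r.
by rewrite (onb_decomp _ dw) h add0r scalerA -exprSr.
Qed.

Lemma bshift_le l (x : 'M[C]_(N, l)) : fro2 (bshift *m x) <= fro2 x.
Proof.
by rewrite (isometry_split x bshift_isometry) lerDl fro2_ge0.
Qed.

Lemma iter_bshift_le l (x : 'M[C]_(N, l)) j : fro2 (iter j (mulmx bshift) x) <= fro2 x.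
Proof. by elim: j => //= j; apply: le_trans; exact: bshift_le. Qed.

Lemma geom_le0 (c r M : R) : 0 <= r -> r < 1 -> (forall j, c <= r ^+ j * M) -> c <= 0.
Proof.
move=> r0 r1 h; have := @cvg_expr R r; rewrite ger0_norm// => /(_ r1) h1.
have h2 : (fun j => r ^+ j * M) @ \oo --> 0 * M by apply: cvgMr_tmp.
rewrite mul0r in h2.
by rewrite -(cvg_lim _ h2)//; apply: limr_ge; [exact: cvgP h2|exact: nearW].
Qed.

(* By [onb_iter] the function is divisible by [w^j] with quotients bounded
   independently of [j]. *)
Lemma bshift_observable l (x : 'M[C]_(N, l)) :
  (forall j, onb 0 *m iter j (mulmx bshift) x = 0) -> x = 0.
Proof.
move=> h.
have z0 w : disk w -> onb w *m x = 0.
  move=> dw; apply/matrixP => i s; rewrite [RHS]mxE.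
  have [a a0 ha] := mx_bounded (onb w).
  have hb j u v : normc (iter j (mulmx bshift) x u v) <= fro2 x + 1.
    apply: sqr_le_le (fro2_ge0 _) _; apply: le_trans (fro2_entry _ _ _) _.
    exact: iter_bshift_le.
  apply/eqP; rewrite -normc_eq0 eq_le normc_ge0 andbT.
  apply: (@geom_le0 _ (normc w) (N%:R * (a * (fro2 x + 1)))); first exact: normc_ge0.
    by rewrite -diskE.
  move=> j; rewrite (onb_iter dw h j) mxE normcM normcX ler_wpM2l ?exprn_ge0 ?normc_ge0//.
  exact: (normc_le_mx ha (hb j)).
apply: fro2_0; rewrite -norm_onb (inner_normsq (mH2_onb x)).
rewrite (@inner_eq _ _ _ _ (fun=> 0) _ (fun=> 0) z0 z0 (mH2_onb x) (mH2_onb x)).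
by rewrite inner0l//; exact: mH2_cst.
Qed.

End Orthonormal.

(** * Interpolation by a transfer function *)

Section Realization.
Context {R : realType}.
Local Notation C := R[i].

Lemma hol_bigsum (I : Type) (s : seq I) (f : I -> C -> C) : (forall i, hol (f i)) ->
  hol (fun w => \sum_(i <- s) f i w).
Proof.
move=> hf; elim: s => [|i s IH].
  rewrite (_ : (fun w => _) = fun=> 0); last by apply/funext => w; rewrite big_nil.
  exact: hol_cst.
rewrite (_ : (fun w => _) = fun w => f i w + \sum_(j <- s) f j w); last by apply/funext => w; rewrite big_cons.
exact: holD.
Qed.

Lemma hol_bigprod (I : Type) (s : seq I) (f : I -> C -> C) : (forall i, hol (f i)) ->
  hol (fun w => \prod_(i <- s) f i w).
Proof.
move=> hf; elim: s => [|i s IH].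
  rewrite (_ : (fun w => _) = fun=> 1); last by apply/funext => w; rewrite big_nil.
  exact: hol_cst.
rewrite (_ : (fun w => _) = fun w => f i w * \prod_(j <- s) f j w); last by apply/funext => w; rewrite big_cons.
exact: holM.
Qed.

Definition mxhol m n (F : C -> 'M[C]_(m, n)) := forall i j, hol (fun w => F w i j).

Lemma mxhol_cst m n (X : 'M[C]_(m, n)) : mxhol (fun=> X).
Proof. by move=> i j; exact: hol_cst. Qed.

Lemma mxholD m n (F G : C -> 'M[C]_(m, n)) : mxhol F -> mxhol G -> mxhol (fun w => F w + G w).
Proof.
move=> hF hG i j; rewrite (_ : (fun w => _) = fun w => F w i j + G w i j); first exact: holD.
by apply/funext => w; rewrite mxE.
Qed.

Lemma mxholZ m n (f : C -> C) (G : C -> 'M[C]_(m, n)) : hol f -> mxhol G -> mxhol (fun w => f w *: G w).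
Proof.
move=> hf hG i j; rewrite (_ : (fun w => _) = fun w => f w * G w i j); first exact: holM.
by apply/funext => w; rewrite mxE.
Qed.

Lemma mxholM m n p (F : C -> 'M[C]_(m, n)) (G : C -> 'M[C]_(n, p)) :
  mxhol F -> mxhol G -> mxhol (fun w => F w *m G w).
Proof.
move=> hF hG i j; rewrite (_ : (fun w => _) = fun w => \sum_l F w i l * G w l j); last first.
  by apply/funext => w; rewrite mxE.
by apply: hol_bigsum => l; exact: holM.
Qed.

Lemma hol_det n (M : C -> 'M[C]_n) : mxhol M -> hol (fun w => \det (M w)).
Proof.
move=> hM; apply: hol_bigsum => s; apply: holZ; exact: hol_bigprod.
Qed.

(** Cramer's rule. It describes [invmx] only where the matrix is invertible, so it is used near a
    point of the disk. *)
Lemma mxhol_invmx n (M : C -> 'M[C]_n) : mxhol M -> (forall w, disk w -> M w \in unitmx) ->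
  mxhol (fun w => invmx (M w)).
Proof.
move=> hM uM i j.
have hd : hol (fun w => (\det (M w))^-1).
  split=> w dw; apply: derivableCV; last exact: (holP (hol_det hM)).
  by have := uM w dw; rewrite unitmxE unitfE.
have hc : hol (fun w => cofactor (M w) j i).
  apply: holZ; apply: hol_det => a b.
  rewrite (_ : (fun w => _) = fun w => M w (lift j a) (lift i b)); first exact: hM.
  by apply/funext => w; rewrite !mxE.
have h := holM hd hc; split=> w dw.
apply: (near_eq_derive1 _ (holP h dw)).1.
have := near_disk dw; apply: filterS => v dv.
by rewrite /invmx uM// !mxE.
Qed.

Variables (N k : nat) (V : 'M[C]_(N + k)).
Hypothesis Vc : mxcontraction V.
Let A1 := ulsubmx V.
Let B1 := dlsubmx V.
Let C1 := ursubmx V.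
Let D1 := drsubmx V.

Lemma fro2_col_mx m n l (X : 'M[C]_(m, l)) (Y : 'M[C]_(n, l)) : fro2 (col_mx X Y) = fro2 X + fro2 Y.
Proof.
rewrite /fro2 big_split_ord /=; congr (_ + _); apply: eq_bigr => i _; apply: eq_bigr => j _.
  by rewrite col_mxEu.
by rewrite col_mxEd.
Qed.

Lemma V_col l (x : 'M[C]_(N, l)) (y : 'M[C]_(k, l)) :
  V *m col_mx x y = col_mx (A1 *m x + C1 *m y) (B1 *m x + D1 *m y).
Proof. by rewrite -[V]submxK mul_block_col. Qed.

Lemma resolvent_unit w : disk w -> 1%:M - w *: A1 \in unitmx.
Proof.
rewrite diskE => dw; apply: unitmx_inj => x; rewrite mulmxBl mul1mx => /eqP; rewrite subr_eq0 => /eqP E.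
have h1 : fro2 (A1 *m x) <= fro2 x.
  have := Vc (col_mx x 0); rewrite V_col !mulmx0 !addr0 !fro2_col_mx fro2mx0 addr0; apply: le_trans.
  by rewrite lerDl fro2_ge0.
have h2 : fro2 x = normc w ^+ 2 * fro2 (A1 *m x) by rewrite {1}E -scalemxAl fro2Z.
have w1 : normc w ^+ 2 < 1 by rewrite exprn_ilt1// normc_ge0.
apply: fro2_0; have h0 := fro2_ge0 x; apply/eqP; rewrite eq_le h0 andbT.
have h3 : fro2 x <= normc w ^+ 2 * fro2 x by rewrite {1}h2 ler_wpM2l// exprn_ge0// normc_ge0.
by rewrite -(@pmulr_rle0 _ (1 - normc w ^+ 2)) ?subr_gt0// mulrBl mul1r subr_le0.
Qed.

(** The transfer function of the colligation [V], with state space of dimension [N], scaled by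
    [g]. *)
Definition transfer (g w : C) : 'M[C]_k :=
  g *: (D1 + w *: (B1 *m (invmx (1%:M - w *: A1) *m C1))).

(** [h] is the state: [V] sends [(w h, x)] to [(h, y)] with [y] the output before scaling.
    Contractivity of [V] and [|w| <= 1] give [|y| <= |x|]. *)
Lemma transfer_le (g : R) w l (x : 'M[C]_(k, l)) : disk w ->
  fro2 (transfer g%:C%C w *m x) <= g ^+ 2 * fro2 x.
Proof.
move=> dw; have u := resolvent_unit dw.
pose h := invmx (1%:M - w *: A1) *m (C1 *m x).
have hE : h = A1 *m (w *: h) + C1 *m x.
  have : (1%:M - w *: A1) *m h = C1 *m x by rewrite /h mulKVmx.
  by move=> <-; rewrite mulmxBl mul1mx -scalemxAl -scalemxAr addrC subrK.
have -> : transfer g%:C%C w *m x = g%:C%C *: (B1 *m (w *: h) + D1 *m x).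
  by rewrite /transfer -scalemxAl mulmxDl addrC -scalemxAl -scalemxAr /h !mulmxA.
rewrite fro2Z normc_real -normrX ger0_norm ?sqr_ge0//; apply: ler_wpM2l; first exact: sqr_ge0.
have := Vc (col_mx (w *: h) x); rewrite V_col -hE !fro2_col_mx fro2Z.
have h1 : normc w ^+ 2 * fro2 h <= fro2 h.
  by rewrite ler_piMl ?fro2_ge0// exprn_ile1 ?normc_ge0// -?diskE// ltW// -diskE.
by move=> h2; rewrite -(lerD2l (fro2 h)); apply: (le_trans h2); rewrite lerD2r.
Qed.

Lemma transfer_hol (g : C) : mxhol (transfer g).
Proof.
have hid : hol (fun w : C => w) by split=> w _; exact: derivableC_id.
apply: mxholZ; first exact: hol_cst.
apply: mxholD; first exact: mxhol_cst.
apply: mxholZ => //; apply: mxholM; first exact: mxhol_cst.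
apply: mxholM; last exact: mxhol_cst.
apply: (@mxhol_invmx _ (fun w => 1%:M - w *: A1)) => [|w]; last exact: resolvent_unit.
move=> i j; rewrite (_ : (fun w => _) = fun w => (1%:M : 'M[C]_N) i j - w * A1 i j).
  by apply: holB; [exact: hol_cst|apply: holM => //; exact: hol_cst].
by apply/funext => w; rewrite !mxE.
Qed.

Lemma transfer_derive0 (g : C) : B1 *m C1 = 0 -> derive1 (transfer g) 0 = 0.
Proof.
move=> BC; have hid : hol (fun w : C => w) by split=> w _; exact: derivableC_id.
have hH : mxhol (fun w => B1 *m (invmx (1%:M - w *: A1) *m C1)).
  apply: mxholM; first exact: mxhol_cst.
  apply: mxholM; last exact: mxhol_cst.
  apply: (@mxhol_invmx _ (fun w => 1%:M - w *: A1)) => [|w]; last exact: resolvent_unit.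
  move=> i j; rewrite (_ : (fun w => _) = fun w => (1%:M : 'M[C]_N) i j - w * A1 i j).
    by apply: holB; [exact: hol_cst|apply: holM => //; exact: hol_cst].
  by apply/funext => w; rewrite !mxE.
have H0 : B1 *m (invmx (1%:M - (0 : C) *: A1) *m C1) = 0.
  by rewrite scale0r subr0 invmx1 mul1mx.
move: hH H0; set H := fun w => B1 *m (invmx (1%:M - w *: A1) *m C1).
rewrite (_ : B1 *m (invmx (1%:M - (0 : C) *: A1) *m C1) = H 0) // => hH H0.
have dt : derivable (transfer g) 0 1 by apply/derivable_mxE => i j; exact: (holP (transfer_hol g i j) disk0).
apply/matrixP => i j; rewrite derive1_mxE// mxE.
have -> : (fun w => transfer g w i j) = fun w => g * D1 i j + g * (w * H w i j).
  by apply/funext => w; rewrite /transfer [LHS]mxE [X in g * X]mxE [X in g * (_ + X)]mxE mulrDr.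
have d1 := holP (holM hid (hH i j)) disk0.
have d2 := derive1M (@derivableC_cst R g 0) d1.
rewrite (derive1D (@derivableC_cst R (g * D1 i j) 0) d2.1).2 d2.2 (derive1M (holP hid disk0) (holP (hH i j) disk0)).2.
by rewrite !derive1C_cst derive1C_id H0 mxE !(mulr0, mul0r, addr0).
Qed.

(** The first equation gives [Y = g B1 (1 - w A1)^-1]; substituted into the second, it produces the
    transfer function. *)
Lemma transfer_val (g w : C) (Y : 'M[C]_(k, N)) (Z : 'M[C]_k) : disk w ->
  w *: (Y *m A1) + g *: B1 = Y -> w *: (Y *m C1) + g *: D1 = Z -> transfer g w = Z.
Proof.
move=> dw h1 h2; have u := resolvent_unit dw.
have h3 : Y *m (1%:M - w *: A1) = g *: B1.
  by rewrite mulmxBr mulmx1 -scalemxAr -{1}h1 addrC addKr.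
have h4 : g *: (B1 *m invmx (1%:M - w *: A1)) = Y by rewrite scalemxAl -h3 mulmxK.
by rewrite /transfer mulmxA scalerDr scalerA mulrC -scalerA scalemxAl h4 addrC.
Qed.

End Realization.

Local Opaque emb.

Lemma sum_pick (V : nmodType) (I : finType) (i : I) (f : I -> V) : (forall j, j != i -> f j = 0) -> \sum_j f j = f i.
Proof. by move=> h; rewrite (bigD1 i) //= big1 ?addr0. Qed.

(** * Block diagonal operators commuting with the backward shift *)

Section Symbol.
Context {R : realType} (n k : nat).
Local Notation C := R[i].
Variable (z : 'I_n -> C).
Hypothesis z_disk : forall i, disk (z i).
Local Notation A := ('I_n + bool)%type.
Local Notation N := #|{: A * 'I_k}|.
Local Notation emb a := (@emb R A k a).
Local Notation Ev := (@Evr R n k z).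
Variable R0 : 'M[C]_N.
Hypotheses (R0u : R0 \in unitmx) (R0K : R0 ^t* *m R0 = Ecol z Ev).
Local Notation B := (bshift z R0).
Local Notation e := (onb z R0).

Definition bdiag (t : A -> 'M[C]_k) : 'M[C]_N := \sum_a emb a *m t a *m emb a ^t*.

Lemma bdiag_emb t a : bdiag t *m emb a = emb a *m t a.
Proof.
rewrite /bdiag mulmx_suml (sum_pick (i := a)) => [|b /negbTE ba].
  by rewrite -(mulmxA (emb a *m t a)) (emb_orth1 k a) mulmx1.
by rewrite -(mulmxA (emb b *m t b)) (emb_orth k b a) ba mulmx0.
Qed.

Lemma emb_bdiag t a : emb a ^t* *m bdiag t = t a *m emb a ^t*.
Proof.
rewrite /bdiag mulmx_sumr (sum_pick (i := a)) => [|b /negbTE ba].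
  by rewrite !mulmxA (emb_orth1 k a) mul1mx.
by rewrite !mulmxA (emb_orth k a b) eq_sym ba !mul0mx.
Qed.

Lemma bdiag_bshift0 t : t (inr true) = t (inr false) ->
  bdiag t *m bshift0 k z = bshift0 k z *m bdiag t.
Proof.
move=> tt; rewrite /bshift0 mulmxDr mulmxDl; congr (_ + _).
  rewrite mulmx_sumr [RHS]mulmx_suml; apply: eq_bigr => i _; rewrite -scalemxAr -scalemxAl; congr (_ *: _).
  by rewrite mulmxA bdiag_emb -[RHS]mulmxA emb_bdiag mulmxA.
by rewrite mulmxA bdiag_emb -[RHS]mulmxA emb_bdiag mulmxA tt.
Qed.

Variable F : C -> 'M[C]_k.
Hypothesis hF : Hinf1 F.

(* The same block [X] on the constants and on the coordinate function is what
   commutation with the backward shift allows. *)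
Definition symb (X : 'M[C]_k) (a : A) : 'M[C]_k :=
  match a with inl i => (F (z i)) ^t* | inr _ => (F 0) ^t* + X end.

Definition Tsymb X := R0 *m bdiag (symb X) *m invmx R0.

Local Notation J a := (R0 *m emb a).
Local Notation J' a := (emb a ^t* *m invmx R0).
Local Notation L := (Lpar (J (inr false)) (J (inr true)) (J' (inr false)) (J' (inr true))).

Lemma J'J a b : J' a *m J b = if a == b then 1%:M else 0.
Proof. by rewrite -mulmxA mulKmx// emb_orth. Qed.

Lemma Tsymb_Lpar X : Tsymb 0 + L X = Tsymb X.
Proof.
rewrite /Tsymb /Lpar.
have -> : bdiag (symb X) = bdiag (symb 0) +
    (emb (inr false) *m X *m emb (inr false) ^t* + emb (inr true) *m X *m emb (inr true) ^t*).
  rewrite /bdiag !big_sumType !big_bool /= addr0 -addrA; congr (_ + _).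
  move: (emb (inr true)) (emb (inr false)) ((F 0) ^t*) => u v W.
  by rewrite !mulmxDr !mulmxDl addrACA; congr (_ + _); exact: addrC.
move: (bdiag _) (emb (inr true)) (emb (inr false)) => P u v.
by rewrite !mulmxDr !mulmxDl !mulmxA.
Qed.

Lemma Lpar_pick X : J' (inr false) *m L X *m J (inr false) = X.
Proof.
rewrite /Lpar; have e1 := J'J (inr false) (inr false); have e2 := J'J (inr false) (inr true).
move: e1 e2; rewrite /=; move: (J (inr false)) (J (inr true)) (J' (inr false)) (J' (inr true)) => a b c d ca cb.
by rewrite mulmxDr mulmxDl !mulmxA ca cb !mul0mx addr0 mul1mx -mulmxA ca mulmx1.
Qed.

Lemma Tsymb_comm X : Tsymb X *m B = B *m Tsymb X.
Proof.
rewrite /Tsymb /bshift; have := @bdiag_bshift0 (symb X) erefl.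
move: (bdiag _) (bshift0 _ _) => P Q PQ; rewrite !mulmxA !mulmxKV//.
by rewrite -!mulmxA (mulmxA P) PQ !mulmxA.
Qed.

(** On the functionals [ev a], multiplication by [F] acts through [F (z i)] and, for both
    functionals at 0, through [F 0]; for the derivative this rests on [F'(0) = 0]. *)
Lemma modelcoord_mulop l (h : C -> 'M[C]_(k, l)) : mH2 h ->
  modelcoord z R0 (mulop F h) = (Tsymb 0) ^t* *m modelcoord z R0 h.
Proof.
move=> hh; rewrite /modelcoord /Tsymb !ctmxM -!mulmxA; congr (_ *m _).
rewrite [X in _ *m X]mulmxA -ctmxM mulVmx// ctmx1 mul1mx.
apply: emb_eq => a; rewrite /Ecol emb_pick mulmxA -ctmxM bdiag_emb ctmxM -mulmxA emb_pick.
case: a => [i|[]] /=; rewrite ?trmxCK ?addr0 ?trmxCK//.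
have [[dF _] F1] := hF.
by rewrite (derive1_mulmx (dF _ disk0) (mH2_derivable hh disk0)).2 F1 mul0mx add0r.
Qed.

Lemma inner_mulop_onb l (f h : 'M[C]_(N, l)) :
  inner (mulop F (fun w => e w *m h)) (fun w => e w *m f) = (\tr (h ^t* *m Tsymb 0 *m f))^*.
Proof.
have hh := mH2_onb z_disk R0 h.
rewrite (inner_onb z_disk _ _ (mulop_mH2 hF.1 hh)) (modelcoord_mulop hh) (modelcoord_onb z_disk R0u R0K).
by rewrite mulmxA tr_adj3.
Qed.

Lemma onb0_J a : e 0 *m J a = (phi z a 0)%:M.
Proof. by rewrite /onb -mulmxA mulKmx// Evr_emb. Qed.

Lemma Tsymb_J X a : Tsymb X *m J a = J a *m symb X a.
Proof. by rewrite /Tsymb -!mulmxA mulKmx// bdiag_emb. Qed.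

Lemma bshift0_emb a : bshift0 k z *m emb a =
  match a with inl i => (z i)^* *: emb (inl i) | inr true => emb (inr false) | inr false => 0 end.
Proof.
rewrite /bshift0 mulmxDl mulmx_suml -mulmxA emb_orth; case: a => [i|b] /=.
  rewrite mulmx0 addr0 (sum_pick (i := i)) => [|j /negbTE ji].
    by rewrite -scalemxAl -mulmxA (emb_orth1 k (inl i)) mulmx1.
  by rewrite -scalemxAl -mulmxA (emb_orth k (inl j) (inl i)) (_ : (inl j == inl i :> A) = false) ?mulmx0 ?scaler0.
rewrite big1 => [|j _]; last by rewrite -scalemxAl -mulmxA emb_orth mulmx0 scaler0.
by rewrite add0r; case: b => /=; rewrite ?mulmx1 ?mulmx0.
Qed.

Lemma bshift_J a : B *m J a =
  match a with inl i => (z i)^* *: J (inl i) | inr true => J (inr false) | inr false => 0 end.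
Proof.
rewrite /bshift -!mulmxA mulKmx// bshift0_emb; case: a => [i|[]] //; last by rewrite mulmx0.
by rewrite scalemxAr.
Qed.

Variable g : R.
Hypothesis g0 : 0 < g.

(* Applying the adjoint relations to the kernel at [z i] gives the values of the
   transfer function, and to [1] and [w] its derivative at 0. *)
Lemma lift_interp X (D : 'M[C]_N) (U : 'M[C]_(N + k)) : mxcontraction (U ^t*) ->
  U *m col_mx (D *m B) (g%:C%C *: e 0) = col_mx D (e 0 *m Tsymb X) ->
  exists2 G, interp_ideal z G & (Hinf_norm (F \- G)%R <= g%:E)%E.
Proof.
move=> cU UE; set V := U ^t* in cU.
pose S := transfer V g%:C%C.
(* The adjoint of the relation [UE] on the block [J a], read as two equations in the blocks of
   [V]. *)
have key a (p := phi z a 0) : (B *m J a) ^t* *m D ^t* *m ulsubmx V + (g%:C%C * p) *: dlsubmx V = (J a) ^t* *m D ^t* /\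
  (B *m J a) ^t* *m D ^t* *m ursubmx V + (g%:C%C * p) *: drsubmx V = p *: (symb X a) ^t*.
  have p0 : p^* = p.
    by rewrite /p; clear p; case: a => [i|[]] /=; rewrite ?conjC0 ?conjC1// /kern mulr0 subr0 invr1 conjC1.
  have := congr1 (fun M => (M *m J a) ^t*) UE.
  have := Tsymb_J X a; have := onb0_J a; rewrite -/p.
  move: (J a) (e 0) (Tsymb X) B UE => j E T BB UE e2 e3 /=.
  rewrite -mulmxA !mul_col_mx -(mulmxA D) -scalemxAl e2 -(mulmxA E) e3 (mulmxA E) e2 mul_scalar_mx.
  rewrite ctmxM !adj_col -/V -[V in _ *m V]submxK mul_row_block => /eq_row_mx[].
  rewrite scale_scalar_mx !(tr_scalar_mx, map_scalar_mx) /= rmorphM /= conj_realC p0 !mul_scalar_mx.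
  rewrite ctmxZ p0 => h1 h2.
  by rewrite -(ctmxM D (BB *m j)) -(ctmxM D j).
have Si i : S (z i) = F (z i).
  have [h1 h2] := key (inl i); rewrite bshift_J /= in h1 h2.
  have p1 : kern (z i) 0 = 1 by rewrite /kern mulr0 subr0 invr1.
  rewrite p1 mulr1 ctmxZ conjCK -!scalemxAl in h1.
  rewrite p1 mulr1 scale1r trmxCK ctmxZ conjCK -!scalemxAl in h2.
  exact: (transfer_val cU (z_disk i) h1 h2).
have [h1 h2] := key (inr false); have [h3 h4] := key (inr true).
rewrite bshift_J /= ctmx0 !mul0mx add0r mulr1 in h1.
rewrite bshift_J /= mulr0 !scale0r !addr0 in h3.
rewrite bshift_J /= mulr0 !scale0r !addr0 in h4.
have gn : (g%:C%C : C) != 0 by rewrite (_ : 0 = 0%:C%C)// (inj_eq (@complexI R)) gt_eqF.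
(* The constant function identifies [g] times the lower left block with the row [(J 1)^* D^*]; the
   coordinate function, which [B] shifts to the constant, says that this row is annihilated by the
   upper right block. *)
have BC : dlsubmx V *m ursubmx V = 0.
  have : g%:C%C *: (dlsubmx V *m ursubmx V) = 0 by rewrite scalemxAl h1 h4.
  by move=> /eqP; rewrite scaler_eq0 (negbTE gn) => /eqP.
have S0 := transfer_derive0 cU g%:C%C BC.
have hS : Hinf S.
  split; first by move=> w dw; apply/derivable_mxE => i j; exact: (holP (transfer_hol cU _ i j) dw).
  apply: (@le_lt_trans _ _ g%:E); last exact: ltry.
  by apply: le_Hinf_norm (ltW g0) _ => w dw x; exact: transfer_le.
exists (F \- S).
  split; last by move=> i; rewrite /= Si subrr.
  split; first exact: Hinf_sub hF.1 hS.
  have [[dF _] F1] := hF; have [dS _] := hS.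
  by rewrite derive1E deriveB -?derive1E ?F1 ?S0 ?subr0//; [exact: dF disk0|exact: dS disk0].
apply: le_Hinf_norm (ltW g0) _ => w dw x; rewrite /= subKr; exact: transfer_le.
Qed.

End Symbol.

(** * Compressions to the model spaces *)

Lemma Re_le_prod0 (R : realType) (u : R[i]) (d : R) : normc u <= d -> complex.Re u <= d.
Proof. by move=> h; apply: (le_trans (ler_norm _)); apply: (le_trans (Re_le_normc _)). Qed.

Section Projection.
Context {R : realType}.
Local Notation C := R[i].

Lemma derive1_mxB m l (F G : C -> 'M[C]_(m, l)) w : derivable F w 1 -> derivable G w 1 ->
  derive1 (fun w => F w - G w) w = derive1 F w - derive1 G w.
Proof. by move=> dF dG; have h := deriveB dF dG; rewrite !derive1E; exact: h. Qed.

Lemma derive1_mxD m l (F G : C -> 'M[C]_(m, l)) w : derivable F w 1 -> derivable G w 1 ->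
  derive1 (fun w => F w + G w) w = derive1 F w + derive1 G w.
Proof. by move=> dF dG; have h := deriveD dF dG; rewrite !derive1E; exact: h. Qed.

Lemma tr_row m l l' (c0 c1 : 'M[C]_(m, l)) (U : 'M[C]_(m, l')) (a b : 'M[C]_(l', l)) :
  c0 *m a ^t* + c1 *m b ^t* = 0 ->
  \tr (c0 ^t* *m (U *m a)) + \tr (c1 ^t* *m (U *m b)) = 0.
Proof.
move=> h; rewrite 2!mulmxA [X in X + _]mxtrace_mulC [X in _ + X]mxtrace_mulC 2!mulmxA -mxtraceD -mulmxDl.
by rewrite -[a]trmxCK -[b]trmxCK -!ctmxM -ctmxD h ctmx0 mul0mx mxtrace0.
Qed.

Lemma Hardy2_ab_mH2 k l' l (a b : 'M[C]_(l', l)) (f : C -> 'M[C]_(k, l)) : Hardy2_ab a b f -> mH2 f.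
Proof. by case=> /mxHardy2P. Qed.

(** Membership constrains only the value and the derivative at 0, so the projection changes only the
    coefficients of 1 and w. The row [[G(0) G'(0)]] is projected onto the row space of [[a b]], with
    projection matrix [[a b]^* [a b]] because [[a b]] is coisometric. *)
Lemma Hardy2_ab_proj k l' l (a b : 'M[C]_(l', l)) (G : C -> 'M[C]_(k, l)) :
  a *m a ^t* + b *m b ^t* = 1%:M -> mH2 G ->
  exists p, [/\ Hardy2_ab a b p, forall q, Hardy2_ab a b q -> inner q G = inner q p &
    inner_norm p <= inner_norm G].
Proof.
move=> ab hG; pose W := G 0 *m a ^t* + derive1 G 0 *m b ^t*.
pose c0 := G 0 - W *m a; pose c1 := derive1 G 0 - W *m b.
have c01 : c0 *m a ^t* + c1 *m b ^t* = 0.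
  by rewrite !mulmxBl addrACA -opprD -!mulmxA -mulmxDr ab mulmx1 subrr.
pose K0 : C -> 'M[C]_(k, l) := fun=> c0; pose K1 : C -> 'M[C]_(k, l) := fun w => w *: c1.
have h0 : mH2 K0 by exact: mH2_cst.
have h1 : mH2 K1 by exact: mH2_scal H2_id.
have hK : mH2 (fun w => K0 w + K1 w) := mH2D h0 h1.
pose p := fun w => G w - (K0 w + K1 w).
have hp : mH2 p := mH2B hG hK.
have dG := mH2_derivable hG disk0; have d0 := mH2_derivable h0 disk0; have d1 := mH2_derivable h1 disk0.
have pab : Hardy2_ab a b p.
  split; first exact/mxHardy2P.
  exists W; split; first by rewrite /p /K0 /K1 scale0r addr0 /c0 subKr.
  have dK1 : derive1 K1 0 = c1.
    by have := ev_scal (fun _ : 'I_0 => 0) c1 (inr true) H2_id; rewrite /= derive1C_id scale1r.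
  rewrite (derive1_mxB dG (mH2_derivable hK disk0)) (derive1_mxD d0 d1) dK1.
  have -> : derive1 K0 0 = 0 by exact: derive1_cst.
  by rewrite add0r /c1 subKr.
have orth q : Hardy2_ab a b q -> inner q (fun w => K0 w + K1 w) = 0.
  move=> [/mxHardy2P hq [U [q0 q1]]].
  by rewrite (innerDr h0 h1 hq) (inner_cst _ hq) (inner_id _ hq) !frodE q0 q1 (tr_row _ c01).
have eq q : Hardy2_ab a b q -> inner q G = inner q p.
  by move=> Hq; rewrite (innerBr hG hK (Hardy2_ab_mH2 Hq)) (orth _ Hq) subr0.
exists p; split; [exact: pab|exact: eq|].
have e2 : complex.Re (inner p p) <= inner_norm G * inner_norm p.
  by rewrite -(eq _ pab) mulrC; exact: (Re_le_prod0 (inner_CauchySchwarz hp hG)).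
exact: (le_of_sq_le (inner_norm_ge0 p) (inner_norm_ge0 G) (inner_normsq hp) e2).
Qed.

End Projection.

Section Witness.
Context {R : realType} (n k : nat).
Local Notation C := R[i].
Variable (z : 'I_n -> C).
Hypothesis z_disk : forall i, disk (z i).
Local Notation A := ('I_n + bool)%type.
Local Notation N := #|{: A * 'I_k}|.
Local Notation emb a := (@emb R A k a).
Local Notation Ev := (@Evr R n k z).
Variable R0 : 'M[C]_N.
Hypotheses (R0u : R0 \in unitmx) (R0K : R0 ^t* *m R0 = Ecol z Ev).
Local Notation e := (onb z R0).
Variable F : C -> 'M[C]_k.
Hypothesis hF : Hinf1 F.
Local Notation J a := (R0 *m emb a).
Local Notation J' a := (emb a ^t* *m invmx R0).
Local Notation T0 := (Tsymb z R0 F 0).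

Lemma J_modelcoord l (H : C -> 'M[C]_(k, l)) a : (J a) ^t* *m modelcoord z R0 H = ev z a H.
Proof.
by rewrite ctmxM -mulmxA /modelcoord [X in _ *m X]mulmxA -ctmxM mulVmx// ctmx1 mul1mx /Ecol emb_pick.
Qed.

(* The hypothesis on [f] says that its components along [1] and [w] are
   orthogonal to the space, so only the values at the [z i] count. *)
Lemma inner_onb_vanish l' l (a b : 'M[C]_(l', l)) (f : 'M[C]_(N, l)) (q : C -> 'M[C]_(k, l)) :
  J' (inr false) *m f *m a ^t* + J' (inr true) *m f *m b ^t* = 0 ->
  Hardy2_ab a b q -> (forall i, q (z i) = 0) -> inner q (fun w => e w *m f) = 0.
Proof.
move=> fab [/mxHardy2P hq [U [q0 q1]]] qz.
have -> : (fun w => e w *m f) = fun w => Ev w *m (invmx R0 *m f).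
  by apply/funext => w; rewrite onbE.
rewrite (inner_Phi z_disk _ hq) /Ecol mulmx_sumr raddf_sum big_sumType big_bool /= q0 q1 big1 ?add0r.
  have e b' X : \tr ((invmx R0 *m f) ^t* *m (emb (inr b') *m X)) =
      \tr ((emb (inr b') ^t* *m invmx R0 *m f) ^t* *m X).
    by rewrite -(mulmxA (emb (inr b') ^t*)) (ctmxM (emb (inr b') ^t*)) trmxCK mulmxA.
  by rewrite addrC 2!e tr_row.
by move=> i _; rewrite qz !mulmx0 mxtrace0.
Qed.

(** The projection [p] of the function of [f] lies in the model space. An adjoint image of [p]
    exists, namely the projection [p'] of the function of [T0 f], so [adjoint_in] does not return
    its default value; the pairing becomes one of [H] with [M_F^* p]. *)
Lemma model_bound l' l (a b : 'M[C]_(l', l)) (f : 'M[C]_(N, l)) (H : C -> 'M[C]_(k, l)) (g : R) :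
  a *m a ^t* + b *m b ^t* = 1%:M -> 0 <= g ->
  J' (inr false) *m f *m a ^t* + J' (inr true) *m f *m b ^t* = 0 ->
  fro2 f <= 1 -> Hardy2_ab a b H -> (adjoint_mul_norm z F a b <= g%:E)%E ->
  normc (inner (mulop F H) (fun w => e w *m f)) <= g * inner_norm H.
Proof.
move=> ab g0 fab f1 HH hg; have hf := mH2_onb z_disk R0 f.
have [p [pab pE pn]] := Hardy2_ab_proj ab hf.
have [p' [p'ab p'E _]] := Hardy2_ab_proj ab (mH2_onb z_disk R0 (T0 *m f)).
have p1 : inner_norm p <= 1.
  apply: (le_trans pn); apply: sqr_le_mono => //; first exact: inner_norm_ge0.
  by rewrite (norm_onb z_disk R0u R0K) expr1n.
have pm : model_space z a b p.
  split=> // q [Hq [q' hq' qq']]; have hq := Hardy2_ab_mH2 Hq.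
  rewrite (inner_conj hq (Hardy2_ab_mH2 pab)) -(pE _ Hq) (inner_onb_vanish fab Hq) ?conjC0// => i.
  rewrite qq' ?z_disk// /blaschke (bigD1 i)//= subrr mul0r mul0r mul_scalar_mx scale0r//.
have adj q : Hardy2_ab a b q -> inner (mulop F q) p = inner q p'.
  move=> Hq; have hq := Hardy2_ab_mH2 Hq.
  rewrite -(pE _ (mulop_ab hF Hq)) -(p'E _ Hq) (inner_onb z_disk _ _ (mulop_mH2 hF.1 hq)).
  have e1 := modelcoord_mulop z R0u hF hq.
  have e2 := inner_onb z_disk R0 (T0 *m f) hq.
  by rewrite e1 e2 (ctmxM T0 f) mulmxA.
pose h := adjoint_in (Hardy2_ab a b) (mulop F) p.
have [hab hE] : Hardy2_ab a b h /\ forall q, Hardy2_ab a b q -> inner (mulop F q) p = inner q h.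
  rewrite /h /adjoint_in; case: xgetP => [y _ []//|/(_ p')[]]; by split.
have hn : inner_norm h <= g.
  by rewrite -lee_fin; apply: (le_trans _ hg); apply: ereal_sup_ubound; exists p.
rewrite (pE _ (mulop_ab hF HH)) (hE _ HH) mulrC.
apply: (le_trans (inner_CauchySchwarz (Hardy2_ab_mH2 HH) (Hardy2_ab_mH2 hab))).
by apply: ler_wpM2l hn; exact: inner_norm_ge0.
Qed.

End Witness.

(** * Excluding the dual witness *)

Section Annihilator.
Context {R : realType}.
Local Notation C := R[i].

Lemma adj_row m p q (a : 'M[C]_(m, p)) (b : 'M[C]_(m, q)) : (row_mx a b) ^t* = col_mx (a ^t*) (b ^t*).
Proof. by rewrite -[a]trmxCK -[b]trmxCK -adj_col !trmxCK. Qed.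

(** Cyclicity of the trace turns the condition into [tr (U^* X S) = 0] for all [X]; the choice
    [X = U'^* S^*] then gives [|S|^2 = 0], since [U' U = 1]. *)
Lemma annihilator N k l r (f h : 'M[C]_(N, l)) (j0 j1 : 'M[C]_(N, k)) (j0' j1' : 'M[C]_(k, N))
    (U : 'M[C]_(k, r)) (U' : 'M[C]_(r, k)) (a b : 'M[C]_(r, l)) :
  U' *m U = 1%:M -> j0 ^t* *m h = U *m a -> j1 ^t* *m h = U *m b ->
  (forall X, \tr (h ^t* *m Lpar j0 j1 j0' j1' X *m f) = 0) ->
  j0' *m f *m a ^t* + j1' *m f *m b ^t* = 0.
Proof.
move=> U'U h0 h1 ann; set S := _ + _.
have trS X : \tr (U ^t* *m X *m S) = 0.
  rewrite -(ann X) /Lpar.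
  have e0 : h ^t* *m j0 = a ^t* *m U ^t* by have := congr1 (fun M => M ^t*) h0; rewrite /= !ctmxM trmxCK.
  have e1 : h ^t* *m j1 = b ^t* *m U ^t* by have := congr1 (fun M => M ^t*) h1; rewrite /= !ctmxM trmxCK.
  rewrite /S !mulmxDr mulmxDl !mxtraceD !mulmxA e0 e1; congr (_ + _).
    by rewrite [LHS]mxtrace_mulC !mulmxA.
  by rewrite [LHS]mxtrace_mulC !mulmxA.
have := trS (U' ^t* *m S ^t*); rewrite mulmxA -ctmxM U'U ctmx1 mul1mx -frodE; exact: fro2_eq0.
Qed.

Lemma annihilator_scale N k l r (c : C) (f : 'M[C]_(N, l)) (j0 j1 : 'M[C]_(k, N)) (a b : 'M[C]_(r, l)) :
  j0 *m f *m a ^t* + j1 *m f *m b ^t* = 0 ->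
  j0 *m (c *: f) *m a ^t* + j1 *m (c *: f) *m b ^t* = 0.
Proof. by move=> h; rewrite -!scalemxAr -!scalemxAl -scalerDr h scaler0. Qed.

Lemma amgm_contra (g a b x : R) : 0 < g -> - x <= g * (a * b) -> g * (a ^+ 2 + b ^+ 2) + 2 * x < 0 -> False.
Proof.
move=> g0 h1 h2; have h3 : 0 <= g * (a - b) ^+ 2 by rewrite mulr_ge0 ?sqr_ge0// ltW.
have E : g * (a - b) ^+ 2 = g * (a ^+ 2 + b ^+ 2) - 2 * (g * (a * b)) by ring.
rewrite E in h3; lra.
Qed.

End Annihilator.

Section NoWitness.
Context {R : realType} (n k : nat).
Local Notation C := R[i].
Variable (z : 'I_n -> C).
Hypothesis z_disk : forall i, disk (z i).
Local Notation A := ('I_n + bool)%type.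
Local Notation N := #|{: A * 'I_k}|.
Local Notation emb a := (@emb R A k a).
Local Notation Ev := (@Evr R n k z).
Variable R0 : 'M[C]_N.
Hypotheses (R0u : R0 \in unitmx) (R0K : R0 ^t* *m R0 = Ecol z Ev).
Local Notation e := (onb z R0).
Variable F : C -> 'M[C]_k.
Hypothesis hF : Hinf1 F.
Local Notation J a := (R0 *m emb a).
Local Notation J' a := (emb a ^t* *m invmx R0).
Local Notation T0 := (Tsymb z R0 F 0).
Local Notation L := (Lpar (J (inr false)) (J (inr true)) (J' (inr false)) (J' (inr true))).

Lemma no_witness (g : R) l (f h : 'M[C]_(N, l)) : 0 < g ->
  (forall (l' l : nat) (a b : 'M[C]_(l', l)), (1 <= l)%N -> (l <= l')%N -> (l' <= k)%N -> admissible a b ->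
    (adjoint_mul_norm z F a b <= g%:E)%E) ->
  (forall v : 'cV[C]_l, e 0 *m h *m v = 0 -> v = 0) ->
  (forall X, \tr (h ^t* *m L X *m f) = 0) ->
  g * (fro2 f + fro2 h) + 2 * complex.Re (\tr (h ^t* *m T0 *m f)) < 0 -> False.
Proof.
move=> g0 bound hinj ann neg.
(* With [l = 0] all norms and traces vanish, against the strict inequality. *)
have l1 : (1 <= l)%N.
  case: l f h hinj ann neg => // f h _ _.
  by rewrite (thinmx0 f) (thinmx0 h) !fro2mx0 mulmx0 mxtrace0 addr0 !mulr0 addr0 ltxx.
pose H w := e w *m h; have hH : mH2 H := mH2_onb z_disk R0 h.
have [r [U [Q [U' [ME QQ U'U rk]]]]] := row_orthonormal (row_mx (H 0) (derive1 H 0)).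
pose a := lsubmx Q; pose b := rsubmx Q.
have [H0 H1] : H 0 = U *m a /\ derive1 H 0 = U *m b.
  by apply: eq_row_mx; rewrite ME -mul_mx_row hsubmxK.
have ab : a *m a ^t* + b *m b ^t* = 1%:M by rewrite -mul_row_col -adj_row hsubmxK.
have ainj (x : 'cV[C]_l) : a *m x = 0 -> x = 0.
  by move=> ax; apply: hinj; rewrite -/(H 0) H0 -mulmxA ax mulmx0.
have lr : (l <= r)%N.
  have /eqP <- : row_free (a^T).
    apply: inj_row_free => v va; apply: trmx_inj; rewrite trmx0; apply: ainj.
    by apply: trmx_inj; rewrite trmx_mul trmxK va trmx0.
  exact: rank_leq_col.
have hg := bound _ _ a b l1 lr rk (conj ab ainj).
have HH : Hardy2_ab a b H by split; [exact/mxHardy2P|exists U].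
have hc : modelcoord z R0 H = h := modelcoord_onb z_disk R0u R0K h.
have fab : J' (inr false) *m f *m a ^t* + J' (inr true) *m f *m b ^t* = 0.
  apply: (annihilator U'U _ _ ann); rewrite -hc J_modelcoord//.
have [f0|f0] := eqVneq (fro2 f) 0.
  move: neg; rewrite f0 (fro2_0 f0) mulmx0 mxtrace0 mulr0 addr0 add0r ltNge mulr_ge0 ?fro2_ge0 ?ltW//.
have fp : 0 < fro2 f by rewrite lt_neqAle eq_sym f0 fro2_ge0.
pose c := (Num.sqrt (fro2 f))^-1; have cp : 0 < c by rewrite invr_gt0 sqrtr_gt0.
have cc : c ^+ 2 * fro2 f = 1 by rewrite /c exprVn sqr_sqrtr ?fro2_ge0// mulVf.
have fc : fro2 (c%:C%C *: f) <= 1 by rewrite fro2Z normc_real gtr0_norm// cc.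
have fabc : J' (inr false) *m (c%:C%C *: f) *m a ^t* + J' (inr true) *m (c%:C%C *: f) *m b ^t* = 0.
  exact: annihilator_scale.
have := model_bound z_disk R0u R0K hF ab (ltW g0) fabc fc HH hg.
rewrite (inner_mulop_onb z_disk R0u R0K hF) normc_conj -scalemxAr mxtraceZ normcM normc_real gtr0_norm//.
have hn := norm_onb z_disk R0u R0K h; rewrite -/H in hn.
move: neg; set x := \tr _; rewrite -hn => neg nx.
have sf : Num.sqrt (fro2 f) ^+ 2 = fro2 f by rewrite sqr_sqrtr// fro2_ge0.
rewrite -sf in neg; apply: (amgm_contra g0 _ neg).
apply: (@le_trans _ _ (normc x)); first by apply: (le_trans (ler_norm _)); rewrite normrN; exact: Re_le_normc.
by rewrite [_ * inner_norm H]mulrC mulrA -ler_pdivrMr ?sqrtr_gt0// mulrC.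
Qed.

End NoWitness.

(** * The two inequalities combined *)

Section Final.
Context {R : realType}.
Local Notation C := R[i].

Lemma adjoint_mul_norm_ge0 k l' l n (z : 'I_n -> C) (F : C -> 'M[C]_k) (a b : 'M[C]_(l', l)) :
  (0 <= adjoint_mul_norm z F a b)%E.
Proof.
pose o : C -> 'M[C]_(k, l) := fun=> 0; have ho : mH2 o := mH2_cst 0.
have n0 : inner_norm o = 0.
  by have /eqP := inner_normsq ho; rewrite (inner0l ho) sqrf_eq0 => /eqP.
apply: (@le_trans _ _ (inner_norm (adjoint_in (Hardy2_ab a b) (mulop F) o))%:E).
  by rewrite lee_fin inner_norm_ge0.
apply: ereal_sup_ubound; exists o => //; split; last by rewrite n0.
split.
  split; first exact/mxHardy2P.
  by exists 0; rewrite !mul0mx; split=> //; exact: derive1_cst.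
by move=> G [[/mxHardy2P hG _] _]; exact: inner0l.
Qed.

Lemma dist_le k n (z : 'I_n -> C) (F : C -> 'M[C]_k) (g : R) :
  injective z -> (forall i, z i != 0) -> (forall i, disk (z i)) -> Hinf1 F -> 0 < g ->
  (forall (l' l : nat) (a b : 'M[C]_(l', l)), (1 <= l)%N -> (l <= l')%N -> (l' <= k)%N -> admissible a b ->
    (adjoint_mul_norm z F a b <= g%:E)%E) ->
  (Hinf_dist F (interp_ideal z) <= g%:E)%E.
Proof.
move=> zi z0 zd hF g0 bound.
have [R0 R0u R0K] := gram_root k zi zd z0.
have obs (x : 'cV_#|{: ('I_n + bool) * 'I_k}|) :
    (forall j, onb z R0 0 *m iter j (mulmx (bshift z R0)) x = 0) -> x = 0.
  by move=> hx; exact: (bshift_observable zd R0u R0K hx).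
have TB X : (Tsymb z R0 F 0 + Lpar (R0 *m emb k (inr false)) (R0 *m emb k (inr true))
    (emb k (inr false) ^t* *m invmx R0) (emb k (inr true) ^t* *m invmx R0) X) *m bshift z R0 =
  bshift z R0 *m (Tsymb z R0 F 0 + Lpar (R0 *m emb k (inr false)) (R0 *m emb k (inr true))
    (emb k (inr false) ^t* *m invmx R0) (emb k (inr true) ^t* *m invmx R0) X).
  rewrite (Tsymb_Lpar z R0 F X); exact: Tsymb_comm.
have [[X [D [U [cU UE]]]]|[l [f [h [h1 h2 h3]]]]] :=
  lift_or_witness (bshift_isometry zd R0u R0K) TB obs (@Lpar_pick _ _ _ _ R0u) g0.
- rewrite Tsymb_Lpar in UE.
  have [G hG le] := lift_interp zd R0u hF g0 cU UE.
  by apply: le_trans le; apply: ereal_inf_lbound; exists G.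
- by have := no_witness zd R0u R0K hF g0 bound h1 h2 h3.
Qed.

End Final.

Theorem corollary2p9 (R : realType) (k n : nat) (hk : (1 <= k)%N)
  (hn : (1 <= n)%N) (z : 'I_n -> R[i]) (z_inj : injective z)
  (z_neq0 : forall i, z i != 0) (z_disk : forall i, disk (z i))
  (F : R[i] -> 'M[R[i]]_k) (hF : Hinf1 F) :
  Hinf_dist F (interp_ideal z) =
  ereal_sup [set x : \bar R |
    exists (l' l : nat) (a b : 'M[R[i]]_(l', l)),
      [/\ (1 <= l)%N, (l <= l')%N, (l' <= k)%N, admissible a b
        & x = adjoint_mul_norm z F a b]].
Proof.
set T := [set x | _]; apply/eqP; rewrite eq_le; apply/andP; split; last first.
  apply: ge_ereal_sup => _ [l' [l [a [b [_ _ _ _ ->]]]]].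
  by apply: le_ereal_inf_tmp => _ [G hG <-]; exact: adjoint_le.
have ub l' l (a b : 'M[R[i]]_(l', l)) : (1 <= l)%N -> (l <= l')%N -> (l' <= k)%N -> admissible a b ->
    (adjoint_mul_norm z F a b <= ereal_sup T)%E.
  by move=> *; apply: ereal_sup_ubound; exists l', l, a, b.
have T0 : (0 <= ereal_sup T)%E.
  (* As [1 <= k], the pair [(1, 0)] with [l = l' = 1] takes part in the supremum, which is therefore
     nonnegative. *)
  have adm : admissible (1%:M : 'M[R[i]]_1) 0.
    by split=> [|x]; [rewrite ctmx1 mulmx1 mul0mx addr0|rewrite mul1mx].
  exact: le_trans (adjoint_mul_norm_ge0 z F 1%:M 0) (ub _ _ _ _ (leqnn _) (leqnn _) hk adm).
case: (ereal_sup T) T0 ub => [s|_ _|//]; last by rewrite leey.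
(* The slack [e] makes the level [s + e] positive even when the supremum is 0, as [dist_le]
   requires. *)
rewrite lee_fin => s0 ub; apply/lee_addgt0Pr => e e0; rewrite -EFinD.
apply: dist_le => //; first exact: ltr_wpDl.
move=> l' l a b h1 h2 h3 h4; apply: le_trans (ub l' l a b h1 h2 h3 h4) _.
by rewrite lee_fin lerDl ltW.
Qed.
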